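(* Let $K$ be a totally real number field of degree $e$ over $\mathbb{Q}$ with embeddings $\sigma_1,\dots,\sigma_e$ into $\mathbb{R}$. Let $g$ be a positive integer divisible by $e$, let $m:=g/e$, and let $\rho\colon K\to M_g(\mathbb{C})$ be the representation of $\mathbb{Q}$-algebras $\eta\mapsto\operatorname{diag}(\sigma_1(\eta),\dots,\sigma_e(\eta))\otimes\mathbf{1}_m$ (Kronecker product). Let $(X,H,\iota)$ be a polarized (complex) abelian variety, of dimension $g$, with endomorphism structure $(K,\operatorname{id}_K,\rho)$. Then, for all integers $\ell\geq 0$ and $k\geq 0$ with $\ell+k\leq e$, $X$ admits classes $a,b\in\operatorname{NS}(X)_{\mathbb{Q}}$ and non-degenerate simple semi-homogeneous vector bundles $E$ and $F$ with the properties that $\operatorname{slope}(E)=a$, $\operatorname{slope}(F)=b$, $\mathrm{i}(E)=m\ell$, $\mathrm{i}(F)=mk$, $E\otimes F$ is non-degenerate, and $\mathrm{i}(E\otimes F)=m(\ell+k)$.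
   Context: A polarized abelian variety with endomorphism structure $(K,\operatorname{id}_K,\rho)$ is a triple $(X,H,\iota)$, where $X$ is a complex abelian variety of dimension $g$, $H$ is (the Hermitian form of) a polarization on $X$, and $\iota\colon K\hookrightarrow\operatorname{End}(X)\otimes_{\mathbb{Z}}\mathbb{Q}$ is an embedding of $\mathbb{Q}$-algebras such that the composite of $\iota$ with the analytic representation of $\operatorname{End}(X)\otimes\mathbb{Q}$ is equivalent to $\rho$, and such that the Rosati involution with respect to $H$ restricts to the identity on $\iota(K)$. $\operatorname{NS}(X)=\operatorname{Pic}(X)/\operatorname{Pic}^0(X)$ and $\operatorname{NS}(X)_{\mathbb{Q}}=\operatorname{NS}(X)\otimes_{\mathbb{Z}}\mathbb{Q}$. For a vector bundle $E$, $\operatorname{slope}(E):=\frac{[\det E]}{\operatorname{rank}E}\in\operatorname{NS}(X)_{\mathbb{Q}}$, where $[\det E]$ is the class of $\det E$. A vector bundle $E$ on $X$ is non-degenerate if $\chi(E)\neq 0$; simple if its only endomorphisms are scalars; semi-homogeneous if for every $x\in X$ there is a line bundle $L$ with $T_x^*E\cong E\otimes L$, where $T_x\colon X\to X$ is translation by $x$. $E$ satisfies the index condition if exactly one of its cohomology groups is nonzero; in that case the index $\mathrm{i}(E)$ is the unique integer $j$ with $H^j(X,E)\neq 0$. An assertion $\mathrm{i}(E)=j$ includes the assertion that $E$ satisfies the index condition. *)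

(* Defs.v *)
From HB Require Import structures.
From mathcomp Require Import all_boot all_order all_algebra all_fingroup all_field.
From mathcomp Require Import all_classical all_reals all_analysis.
From mathcomp Require Import complex mxtens.

Set Implicit Arguments.
Unset Strict Implicit.
Unset Printing Implicit Defensive.

Import Order.TTheory GRing.Theory Num.Theory.
Import numFieldNormedType.Exports.

Local Open Scope classical_set_scope.
Local Open Scope ring_scope.

(* The complex numbers, packed as a structure so that the topology of a
   [numFieldType] (hence of ['M[Cplx R]_(p, q)]) is inferred. *)
Definition Cplx (R : realType) : numClosedFieldType := R[i].

Definition toC (R : realType) (x : R) : Cplx R := real_complex R x.

Section Differentiable.
Variables (K : numFieldType) (V : normedModType K).

Lemma differentiable_entry p q (f : V -> 'M[K]_(p, q)) x i j :
  differentiable f x -> differentiable (fun z => f z i j) x.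
Proof.
move=> df; apply: (@differentiable_comp _ _ _ _ f (fun M : 'M[K]_(p, q) => M i j)).
  exact: df.
exact: differentiable_coord.
Qed.

Lemma differentiable_mx p q (f : V -> 'M[K]_(p, q)) x :
  (forall i j, differentiable (fun z => f z i j) x) -> differentiable f x.
Proof.
move=> df.
have -> : f = \sum_(i < p) \sum_(j < q) (fun z => f z i j *: delta_mx i j).
  apply/funext => z; rewrite fct_sumE [LHS]matrix_sum_delta.
  by apply: eq_bigr => i _; rewrite fct_sumE.
apply: differentiable_sum => i; apply: differentiable_sum => j.
exact: differentiableZl.
Qed.

Lemma differentiable_mulmx p q s (f : V -> 'M[K]_(p, q)) (h : V -> 'M[K]_(q, s)) x :
  differentiable f x -> differentiable h x ->
  differentiable (fun z => f z *m h z) x.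
Proof.
move=> df dh; apply: differentiable_mx => i j.
have -> : (fun z => (f z *m h z) i j) =
    \sum_(k < q) ((fun z => f z i k) * (fun z => h z k j)).
  by apply/funext => z; rewrite fct_sumE mxE.
apply: differentiable_sum => k.
by apply: differentiableM; apply: differentiable_entry.
Qed.

Lemma differentiable_tensmx p q s t (f : V -> 'M[K]_(p, q)) (h : V -> 'M[K]_(s, t)) x :
  differentiable f x -> differentiable h x ->
  differentiable (fun z => f z *t h z) x.
Proof.
move=> df dh; apply: differentiable_mx => i j.
have -> : (fun z => (f z *t h z) i j) =
    (fun z => f z (mxtens_unindex i).1 (mxtens_unindex j).1) *
    (fun z => h z (mxtens_unindex i).2 (mxtens_unindex j).2).
  by apply/funext => z; rewrite mxE.
by apply: differentiableM; apply: differentiable_entry.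
Qed.

Lemma differentiable_tr p q (f : V -> 'M[K]_(p, q)) x :
  differentiable f x -> differentiable (fun z => (f z)^T) x.
Proof.
move=> df; apply: differentiable_mx => i j.
have -> : (fun z => (f z)^T i j) = (fun z => f z j i).
  by apply/funext => z; rewrite mxE.
exact: differentiable_entry.
Qed.

Lemma differentiable_det p (f : V -> 'M[K]_p) x :
  differentiable f x -> differentiable (fun z => (\det (f z))%:M : 'M[K]_1) x.
Proof.
move=> df; apply: differentiable_mx => i j.
have -> : (fun z => (\det (f z))%:M i j) =
    \sum_(s : 'S_p) (fun z => (-1) ^+ s * \prod_i f z i (s i)).
  by apply/funext => z; rewrite fct_sumE !ord1 mxE eqxx mulr1n.
elim/big_ind: _ => [|a b da db|s _].
- exact: differentiable_cst.
- exact: differentiableD.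
apply: (@differentiableM _ _ (cst ((-1) ^+ s)) (fun z => \prod_i f z i (s i))).
  exact: differentiable_cst.
have -> : (fun z => \prod_i f z i (s i)) = \prod_i (fun z => f z i (s i)).
  by apply/funext => z; rewrite (big_morph (fun h : V -> K => h z) (id1 := 1) (op1 := *%R)).
elim/big_ind: _ => [|a b da db|k _].
- exact: differentiable_cst.
- exact: differentiableM.
exact: differentiable_entry.
Qed.

End Differentiable.

Lemma tensmx11 (A : pzRingType) r s :
  (1%:M : 'M[A]_r) *t (1%:M : 'M[A]_s) = 1%:M.
Proof.
apply/matrixP => i j; case: (mxtens_indexP i) => i1 i2.
case: (mxtens_indexP j) => j1 j2.
by rewrite tensmxE !mxE (inj_eq (can_inj (@mxtens_indexK r s))) xpair_eqE
  -natrM mulnb.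
Qed.

Section ComplexTorus.
Variables (R : realType) (g : nat).
Local Notation C := (Cplx R).
Local Notation V := 'cV[C]_g.

Definition real_free n (b : 'I_n -> V) : Prop :=
  forall a : 'I_n -> R, \sum_i toC (a i) *: b i = 0 -> forall i, a i = 0.

Definition is_lattice (L : set V) : Prop :=
  exists b : 'I_(2 * g) -> V, real_free b /\
    L = [set \sum_i (n i)%:~R *: b i | n in [set: 'I_(2 * g) -> int]].

(* The complex torus C^g / L, given by its lattice L. *)
Record complexTorus := ComplexTorus {
  lattice : set V;
  latticeP : is_lattice lattice
}.

(* The homomorphisms X -> X are the linear maps (the analytic representation)
   that preserve the lattice; End(X) (x) Q is identified with its image in
   M_g(C) under the analytic representation. *)
Definition Endo (X : complexTorus) : set 'M[C]_g :=
  [set A | forall l, lattice X l -> lattice X (A *m l)].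

Definition EndoQ (X : complexTorus) : set 'M[C]_g :=
  [set A | exists2 n : nat, (0 < n)%N & Endo X (n%:R *: A)].

(* The sesquilinear form with matrix H: linear in v, antilinear in w. *)
Definition herm (H : 'M[C]_g) (v w : V) : C :=
  (v^T *m H *m map_mx Num.conj w) ord0 ord0.

Definition is_polarization (X : complexTorus) (H : 'M[C]_g) : Prop :=
  [/\ H \is hermsymmx,
      forall v, v != 0 -> 0 < herm H v v
    & forall l l', lattice X l -> lattice X l' ->
        exists n : int, 'Im (herm H l l') = n%:~R].

(* phi_H : X -> X^ has analytic representation v |-> herm H v into the space
   of antilinear forms, and the dual of an endomorphism A is precomposition
   with A. *)
Definition phi (H : 'M[C]_g) (v : V) : V -> C := herm H v.
Definition dual_map (A : 'M[C]_g) (f : V -> C) : V -> C := fun w => f (A *m w).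

(* A' is phi_H^-1 o A^ o phi_H, the image of A under the Rosati involution. *)
Definition is_rosati (H A A' : 'M[C]_g) : Prop :=
  forall v, phi H (A' *m v) = dual_map A (phi H v).

End ComplexTorus.

Section EndomorphismStructure.
Variables (R : realType) (K : fieldExtType rat).
Local Notation C := (Cplx R).

Definition totally_real : Prop :=
  forall (tau : {rmorphism K -> C}) (x : K), tau x \is Num.real.

Definition enumerates_real_embeddings e (sigma : 'I_e -> {rmorphism K -> R}) : Prop :=
  (forall i j, sigma i =1 sigma j -> i = j) /\
  (forall tau : {rmorphism K -> R}, exists i, tau =1 sigma i).

Definition rho e (sigma : 'I_e -> {rmorphism K -> R}) (m : nat) (eta : K) :
    'M[C]_(e * m) :=
  diag_mx (\row_i toC (sigma i eta)) *t (1%:M : 'M[C]_m).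

(* Equivalence of representations is stated with an isomorphism between
   C^g and C^d, so that g and d need not be convertible. *)
Definition equiv_rep g d (r1 : K -> 'M[C]_g) (r2 : K -> 'M[C]_d) : Prop :=
  exists (P : 'M[C]_(g, d)) (Q : 'M[C]_(d, g)),
    [/\ P *m Q = 1%:M, Q *m P = 1%:M
      & forall eta, r1 eta = P *m r2 eta *m Q].

(* [(X, H, iota)] is a polarized abelian variety with endomorphism structure
   [(K, id, r)]. A ring morphism out of a number field is automatically
   Q-linear and injective. *)
Record polarized_endo_structure g d (X : complexTorus R g) (H : 'M[C]_g)
    (iota : {rmorphism K -> 'M[C]_g}) (r : K -> 'M[C]_d) : Prop := {
  pes_polarization : is_polarization X H;
  pes_endo : forall eta, EndoQ X (iota eta);
  pes_rep : equiv_rep iota r;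
  pes_rosati : forall eta, is_rosati H (iota eta) (iota eta)
}.

End EndomorphismStructure.

Section VectorBundles.
Variables (R : realType) (g : nat) (X : complexTorus R g).
Local Notation C := (Cplx R).
Local Notation V := 'cV[C]_g.

(* The open subsets of X = C^g / L are the L-invariant open subsets of C^g,
   and the holomorphic functions on them are the L-invariant ones. *)
Definition openX (U : set V) : Prop :=
  open U /\ forall v l, lattice X l -> U v -> U (v + l).

Definition holX (U : set V) p q (f : V -> 'M[C]_(p, q)) : Prop :=
  (forall v, U v -> differentiable f v) /\
  (forall v l, lattice X l -> U v -> f (v + l) = f v).

Lemma openX_setI U U' : openX U -> openX U' -> openX (U `&` U').
Proof.
move=> [oU iU] [oU' iU']; split; first exact: openI.
by move=> v l Xl [Uv U'v]; split; [apply: iU|apply: iU'].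
Qed.

(* A holomorphic vector bundle of rank r on X, given by a trivialization over
   an open neighbourhood [vdom x] of each point x and by the transition
   functions [vtr x y] from the trivialization at y to the one at x. *)
Record vbundle (r : nat) := VBundle {
  vdom : V -> set V;
  vdom_open : forall x, openX (vdom x);
  vdom_id : forall x, vdom x x;
  vtr : V -> V -> V -> 'M[C]_r;
  vtr_hol : forall x y, holX (vdom x `&` vdom y) (vtr x y);
  vtr_id : forall x v, vdom x v -> vtr x x v = 1%:M;
  vtr_cocycle : forall x y z v, vdom x v -> vdom y v -> vdom z v ->
    vtr x y v *m vtr y z v = vtr x z v
}.

Program Definition trivial_bundle : vbundle 1 :=
  @VBundle 1 (fun _ => setT) _ _ (fun _ _ _ => 1%:M) _ _ _.
Next Obligation. by move=> x; split=> //; exact: openT. Qed.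
Next Obligation. by []. Qed.
Next Obligation.
by move=> x y; split=> // v _; exact: differentiable_cst.
Qed.
Next Obligation. by []. Qed.
Next Obligation. by move=> *; rewrite mul1mx. Qed.

Program Definition tensor r s (E : vbundle r) (F : vbundle s) : vbundle (r * s) :=
  @VBundle (r * s) (fun x => vdom E x `&` vdom F x) _ _
    (fun x y v => vtr E x y v *t vtr F x y v) _ _ _.
Next Obligation. by move=> *; apply: openX_setI; exact: vdom_open. Qed.
Next Obligation. by move=> *; split; exact: vdom_id. Qed.
Next Obligation.
move=> r s E F x y; split=> [v|v l Xl] [[Ex Fx] [Ey Fy]].
  by apply: differentiable_tensmx; apply: (vtr_hol _ _ _).1.
by rewrite (vtr_hol E x y).2// (vtr_hol F x y).2.
Qed.
Next Obligation.
move=> r s E F x v [Ex Fx]; rewrite !vtr_id//.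
exact: tensmx11.
Qed.
Next Obligation.
move=> r s E F x y z v [Ex Fx] [Ey Fy] [Ez Fz].
by rewrite tensmx_mul !vtr_cocycle.
Qed.

Program Definition dual r (E : vbundle r) : vbundle r :=
  @VBundle r (vdom E) _ _ (fun x y v => (vtr E y x v)^T) _ _ _.
Next Obligation. by move=> *; exact: vdom_open. Qed.
Next Obligation. by move=> *; exact: vdom_id. Qed.
Next Obligation.
move=> r E x y; split=> [v|v l Xl] [Ex Ey].
  by apply: differentiable_tr; apply: (vtr_hol _ _ _).1.
by rewrite (vtr_hol E y x).2.
Qed.
Next Obligation. by move=> r E x v Ex /=; rewrite vtr_id// trmx1. Qed.
Next Obligation. by move=> r E x y z v * /=; rewrite -trmx_mul vtr_cocycle. Qed.

Program Definition det_bundle r (E : vbundle r) : vbundle 1 :=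
  @VBundle 1 (vdom E) _ _ (fun x y v => (\det (vtr E x y v))%:M) _ _ _.
Next Obligation. by move=> *; exact: vdom_open. Qed.
Next Obligation. by move=> *; exact: vdom_id. Qed.
Next Obligation.
move=> r E x y; split=> [v|v l Xl] [Ex Ey].
  by apply: differentiable_det; apply: (vtr_hol _ _ _).1.
by rewrite (vtr_hol E x y).2.
Qed.
Next Obligation. by move=> r E x v Ex /=; rewrite vtr_id// det1. Qed.
Next Obligation.
by move=> r E x y z v * /=; rewrite -scalar_mxM -det_mulmx vtr_cocycle.
Qed.

(* T_t^* E, where T_t is the translation v |-> v + t. *)
Program Definition translate (t : V) r (E : vbundle r) : vbundle r :=
  @VBundle r (fun x => [set v | vdom E (x + t) (v + t)]) _ _
    (fun x y v => vtr E (x + t) (y + t) (v + t)) _ _ _.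
Next Obligation.
move=> t r E x; have [oE iE] := vdom_open E (x + t); split.
  apply: (@open_comp _ _ (fun v : V => v + t)) => // v _.
  apply: differentiable_continuous; apply: differentiableD => //.
by move=> v l Xl /= Ev; rewrite addrAC; exact: iE.
Qed.
Next Obligation. by move=> *; exact: vdom_id. Qed.
Next Obligation.
move=> t r E x y; split=> [v|v l Xl] [Ex Ey].
  apply: (@differentiable_comp _ _ _ _ (fun v : V => v + t)).
    by apply: differentiableD => //; exact: differentiable_cst.
  exact: (vtr_hol _ _ _).1.
by rewrite /= addrAC; apply: (vtr_hol E _ _).2.
Qed.
Next Obligation. by move=> * /=; rewrite vtr_id. Qed.
Next Obligation. by move=> * /=; rewrite vtr_cocycle. Qed.

Definition is_hom r s (E : vbundle r) (F : vbundle s)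
    (f : V -> V -> 'M[C]_(s, r)) : Prop :=
  (forall x, holX (vdom E x `&` vdom F x) (f x)) /\
  (forall x y v, vdom E x v -> vdom F x v -> vdom E y v -> vdom F y v ->
     vtr F x y v *m f y v = f x v *m vtr E x y v).

Definition iso r s (E : vbundle r) (F : vbundle s) : Prop :=
  exists f h, [/\ is_hom E F f, is_hom F E h
    & forall x v, vdom E x v -> vdom F x v ->
        h x v *m f x v = 1%:M /\ f x v *m h x v = 1%:M].

Definition simple_bundle r (E : vbundle r) : Prop :=
  forall f, is_hom E E f ->
    exists c : C, forall x v, vdom E x v -> f x v = c%:M.

Definition semihomogeneous r (E : vbundle r) : Prop :=
  forall t : V, exists L : vbundle 1, iso (translate t E) (tensor E L).

(* Cech cohomology H^q(X, E), as the colimit over the open coverings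
   (W_x)_x of X with x in W_x, ordered by pointwise inclusion (these are
   cofinal among all open coverings). Cochains are total functions, and two
   of them agree if they do so on some such covering; hence the colimit
   is the quotient of the vector space of cocycles on some covering by the
   subspace of coboundaries on some covering. *)

(* [s x] is the section read in the trivialization at x. *)
Definition is_section r (E : vbundle r) (U : set V) (s : V -> V -> 'cV[C]_r) : Prop :=
  (forall x, holX (U `&` vdom E x) (s x)) /\
  (forall x y v, U v -> vdom E x v -> vdom E y v ->
     s x v = vtr E x y v *m s y v).

Definition is_covering (W : V -> set V) : Prop :=
  forall x, openX (W x) /\ W x x.

Definition overlap (W : V -> set V) q (t : 'I_q.+1 -> V) : set V :=
  [set v | forall k, W (t k) v].

Definition cochain (r q : nat) : lmodType C :=
  ('I_q.+1 -> V) -> V -> V -> 'cV[C]_r.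

Definition is_cochain r (E : vbundle r) (W : V -> set V) q (c : cochain r q) : Prop :=
  forall t, is_section E (overlap W t) (c t).

Definition agree_on r (E : vbundle r) (W : V -> set V) q (c c' : cochain r q) : Prop :=
  forall t x v, overlap W t v -> vdom E x v -> c t x v = c' t x v.

Definition coboundary r q (c : cochain r q) : cochain r q.+1 :=
  fun t => \sum_(k < q.+2) (-1) ^+ k *: c (fun l => t (lift k l)).

Definition cocycles r (E : vbundle r) q : set (cochain r q) :=
  [set c | exists W, [/\ is_covering W, is_cochain E W c
                       & agree_on E W (coboundary c) 0]].

Arguments cocycles {r} E q.

Definition coboundaries r (E : vbundle r) q : set (cochain r q) :=
  match q with
  | 0 => [set c | exists W, is_covering W /\ agree_on E W c 0]
  | p.+1 => [set c | exists W (b : cochain r p),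
      [/\ is_covering W, is_cochain E W b & agree_on E W c (coboundary b)]]
  end.

Arguments coboundaries {r} E q.

Definition cohomology_eq0 r (E : vbundle r) q : Prop :=
  cocycles E q `<=` coboundaries E q.

Definition has_cohomology_dim r (E : vbundle r) q n : Prop :=
  exists b : 'I_n -> cochain r q, (forall i, cocycles E q (b i)) /\
    forall c, cocycles E q c ->
      exists! a : 'rV[C]_n, coboundaries E q (c - \sum_i a ord0 i *: b i).

(* Cohomology being finite-dimensional on a compact manifold, the default
   value is never used. *)
Definition cohomology_dim r (E : vbundle r) q : nat :=
  xget 0%N [set n | has_cohomology_dim E q n].

Definition euler_char r (E : vbundle r) : int :=
  \sum_(q < g.+1) (-1) ^+ q * (cohomology_dim E q)%:Z.

Definition nondegenerate_bundle r (E : vbundle r) : Prop := euler_char E <> 0.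

Definition has_index r (E : vbundle r) (j : nat) : Prop :=
  ~ cohomology_eq0 E j /\ forall q, q <> j -> cohomology_eq0 E q.

(* 1 * 1 is convertible to 1, so that a tensor product of line bundles is
   again of type [vbundle 1]. *)
Definition line_expn (L : vbundle 1) (n : nat) : vbundle 1 :=
  iter n (tensor L : vbundle 1 -> vbundle 1) trivial_bundle.

Definition line_expz (L : vbundle 1) (n : int) : vbundle 1 :=
  match n with
  | Posz n => line_expn L n
  | Negz n => line_expn (dual L) n.+1
  end.

(* Pic^0(X) consists of the translation-invariant line bundles. *)
Definition Pic0 (L : vbundle 1) : Prop := forall t : V, iso (translate t L) L.

Definition NS_equiv (L M : vbundle 1) : Prop :=
  Pic0 (tensor L (dual M) : vbundle 1).

(* Every element of NS(X) (x) Q is of the form [L] (x) a with a rational, and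
   [L] (x) a = [M] (x) b iff L^(k n d') and M^(k n' d) have the same class in
   NS(X) for some k > 0, where a = n / d and b = n' / d'. *)
Definition NSQ_equiv (p q : vbundle 1 * rat) : Prop :=
  exists2 k : nat, (0 < k)%N &
    NS_equiv (line_expz p.1 (k%:Z * (numq p.2 * denq q.2)))
             (line_expz q.1 (k%:Z * (numq q.2 * denq p.2))).

(* NS(X)_Q as the set of equivalence classes of [NSQ_equiv]. *)
Record NSQ := MkNSQ {
  NSQ_class : set (vbundle 1 * rat);
  NSQ_classP : exists p, NSQ_class = [set q | NSQ_equiv p q]
}.

Definition NSQ_pi (L : vbundle 1) (a : rat) : NSQ :=
  @MkNSQ [set q | NSQ_equiv (L, a) q] (ex_intro _ (L, a) erefl).

Definition slope r (E : vbundle r) : NSQ := NSQ_pi (det_bundle E) (r%:R)^-1.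

End VectorBundles.

(* Main.v *)
(** E and F are line bundles with Hermitian forms N H(iota(x) ., .), where x in K has prescribed signs at
    the real places (weak approximation), so the index is the number of negative eigenvalues.  In the
    unitary gauge, sections are smooth quasi-periodic functions killed by the operators [dbar] along an
    orthogonal eigenbasis q_j.  When the j-th eigenvalue is positive, fibrewise convolution with the
    Gaussian kernel is a right inverse of the j-th operator; when it is negative, it is a left inverse.
    Imposing the equations one direction at a time, Cech cohomology moves up one degree for each negative
    eigenvalue, and ends as the space of harmonic sections, i.e. the fixed points of Gaussian averages.
    That space is finite-dimensional by a gradient estimate, and nonzero for large N because the
    automorphization of a Gaussian is almost fixed. *)
Require Import Defs.
From HB Require Import structures.
From mathcomp Require Import all_boot all_order all_algebra all_fingroup all_field.
From mathcomp Require Import all_classical all_reals all_analysis.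
From mathcomp Require Import complex mxtens ring lra.
Set Implicit Arguments.
Unset Strict Implicit.
Unset Printing Implicit Defensive.
Import Order.TTheory GRing.Theory Num.Theory.
Import numFieldNormedType.Exports.
Local Open Scope classical_set_scope.
Local Open Scope ring_scope.

(** The multiplier N has two tasks: it clears the denominators of [iota x], and it has to be large
    for a harmonic section to exist. The gauge has the factor of automorphy exp(i Im h(v, l)),
    without a semicharacter; this is a cocycle because h is 2 pi times a form integral on the
    lattice, so that the Chern form is twice an integral one. Cech cochains carry no bounds, while
    the convolutions integrate over whole complex lines. The Gaussian operators are therefore
    applied to global sections, which are bounded by quasi-periodicity, and, for local solvability,
    to cut-off data after the form has been made positive in the relevant direction. The passage
    from one direction to the next is the exact sequence 0 -> ker D -> F -> F -> 0 with D one of the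
    operators; classes are followed through relations between cochains and global sections instead
    of quotient spaces. No dimension is computed: finite and nonzero is enough for the Euler
    characteristic. The tensor product needs no separate analysis, since its form is the sum of the
    two forms, again given by an element of K. *)

Ltac qlra := clear; repeat match goal with x := _ |- _ => clearbody x end; intros; try split; lra.

(** * Complex numbers in real coordinates *)

Section ComplexNumbers.

Variable R : realType.
Local Notation C := (Cplx R).

Definition re (z : C) : R := complex.Re z.
Definition im (z : C) : R := complex.Im z.
Definition mkC (x y : R) : C := Complex x y.
Definition ci : C := mkC 0 1.
(** The l1 norm, with values in [R]: the norm of [Cplx R] has complex values, out of reach of linear
    arithmetic over [R]. It is only submultiplicative, and a number of modulus 1 is bounded by 2 in
    it, whence the many factors 2 in the estimates. *)
Definition cn (z : C) : R := `|re z| + `|im z|.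
Definition cconj (z : C) : C := mkC (re z) (- im z).
Definition cexp (z : C) : C :=
  mkC (expR (re z) * cos (im z)) (expR (re z) * sin (im z)).

Lemma ceq (a b : C) : re a = re b -> im a = im b -> a = b.
Proof. by case: a b => [a1 a2] [b1 b2] /= <- <-. Qed.

Lemma reD a b : re (a + b) = re a + re b. Proof. by case: a; case: b. Qed.
Lemma imD a b : im (a + b) = im a + im b. Proof. by case: a; case: b. Qed.
Lemma reN a : re (- a) = - re a. Proof. by case: a. Qed.
Lemma imN a : im (- a) = - im a. Proof. by case: a. Qed.
Lemma reM a b : re (a * b) = re a * re b - im a * im b.
Proof. by case: a; case: b. Qed.
Lemma imM a b : im (a * b) = re a * im b + im a * re b.
Proof. by case: a => a1 a2; case: b. Qed.
Lemma re0 : re 0 = 0. Proof. by []. Qed.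
Lemma im0 : im 0 = 0. Proof. by []. Qed.
Lemma re1 : re 1 = 1. Proof. by []. Qed.
Lemma im1 : im 1 = 0. Proof. by []. Qed.
Lemma rei : re ci = 0. Proof. by []. Qed.
Lemma imi : im ci = 1. Proof. by []. Qed.
Lemma re_toC x : re (toC x) = x. Proof. by []. Qed.
Lemma im_toC x : im (toC x) = 0. Proof. by []. Qed.
Lemma re_mkC x y : re (mkC x y) = x. Proof. by []. Qed.
Lemma im_mkC x y : im (mkC x y) = y. Proof. by []. Qed.
Lemma re_conj z : re (cconj z) = re z. Proof. by []. Qed.
Lemma im_conj z : im (cconj z) = - im z. Proof. by []. Qed.
Definition reimE := (reD, imD, reN, imN, reM, imM, re0, im0, re1, im1, rei, imi,
  re_toC, im_toC, re_mkC, im_mkC, re_conj, im_conj).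

Lemma mkCE x y : mkC x y = toC x + ci * toC y.
Proof. by apply: ceq; rewrite !reimE; ring. Qed.
Lemma toC0 : toC (0 : R) = 0 :> C. Proof. exact: ceq. Qed.
Lemma toC1 : toC (1 : R) = 1 :> C. Proof. exact: ceq. Qed.
Lemma toCD (x y : R) : toC (x + y) = toC x + toC y :> C.
Proof. by apply: ceq; rewrite !reimE ?addr0. Qed.
Lemma toCN (x : R) : toC (- x) = - toC x :> C.
Proof. by apply: ceq; rewrite !reimE ?oppr0. Qed.
Lemma toCM (x y : R) : toC (x * y) = toC x * toC y :> C.
Proof. by apply: ceq; rewrite !reimE; ring. Qed.
Lemma toC_inj : injective (@toC R). Proof. by move=> x y []. Qed.
Lemma toCV (x : R) : toC (x^-1) = (toC x)^-1 :> C.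
Proof.
have [->|x0] := eqVneq x 0; first by rewrite invr0 toC0 invr0.
have x1 : toC x != 0 :> C by apply/eqP => -[]; exact/eqP.
by apply: (mulfI x1); rewrite -toCM !divff// toC1.
Qed.
Lemma toC_eq0 (x : R) : (toC x == 0 :> C) = (x == 0).
Proof. by apply/eqP/eqP => [[]//|->]; rewrite toC0. Qed.
Lemma toC_sum I (r : seq I) P (F : I -> R) :
  toC (\sum_(i <- r | P i) F i) = \sum_(i <- r | P i) toC (F i) :> C.
Proof. exact: (big_morph _ toCD toC0). Qed.
Lemma toC_nat n : toC (n%:R : R) = n%:R :> C.
Proof. by elim: n => [|n IH]; rewrite ?toC0// -!natr1 toCD IH toC1. Qed.
Lemma toC_int (n : int) : toC (n%:~R : R) = n%:~R :> C.
Proof. by case: n => n; rewrite ?NegzE ?mulrNz ?toCN -!pmulrn toC_nat. Qed.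
Lemma ci2 : ci * ci = -1.
Proof. by apply: ceq; rewrite !reimE; ring. Qed.
Lemma reimC z : z = toC (re z) + ci * toC (im z).
Proof. by apply: ceq; rewrite !reimE; ring. Qed.

Lemma conjE (z : C) : z^* = cconj z. Proof. by case: z. Qed.
Lemma cconjD a b : cconj (a + b) = cconj a + cconj b.
Proof. by apply: ceq; rewrite !reimE ?opprD. Qed.
Lemma cconjM a b : cconj (a * b) = cconj a * cconj b.
Proof. by apply: ceq; rewrite !reimE; ring. Qed.
Lemma cconjN a : cconj (- a) = - cconj a.
Proof. by apply: ceq; rewrite !reimE. Qed.
Lemma cconjK : involutive cconj.
Proof. by move=> a; apply: ceq; rewrite !reimE ?opprK. Qed.
Lemma cconj_toC x : cconj (toC x) = toC x.
Proof. by apply: ceq; rewrite !reimE ?oppr0. Qed.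
Lemma cconj_ci : cconj ci = - ci.
Proof. by apply: ceq; rewrite !reimE ?oppr0. Qed.
Lemma cconj0 : cconj 0 = 0. Proof. by rewrite -toC0 cconj_toC. Qed.

Lemma norm_toC (z : C) : `|z| = toC (Num.sqrt (re z ^+ 2 + im z ^+ 2)).
Proof. exact: normc_def. Qed.

Lemma ltC_toC (x y : R) : (toC x < toC y :> C) = (x < y).
Proof. by rewrite ltcE /= eqxx. Qed.
Lemma leC_toC (x y : R) : (toC x <= toC y :> C) = (x <= y).
Proof. by rewrite lecE /= eqxx. Qed.
Lemma gt0C (z : C) : 0 < z -> exists2 x : R, 0 < x & z = toC x.
Proof.
by case: z => x y; rewrite ltcE /= => /andP[/eqP -> x0]; exists x.
Qed.
Lemma ge0C (z : C) : 0 <= z -> exists2 x : R, 0 <= x & z = toC x.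
Proof.
by case: z => x y; rewrite lecE /= => /andP[/eqP -> x0]; exists x.
Qed.

Lemma cn_ge0 z : 0 <= cn z. Proof. by rewrite addr_ge0. Qed.
Lemma cn0 : cn 0 = 0. Proof. by rewrite /cn !normr0 addr0. Qed.
Lemma cn1 : cn 1 = 1. Proof. by rewrite /cn normr1 normr0 addr0. Qed.
Lemma cn_eq0 z : (cn z == 0) = (z == 0).
Proof.
apply/idP/eqP => [|->]; last by rewrite cn0.
by rewrite paddr_eq0// !normr_eq0 => /andP[/eqP ? /eqP ?]; apply: ceq.
Qed.
Lemma cnN z : cn (- z) = cn z. Proof. by rewrite /cn !reimE !normrN. Qed.
Lemma cnD a b : cn (a + b) <= cn a + cn b.
Proof.
by rewrite /cn !reimE; have := ler_normD (re a) (re b);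
  have := ler_normD (im a) (im b); lra.
Qed.
Lemma cnB a b : cn (a - b) <= cn a + cn b.
Proof. by rewrite -(cnN b) cnD. Qed.
Lemma cnBC a b : cn (a - b) = cn (b - a).
Proof. by rewrite -cnN opprB. Qed.
Lemma cnM a b : cn (a * b) <= cn a * cn b.
Proof.
rewrite /cn !reimE.
have := ler_normB (re a * re b) (im a * im b).
have := ler_normD (re a * im b) (im a * re b).
rewrite !normrM; lra.
Qed.
Lemma cn_toC x : cn (toC x) = `|x|. Proof. by rewrite /cn /= normr0 addr0. Qed.
Lemma cnMtoC x z : cn (toC x * z) = `|x| * cn z.
Proof. by rewrite /cn !reimE !mul0r subr0 addr0 !normrM mulrDr. Qed.
Lemma cn_ci : cn ci = 1. Proof. by rewrite /cn !reimE normr0 normr1 add0r. Qed.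
Lemma cn_conj z : cn (cconj z) = cn z. Proof. by rewrite /cn !reimE normrN. Qed.
Lemma cnMci z : cn (ci * z) = cn z.
Proof. by rewrite /cn !reimE !mul0r !mul1r !add0r normrN addrC. Qed.
Lemma re_le_cn z : `|re z| <= cn z. Proof. by rewrite lerDl. Qed.
Lemma im_le_cn z : `|im z| <= cn z. Proof. by rewrite lerDr. Qed.
Lemma cn_sum I (r : seq I) P (F : I -> C) :
  cn (\sum_(i <- r | P i) F i) <= \sum_(i <- r | P i) cn (F i).
Proof.
elim/big_ind2: _ => [|a x b y ha hb|//]; first by rewrite cn0.
exact: le_trans (cnD _ _) (lerD ha hb).
Qed.
Lemma normC_le_cn (z : C) : `|z| <= toC (cn z) :> C.
Proof.
rewrite norm_toC leC_toC -(ger0_norm (cn_ge0 z)) -sqrtr_sqr ler_wsqrtr//.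
rewrite /cn sqrrD !real_normK ?num_real// addrAC lerDl.
by rewrite pmulrn_lge0// mulr_ge0.
Qed.
Lemma cn_le_normC (z : C) : toC (cn z) <= 2 * `|z| :> C.
Proof.
rewrite norm_toC -(toC_nat 2) -toCM leC_toC /cn.
have h (x y : R) : `|x| <= Num.sqrt (x ^+ 2 + y ^+ 2).
  by rewrite -(sqrtr_sqr x) ler_wsqrtr// lerDl sqr_ge0.
have := h (re z) (im z); have := h (im z) (re z).
by rewrite addrC; lra.
Qed.

Lemma cexp0 : cexp 0 = 1.
Proof. by apply: ceq; rewrite /cexp !reimE expR0 ?cos0 ?sin0; ring. Qed.
Lemma cexpD a b : cexp (a + b) = cexp a * cexp b.
Proof. by apply: ceq; rewrite /cexp !reimE expRD ?cosD ?sinD; ring. Qed.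
Lemma cexpNK a : cexp a * cexp (- a) = 1.
Proof. by rewrite -cexpD subrr cexp0. Qed.
Lemma cexp_neq0 a : cexp a != 0.
Proof.
apply/eqP => h; have := cexpNK a; rewrite h mul0r => /esym/eqP.
by rewrite oner_eq0.
Qed.
Lemma cexpN a : cexp (- a) = (cexp a)^-1.
Proof. by apply: (mulfI (cexp_neq0 a)); rewrite cexpNK divff ?cexp_neq0. Qed.
Lemma cn_cexp a : cn (cexp a) <= 2 * expR (re a).
Proof.
rewrite /cn /cexp !reimE !normrM ger0_norm ?expR_ge0//.
have := cos_max (im a); have := sin_max (im a); have := expR_gt0 (re a).
by nra.
Qed.
Lemma cn_cexpi x : cn (cexp (ci * toC x)) <= 2.
Proof. by have := cn_cexp (ci * toC x); rewrite !reimE mul0r mulr0 subrr expR0 mulr1. Qed.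
Lemma cconj_cexp a : cconj (cexp a) = cexp (cconj a).
Proof. by apply: ceq; rewrite /cexp !reimE ?cosN// sinN mulrN. Qed.
Lemma cexp_toC x : cexp (toC x) = toC (expR x).
Proof. by apply: ceq; rewrite /cexp !reimE ?cos0 ?sin0; ring. Qed.
End ComplexNumbers.

(** * Differential calculus of curves in the complex plane *)

Section Curves.

Variable R : realType.
Local Notation C := (Cplx R).
Implicit Types (u w : R -> C) (t : R) (l m : C).

(** Real and imaginary parts are differentiated separately, so that the real mean value theorem and
    the fundamental theorem of calculus apply to each of them. *)
Definition iscd u t l : Prop :=
  is_derive t (1 : R) (fun x => re (u x)) (re l) /\
  is_derive t (1 : R) (fun x => im (u x)) (im l).

Lemma iscd_cst l t : iscd (fun=> l) t 0.
Proof. by split; exact: is_derive_cst. Qed.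

Lemma iscd_eq u t l m : iscd u t l -> l = m -> iscd u t m.
Proof. by move=> ? <-. Qed.

Lemma iscd_near u w t l : (\near t, u t = w t) -> iscd u t l -> iscd w t l.
Proof.
move=> h [h1 h2]; split; [apply: near_eq_is_derive h1|apply: near_eq_is_derive h2];
  by near=> x; congr (_ (_ : C)); near: x.
Unshelve. all: by end_near. Qed.

Lemma iscd_ext u w t l : u =1 w -> iscd u t l -> iscd w t l.
Proof. by move=> /funext ->. Qed.

Lemma iscd_toC (f : R -> R) t (d : R) :
  is_derive t (1 : R) f d -> iscd (fun x => toC (f x)) t (toC d).
Proof. by move=> h; split => //=; exact: is_derive_cst. Qed.

Lemma iscd_id t : iscd (fun x => toC x) t 1.
Proof. by rewrite -(toC1 R); apply: (@iscd_toC id); exact: is_derive_id. Qed.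

Lemma iscdD u w t l m : iscd u t l -> iscd w t m -> iscd (fun x => u x + w x) t (l + m).
Proof.
move=> [u1 u2] [w1 w2]; split.
  rewrite (_ : (fun x => _) = (fun x => re (u x)) + (fun x => re (w x))).
    by rewrite reD; exact: is_deriveD.
  by apply/funext => x; rewrite reD.
rewrite (_ : (fun x => _) = (fun x => im (u x)) + (fun x => im (w x))).
  by rewrite imD; exact: is_deriveD.
by apply/funext => x; rewrite imD.
Qed.

Lemma iscdM u w t l m : iscd u t l -> iscd w t m ->
  iscd (fun x => u x * w x) t (l * w t + u t * m).
Proof.
move=> [u1 u2] [w1 w2]; split.
  rewrite (_ : (fun x => _) = (fun x => re (u x)) * (fun x => re (w x)) -
    (fun x => im (u x)) * (fun x => im (w x))); last first.
    by apply/funext => x; rewrite reM.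
  have h1 := is_deriveM u1 w1; have h2 := is_deriveM u2 w2.
  have h := is_deriveB h1 h2; apply: is_derive_eq.
  by rewrite !reimE /GRing.scale /=; ring.
rewrite (_ : (fun x => _) = (fun x => re (u x)) * (fun x => im (w x)) +
    (fun x => im (u x)) * (fun x => re (w x))); last first.
  by apply/funext => x; rewrite imM.
have h1 := is_deriveM u1 w2; have h2 := is_deriveM u2 w1.
have h := is_deriveD h1 h2; apply: is_derive_eq.
by rewrite !reimE /GRing.scale /=; ring.
Qed.

Lemma iscdZ l u t m : iscd u t m -> iscd (fun x => l * u x) t (l * m).
Proof.
move=> h; apply: iscd_eq (iscdM (iscd_cst l t) h) _.
by rewrite mul0r add0r.
Qed.

Lemma iscdN u t m : iscd u t m -> iscd (fun x => - u x) t (- m).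
Proof.
move=> h; apply: (@iscd_ext (fun x => -1 * u x)) => [x|]; first by rewrite mulN1r.
by apply: iscd_eq (iscdZ (-1) h) _; rewrite mulN1r.
Qed.

Lemma iscdB u w t l m : iscd u t l -> iscd w t m -> iscd (fun x => u x - w x) t (l - m).
Proof. by move=> hu hw; apply: iscdD => //; exact: iscdN. Qed.

Lemma iscd_sum I (r : seq I) (P : pred I) (F : I -> R -> C) t (d : I -> C) :
  (forall i, P i -> iscd (F i) t (d i)) ->
  iscd (fun x => \sum_(i <- r | P i) F i x) t (\sum_(i <- r | P i) d i).
Proof.
move=> h; elim: r => [|i r IH].
  by rewrite big_nil; apply: iscd_ext (iscd_cst _ _) => x; rewrite big_nil.
rewrite big_cons; case: ifPn => Pi; last first.
  by apply: iscd_ext IH => x; rewrite big_cons (negPf Pi).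
by apply: iscd_ext (iscdD (h i Pi) IH) => x; rewrite big_cons Pi.
Qed.

Lemma iscd_conj u t m : iscd u t m -> iscd (fun x => cconj (u x)) t (cconj m).
Proof. by move=> [h1 h2]; split => //=; exact: is_deriveN. Qed.

Lemma iscd_comp u (f : R -> R) t (d : R) m :
  iscd u (f t) m -> is_derive t (1 : R) f d -> iscd (fun x => u (f x)) t (m * toC d).
Proof.
move=> [h1 h2] h; split.
  by rewrite !reimE mulr0 subr0; exact: (is_derive1_comp h1 h).
by rewrite !reimE mulr0 add0r; exact: (is_derive1_comp h2 h).
Qed.

Lemma iscd_cexp u t m : iscd u t m -> iscd (fun x => cexp (u x)) t (m * cexp (u t)).
Proof.
move=> [h1 h2].
have e := is_derive1_comp (is_derive_expR (re (u t))) h1.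
have c := is_derive1_comp (is_derive_cos (im (u t))) h2.
have s := is_derive1_comp (is_derive_sin (im (u t))) h2.
split.
  have h := is_deriveM e c; apply: is_derive_eq.
  by rewrite /cexp !reimE /GRing.scale /=; ring.
have h := is_deriveM e s; apply: is_derive_eq.
by rewrite /cexp !reimE /GRing.scale /=; ring.
Qed.

Definition nsq (z : C) : R := re z ^+ 2 + im z ^+ 2.

Lemma nsq_eq0 z : (nsq z == 0) = (z == 0).
Proof.
apply/idP/eqP => [|->]; last by rewrite /nsq !reimE expr0n addr0.
rewrite /nsq paddr_eq0 ?sqr_ge0// !sqrf_eq0 => /andP[/eqP ? /eqP ?].
exact: ceq.
Qed.

Lemma cinvE z : z != 0 -> z^-1 = toC (nsq z)^-1 * cconj z.
Proof.
move=> z0; have n0 : toC (nsq z) != 0 :> C by rewrite toC_eq0 nsq_eq0.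
apply: (mulfI z0); rewrite divff// mulrCA toCV.
apply: (mulfI n0); rewrite mulr1 mulVKf//.
by apply: ceq; rewrite /nsq !reimE; ring.
Qed.

Lemma iscdV u t m : u t != 0 -> (\forall x \near t, u x != 0) ->
  iscd u t m -> iscd (fun x => (u x)^-1) t (- m / (u t) ^+ 2).
Proof.
move=> u0 un h.
have n0 : nsq (u t) != 0 by rewrite nsq_eq0.
have hn : is_derive t (1 : R) (fun x => nsq (u x))
    (2 * (re (u t) * re m + im (u t) * im m)).
  have h1 := is_deriveM h.1 h.1; have h2 := is_deriveM h.2 h.2.
  have h3 := is_deriveD h1 h2.
  rewrite (_ : (fun x => _) = (fun x => re (u x)) * (fun x => re (u x)) +
    (fun x => im (u x)) * (fun x => im (u x))); last first.
    by apply/funext => x; rewrite /nsq.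
  apply: is_derive_eq; rewrite /GRing.scale /=; ring.
have hV := iscd_toC (is_deriveV (f := fun x => nsq (u x)) n0 hn).
have hh := iscdM hV (iscd_conj h).
apply: (@iscd_near (fun x => toC (nsq (u x))^-1 * cconj (u x))).
  by near=> x; rewrite cinvE//; near: x.
apply: iscd_eq hh _.
have nz : toC (nsq (u t)) != 0 :> C by rewrite toC_eq0.
have e : toC (nsq (u t)) = u t * cconj (u t).
  by apply: ceq; rewrite /nsq !reimE; ring.
have c0 : cconj (u t) != 0.
  by apply: contra nz => /eqP; rewrite e => ->; rewrite mulr0.
have e2 : toC (2 * (re (u t) * re m + im (u t) * im m)) =
   u t * cconj m + cconj (u t) * m.
  by apply: ceq; rewrite !reimE; ring.
rewrite /GRing.scale /= toCM e2 toCN -exprVn expr2 toCM !toCV e.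
by field; rewrite u0 c0.
Unshelve. all: by end_near. Qed.

Definition ccont u t : Prop :=
  re (u x) @[x --> t] --> re (u t) /\ im (u x) @[x --> t] --> im (u t).

Lemma is_derive_cont (f : R -> R) t d : is_derive t (1 : R) f d -> {for t, continuous f}.
Proof.
by move=> h; apply: differentiable_continuous; apply/derivable1_diffP; exact: ex_derive.
Qed.

Lemma iscd_cont u t l : iscd u t l -> ccont u t.
Proof. by move=> [h1 h2]; split; [exact: is_derive_cont h1|exact: is_derive_cont h2]. Qed.

Lemma ccont_cst l t : ccont (fun=> l) t.
Proof. by apply: iscd_cont; exact: iscd_cst. Qed.

Lemma ccontD u w t : ccont u t -> ccont w t -> ccont (fun x => u x + w x) t.
Proof.
move=> [u1 u2] [w1 w2]; split; rewrite ?(reD, imD); under eq_fun do rewrite ?(reD, imD); exact: cvgD.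
Qed.

Lemma ccontM u w t : ccont u t -> ccont w t -> ccont (fun x => u x * w x) t.
Proof.
move=> [u1 u2] [w1 w2]; split; rewrite ?(reM, imM); under eq_fun do rewrite ?(reM, imM).
  by apply: cvgB; exact: cvgM.
by apply: cvgD; exact: cvgM.
Qed.

Lemma ccontN u t : ccont u t -> ccont (fun x => - u x) t.
Proof. by move=> [u1 u2]; split; rewrite ?(reN, imN); under eq_fun do rewrite ?(reN, imN); exact: cvgN. Qed.

Lemma ccont_toC (f : R -> R) t : {for t, continuous f} -> ccont (fun x => toC (f x)) t.
Proof. by move=> h; split => //=; exact: cvg_cst. Qed.

Lemma ccont_ext u w t : u =1 w -> ccont u t -> ccont w t.
Proof. by move=> /funext ->. Qed.

Lemma ccont_near u w t : (\near t, u t = w t) -> ccont u t -> ccont w t.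
Proof.
move=> h [h1 h2]; rewrite /ccont -(nbhs_singleton h); split.
  by apply: cvg_trans h1; apply: near_eq_cvg; near=> x; congr re; near: x.
by apply: cvg_trans h2; apply: near_eq_cvg; near=> x; congr im; near: x.
Unshelve. all: by end_near. Qed.

Lemma ccontP u t : ccont u t <->
  (forall e : R, 0 < e -> exists2 d : R, 0 < d & forall x, `|x - t| < d -> cn (u x - u t) < e).
Proof.
split=> [[h1 h2] e e0|h].
  have e2 : 0 < e / 2 by lra.
  move/cvgrPdist_lt : h1 => /(_ _ e2) [d1 d10 H1].
  move/cvgrPdist_lt : h2 => /(_ _ e2) [d2 d20 H2].
  exists (Num.min d1 d2) => [|x]; first by rewrite lt_min d10.
  rewrite lt_min distrC => /andP[x1 x2].
  have := H1 x x1; have := H2 x x2.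
  rewrite /cn !reimE distrC (distrC (re (u t))); lra.
split; apply/cvgrPdist_lt => e e0; have [d d0 H] := h e e0;
  exists d => // x /=; rewrite distrC => /H hx.
  by apply: le_lt_trans hx; rewrite distrC -reN -reD re_le_cn.
by apply: le_lt_trans hx; rewrite distrC -imN -imD im_le_cn.
Qed.

(** The mean value theorem in equality form fails for complex values; it is applied to the real and
    the imaginary part, at two different points, and the factor 2 is the price in the l1 norm. *)
Lemma cmvt u (u' : R -> C) (a b M : R) : a <= b ->
  (forall t, a <= t <= b -> iscd u t (u' t)) ->
  (forall t, a <= t <= b -> cn (u' t) <= M) ->
  cn (u b - u a) <= 2 * M * (b - a).
Proof.
rewrite le_eqVlt => /predU1P[->|ab] hu hM; first by rewrite subrr cn0 subrr mulr0.
have H (p : C -> R) (f f' : R -> R) : (forall t, a <= t <= b -> is_derive t (1:R) f (f' t)) ->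
   (forall t, a <= t <= b -> `|f' t| <= cn (u' t)) -> `|f b - f a| <= M * (b - a).
  move=> df lef.
  have cf : {within `[a, b], continuous f}.
    apply: continuous_in_subspaceT => x; rewrite inE /= in_itv /= => xab.
    exact: is_derive_cont (df x xab).
  have df' x : x \in `]a, b[%R -> is_derive x 1 f (f' x).
    by rewrite in_itv /= => /andP[/ltW ax /ltW xb]; apply: df; rewrite ax.
  have [c] := MVT ab df' cf.
  rewrite in_itv /= => /andP[/ltW ac /ltW cb] ->.
  have cab : a <= c <= b by rewrite ac.
  rewrite normrM (gtr0_norm (x := b - a)) ?subr_gt0// ler_wpM2r ?subr_ge0 ?(ltW ab)//.
  exact: le_trans (lef c cab) (hM c cab).
have h1 := H (@re R) (fun x => re (u x)) (fun x => re (u' x)).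
have h2 := H (@im R) (fun x => im (u x)) (fun x => im (u' x)).
have {}h1 := h1 (fun t h => (hu t h).1) (fun t _ => re_le_cn _).
have {}h2 := h2 (fun t h => (hu t h).2) (fun t _ => im_le_cn _).
rewrite /cn !reimE; lra.
Qed.

End Curves.

(** * Integrals of complex-valued functions over intervals *)

Section Integrals.

Variable R : realType.
Local Notation C := (Cplx R).
Local Notation mu := (@lebesgue_measure R).
Implicit Types (u w : R -> C) (a b t M : R) (l m : C).

Definition ri a b (f : R -> R) : R := \int[mu]_(x in `[a, b]) f x.
Definition rcOn a b (f : R -> R) := forall t, a <= t <= b -> {for t, continuous f}.
Definition cI a b u : C := mkC (ri a b (fun t => re (u t))) (ri a b (fun t => im (u t))).
Definition ccOn a b u := forall t, a <= t <= b -> ccont u t.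

Lemma rcOn_itv a b f : rcOn a b f -> {within `[a, b], continuous f}.
Proof.
move=> h; apply: continuous_in_subspaceT => x; rewrite inE /= in_itv /=; exact: h.
Qed.

Lemma rcOn_int a b f : rcOn a b f -> mu.-integrable `[a, b] (EFin \o f).
Proof.
move=> /rcOn_itv; apply: continuous_compact_integrable; exact: segment_compact.
Qed.

Lemma ccOn_re a b u : ccOn a b u -> rcOn a b (fun t => re (u t)).
Proof. by move=> h t /h []. Qed.
Lemma ccOn_im a b u : ccOn a b u -> rcOn a b (fun t => im (u t)).
Proof. by move=> h t /h []. Qed.

Lemma ri_ext a b f h : (forall t, a <= t <= b -> f t = h t) -> ri a b f = ri a b h.
Proof. by move=> e; apply: eq_Rintegral => x; rewrite inE /= in_itv /=; exact: e. Qed.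

Lemma ri_cst a b k : a <= b -> ri a b (fun=> k) = k * (b - a).
Proof.
move=> ab; have h : mu `[a, b]%classic = (b - a)%:E.
  by rewrite lebesgue_measure_itv /= lte_fin; case: ltgtP ab => // ->; rewrite subrr.
rewrite /ri Rintegral_cst//; congr (k * _).
transitivity (fine (b - a)%:E) => //; congr fine; exact: h.
Qed.

Lemma riD a b f h : rcOn a b f -> rcOn a b h ->
  ri a b (fun t => f t + h t) = ri a b f + ri a b h.
Proof. by move=> cf ch; rewrite /ri RintegralD//; exact: rcOn_int. Qed.

Lemma riZ a b f k : rcOn a b f -> ri a b (fun t => k * f t) = k * ri a b f.
Proof. by move=> cf; rewrite /ri RintegralZl//; exact: rcOn_int. Qed.

Lemma riN a b f : rcOn a b f -> ri a b (fun t => - f t) = - ri a b f.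
Proof.
by move=> cf; rewrite -mulN1r -riZ//; apply: ri_ext => t _; rewrite mulN1r.
Qed.

Lemma ri_le a b f h : rcOn a b f -> rcOn a b h ->
  (forall t, a <= t <= b -> f t <= h t) -> ri a b f <= ri a b h.
Proof.
move=> cf ch le; apply: le_Rintegral => //; exact: rcOn_int.
Qed.

Lemma rcOn_cst a b k : rcOn a b (fun=> k).
Proof. by move=> t _; exact: cvg_cst. Qed.

Lemma ri_norm a b f M : a <= b -> rcOn a b f ->
  (forall t, a <= t <= b -> `|f t| <= M) -> `|ri a b f| <= M * (b - a).
Proof.
move=> ab cf h; have cM k := @rcOn_cst a b k.
rewrite ler_norml -mulNr -!ri_cst//; apply/andP; split; apply: ri_le => // t /h;
  by rewrite ler_norml => /andP[].
Qed.

Lemma ri_FTC a b f F : a < b -> rcOn a b f -> rcOn a b F ->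
  (forall t, a < t < b -> is_derive t (1:R) F (f t)) -> ri a b f = F b - F a.
Proof.
move=> ab cf cF dF; rewrite /ri /Rintegral.
rewrite (continuous_FTC2 ab (rcOn_itv cf) (F := F)) ?EFinB//.
  split.
  - by move=> x; rewrite in_itv /= => /dF h; exact: ex_derive.
  - by apply: cvg_at_right_filter; apply: cF; rewrite lexx ltW.
  - by apply: cvg_at_left_filter; apply: cF; rewrite lexx ltW.
by move=> x; rewrite in_itv /= => /dF h; rewrite derive1E derive_val.
Qed.

Lemma ri_split a b c f : a <= b -> b <= c -> rcOn a c f ->
  ri a c f = ri a b f + ri b c f.
Proof.
move=> ab bc cf.
have h := @Rintegral_itvB R f (BLeft a) (BRight c) b (rcOn_int cf).
rewrite /ri; apply/eqP; rewrite addrC -subr_eq; apply/eqP.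
rewrite h ?bnd_simp//.
by rewrite Rintegral_itv_obnd_cbnd//; apply: (integrableS _ _ _ (rcOn_int cf)) => //;
  apply: subset_itvr; rewrite bnd_simp.
Qed.

Lemma cI_ext a b u w : (forall t, a <= t <= b -> u t = w t) -> cI a b u = cI a b w.
Proof. by move=> h; rewrite /cI; congr mkC; apply: ri_ext => t /h ->. Qed.

Lemma cI_cst a b l : a <= b -> cI a b (fun=> l) = toC (b - a) * l.
Proof. by move=> ab; apply: ceq; rewrite /cI !reimE ri_cst//; ring. Qed.

Lemma cID a b u w : ccOn a b u -> ccOn a b w ->
  cI a b (fun t => u t + w t) = cI a b u + cI a b w.
Proof.
move=> cu cw; apply: ceq; rewrite !reimE.
  rewrite -riD; [|exact: ccOn_re..].
  by apply: ri_ext => t _; rewrite reD.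
rewrite -riD; [|exact: ccOn_im..].
by apply: ri_ext => t _; rewrite imD.
Qed.

Lemma rcOnZ a b f k : rcOn a b f -> rcOn a b (fun t => k * f t).
Proof. by move=> h t /h; exact: cvgMr. Qed.

Lemma cIZ a b u l : ccOn a b u -> cI a b (fun t => l * u t) = l * cI a b u.
Proof.
move=> cu; have c1 := ccOn_re cu; have c2 := ccOn_im cu.
apply: ceq; rewrite !reimE.
  rewrite -mulNr -!riZ// -riD; [|exact: rcOnZ..].
  by apply: ri_ext => t _; rewrite reM mulNr.
rewrite -!riZ// -riD; [|exact: rcOnZ..].
by apply: ri_ext => t _; rewrite imM.
Qed.

Lemma cIN a b u : ccOn a b u -> cI a b (fun t => - u t) = - cI a b u.
Proof.
by move=> cu; rewrite -mulN1r -cIZ//; apply: cI_ext => t _; rewrite mulN1r.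
Qed.

Lemma ccOnN a b u : ccOn a b u -> ccOn a b (fun t => - u t).
Proof. by move=> h t /h; exact: ccontN. Qed.
Lemma ccOnD a b u w : ccOn a b u -> ccOn a b w -> ccOn a b (fun t => u t + w t).
Proof. by move=> h h' t tab; apply: ccontD; [exact: h|exact: h']. Qed.
Lemma ccOnM a b u w : ccOn a b u -> ccOn a b w -> ccOn a b (fun t => u t * w t).
Proof. by move=> h h' t tab; apply: ccontM; [exact: h|exact: h']. Qed.
Lemma ccOn_cst a b l : ccOn a b (fun=> l).
Proof. by move=> t _; exact: ccont_cst. Qed.

Lemma cIB a b u w : ccOn a b u -> ccOn a b w ->
  cI a b (fun t => u t - w t) = cI a b u - cI a b w.
Proof. by move=> cu cw; rewrite cID ?cIN//; exact: ccOnN. Qed.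

Lemma cI_conj a b u : ccOn a b u -> cI a b (fun t => cconj (u t)) = cconj (cI a b u).
Proof. by move=> cu; apply: ceq; rewrite !reimE //= riN//; exact: ccOn_im. Qed.

Lemma cI_norm a b u M : a <= b -> ccOn a b u ->
  (forall t, a <= t <= b -> cn (u t) <= M) -> cn (cI a b u) <= 2 * M * (b - a).
Proof.
move=> ab cu h.
have h1 := ri_norm ab (ccOn_re cu) (fun t tab => le_trans (re_le_cn _) (h t tab)).
have h2 := ri_norm ab (ccOn_im cu) (fun t tab => le_trans (im_le_cn _) (h t tab)).
rewrite /cn !reimE; lra.
Qed.

Lemma cI_FTC a b u U : a < b -> ccOn a b u -> ccOn a b U ->
  (forall t, a < t < b -> iscd U t (u t)) -> cI a b u = U b - U a.
Proof.
move=> ab cu cU dU; apply: ceq; rewrite !reimE.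
  by apply: (ri_FTC ab (ccOn_re cu) (ccOn_re cU)) => t /dU [].
by apply: (ri_FTC ab (ccOn_im cu) (ccOn_im cU)) => t /dU [].
Qed.

Lemma cI_split a b c u : a <= b -> b <= c -> ccOn a c u ->
  cI a c u = cI a b u + cI b c u.
Proof.
move=> ab bc cu; apply: ceq; rewrite !reimE; apply: ri_split => //.
  exact: ccOn_re.
exact: ccOn_im.
Qed.

Lemma ri_cont a b (x0 d M : R) (F : R -> R -> R) : 0 < d ->
  (forall x, `|x - x0| < d -> rcOn a b (F x)) ->
  (forall x t, `|x - x0| < d -> a <= t <= b -> {for x, continuous (F ^~ t)}) ->
  (forall x t, `|x - x0| < d -> a <= t <= b -> `|F x t| <= M) ->
  {for x0, continuous (fun x => ri a b (F x))}.
Proof.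
move=> d0 h1 h2 h3.
have I x : x \in `]x0 - d, x0 + d[ -> `|x - x0| < d.
  by rewrite in_itv /= ltr_norml; lra.
apply: (@continuity_under_integral R _ _ mu F `[a, b] _ (x0 - d) (x0 + d) _ _ (fun=> M)) => //.
- by move=> x /I /h1; exact: rcOn_int.
- apply/aeW => y; rewrite /= in_itv /= => yab x; rewrite inE => /I xd.
  exact: h2.
- by apply: rcOn_int => t _; exact: cvg_cst.
- move=> x /I xd; apply/aeW => y; rewrite /= in_itv /= => yab; exact: h3.
by rewrite inE /= in_itv /=; lra.
Qed.

Lemma cI_cont a b (x0 d M : R) (F : R -> R -> C) : 0 < d ->
  (forall x, `|x - x0| < d -> ccOn a b (F x)) ->
  (forall x t, `|x - x0| < d -> a <= t <= b -> ccont (F ^~ t) x) ->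
  (forall x t, `|x - x0| < d -> a <= t <= b -> cn (F x t) <= M) ->
  ccont (fun x => cI a b (F x)) x0.
Proof.
move=> d0 h1 h2 h3; split.
  apply: (@ri_cont a b x0 d M (fun x t => re (F x t))) => //.
  - by move=> x /h1; exact: ccOn_re.
  - by move=> x t xd tab; have [] := h2 x t xd tab.
  - by move=> x t xd tab; apply: le_trans (h3 x t xd tab); exact: re_le_cn.
apply: (@ri_cont a b x0 d M (fun x t => im (F x t))) => //.
- by move=> x /h1; exact: ccOn_im.
- by move=> x t xd tab; have [] := h2 x t xd tab.
- by move=> x t xd tab; apply: le_trans (h3 x t xd tab); exact: im_le_cn.
Qed.

Lemma ri_diff a b (x0 d M : R) (F F' : R -> R -> R) : 0 < d ->
  (forall x, `|x - x0| < d -> rcOn a b (F x)) ->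
  (forall x t, `|x - x0| < d -> a <= t <= b -> is_derive x (1:R) (F ^~ t) (F' x t)) ->
  (forall x t, `|x - x0| < d -> a <= t <= b -> `|F' x t| <= M) ->
  is_derive x0 (1:R) (fun x => ri a b (F x)) (ri a b (F' x0)).
Proof.
move=> d0 h1 h2 h3.
have I x : x \in `]x0 - d, x0 + d[ -> `|x - x0| < d.
  by rewrite in_itv /= ltr_norml; lra.
have x0d : `|x0 - x0| < d by rewrite subrr normr0.
have I0 : `]x0 - d, x0 + d[%classic x0 by rewrite /= in_itv /=; lra.
have e x t : `|x - x0| < d -> a <= t <= b -> (F ^~ t)^`()%classic x = F' x t.
  by move=> xd tab; have h := h2 x t xd tab; rewrite derive1E derive_val.
have i1 x : `]x0 - d, x0 + d[%classic x -> mu.-integrable `[a, b] (EFin \o F x).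
  by move=> /I xd; apply: rcOn_int; exact: h1.
have i2 x y : `]x0 - d, x0 + d[%classic x -> `[a, b]%classic y -> derivable (F ^~ y) x 1.
  by move=> /I xd; rewrite /= in_itv /= => yab; have h := h2 x y xd yab; exact: ex_derive.
have i3 (y : R) : 0 <= (fun=> `|M|) y :> R by [].
have i4 : mu.-integrable `[a, b] (EFin \o (fun=> `|M|)).
  by apply: rcOn_int => t _; exact: cvg_cst.
have i5 x y : `]x0 - d, x0 + d[%classic x -> `[a, b]%classic y ->
    `|partial1of2 F x y| <= (fun=> `|M|) y.
  move=> /I xd; rewrite /= in_itv /= => yab; rewrite /partial1of2 e//.
  by apply: le_trans (h3 _ _ xd yab) _; exact: ler_norm.
have mab : measurable (`[a, b]%classic : set R) by [].
apply: DeriveDef.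
  exact: (@derivable_under_integral R _ _ mu F `[a, b] mab x0 (x0 - d) (x0 + d) I0 i1 i2 (fun=> `|M|) i3 i4 i5).
rewrite -derive1E (@differentiation_under_integral R _ _ mu F `[a, b] mab x0 (x0 - d) (x0 + d) I0 i1 i2 (fun=> `|M|) i3 i4 i5).
by apply: ri_ext => t tab; rewrite /partial1of2 e.
Qed.

(** Leibniz's rule with a constant majorant; this suffices because the convolutions are brought to
    bounded integrands on compact intervals. *)
Lemma cI_diff a b (x0 d M : R) (F F' : R -> R -> C) : 0 < d ->
  (forall x, `|x - x0| < d -> ccOn a b (F x)) ->
  (forall x t, `|x - x0| < d -> a <= t <= b -> iscd (F ^~ t) x (F' x t)) ->
  (forall x t, `|x - x0| < d -> a <= t <= b -> cn (F' x t) <= M) ->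
  iscd (fun x => cI a b (F x)) x0 (cI a b (F' x0)).
Proof.
move=> d0 h1 h2 h3; split.
  apply: (@ri_diff a b x0 d M (fun x t => re (F x t)) (fun x t => re (F' x t))) => //.
  - by move=> x /h1; exact: ccOn_re.
  - by move=> x t xd tab; have [] := h2 x t xd tab.
  - by move=> x t xd tab; apply: le_trans (h3 x t xd tab); exact: re_le_cn.
apply: (@ri_diff a b x0 d M (fun x t => im (F x t)) (fun x t => im (F' x t))) => //.
- by move=> x /h1; exact: ccOn_im.
- by move=> x t xd tab; have [] := h2 x t xd tab.
- by move=> x t xd tab; apply: le_trans (h3 x t xd tab); exact: im_le_cn.
Qed.

End Integrals.

(** * Derivatives through explicit remainder estimates *)

Section LittleO.

Variable R : realType.
Local Notation C := (Cplx R).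

Lemma is_deriveP (f : R -> R) t l : is_derive t (1 : R) f l <->
  (forall e : R, 0 < e -> exists2 d : R, 0 < d & forall h, `|h| < d ->
     `|f (t + h) - f t - h * l| <= e * `|h|).
Proof.
have E h : h != 0 -> h^-1 *: (f (h *: (1 : R) + t) - f t) - l = h^-1 * (f (t + h) - f t - h * l).
  by move=> h0; rewrite /GRing.scale /= mulr1 (addrC h) [RHS]mulrBr mulKf.
split=> [H e e0|H].
  have [dr vl] := H; have := dr; rewrite /derivable -/(derive f t 1) => /cvgrPdist_le.
  rewrite -/(derive _ _ _) vl => /(_ e e0).
  rewrite /nbhs /= /dnbhs => -[d /= d0 Hd]; exists d => // h hd.
  have [->|h0] := eqVneq h 0; first by rewrite addr0 mul0r !subr0 subrr !normr0 mulr0.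
  have hd' : ball_ Num.norm 0 d h by rewrite /ball_ /= sub0r normrN.
  have := Hd h hd' h0; rewrite /= distrC E// normrM normfV.
  by rewrite mulrC ler_pdivrMr ?normr_gt0.
have c : h^-1 *: (f (h *: (1 : R) + t) - f t) @[h --> 0^'] --> l.
  apply/cvgrPdist_le => e e0; have [d d0 Hd] := H e e0.
  exists d => // h; rewrite /ball_ /= sub0r normrN => hd h0.
  rewrite distrC E// normrM normfV mulrC ler_pdivrMr ?normr_gt0//.
  exact: Hd.
by apply: DeriveDef; [apply: cvgP c|apply/cvg_lim].
Qed.

Lemma iscdP (u : R -> C) t l : iscd u t l <->
  (forall e : R, 0 < e -> exists2 d : R, 0 < d & forall h, `|h| < d ->
     cn (u (t + h) - u t - toC h * l) <= e * `|h|).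
Proof.
split=> [[/is_deriveP H1 /is_deriveP H2] e e0|H].
  have e2 : 0 < e / 2 by lra.
  have [d1 d10 h1] := H1 _ e2; have [d2 d20 h2] := H2 _ e2.
  exists (Num.min d1 d2) => [|h]; first by rewrite lt_min d10.
  rewrite lt_min => /andP[/h1 + /h2].
  rewrite /cn !reimE !mul0r subr0 addr0; lra.
split; apply/is_deriveP => e e0; have [d d0 h] := H e e0; exists d => // x /h hx;
  apply: le_trans hx.
  by apply: le_trans (re_le_cn _); rewrite !reimE mul0r subr0.
by apply: le_trans (im_le_cn _); rewrite !reimE mul0r addr0.
Qed.

End LittleO.

(** * Smooth functions on open subsets of C^g *)

Section Smooth.

Variables (R : realType) (g : nat).
Local Notation C := (Cplx R).
Local Notation V := 'cV[C]_g.
Implicit Types (f : V -> C) (U : set V) (v w d : V) (h t M : R).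

Definition sc h d : V := toC h *: d.
Definition vn v : R := \sum_i cn (v i ord0).

Lemma scD h h' d : sc (h + h') d = sc h d + sc h' d.
Proof. by rewrite /sc toCD scalerDl. Qed.
Lemma scDr h d d' : sc h (d + d') = sc h d + sc h d'.
Proof. by rewrite /sc scalerDr. Qed.
Lemma scN h d : sc (- h) d = - sc h d.
Proof. by rewrite /sc toCN scaleNr. Qed.
Lemma sc0 d : sc 0 d = 0. Proof. by rewrite /sc toC0 scale0r. Qed.
Lemma sc1 d : sc 1 d = d. Proof. by rewrite /sc toC1 scale1r. Qed.
Lemma scA h h' d : sc h (sc h' d) = sc (h * h') d.
Proof. by rewrite /sc toCM scalerA. Qed.
Lemma vn_ge0 v : 0 <= vn v.
Proof. by apply: sumr_ge0 => i _; exact: cn_ge0. Qed.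
Lemma vn0 : vn 0 = 0.
Proof. by rewrite /vn big1// => i _; rewrite mxE cn0. Qed.
Lemma vnD v w : vn (v + w) <= vn v + vn w.
Proof. by rewrite -big_split; apply: ler_sum => i _; rewrite mxE cnD. Qed.
Lemma vnN v : vn (- v) = vn v.
Proof. by apply: eq_bigr => i _; rewrite mxE cnN. Qed.
Lemma vnB v w : vn (v - w) <= vn v + vn w.
Proof. by rewrite -(vnN w) vnD. Qed.
Lemma vn_sc h d : vn (sc h d) = `|h| * vn d.
Proof. by rewrite /vn mulr_sumr; apply: eq_bigr => i _; rewrite mxE cnMtoC. Qed.
Lemma vn_scale (c : C) d : vn (c *: d) <= cn c * vn d.
Proof. by rewrite /vn mulr_sumr; apply: ler_sum => i _; rewrite mxE cnM. Qed.
Lemma cn_le_vn v i : cn (v i ord0) <= vn v.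
Proof.
by rewrite /vn (bigD1 i)//= lerDl; apply: sumr_ge0 => j _; exact: cn_ge0.
Qed.

Definition vopen U := forall v, U v -> exists2 e : R, 0 < e & forall w, vn (w - v) < e -> U w.

Lemma vopenI U U' : vopen U -> vopen U' -> vopen (U `&` U').
Proof.
move=> h h' v [/h[e e0 He] /h'[e' e'0 He']]; exists (Num.min e e').
  by rewrite lt_min e0.
by move=> w; rewrite lt_min => /andP[/He ? /He'].
Qed.
Lemma vopenT : vopen setT.
Proof. by move=> v _; exists 1 => //; rewrite ltr01. Qed.
Lemma vopen_ball v (e : R) : vopen [set w | vn (w - v) < e].
Proof.
move=> w /= we; exists (e - vn (w - v)); first by rewrite subr_gt0.
by move=> x; have := vnD (x - w) (w - v); rewrite addrA subrK; lra.
Qed.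

(** Local boundedness of the iterated directional derivatives stands in for their continuity: it
    passes through sums, products and composites at once, and continuity is recovered from it by the
    mean value inequality. *)
Definition lb U f := forall v, U v -> exists e M : R, 0 < e /\
  forall w, U w -> vn (w - v) < e -> cn (f w) <= M.

Definition haspd f v d (l : C) := iscd (fun h => f (v + sc h d)) 0 l.

(** Total by the convention of [derive1], hence meaningful only where [haspd] holds with this value;
    [Cn] asks for that at every point. Neither linearity in d nor symmetry of second derivatives is
    built in; both are derived from the bounds. *)
Definition pd d f v : C :=
  mkC (derive1 (fun h : R => re (f (v + sc h d))) 0)
      (derive1 (fun h : R => im (f (v + sc h d))) 0).

Fixpoint Cn n U f : Prop :=
  match n with
  | 0 => lb U f
  | n'.+1 => lb U f /\
      forall d, (forall v, U v -> haspd f v d (pd d f v)) /\ Cn n' U (pd d f)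
  end.

Definition sm U f := forall n, Cn n U f.

Lemma haspd_pd f v d l : haspd f v d l -> pd d f v = l.
Proof.
by move=> [h1 h2]; apply: ceq; rewrite !reimE derive1E derive_val.
Qed.

Lemma haspd_ok f v d l : haspd f v d l -> haspd f v d (pd d f v).
Proof. by move=> h; rewrite (haspd_pd h). Qed.

Lemma near0_sub U v d : vopen U -> U v -> \forall h \near (0 : R), U (v + sc h d).
Proof.
move=> oU /oU [e e0 He].
have v1 : 0 < vn d + 1 by have := vn_ge0 d; lra.
exists (e / (vn d + 1)); first exact: divr_gt0.
move=> h; rewrite /ball_ /= sub0r normrN ltr_pdivlMr// => hh.
apply: He; rewrite addrC addKr vn_sc.
have := normr_ge0 h; have := vn_ge0 d; nra.
Qed.

Lemma haspd_ext U f f' v d l : vopen U -> U v -> (forall w, U w -> f w = f' w) ->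
  haspd f v d l -> haspd f' v d l.
Proof.
move=> oU Uv e; apply: iscd_near.
by near=> h; apply: e; near: h; exact: near0_sub.
Unshelve. all: by end_near. Qed.

Lemma pd_ext U f f' v d : vopen U -> U v -> (forall w, U w -> f w = f' w) ->
  pd d f v = pd d f' v.
Proof.
move=> oU Uv e; apply: ceq; rewrite !reimE !derive1E; apply: near_eq_derive;
  near=> h; congr (_ (_ : C)); apply: e; near: h; exact: near0_sub.
Unshelve. all: by end_near. Qed.

Lemma lb_ext U f f' : (forall w, U w -> f w = f' w) -> lb U f -> lb U f'.
Proof.
move=> e h v Uv; have [x [M [x0 H]]] := h v Uv; exists x, M; split=> // w Uw wv.
by rewrite -e//; exact: H.
Qed.

Lemma Cn_ext n U f f' : vopen U -> (forall w, U w -> f w = f' w) -> Cn n U f -> Cn n U f'.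
Proof.
move=> oU; elim: n f f' => [|n IH] f f' e; first exact: lb_ext.
move=> [h1 h2]; split; first exact: lb_ext h1.
move=> d; have [h3 h4] := h2 d; split.
  by move=> v Uv; apply: haspd_ok; apply: (haspd_ext oU Uv e (l := pd d f v)); exact: h3.
by apply: IH h4 => w Uw; exact: (pd_ext _ oU).
Qed.

Lemma Cn_lb n U f : Cn n U f -> lb U f.
Proof. by case: n => [|n] // []. Qed.

Lemma Cn_pd n U f d : Cn n.+1 U f -> Cn n U (pd d f).
Proof. by move=> [_ /(_ d) []]. Qed.

Lemma Cn_has n U f d v : Cn n.+1 U f -> U v -> haspd f v d (pd d f v).
Proof. by move=> [_ /(_ d) [h _]]; exact: h. Qed.

Lemma sm_pd U f d : sm U f -> sm U (pd d f).
Proof. by move=> h n; apply: Cn_pd; exact: h. Qed.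

Lemma sm_has U f d v : sm U f -> U v -> haspd f v d (pd d f v).
Proof. by move=> h; apply: Cn_has; exact: (h 1%N). Qed.

Lemma sm_ext U f f' : vopen U -> (forall w, U w -> f w = f' w) -> sm U f -> sm U f'.
Proof. by move=> oU e h n; apply: Cn_ext (h n). Qed.

Lemma Cn_sub n U U' f : U' `<=` U -> Cn n U f -> Cn n U' f.
Proof.
move=> s; have lbs f' : lb U f' -> lb U' f'.
  move=> h v /s/h [e [M [e0 H]]]; exists e, M; split=> // w /s; exact: H.
elim: n f => [|n IH] f; first exact: lbs.
move=> [h1 h2]; split; first exact: lbs.
by move=> d; have [h3 h4] := h2 d; split; [move=> v /s; exact: h3|exact: IH].
Qed.

Lemma sm_sub U U' f : U' `<=` U -> sm U f -> sm U' f.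
Proof. by move=> s h n; exact: Cn_sub (h n). Qed.

Lemma Cn_loc n U f : (forall v, U v -> exists U', [/\ vopen U', U' v & Cn n U' f]) -> Cn n U f.
Proof.
have lbl f' : (forall v, U v -> exists U', [/\ vopen U', U' v & lb U' f']) -> lb U f'.
  move=> h v Uv; have [U' [oU' U'v H]] := h v Uv.
  have [e [M [e0 He]]] := H v U'v; have [e' e'0 He'] := oU' v U'v.
  exists (Num.min e e'), M; split; first by rewrite lt_min e0.
  move=> w _; rewrite lt_min => /andP[w1 w2]; apply: He => //; exact: He'.
elim: n f => [|n IH] f h; first exact: lbl.
split.
  by apply: lbl => v /h [U' [? ? H]]; exists U'; split=> //; exact: Cn_lb H.
move=> d; split; first by move=> v /h [U' [? ? H]]; exact: Cn_has H _.
by apply: IH => v /h [U' [? ? H]]; exists U'; split=> //; exact: Cn_pd.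
Qed.

Lemma sm_loc U f : (forall v, U v -> exists U', [/\ vopen U', U' v & sm U' f]) -> sm U f.
Proof.
by move=> h n; apply: Cn_loc => v /h [U' [? ? H]]; exists U'; split=> //; exact: H.
Qed.

Lemma CnW n U f : Cn n.+1 U f -> Cn n U f.
Proof.
elim: n f => [|n IH] f; first by case.
move=> [h1 h2]; split; first exact: h1.
by move=> d; have [h3 h4] := h2 d; split; [exact: h3|exact: IH].
Qed.

Lemma lb_cst U l : lb U (fun=> l).
Proof. by move=> v _; exists 1, (cn l); split. Qed.

Lemma lbD U f f' : lb U f -> lb U f' -> lb U (fun v => f v + f' v).
Proof.
move=> h h' v Uv; have [e [M [e0 H]]] := h v Uv; have [e' [M' [e'0 H']]] := h' v Uv.
exists (Num.min e e'), (M + M'); split; first by rewrite lt_min e0.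
move=> w Uw; rewrite lt_min => /andP[w1 w2].
by apply: le_trans (cnD _ _) _; apply: lerD; [exact: H|exact: H'].
Qed.

Lemma lbM U f f' : lb U f -> lb U f' -> lb U (fun v => f v * f' v).
Proof.
move=> h h' v Uv; have [e [M [e0 H]]] := h v Uv; have [e' [M' [e'0 H']]] := h' v Uv.
exists (Num.min e e'), (M * M'); split; first by rewrite lt_min e0.
move=> w Uw; rewrite lt_min => /andP[w1 w2].
apply: le_trans (cnM _ _) _; apply: ler_pM => //; try exact: cn_ge0.
  exact: H.
exact: H'.
Qed.

Lemma haspd_cst l v d : haspd (fun=> l) v d 0.
Proof. exact: iscd_cst. Qed.
Lemma haspdD f f' v d l l' : haspd f v d l -> haspd f' v d l' ->
  haspd (fun w => f w + f' w) v d (l + l').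
Proof. exact: iscdD. Qed.
Lemma haspdM f f' v d l l' : haspd f v d l -> haspd f' v d l' ->
  haspd (fun w => f w * f' w) v d (l * f' v + f v * l').
Proof. by move=> h h'; have := iscdM h h'; rewrite sc0 addr0. Qed.
Lemma haspdZ c f v d l : haspd f v d l -> haspd (fun w => c * f w) v d (c * l).
Proof. exact: iscdZ. Qed.
Lemma haspd_conj f v d l : haspd f v d l -> haspd (fun w => cconj (f w)) v d (cconj l).
Proof. exact: iscd_conj. Qed.
Lemma haspd_cexp f v d l : haspd f v d l -> haspd (fun w => cexp (f w)) v d (l * cexp (f v)).
Proof. by move=> h; have := iscd_cexp h; rewrite sc0 addr0. Qed.

Lemma Cn_cst n U l : vopen U -> Cn n U (fun=> l).
Proof.
move=> oU; elim: n l => [|n IH] l; first exact: lb_cst.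
split; first exact: lb_cst.
move=> d; have h v := haspd_cst l v d; split; first by move=> v _; exact: haspd_ok (h v).
by apply: Cn_ext (IH 0) => // w _; rewrite (haspd_pd (h w)).
Qed.

Lemma CnD n U f f' : vopen U -> Cn n U f -> Cn n U f' -> Cn n U (fun v => f v + f' v).
Proof.
move=> oU; elim: n f f' => [|n IH] f f'; first exact: lbD.
move=> [a1 a2] [b1 b2]; split; first exact: lbD.
move=> d; have [a3 a4] := a2 d; have [b3 b4] := b2 d.
have h v : U v -> haspd (fun v => f v + f' v) v d (pd d f v + pd d f' v).
  by move=> Uv; apply: haspdD; [exact: a3|exact: b3].
split; first by move=> v Uv; exact: haspd_ok (h v Uv).
by apply: Cn_ext (IH _ _ a4 b4) => // v Uv; rewrite (haspd_pd (h v Uv)).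
Qed.

Lemma CnM n U f f' : vopen U -> Cn n U f -> Cn n U f' -> Cn n U (fun v => f v * f' v).
Proof.
move=> oU; elim: n f f' => [|n IH] f f'; first exact: lbM.
move=> A B; move: (A) (B) => [a1 a2] [b1 b2]; split; first exact: lbM.
move=> d; have [a3 a4] := a2 d; have [b3 b4] := b2 d.
have h v : U v -> haspd (fun v => f v * f' v) v d (pd d f v * f' v + f v * pd d f' v).
  by move=> Uv; apply: haspdM; [exact: a3|exact: b3].
split; first by move=> v Uv; exact: haspd_ok (h v Uv).
apply: (Cn_ext (f := fun v => pd d f v * f' v + f v * pd d f' v)) => //.
  by move=> v Uv; rewrite (haspd_pd (h v Uv)).
by apply: CnD => //; apply: IH => //; exact: CnW.
Qed.

Lemma smD U f f' : vopen U -> sm U f -> sm U f' -> sm U (fun v => f v + f' v).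
Proof. by move=> oU h h' n; exact: CnD. Qed.
Lemma smM U f f' : vopen U -> sm U f -> sm U f' -> sm U (fun v => f v * f' v).
Proof. by move=> oU h h' n; exact: CnM. Qed.
Lemma sm_cst U l : vopen U -> sm U (fun=> l).
Proof. by move=> oU n; exact: Cn_cst. Qed.
Lemma smZ U c f : vopen U -> sm U f -> sm U (fun v => c * f v).
Proof. by move=> oU h; apply: smM => //; exact: sm_cst. Qed.
Lemma smN U f : vopen U -> sm U f -> sm U (fun v => - f v).
Proof.
move=> oU h; apply: (sm_ext (f := fun v => -1 * f v)) => //; last exact: smZ.
by move=> w _; rewrite mulN1r.
Qed.
Lemma smB U f f' : vopen U -> sm U f -> sm U f' -> sm U (fun v => f v - f' v).
Proof. by move=> oU h h'; apply: smD => //; exact: smN. Qed.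
Lemma sm_sum U I (r : seq I) (P : pred I) (F : I -> V -> C) : vopen U ->
  (forall i, P i -> sm U (F i)) -> sm U (fun v => \sum_(i <- r | P i) F i v).
Proof.
move=> oU h; elim: r => [|i r IH].
  by apply: sm_ext (sm_cst 0 oU) => // v _; rewrite big_nil.
have [Pi|Pi] := boolP (P i).
  apply: (sm_ext (f := fun v => F i v + \sum_(i <- r | P i) F i v)) => //.
    by move=> v _; rewrite big_cons Pi.
  by apply: smD => //; exact: h.
by apply: sm_ext IH => // v _; rewrite big_cons (negPf Pi).
Qed.

Lemma Cn_cexp n U f : vopen U -> Cn n U f -> Cn n U (fun v => cexp (f v)).
Proof.
move=> oU; have lbc f' : lb U f' -> lb U (fun v => cexp (f' v)).
  move=> h v Uv; have [e [M [e0 H]]] := h v Uv; exists e, (2 * expR M); split=> // w Uw wv.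
  apply: le_trans (cn_cexp _) _; rewrite ler_pM2l// ler_expR.
  by apply: le_trans (ler_norm _) _; apply: le_trans (re_le_cn _) _; exact: H.
elim: n f => [|n IH] f; first exact: lbc.
move=> A; move: (A) => [a1 a2]; split; first exact: lbc.
move=> d; have [a3 a4] := a2 d.
have h v : U v -> haspd (fun v => cexp (f v)) v d (pd d f v * cexp (f v)).
  by move=> Uv; apply: haspd_cexp; exact: a3.
split; first by move=> v Uv; exact: haspd_ok (h v Uv).
apply: (Cn_ext (f := fun v => pd d f v * cexp (f v))) => //.
  by move=> v Uv; rewrite (haspd_pd (h v Uv)).
by apply: CnM => //; apply: IH => //; exact: CnW.
Qed.

Lemma sm_cexp U f : vopen U -> sm U f -> sm U (fun v => cexp (f v)).
Proof. by move=> oU h n; exact: Cn_cexp. Qed.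

Lemma Cn_conj n U f : vopen U -> Cn n U f -> Cn n U (fun v => cconj (f v)).
Proof.
move=> oU; have lbc f' : lb U f' -> lb U (fun v => cconj (f' v)).
  move=> h v Uv; have [e [M [e0 H]]] := h v Uv; exists e, M; split=> // w Uw wv.
  by rewrite cn_conj; exact: H.
elim: n f => [|n IH] f; first exact: lbc.
move=> [a1 a2]; split; first exact: lbc.
move=> d; have [a3 a4] := a2 d.
have h v : U v -> haspd (fun v => cconj (f v)) v d (cconj (pd d f v)).
  by move=> Uv; apply: haspd_conj; exact: a3.
split; first by move=> v Uv; exact: haspd_ok (h v Uv).
by apply: Cn_ext (IH _ a4) => // v Uv; rewrite (haspd_pd (h v Uv)).
Qed.

Lemma sm_conj U f : vopen U -> sm U f -> sm U (fun v => cconj (f v)).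
Proof. by move=> oU h n; exact: Cn_conj. Qed.

Definition rlin f := (forall v w, f (v + w) = f v + f w) /\
  (forall h v, f (sc h v) = toC h * f v) /\ exists K : R, forall v, cn (f v) <= K * vn v.

Lemma haspd_rlin f v d : rlin f -> haspd f v d (f d).
Proof.
move=> [fD [fs _]].
have := iscdD (iscd_cst (f v) 0) (iscdM (iscd_id 0) (iscd_cst (f d) 0)).
rewrite mul1r mulr0 addr0 add0r; apply: iscd_ext => h.
by rewrite fD fs.
Qed.

Lemma sm_rlin U f : vopen U -> rlin f -> sm U f.
Proof.
move=> oU rf; have lbf : lb U f.
  have [_ [_ [K HK]]] := rf; move=> v Uv; exists 1, (`|K| * (vn v + 1)); split=> // w _ wv.
  apply: le_trans (HK _) _; have := vnD (w - v) v; rewrite subrK => hw.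
  have := ler_norm K; have := vn_ge0 w; have := normr_ge0 K; nra.
case=> [|n]; first exact: lbf.
split; first exact: lbf.
move=> d; split.
  by move=> v _; exact: haspd_ok (haspd_rlin v d rf).
apply: Cn_ext (Cn_cst n (f d) oU) => // v _.
by rewrite (haspd_pd (haspd_rlin v d rf)).
Qed.

(** Every derivative of 1/f is a polynomial in 1/f and derivatives of f, so local boundedness of 1/f
    is the only further input to the induction. *)
Lemma smV U f : vopen U -> sm U f -> (forall v, U v -> f v != 0) ->
  (forall v, U v -> exists e M : R, 0 < e /\ forall w, U w -> vn (w - v) < e -> cn ((f w)^-1) <= M) ->
  sm U (fun v => (f v)^-1).
Proof.
move=> oU sf f0 lbV.
have h d v : U v -> haspd (fun v => (f v)^-1) v d (- pd d f v * ((f v)^-1 * (f v)^-1)).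
  move=> Uv; have := @iscdV R (fun h => f (v + sc h d)) 0 (pd d f v).
  rewrite sc0 addr0 expr2 invfM; apply; first exact: f0; last exact: sm_has.
  by near=> h; apply: f0; near: h; exact: near0_sub.
elim=> [|n IH]; first exact: lbV.
split; first exact: lbV.
move=> d; split; first by move=> v Uv; exact: haspd_ok (h d v Uv).
apply: (Cn_ext (f := fun v => - pd d f v * ((f v)^-1 * (f v)^-1))) => //.
  by move=> v Uv; rewrite (haspd_pd (h d v Uv)).
by apply: CnM => //; [apply: smN => //; exact: sm_pd|exact: CnM].
Unshelve. all: by end_near. Qed.

Lemma haspd_shift f v c d l : haspd f (v + c) d l -> haspd (fun w => f (w + c)) v d l.
Proof. by apply: iscd_ext => h; rewrite addrAC. Qed.

Lemma Cn_shift n U f c : vopen U -> Cn n U f -> Cn n [set v | U (v + c)] (fun v => f (v + c)).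
Proof.
move=> oU.
have oU' : vopen [set v | U (v + c)].
  move=> v /= /oU [e e0 H]; exists e => // w wv; apply: H.
  by rewrite opprD addrACA subrr addr0.
have lbs f' : lb U f' -> lb [set v | U (v + c)] (fun v => f' (v + c)).
  move=> h v /= Uv; have [e [M [e0 H]]] := h _ Uv; exists e, M; split=> // w Uw wv.
  by apply: H => //; rewrite opprD addrACA subrr addr0.
elim: n f => [|n IH] f; first exact: lbs.
move=> [a1 a2]; split; first exact: lbs.
move=> d; have [a3 a4] := a2 d.
have h v : U (v + c) -> haspd (fun v => f (v + c)) v d (pd d f (v + c)).
  by move=> Uv; apply: haspd_shift; exact: a3.
split; first by move=> v Uv; exact: haspd_ok (h v Uv).
by apply: Cn_ext (IH _ a4) => // v Uv; rewrite (haspd_pd (h v Uv)).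
Qed.

End Smooth.

Ltac clra := repeat match goal with
  | |- context [@cn ?r ?x] => let a := fresh "a" in generalize (@cn r x); intro a
  | |- context [@vn ?r ?n ?x] => let a := fresh "a" in generalize (@vn r n x); intro a
  | |- context [@Num.norm ?r ?s ?x] => let a := fresh "a" in move: (@Num.norm r s x) => a
  end; clear; intros; lra.

(** * Lipschitz and Taylor estimates *)

Section C1.

Variables (R : realType) (g : nat).
Local Notation C := (Cplx R).
Local Notation V := 'cV[C]_g.
Implicit Types (f : V -> C) (U : set V) (v w d p : V) (h t M : R).

Lemma haspd_line f p d t l : haspd f (p + sc t d) d l -> iscd (fun x => f (p + sc x d)) t l.
Proof.
move=> H; have H' : iscd (fun h => f (p + sc t d + sc h d)) (t - t) l by rewrite subrr.
have dx : is_derive t (1 : R) (fun x : R => x - t) 1.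
  have := is_deriveB (is_derive_id t (1 : R)) (is_derive_cst t t (1 : R)).
  by rewrite subr0.
have := iscd_comp (f := fun x => x - t) H' dx.
rewrite toC1 mulr1; apply: iscd_ext => x.
by rewrite -addrA -scD (addrC t) subrK.
Qed.

Lemma haspd_line_scale f p d h t l : haspd f (p + sc (t * h) d) d l ->
  iscd (fun x => f (p + sc (x * h) d)) t (l * toC h).
Proof.
move=> H; have := haspd_line H => H'.
have dx : is_derive t (1 : R) (fun x : R => x * h) h.
  have := is_deriveM (is_derive_id t (1 : R)) (is_derive_cst h t (1 : R)).
  by rewrite scaler0 add0r /GRing.scale /= mulr1.
exact: (iscd_comp (f := fun x => x * h) H' dx).
Qed.

Lemma line_bound f p d h M :
  (forall t, 0 <= t <= 1 -> haspd f (p + sc (t * h) d) d (pd d f (p + sc (t * h) d))) ->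
  (forall t, 0 <= t <= 1 -> cn (pd d f (p + sc (t * h) d)) <= M) ->
  cn (f (p + sc h d) - f p) <= 2 * M * `|h|.
Proof.
move=> H HM.
have := @cmvt R (fun x => f (p + sc (x * h) d)) (fun x => pd d f (p + sc (x * h) d) * toC h)
  0 1 (M * `|h|) ler01 _ _.
rewrite mul1r mul0r sc0 addr0 subr0 mulr1 mulrA; apply.
  by move=> t /H; exact: haspd_line_scale.
move=> t /HM tM; rewrite mulrC cnMtoC mulrC.
by rewrite ler_wpM2r.
Qed.

Definition psum (s : seq (R * V)) : V := \sum_(x <- s) sc x.1 x.2.
Definition cost (s : seq (R * V)) : R := \sum_(x <- s) `|x.1| * vn x.2.

Lemma cost_ge0 s : 0 <= cost s.
Proof. by apply: sumr_ge0 => x _; rewrite mulr_ge0 ?vn_ge0. Qed.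

Lemma pd_lb_list f U v (D : seq V) : vopen U -> Cn 1 U f -> U v ->
  exists e M : R, [/\ 0 < e, 0 <= M & forall d w, d \in D -> vn (w - v) < e ->
    U w /\ cn (pd d f w) <= M].
Proof.
move=> oU fC Uv; elim: D => [|d D [e [M [e0 M0 H]]]].
  by exists 1, 0; split.
have [e1 e10 H1] := oU v Uv.
have [e2 [M2 [e20 H2]]] := Cn_lb (Cn_pd d fC) Uv.
exists (Num.min e (Num.min e1 e2)), (Num.max M M2); split.
- by rewrite !lt_min e0 e10.
- by rewrite le_max M0.
move=> d' w; rewrite inE !lt_min => /orP[/eqP ->|d'D] /and3P[we w1 w2].
  by split; [exact: H1|rewrite le_max H2 ?orbT//; exact: H1].
by have [? ?] := H d' w d'D we; split=> //; rewrite le_max; apply/orP; left.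
Qed.

(** The increments are followed one direction at a time along a polygonal path; [cost s] bounds its
    length, which keeps it in the ball where the derivatives are bounded. The directions come from a
    finite list because bounds for different directions hold on different neighbourhoods. *)
Lemma lip_path f U v (D : seq V) : vopen U -> Cn 1 U f -> U v ->
  exists e M : R, [/\ 0 < e, 0 <= M & forall (s : seq (R * V)) p,
    all (fun x => x.2 \in D) s -> vn (p - v) + cost s < e ->
    cn (f (p + psum s) - f p) <= M * \sum_(x <- s) `|x.1|].
Proof.
move=> oU fC Uv; have [e [M [e0 M0 H]]] := pd_lb_list D oU fC Uv.
exists e, (2 * M); split=> //; first by rewrite mulr_ge0.
elim=> [|[h d] s IH] p /=.
  by move=> _ _; rewrite /psum !big_nil addr0 subrr cn0 mulr0.
move=> /andP[dD sD] hp; rewrite /cost big_cons -/(cost s) /= in hp.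
rewrite /psum !big_cons -/(psum s) /= addrA.
have c0 := cost_ge0 s.
have vd (t : R) : 0 <= t <= 1 -> vn (p + sc (t * h) d - v) < e.
  move=> t01; have := vnD (p - v) (sc (t * h) d); rewrite addrAC vn_sc normrM.
  have : `|t| * `|h| * vn d <= `|h| * vn d.
    by rewrite -mulrA ler_piMl ?mulr_ge0 ?vn_ge0// ger0_norm; lra.
  lra.
have h1 : cn (f (p + sc h d) - f p) <= 2 * M * `|h|.
  apply: line_bound => t t01; have [Uw bw] := H d _ dD (vd t t01); last exact: bw.
  exact: Cn_has fC Uw.
have h2 : cn (f (p + sc h d + psum s) - f (p + sc h d)) <= 2 * M * \sum_(x <- s) `|x.1|.
  apply: IH => //; apply: le_lt_trans hp; rewrite addrA lerD2r.
  by have := vnD (p - v) (sc h d); rewrite addrAC vn_sc.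
have := cnD (f (p + sc h d + psum s) - f (p + sc h d)) (f (p + sc h d) - f p).
rewrite addrA subrK; lra.
Qed.

Definition ev (i : 'I_g) : V := delta_mx i ord0.
Definition rbasis : seq V := [seq ev i | i <- index_enum 'I_g] ++ [seq ci R *: ev i | i <- index_enum 'I_g].
Definition rcoord (x : V) : seq (R * V) :=
  [seq (re (x i ord0), ev i) | i <- index_enum 'I_g] ++ [seq (im (x i ord0), ci R *: ev i) | i <- index_enum 'I_g].

Lemma rcoord_sub x : all (fun y => y.2 \in rbasis) (rcoord x).
Proof.
rewrite all_cat !all_map; apply/andP; split; apply/allP => i _ /=; rewrite mem_cat;
  apply/orP; [left|right]; apply/mapP; exists i => //; by rewrite mem_index_enum.
Qed.

Lemma vn_ev i : vn (ev i) = 1.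
Proof.
rewrite /vn (bigD1 i)//= big1 => [|j ji]; rewrite mxE ?eqxx ?(negPf ji) ?cn0//.
by rewrite addr0 cn1.
Qed.

Lemma vn_iev i : vn (ci R *: ev i) = 1.
Proof. by rewrite -(vn_ev i); apply: eq_bigr => j _; rewrite mxE cnMci. Qed.

Lemma rcoord_sum (T : nmodType) (F : R -> V -> T) x :
  \sum_(y <- rcoord x) F y.1 y.2 =
  \sum_i (F (re (x i ord0)) (ev i) + F (im (x i ord0)) (ci R *: ev i)).
Proof. by rewrite big_split /rcoord big_cat !big_map. Qed.

Lemma cost_rcoord x : cost (rcoord x) = vn x.
Proof.
rewrite /cost (rcoord_sum (fun h d => `|h| * vn d)); apply: eq_bigr => i _.
by rewrite vn_ev vn_iev !mulr1.
Qed.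

Lemma coef_rcoord x : \sum_(y <- rcoord x) `|y.1| = vn x.
Proof. by rewrite (rcoord_sum (fun h _ => `|h|)). Qed.

Lemma psum_rcoord x : psum (rcoord x) = x.
Proof.
rewrite /psum (rcoord_sum (@sc R g)); apply/matrixP => i j; rewrite !ord1 summxE.
rewrite (bigD1 i)//= big1 => [|k ki]; rewrite !mxE ?eqxx.
  by rewrite addr0 [RHS]reimC /=; ring.
by rewrite eq_sym (negPf ki) /= !mulr0 addr0.
Qed.

Lemma lipschitz f U v : vopen U -> Cn 1 U f -> U v ->
  exists e M : R, [/\ 0 < e, 0 <= M & forall p w, vn (p - v) < e -> vn (w - v) < e ->
    cn (f w - f p) <= M * vn (w - p)].
Proof.
move=> oU fC Uv; have [e [M [e0 M0 H]]] := lip_path rbasis oU fC Uv.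
exists (e / 3), M; split=> //; first by rewrite divr_gt0.
move=> p w pv wv; have := H (rcoord (w - p)) p (rcoord_sub _).
rewrite cost_rcoord coef_rcoord psum_rcoord (addrC p (w - p)) subrK; apply.
have := vnB (w - v) (p - v).
have -> : w - v - (p - v) = w - p by rewrite opprB addrA subrK.
lra.
Qed.

Definition vcont f v := forall e : R, 0 < e -> exists2 d : R, 0 < d &
  forall w, vn (w - v) < d -> cn (f w - f v) < e.

Lemma Cn_vcont f U v : vopen U -> Cn 1 U f -> U v -> vcont f v.
Proof.
move=> oU fC Uv e e0; have [d [M [d0 M0 H]]] := lipschitz oU fC Uv.
have q0 : 0 < e / (M + 1) by rewrite divr_gt0//; lra.
exists (Num.min d (e / (M + 1))) => [|w]; first by rewrite lt_min d0.
rewrite lt_min => /andP[w1]; rewrite ltr_pdivlMr ?(ltr_wpDl M0)// => w2.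
have := H v w _ w1; rewrite subrr vn0 => /(_ d0).
have := vn_ge0 (w - v); nra.
Qed.

(** Mean value inequality for f(p + t h d) - t h [pd d f p], whose derivative in t is small because
    [pd d f] is Lipschitz. The constants are uniform in p near v, which allows expansions at moving
    base points. *)
Lemma taylor1 f U v d : vopen U -> Cn 2 U f -> U v ->
  exists e M : R, [/\ 0 < e, 0 <= M & forall p h, vn (p - v) < e -> `|h| < e ->
    cn (f (p + sc h d) - f p - toC h * pd d f p) <= M * `|h| * `|h|].
Proof.
move=> oU fC Uv; have [e [M [e0 M0 H]]] := lipschitz oU (Cn_pd d fC) Uv.
have [e1 e10 H1] := oU v Uv.
have v1 : 0 < vn d + 1 by have := vn_ge0 d; lra.
pose e2 := Num.min e e1 / 2 / (vn d + 1).
have m0 : 0 < Num.min e e1 by rewrite lt_min e0.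
exists (Num.min (Num.min e e1 / 2) e2), (2 * M * vn d); split.
- by rewrite lt_min !divr_gt0.
- by rewrite !mulr_ge0 ?vn_ge0.
move=> p h; rewrite !lt_min => /andP[pv _] /andP[_].
rewrite /e2 ltr_pdivlMr// => hv.
have nb t : 0 <= t <= 1 -> vn (p + sc (t * h) d - v) < Num.min e e1 /\
    vn (sc (t * h) d) <= `|h| * vn d.
  move=> t01; have := vnD (p - v) (sc (t * h) d); rewrite addrAC vn_sc normrM.
  have t1 : `|t| <= 1 by rewrite ger0_norm; lra.
  have h2 : `|t| * `|h| * vn d <= `|h| * vn d.
    by rewrite ler_wpM2r ?vn_ge0// ler_piMl.
  split=> //; have := normr_ge0 h; nra.
pose c := pd d f p.
have := @cmvt R (fun x => f (p + sc (x * h) d) - toC x * (toC h * c))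
  (fun x => (pd d f (p + sc (x * h) d) - c) * toC h) 0 1 (M * vn d * `|h| * `|h|) ler01 _ _.
rewrite !mul1r !mul0r sc0 ?toC1 ?toC0 ?mul1r ?mul0r addr0 !subr0.
rewrite mulr1 [X in cn X <= _](_ : _ = f (p + sc h d) - f p - toC h * c); last by ring.
rewrite !mulrA => ->//.
- move=> t t01; have [nt _] := nb t t01; move: nt; rewrite lt_min => /andP[n1 n2].
  have h1 := haspd_line_scale (Cn_has d fC (H1 _ n2)).
  have := iscdB h1 (iscdM (iscd_id t) (iscd_cst (toC h * c) t)).
  by move=> hh; apply: (iscd_eq hh); rewrite mulr0 addr0; ring.
- move=> t t01; have [nt nd] := nb t t01; move: nt; rewrite lt_min => /andP[n1 n2].
  rewrite mulrC cnMtoC mulrC ler_wpM2r//.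
  have pe : vn (p - v) < e.
    by have : Num.min e e1 <= e; [rewrite ge_min lexx|lra].
  apply: le_trans (H p _ pe n1) _.
  have -> : p + sc (t * h) d - p = sc (t * h) d by rewrite addrC addKr.
  by rewrite -mulrA ler_wpM2l// [X in _ <= X]mulrC.
Qed.

Lemma pd_sc f U v d (a : R) : Cn 1 U f -> U v -> pd (sc a d) f v = toC a * pd d f v.
Proof.
move=> fC Uv; apply: haspd_pd; rewrite /haspd.
have h := Cn_has d fC Uv.
have := @haspd_line_scale f v d a 0 (pd d f v); rewrite mul0r sc0 addr0 => /(_ h).
by rewrite mulrC; apply: iscd_ext => x; rewrite scA.
Qed.

Lemma taylor2 f U v q q' : vopen U -> Cn 2 U f -> U v ->
  exists e M : R, [/\ 0 < e, 0 <= M & forall x y : R, `|x| + `|y| < e ->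
   cn (f (v + sc x q + sc y q') - f v - toC x * pd q f v - toC y * pd q' f v)
     <= M * (`|x| + `|y|) * (`|x| + `|y|)].
Proof.
move=> oU fC Uv.
have [e1 [M1 [e10 M10 H1]]] := taylor1 q oU fC Uv.
have [e2 [M2 [e20 M20 H2]]] := taylor1 q' oU fC Uv.
have [e3 [M3 [e30 M30 H3]]] := lipschitz oU (Cn_pd q' fC) Uv.
set n := vn q + 1.
have n0 : 0 < n by rewrite /n; have := vn_ge0 q; lra.
exists (Num.min e1 (Num.min (Num.min e2 (e2 / n)) (e3 / n))), (M1 + M2 + M3 * vn q).
split; [by rewrite !lt_min e10 e20 !divr_gt0 | by rewrite !addr_ge0 // mulr_ge0 // vn_ge0|].
move=> x y; rewrite !lt_min !ltr_pdivlMr// => /andP[h1 /andP[/andP[h2 h2'] h3]].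
have x0 := normr_ge0 x; have y0 := normr_ge0 y; have q0 := vn_ge0 q.
have xn : vn (v + sc x q - v) = `|x| * vn q by rewrite addrAC subrr add0r vn_sc.
have vv : vn (v - v) = 0 by rewrite subrr vn0.
have xq : `|x| * vn q <= (`|x| + `|y|) * n by rewrite /n; nra.
have K1 := H1 v x; rewrite vv in K1; have {}K1 := K1 e10 (le_lt_trans (ler_wpDr y0 (lexx _)) h1).
have K2 : cn (f (v + sc x q + sc y q') - f (v + sc x q) - toC y * pd q' f (v + sc x q)) <= M2 * `|y| * `|y|.
  apply: H2; last by apply: le_lt_trans h2; lra.
  by rewrite xn; apply: le_lt_trans xq _.
have K3 : cn (pd q' f (v + sc x q) - pd q' f v) <= M3 * (`|x| * vn q).
  by rewrite -xn; apply: H3; rewrite ?vv// xn; apply: le_lt_trans xq _.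
rewrite (_ : _ - toC y * _ = (f (v + sc x q) - f v - toC x * pd q f v) +
   ((f (v + sc x q + sc y q') - f (v + sc x q) - toC y * pd q' f (v + sc x q)) +
    toC y * (pd q' f (v + sc x q) - pd q' f v))); last by ring.
apply: le_trans (cnD _ _) _; apply: le_trans (lerD K1 (cnD _ _)) _.
apply: le_trans (lerD (lexx _) (lerD K2 (lexx _))) _; rewrite cnMtoC.
apply: le_trans (lerD (lexx _) (lerD (lexx _) (ler_wpM2l y0 K3))) _.
move: M10 M20 M30 x0 y0 q0; move: (`|x|) (`|y|) (vn q); clear => X Y Q; intros.
rewrite -subr_ge0 (_ : _ - _ = M1 * (2 * (X * Y) + Y * Y) + M2 * (X * X + 2 * (X * Y)) + M3 * Q * (X * X + Y * Y + X * Y)); last by ring.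
by rewrite !addr_ge0 ?mulr_ge0 ?addr_ge0 ?mulr_ge0.
Qed.

(** The two-direction Taylor estimate on the diagonal x = y = h has a remainder of order h^2, hence
    o(h). *)
Lemma pdD f U v d d' : vopen U -> Cn 2 U f -> U v ->
  pd (d + d') f v = pd d f v + pd d' f v.
Proof.
move=> oU fC Uv; apply: haspd_pd; apply/iscdP => e e0.
have [e1 [M [e10 M0 H]]] := taylor2 d d' oU fC Uv.
have M1 : 0 < 4 * (M + 1) by lra.
exists (Num.min (e1 / 2) (e / (4 * (M + 1)))); first by rewrite lt_min !divr_gt0.
move=> h; rewrite !lt_min !ltr_pdivlMr// => /andP[h1 h2].
rewrite !add0r sc0 addr0 scDr addrA mulrDr opprD addrA.
have := H h h; rewrite -mulr2n -mulr_natr => /(_ h1) /le_trans; apply.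
by have := normr_ge0 h; nra.
Qed.

Lemma pd_comm f U v d d' : vopen U -> Cn 3 U f -> U v ->
  pd d (pd d' f) v = pd d' (pd d f) v.
Proof.
move=> oU fC Uv.
pose D h := f (v + sc h d + sc h d') - f (v + sc h d) - f (v + sc h d') + f v.
(* both mixed derivatives are the limit of [D h / h^2] *)
have key (x y : V) : exists e M : R, [/\ 0 < e, 0 <= M & forall h, `|h| < e ->
   cn ((f (v + sc h x + sc h y) - f (v + sc h x) - f (v + sc h y) + f v)
     - toC (h * h) * pd x (pd y f) v) <= M * (`|h| * `|h| * `|h|)].
  have [e1 [M1 [e10 M10 H1]]] := taylor1 x oU (Cn_pd y fC) Uv.
  have [e2 [M2 [e20 M20 H2]]] := lipschitz oU (Cn_pd x (Cn_pd y fC)) Uv.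
  have [e3 e30 H3] := oU v Uv.
  pose m := Num.min e1 (Num.min e2 e3).
  have m0 : 0 < m by rewrite !lt_min e10 e20.
  have vx := vn_ge0 x; have vy := vn_ge0 y.
  pose w := vn x + vn y + 1; have w1 : 1 <= w by rewrite /w; lra.
  have w0 : 0 < w by lra.
  exists (m / w), (2 * (M1 + M2 * vn y)); split; first by rewrite divr_gt0.
    by rewrite mulr_ge0// addr_ge0// mulr_ge0.
  move=> h; rewrite ltr_pdivlMr// => hw; have h0 := normr_ge0 h.
  have hm : `|h| < m by nra.
  set A := pd x (pd y f) v.
  have nb t : 0 <= t <= 1 -> [/\ vn (v + sc (t * h) y - v) < m,
      vn (v + sc h x + sc (t * h) y - v) < m & vn (sc (t * h) y) <= `|h| * vn y].
    move=> t01; have t1 : `|t| <= 1 by rewrite ger0_norm; lra.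
    have b : vn (sc (t * h) y) <= `|h| * vn y.
      by rewrite vn_sc normrM -mulrA ler_piMl ?mulr_ge0.
    split=> //.
      rewrite (addrC v) addrK; apply: le_lt_trans b _; rewrite /w in hw.
      by have := mulr_ge0 h0 vx; lra.
    rewrite -(addrA v) (addrC v) addrK; apply: le_lt_trans (vnD _ _) _; rewrite (vn_sc h x).
    rewrite /w in hw; lra.
  have := @cmvt R (fun t => f (v + sc h x + sc (t * h) y) - f (v + sc (t * h) y) - toC t * (toC (h * h) * A))
    (fun t => (pd y f (v + sc (t * h) y + sc h x) - pd y f (v + sc (t * h) y) - toC h * A) * toC h)
    0 1 ((M1 + M2 * vn y) * (`|h| * `|h| * `|h|)) ler01 _ _.
  rewrite !mul1r !mul0r sc0 ?toC1 ?toC0 ?mul1r ?mul0r !addr0 ?subr0 ?mulr1 ?mulrA.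
  rewrite [X in cn X <= _](_ : _ = f (v + sc h x + sc h y) - f (v + sc h x) - f (v + sc h y) + f v
     - toC (h * h) * A); last by ring.
  apply.
  - move=> t t01; have [n1 n2 n3] := nb t t01.
    move: n1 n2; rewrite !lt_min => /and3P[a1 a2 a3] /and3P[b1 b2 b3].
    have i1 := haspd_line_scale (Cn_has y fC (H3 _ a3)).
    have i2 := haspd_line_scale (Cn_has y fC (H3 _ b3)).
    have := iscdB (iscdB i2 i1) (iscdM (iscd_id t) (iscd_cst (toC (h * h) * A) t)).
    move=> hh; apply: (iscd_eq hh); rewrite toCM mulr0 addr0 (addrAC v (sc (t * h) y)); ring.
  - move=> t t01; have [n1 n2 n3] := nb t t01.
    move: hm n1; rewrite !lt_min => /and3P[c1 c2 c3] /and3P[a1 a2 a3].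
    rewrite mulrC cnMtoC.
    set P := pd y f _; set Q := pd y f _.
    have := H1 _ h a1 c1; rewrite -/P -/Q => q1.
    have := H2 v _ _ a2; rewrite subrr vn0 => /(_ e20).
    rewrite (addrC v) addrK -/A (addrC _ v) => q2.
    set B := pd x _ _ in q1 q2.
    have -> : P - Q - toC h * A = (P - Q - toC h * B) + toC h * (B - A) by ring.
    have q3 := cnD (P - Q - toC h * B) (toC h * (B - A)); rewrite cnMtoC in q3.
    have q4 : `|h| * cn (B - A) <= `|h| * (M2 * (`|h| * vn y)).
      by rewrite ler_wpM2l//; apply: le_trans q2 _; rewrite ler_wpM2l.
    have q5 : cn (P - Q - toC h * B + toC h * (B - A)) <= (M1 + M2 * vn y) * (`|h| * `|h|).
      by move: q1 q3 q4; clra.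
    by move: (ler_wpM2l h0 q5); clra.
have [e1 [M1 [e10 M10 H1]]] := key d d'.
have [e2 [M2 [e20 M20 H2]]] := key d' d.
apply/eqP; rewrite -subr_eq0 -cn_eq0; apply/eqP/le_anti; rewrite cn_ge0 andbT.
apply/ler_addgt0Pr => e e0; rewrite add0r.
pose K := M1 + M2 + 1; have K0 : 0 < K by rewrite /K; lra.
have q0 : 0 < e / K by rewrite divr_gt0.
pose h := Num.min (Num.min e1 e2) (e / K) / 2.
have m0 : 0 < Num.min (Num.min e1 e2) (e / K) by rewrite !lt_min e10 e20.
have h0 : 0 < h by rewrite divr_gt0.
have hh : `|h| = h by rewrite gtr0_norm.
have : h < Num.min (Num.min e1 e2) (e / K) by rewrite /h; lra.
rewrite !lt_min ltr_pdivlMr// => /andP[/andP[he1 he2] hK].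
have := H1 h; have := H2 h; rewrite hh => /(_ he2) b2 /(_ he1) b1.
rewrite (addrAC v) in b2.
set A := pd d _ _ in b1 *; set B := pd d' (pd d f) v in b2 *.
set X := f (v + sc h d + sc h d') in b1 b2.
set Y := f (v + sc h d) in b1 b2; set Z := f (v + sc h d') in b1 b2.
have e3 : toC (h * h) * (A - B) = (X - Z - Y + f v - toC (h * h) * B) - (X - Y - Z + f v - toC (h * h) * A) by ring.
have := cnMtoC (h * h) (A - B); rewrite e3 => e4.
have := cnB (X - Z - Y + f v - toC (h * h) * B) (X - Y - Z + f v - toC (h * h) * A).
rewrite e4 ger0_norm; last by rewrite mulr_ge0 ?ltW.
move=> b3.
have b4 : h * h * cn (A - B) <= h * h * (h * (M1 + M2)) by apply: le_trans b3 _; apply: le_trans (lerD b2 b1) _; clear; lra.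
have hh0 : 0 < h * h by rewrite mulr_gt0.
rewrite ler_pM2l// in b4; apply: le_trans b4 _.
move: hK h0; rewrite /K; clra.
Qed.

End C1.

(** * Comparison with the topology and differentiability of normed spaces *)

Section Topology.

Variables (R : realType) (g : nat).
Local Notation C := (Cplx R).
Local Notation V := 'cV[C]_g.
Implicit Types (f : V -> C) (U : set V) (v w d p : V) (h t M : R).

Lemma entry_le_mx_norm (x : V) i : `|x i ord0| <= `|x|.
Proof.
have [a a0 ea] := ge0C (normr_ge0 x); have [b b0 eb] := ge0C (normr_ge0 (x i ord0)).
rewrite ea eb leC_toC; apply/ler_addgt0Pr => e e0.
have hb : ball (0 : V) (toC (a + e)) x.
  by rewrite -ball_normE /ball_ /= sub0r normrN ea ltC_toC ltrDl.
have := hb.2 i ord0; rewrite -ball_normE /ball_ /= mxE sub0r normrN eb ltC_toC.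
exact: ltW.
Qed.

Lemma norm_le_vn (x : V) : `|x| <= toC (vn x).
Proof.
have e : `|x| = mx_norm x by [].
rewrite e; have [->|x0] := eqVneq (mx_norm x) 0.
  by rewrite -(toC0 R) leC_toC vn_ge0.
have [[i j] ->] := mx_norm_neq0 x0; rewrite /= ord1.
apply: le_trans (normC_le_cn _) _; rewrite leC_toC; exact: cn_le_vn.
Qed.

Lemma vn_le_norm (x : V) : toC (vn x) <= toC (2 * g%:R) * `|x|.
Proof.
rewrite /vn toC_sum; apply: (@le_trans _ _ (\sum_(i < g) 2 * `|x|)).
  apply: ler_sum => i _; apply: le_trans (cn_le_normC _) _.
  by rewrite ler_pM2l ?entry_le_mx_norm.
rewrite sumr_const card_ord toCM !toC_nat -mulr_natr.
by rewrite -[X in X <= _]mulr_natr mulrAC.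
Qed.

Lemma nbhsV v U : nbhs v U <-> exists2 e : R, 0 < e & forall w, vn (w - v) < e -> U w.
Proof.
split.
  move/nbhs_ballP => [e /gt0C [x x0 ->]] H; exists x => // w wv; apply: H.
  rewrite -ball_normE /ball_ /= -normrN opprB.
  by apply: le_lt_trans (norm_le_vn _) _; rewrite ltC_toC.
move=> [e e0 H]; apply/nbhs_ballP; exists (toC (e / (2 * g%:R + 1))).
  have n0 : 0 <= g%:R :> R by rewrite ler0n.
  by rewrite /= -(toC0 R) ltC_toC divr_gt0//; lra.
move=> w; rewrite -ball_normE /ball_ /= -normrN opprB => hw; apply: H.
rewrite -ltC_toC; apply: le_lt_trans (vn_le_norm _) _.
have n0 : 0 <= g%:R :> R by rewrite ler0n.
apply: (@le_lt_trans _ _ (toC (2 * g%:R + 1) * `|w - v|)).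
  by rewrite ler_wpM2r// leC_toC; lra.
have p0 : 0 < toC (2 * g%:R + 1) :> C by rewrite -(toC0 R) ltC_toC; lra.
rewrite -(ltr_pM2l p0) in hw; apply: lt_le_trans hw _.
rewrite -toCM leC_toC mulrC divfK//; apply/eqP => z; lra.
Qed.

Lemma open_vopen U : open U <-> vopen U.
Proof.
rewrite openE; split=> [H v /H|H v /H].
  by rewrite /interior /= => /nbhsV.
by rewrite /interior /= => h; apply/nbhsV.
Qed.

(** The increment c is complex, in contrast to [haspd]: this is complex differentiability of f on
    the line through v in direction d. *)
Definition cdir f v d (l : C) := forall e : R, 0 < e -> exists2 x : R, 0 < x &
  forall c : C, cn c < x -> cn (f (v + c *: d) - f v - c * l) <= e * cn c.

Lemma nbhsC (z : C) (U : set C) : nbhs z U <-> exists2 e : R, 0 < e & forall w : C, cn (w - z) < e -> U w.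
Proof.
split.
  move/nbhs_ballP => [e /gt0C [x x0 ->]] H; exists x => // w wv; apply: H.
  rewrite -ball_normE /ball_ /= -normrN opprB.
  by apply: le_lt_trans (normC_le_cn _) _; rewrite ltC_toC.
move=> [e e0 H]; apply/nbhs_ballP; exists (toC (e / 2)).
  by rewrite /= -(toC0 R) ltC_toC; lra.
move=> w; rewrite -ball_normE /ball_ /= -normrN opprB => hw; apply: H.
rewrite -ltC_toC; apply: le_lt_trans (cn_le_normC _) _.
have p0 : 0 < 2 :> C by [].
rewrite -(ltr_pM2l p0) in hw; apply: lt_le_trans hw _.
by rewrite -(toC_nat R 2) -toCM leC_toC mulrC divfK.
Qed.

Lemma differentiable_cdir f v d : differentiable f v -> cdir f v d ('D_d f v).
Proof.
move=> df e e0.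
have dr : derivable f v d by exact: diff_derivable.
have c : h^-1 *: ((f \o shift v) (h *: d) - f v) @[h --> 0^'] --> 'D_d f v by exact: dr.
move/cvgrPdist_le : c => /(_ (toC (e / 2))).
have e2 : 0 < toC (e / 2) :> C by rewrite -(toC0 R) ltC_toC; lra.
move=> /(_ e2) h; have /nbhsC [x x0 H] : nbhs (0 : C) _ := h; exists x => // c cx.
have [->|c0] := eqVneq c 0.
  by rewrite scale0r addr0 subrr mul0r subr0 cn0 mulr0.
have := H c; rewrite subr0 => /(_ cx c0); rewrite -normrN opprB /= (addrC _ v) => H1.
have e1 : f (v + c *: d) - f v - c * 'D_d f v = c * (c^-1 *: (f (v + c *: d) - f v) - 'D_d f v).
  by rewrite [RHS]mulrBr /GRing.scale /= mulVKf.
rewrite e1; apply: le_trans (cnM _ _) _; rewrite mulrC ler_wpM2r ?cn_ge0//.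
rewrite -leC_toC; apply: le_trans (cn_le_normC _) _.
have p0 : 0 < 2 :> C by [].
rewrite -(ler_pM2l p0) in H1; apply: le_trans H1 _.
by rewrite -(toC_nat R 2) -toCM leC_toC mulrC divfK.
Qed.

Lemma differentiable_vcont f v : differentiable f v -> vcont f v.
Proof.
move=> /differentiable_continuous cf e e0.
have : nbhs (f v) [set z | cn (z - f v) < e] by apply/nbhsC; exists e.
by move=> /cf /= /nbhsV [x x0 H]; exists x.
Qed.

Lemma differentiable_small f v (K x : R) : 0 < x ->
  (forall w, vn (w - v) < x -> cn (f w) <= K * vn (w - v) * vn (w - v)) -> differentiable f v.
Proof.
move=> x0 H.
have fv : f v = 0.
  have := H v; rewrite subrr vn0 mulr0 => /(_ x0) h.
  by apply/eqP; rewrite -cn_eq0; apply/eqP/le_anti; rewrite h cn_ge0.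
have E (e : C) : 0 < e -> \forall w \near (0 : V), `|f (w + v)| <= e * `|w|.
  move=> /gt0C [y y0 ->].
  have g0 : 0 <= g%:R :> R by rewrite ler0n.
  have G0 : 0 < (2 * g%:R + 1) :> R by lra.
  have K0 : 0 < `|K| + 1 by have := normr_ge0 K; lra.
  apply/nbhsV; exists (Num.min x (y / ((`|K| + 1) * (2 * g%:R + 1)))).
    by rewrite lt_min x0 divr_gt0// mulr_gt0.
  move=> w; rewrite subr0 lt_min ltr_pdivlMr ?mulr_gt0// => /andP[wx wy].
  apply: le_trans (normC_le_cn _) _.
  have := H (w + v); rewrite addrK => /(_ wx) hw.
  have h2 := vn_le_norm w.
  apply: (@le_trans _ _ (toC (y / (2 * g%:R + 1)) * toC (vn w))).
    rewrite -toCM leC_toC; apply: le_trans hw _.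
    rewrite ler_wpM2r ?vn_ge0// ler_pdivlMr//.
    have kb : 0 <= `|K| + 1 - K by have := ler_norm K; lra.
    by have := mulr_ge0 kb (mulr_ge0 (vn_ge0 w) (ltW G0)); lra.
  apply: (@le_trans _ _ (toC (y / (2 * g%:R + 1)) * (toC (2 * g%:R) * `|w|))).
    by rewrite ler_pM2l// -(toC0 R) ltC_toC divr_gt0.
  rewrite mulrA ler_wpM2r// -toCM leC_toC mulrAC ler_pdivrMr//; nra.
have c0 : continuous ((\0 : {linear V -> C}) : V -> C).
  have -> : ((\0 : {linear V -> C}) : V -> C) = cst 0 by [].
  exact: cst_continuous.
pose z0 : V := 0.
have o0 : f \o shift v = cst (f v) + ((\0 : {linear V -> C}) : V -> C) +o_ z0 id.
  apply/eqaddoP => e /E; apply: filterS => w.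
  by rewrite !fctE /= fv addr0 subr0.
have D : 'd f v = (\0 : {linear V -> C}) :> (V -> C) by exact: diff_unique c0 o0.
by apply/diff_locallyP; rewrite D; split; [exact: c0|exact: o0].
Qed.

(** The Cauchy-Riemann equations on a basis make the real differential at v complex linear. After
    subtraction of the affine approximation the rest is O(|w - v|^2), by the Lipschitz bounds for
    the derivatives, and [differentiable_small] applies. *)
Lemma sm_differentiable f U v : vopen U -> sm U f -> U v ->
  (forall i, pd (ci R *: ev R i) f v = ci R * pd (ev R i) f v) -> differentiable f v.
Proof.
move=> oU sf Uv CR.
have fl : forall w, pd w f v = \sum_i w i ord0 * pd (ev R i) f v.
  move=> w; rewrite -{1}(psum_rcoord w) /psum.
  have pdl (s : seq (R * V)) : pd (\sum_(x <- s) sc x.1 x.2) f v = \sum_(x <- s) toC x.1 * pd x.2 f v.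
    elim: s => [|x s IH]; last by rewrite !big_cons (pdD _ _ oU) ?IH ?(pd_sc _ _ (sf 1%N)).
    rewrite !big_nil -(sc0 (0 : V)) (pd_sc _ _ (sf 1%N))// toC0 mul0r//.
  rewrite pdl (rcoord_sum (fun h d => toC h * pd d f v)); apply: eq_bigr => i _.
  by rewrite CR {3}(reimC (w i ord0)); ring.
pose L w := f v + \sum_i (w i ord0 - v i ord0) * pd (ev R i) f v.
have dL : differentiable L v.
  apply: differentiableD; first exact: differentiable_cst.
  rewrite (_ : (fun w : V => _) = \sum_i (fun w : V => (w i ord0 - v i ord0) * pd (ev R i) f v)); last first.
    by apply/funext => w; rewrite fct_sumE.
  apply: differentiable_sum => i; apply: differentiableM; last exact: differentiable_cst.
  by apply: differentiableB; [exact: differentiable_coord|exact: differentiable_cst].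
have -> : f = L + (fun w => f w - L w).
  by apply/funext => w; rewrite !fctE addrC subrK.
apply: differentiableD; first exact: dL.
have lip (D : seq V) : exists e M : R, [/\ 0 < e, 0 <= M & forall w, vn (w - v) < e ->
    U w /\ forall d, d \in D -> cn (pd d f w - pd d f v) <= M * vn (w - v)].
  elim: D => [|d D [e [M [e0 M0 H]]]].
    by have [e e0 He] := oU v Uv; exists e, 0; split=> // w /He.
  have [e1 [M1 [e10 M10 H1]]] := lipschitz oU (sm_pd d sf 1%N) Uv.
  exists (Num.min e e1), (M + M1); split; rewrite ?lt_min ?e0 ?addr_ge0// => w.
  rewrite lt_min => /andP[we we1]; have [Uw h] := H w we; split=> // d'.
  have w0 := vn_ge0 (w - v); rewrite inE mulrDl => /orP[/eqP ->|/h h'].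
    have := H1 v w; rewrite subrr vn0 => /(_ e10 we1) h'.
    by apply: le_trans h' _; rewrite lerDr mulr_ge0.
  by apply: le_trans h' _; rewrite lerDl mulr_ge0.
have [e [M [e0 M0 H]]] := lip (rbasis R g).
apply: (@differentiable_small _ v (2 * M) e) => // w we.
have Lw : L w = f v + pd (w - v) f v.
  by rewrite /L fl; congr (_ + _); apply: eq_bigr => i _; rewrite !mxE.
pose x := w - v.
have pdx p : U p -> pd x f p = \sum_(y <- rcoord x) toC y.1 * pd y.2 f p.
  move=> Up; rewrite -{1}(psum_rcoord x) /psum.
  elim: (rcoord x) => [|y s IH]; last first.
    by rewrite !big_cons (pdD _ _ oU (sf 2%N) Up) IH (pd_sc _ _ (sf 1%N) Up).
  by rewrite !big_nil -(sc0 (0 : V)) (pd_sc _ _ (sf 1%N) Up) toC0 mul0r.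
have xb t : 0 <= t <= 1 -> vn (v + sc (t * 1) x - v) <= vn x.
  move=> t01; rewrite (addrC v) addrK vn_sc mulr1 ger0_norm; last by lra.
  by rewrite ler_piMl ?vn_ge0//; lra.
have := @cmvt R (fun t => f (v + sc (t * 1) x) - toC t * pd x f v)
  (fun t => pd x f (v + sc (t * 1) x) - pd x f v) 0 1 (M * vn x * vn x) ler01 _ _.
rewrite toC0 toC1 !mul1r !mul0r sc0 sc1 addr0 !subr0 mulr1 /x.
have -> : v + (w - v) = w by rewrite addrC subrK.
rewrite -/x Lw [X in cn X <= _](_ : _ = f w - (f v + pd x f v)); last by ring.
rewrite !mulrA; apply.
- move=> t t01; have [Ut _] := H _ (le_lt_trans (xb t t01) we).
  have := iscdB (haspd_line_scale (sm_has x sf Ut)) (iscdM (iscd_id t) (iscd_cst (pd x f v) t)).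
  by move=> hh; apply: (iscd_eq hh); rewrite toC1 mulr1 mulr0 addr0 mul1r.
- move=> t t01; have [Ut Hb] := H _ (le_lt_trans (xb t t01) we).
  rewrite !pdx// -sumrB; apply: le_trans (cn_sum _ _ _) _.
  apply: (@le_trans _ _ (\sum_(y <- rcoord x) `|y.1| * (M * vn x))).
    rewrite big_seq [X in _ <= X]big_seq; apply: ler_sum => y yx.
    rewrite -mulrBr cnMtoC ler_wpM2l//.
    have /allP /(_ y yx) /Hb h := rcoord_sub x.
    by apply: le_trans h _; rewrite ler_wpM2l// xb.
  by rewrite -mulr_suml coef_rcoord mulrC.
Qed.
End Topology.

(** * Goursat's theorem for rectangles *)

Section Goursat.

Variable R : realType.
Local Notation C := (Cplx R).
Implicit Types (k : C -> C) (z l c : C) (x y w h e : R).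

Definition cdv k z l := forall e : R, 0 < e -> exists2 d : R, 0 < d &
  forall c : C, cn c < d -> cn (k (z + c) - k z - c * l) <= e * cn c.

Lemma cdv_cont k z l : cdv k z l -> forall e : R, 0 < e -> exists2 d : R, 0 < d &
  forall c : C, cn c < d -> cn (k (z + c) - k z) < e.
Proof.
move=> H e e0; have [d d0 Hd] := H 1 ltr01.
have K0 : 0 < 2 + cn l by have := cn_ge0 l; lra.
exists (Num.min d (e / (2 + cn l))) => [|c]; first by rewrite lt_min d0 divr_gt0.
rewrite lt_min ltr_pdivlMr// => /andP[/Hd h1 h2].
have := cnD (k (z + c) - k z - c * l) (c * l); rewrite subrK.
have := cnM c l; have := cn_ge0 c; nra.
Qed.

Lemma cdv_ccont k (u : R -> C) (t : R) l : cdv k (u t) l -> ccont u t -> ccont (fun s => k (u s)) t.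
Proof.
move=> /cdv_cont ck /ccontP cu; apply/ccontP => e /ck [d d0 H].
have [d' d'0 H'] := cu d d0; exists d' => // s /H' /H.
by rewrite (addrC (u t)) subrK.
Qed.

Definition rect k x y w h : C :=
  cI x (x + w) (fun t => k (mkC t y)) + ci R * cI y (y + h) (fun t => k (mkC (x + w) t))
  - cI x (x + w) (fun t => k (mkC t (y + h))) - ci R * cI y (y + h) (fun t => k (mkC x t)).

Definition hol_on k x y w h := forall s t, x <= s <= x + w -> y <= t <= y + h ->
  exists l, cdv k (mkC s t) l.

Lemma iscd_h y t : iscd (fun s => mkC s y) t 1.
Proof.
by apply: (iscd_ext (u := fun s => toC s + ci R * toC y)) => [s|];
  [rewrite mkCE|have := iscdD (iscd_id t) (iscd_cst (ci R * toC y) t); rewrite addr0].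
Qed.
Lemma iscd_v x t : iscd (fun s => mkC x s) t (ci R).
Proof.
by apply: (iscd_ext (u := fun s => toC x + ci R * toC s)) => [s|];
  [rewrite mkCE|have := iscdD (iscd_cst (toC x) t) (iscdZ (ci R) (iscd_id t)); rewrite add0r mulr1].
Qed.

Lemma hol_ccOn_h k x y w h s : hol_on k x y w h -> y <= s <= y + h ->
  ccOn x (x + w) (fun t => k (mkC t s)).
Proof.
move=> H hs t ht; have [l cd] := H t s ht hs.
by apply: (cdv_ccont (u := fun t => mkC t s) cd); exact: iscd_cont (iscd_h s t).
Qed.
Lemma hol_ccOn_v k x y w h s : hol_on k x y w h -> x <= s <= x + w ->
  ccOn y (y + h) (fun t => k (mkC s t)).
Proof.
move=> H hs t ht; have [l cd] := H s t hs ht.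
by apply: (cdv_ccont (u := fun t => mkC s t) cd); exact: iscd_cont (iscd_v s t).
Qed.

Lemma hol_sub k x y w h x' y' w' h' : hol_on k x y w h ->
  x <= x' -> x' + w' <= x + w -> y <= y' -> y' + h' <= y + h -> hol_on k x' y' w' h'.
Proof. by move=> H a b c d s t hs ht; apply: H; lra. Qed.

Lemma rect_split k x y w h : 0 <= w -> 0 <= h -> hol_on k x y (2 * w) (2 * h) ->
  rect k x y (2 * w) (2 * h) = rect k x y w h + rect k (x + w) y w h
    + rect k x (y + h) w h + rect k (x + w) (y + h) w h.
Proof.
move=> w0 h0 H.
have e1 (a b : R) : a + b + b = a + 2 * b by ring.
rewrite /rect !e1.
have sh s : y <= s <= y + 2 * h -> cI x (x + 2 * w) (fun t => k (mkC t s)) =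
   cI x (x + w) (fun t => k (mkC t s)) + cI (x + w) (x + 2 * w) (fun t => k (mkC t s)).
  by move=> hs; apply: cI_split; [lra|lra|exact: hol_ccOn_h H hs].
have sv s : x <= s <= x + 2 * w -> cI y (y + 2 * h) (fun t => k (mkC s t)) =
   cI y (y + h) (fun t => k (mkC s t)) + cI (y + h) (y + 2 * h) (fun t => k (mkC s t)).
  by move=> hs; apply: cI_split; [lra|lra|exact: hol_ccOn_v H hs].
have q1 : y <= y <= y + 2 * h by lra.
have q2 : y <= y + 2 * h <= y + 2 * h by lra.
have q3 : x <= x <= x + 2 * w by lra.
have q4 : x <= x + 2 * w <= x + 2 * w by lra.
rewrite (sh _ q1) (sh _ q2) (sv _ q3) (sv _ q4).
repeat match goal with |- context [@cI ?r ?a ?b ?u] => generalize (@cI r a b u); intro end.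
by clear; ring.
Qed.

Lemma iscd_line (a b : C) (u : R -> C) t m : iscd u t m ->
  iscd (fun s => a * u s + b * (u s * u s)) t (m * (a + 2 * b * u t)).
Proof.
move=> h; apply: iscd_eq (iscdD (iscdZ a h) (iscdZ b (iscdM h h))) _; ring.
Qed.

(** An affine function has a primitive, so the four sides telescope over the corners. The slope is
    written 2 b so that the primitive is a z + b z^2. *)
Lemma rect_affine (a b : C) x y w h : 0 < w -> 0 < h -> rect (fun z => a + 2 * b * z) x y w h = 0.
Proof.
move=> w0 h0.
have cc (u : R -> C) (t : R) m : iscd u t m -> ccont (fun s => a + 2 * b * u s) t.
  by move=> H; apply: ccontD; [exact: ccont_cst|apply: ccontM; [exact: ccont_cst|exact: iscd_cont H]].
have H s : cI x (x + w) (fun t => a + 2 * b * mkC t s) =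
   (a * mkC (x + w) s + b * (mkC (x + w) s * mkC (x + w) s)) - (a * mkC x s + b * (mkC x s * mkC x s)).
  apply: (cI_FTC (U := fun t => a * mkC t s + b * (mkC t s * mkC t s))); first by rewrite ltrDl.
  - by move=> t _; exact: cc (iscd_h s t).
  - by move=> t _; exact: iscd_cont (iscd_line a b (iscd_h s t)).
  - by move=> t _; apply: iscd_eq (iscd_line a b (iscd_h s t)) _; rewrite mul1r.
have V s : ci R * cI y (y + h) (fun t => a + 2 * b * mkC s t) =
   (a * mkC s (y + h) + b * (mkC s (y + h) * mkC s (y + h))) - (a * mkC s y + b * (mkC s y * mkC s y)).
  have cv : ccOn y (y + h) (fun t => a + 2 * b * mkC s t).
    by move=> t _; exact: cc (iscd_v s t).
  rewrite -cIZ//.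
  apply: (cI_FTC (U := fun t => a * mkC s t + b * (mkC s t * mkC s t))); first by rewrite ltrDl.
  - by apply: ccOnM => //; exact: ccOn_cst.
  - by move=> t _; exact: iscd_cont (iscd_line a b (iscd_v s t)).
  - by move=> t _; exact: iscd_line (iscd_v s t).
by rewrite /rect !H !V; ring.
Qed.

Lemma cn_mkC x y : cn (mkC x y) = `|x| + `|y|. Proof. by []. Qed.

Lemma cn_add4 (a b c d : C) : cn (a + ci R * b - c - ci R * d) <= cn a + cn b + cn c + cn d.
Proof.
rewrite -(cnMci b) -(cnMci d).
apply: le_trans (cnB _ _) _; rewrite lerD2r; apply: le_trans (cnB _ _) _; rewrite lerD2r.
exact: cnD.
Qed.

(** Subtracting the affine approximation of k at the point (x0, y0) does not change the boundary
    integral, and what remains is at most e (w + h) on every side. *)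
Lemma rect_local k l x0 y0 e : cdv k (mkC x0 y0) l -> 0 < e ->
  exists2 d : R, 0 < d & forall x y w h, 0 < w -> 0 < h -> w + h < d ->
   x <= x0 <= x + w -> y <= y0 <= y + h -> hol_on k x y w h ->
   cn (rect k x y w h) <= 4 * e * (w + h) * (w + h).
Proof.
move=> Hk e0; have [d d0 Hd] := Hk e e0; exists d => // x y w h w0 h0 whd hx hy H.
pose z0 := mkC x0 y0; pose A z := (k z0 - z0 * l) + 2 * (l / 2) * z.
have l2 : 2 * (l / 2) = l by rewrite mulrC divfK.
have est s t : x <= s <= x + w -> y <= t <= y + h -> cn (k (mkC s t) - A (mkC s t)) <= e * (w + h).
  move=> hs ht; have : cn (mkC s t - z0) <= w + h.
    rewrite (_ : mkC s t - z0 = mkC (s - x0) (t - y0)); last by apply: ceq; rewrite !reimE.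
    by rewrite cn_mkC; apply: lerD; rewrite ler_norml; lra.
  move=> hc; have := Hd (mkC s t - z0) (le_lt_trans hc whd).
  rewrite -/z0 (addrC z0) subrK /A l2.
  rewrite (_ : _ - _ - _ = k (mkC s t) - (k z0 - z0 * l + l * mkC s t)); last by ring.
  by move=> hh; apply: le_trans hh _; rewrite ler_wpM2l// ltW.
have dA (u : R -> C) (t : R) m : iscd u t m -> ccont (fun s => A (u s)) t.
  by move=> hu; apply: ccontD; [exact: ccont_cst|apply: ccontM; [exact: ccont_cst|exact: iscd_cont hu]].
have hh s : y <= s <= y + h -> cn (cI x (x + w) (fun t => k (mkC t s)) - cI x (x + w) (fun t => A (mkC t s)))
    <= 2 * (e * (w + h)) * w.
  move=> hs; have c1 := hol_ccOn_h H hs.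
  have c2 : ccOn x (x + w) (fun t => A (mkC t s)) by move=> t _; exact: dA (iscd_h s t).
  rewrite -cIB//; have := cI_norm (u := fun t => k (mkC t s) - A (mkC t s)) (M := e * (w + h)) _ (ccOnD c1 (ccOnN c2)).
  rewrite (addrC x w) addrK (addrC w x); apply; first by rewrite lerDl ltW.
  by move=> t ht; exact: est.
have vv s : x <= s <= x + w -> cn (cI y (y + h) (fun t => k (mkC s t)) - cI y (y + h) (fun t => A (mkC s t)))
    <= 2 * (e * (w + h)) * h.
  move=> hs; have c1 := hol_ccOn_v H hs.
  have c2 : ccOn y (y + h) (fun t => A (mkC s t)) by move=> t _; exact: dA (iscd_v s t).
  rewrite -cIB//; have := cI_norm (u := fun t => k (mkC s t) - A (mkC s t)) (M := e * (w + h)) _ (ccOnD c1 (ccOnN c2)).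
  rewrite (addrC y h) addrK (addrC h y); apply; first by rewrite lerDl ltW.
  by move=> t ht; exact: est.
have rA : rect A x y w h = 0 by exact: rect_affine.
rewrite -(subr0 (rect k x y w h)) -rA /rect.
have h1 := hh y; have h2 := hh (y + h); have v1 := vv x; have v2 := vv (x + w).
set a1 := cI x _ _ in h1 *; set b1 := cI x _ (fun t => A (mkC t y)) in h1 *.
set a2 := cI x _ _ in h2 *; set b2 := cI x _ (fun t => A (mkC t (y + h))) in h2 *.
set a3 := cI y _ _ in v1 *; set b3 := cI y _ (fun t => A (mkC x t)) in v1 *.
set a4 := cI y _ _ in v2 *; set b4 := cI y _ (fun t => A (mkC (x + w) t)) in v2 *.
rewrite (_ : _ - _ = (a1 - b1) + ci R * (a4 - b4) - (a2 - b2) - ci R * (a3 - b3)); last by ring.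
have q1 : y <= y <= y + h by rewrite lexx lerDl ltW.
have q2 : y <= y + h <= y + h by rewrite lexx lerDl ltW.
have q3 : x <= x <= x + w by rewrite lexx lerDl ltW.
have q4 : x <= x + w <= x + w by rewrite lexx lerDl ltW.
have big := lerD (lerD (lerD (h1 q1) (v2 q4)) (h2 q2)) (v1 q3).
apply: le_trans (cn_add4 _ _ _ _) _; apply: le_trans big _.
by rewrite le_eqVlt; apply/orP; left; apply/eqP; clear; ring.
Qed.

Lemma bisect k x y w h (K : R) : 0 < w -> 0 < h -> hol_on k x y (2 * w) (2 * h) ->
  4 * K < cn (rect k x y (2 * w) (2 * h)) ->
  exists x' y', [/\ x' = x \/ x' = x + w, y' = y \/ y' = y + h & K < cn (rect k x' y' w h)].
Proof.
move=> w0 h0 H bad; apply: contrapT => no.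
have small x' y' : x' = x \/ x' = x + w -> y' = y \/ y' = y + h -> cn (rect k x' y' w h) <= K.
  by move=> hx hy; rewrite leNgt; apply/negP => Bq; apply: no; exists x', y'.
have s1 := small x y (or_introl erefl) (or_introl erefl).
have s2 := small (x + w) y (or_intror erefl) (or_introl erefl).
have s3 := small x (y + h) (or_introl erefl) (or_intror erefl).
have s4 := small (x + w) (y + h) (or_intror erefl) (or_intror erefl).
have big := lerD (lerD (lerD s1 s2) s3) s4.
move: bad; rewrite ltNge (rect_split (ltW w0) (ltW h0) H) => /negP; apply.
have -> : 4 * K = K + K + K + K by clear; ring.
apply: le_trans big.
apply: le_trans (cnD _ _) _; rewrite lerD2r; apply: le_trans (cnD _ _) _; rewrite lerD2r.
exact: cnD.
Qed.

Lemma nested_intervals (Z D : nat -> R) : (forall n, 0 < D n) ->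
    (forall n m, (n <= m)%N -> Z n <= Z m /\ Z m + D m <= Z n + D n) ->
    exists z : R, forall n, Z n <= z <= Z n + D n.
Proof.
move=> D0 mono; have ub n : ubound (range Z) (Z n + D n).
  move=> _ [j _ <-]; have [nj|jn] := leqP n j.
    by have [_ ?] := mono n j nj; have := D0 j; lra.
  by have [? _] := mono j n (ltnW jn); have := D0 n; lra.
exists (sup (range Z)) => n; apply/andP; split.
  by apply: ub_le_sup; [exists (Z 0%N + D 0%N); exact: ub|exists n].
by apply: ge_sup; [exists (Z 0%N), 0%N|exact: ub].
Qed.

(* Goursat: bisect a rectangle violating the quadratic bound and differentiate at the limit point. *)
Theorem goursat k x y w h : 0 < w -> 0 < h -> hol_on k x y w h -> rect k x y w h = 0.
Proof.
move=> w0 h0 H; apply/eqP; rewrite -cn_eq0; apply/eqP/le_anti; rewrite cn_ge0 andbT.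
(* The constant 5 exceeds the 4 of [rect_local], so that the limit point of the bisection yields a
   strict contradiction. *)
suff main e : 0 < e -> cn (rect k x y w h) <= 5 * e * (w + h) * (w + h).
  apply/ler_addgt0Pr => e e0; rewrite add0r.
  have wh : 0 < w + h by lra.
  have q : 0 < e / (5 * (w + h) * (w + h)) by rewrite divr_gt0 ?mulr_gt0.
  apply: le_trans (main _ q) _.
  by rewrite le_eqVlt; apply/orP; left; apply/eqP; field; apply/eqP; lra.
move=> e0; apply: contrapT => /negP; rewrite -ltNge => bad.
pose W n := w / 2 ^+ n; pose Hh n := h / 2 ^+ n.
have W0 n : 0 < W n by rewrite divr_gt0// exprn_gt0.
have H0 n : 0 < Hh n by rewrite divr_gt0// exprn_gt0.
have WS n : W n = 2 * W n.+1 by rewrite /W exprS; field; rewrite expf_neq0.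
have HS n : Hh n = 2 * Hh n.+1 by rewrite /Hh exprS; field; rewrite expf_neq0.
pose B n (p : R * R) := 5 * e * (W n + Hh n) * (W n + Hh n) < cn (rect k p.1 p.2 (W n) (Hh n)).
pose I n (p : R * R) := [/\ x <= p.1, p.1 + W n <= x + w, y <= p.2 & p.2 + Hh n <= y + h].
have step n p : I n p -> B n p -> exists q, [/\ I n.+1 q, B n.+1 q, p.1 <= q.1, q.1 + W n.+1 <= p.1 + W n
    & p.2 <= q.2 /\ q.2 + Hh n.+1 <= p.2 + Hh n].
  move=> [i1 i2 i3 i4] Bp; rewrite /I /=.
  have w1 := W0 n.+1; have h1 := H0 n.+1; have wS := WS n; have hS := HS n.
  have Hn : hol_on k p.1 p.2 (2 * W n.+1) (2 * Hh n.+1).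
    by apply: hol_sub H _ _ _ _; lra.
  have bad' : 4 * (5 * e * (W n.+1 + Hh n.+1) * (W n.+1 + Hh n.+1)) <
      cn (rect k p.1 p.2 (2 * W n.+1) (2 * Hh n.+1)).
    move: Bp; rewrite /B wS hS; apply: le_lt_trans.
    by rewrite le_eqVlt; apply/orP; left; apply/eqP; clear; ring.
  have [x' [y' [hx hy Bq]]] := bisect w1 h1 Hn bad'.
  have hx' : p.1 <= x' /\ x' + W n.+1 <= p.1 + W n by rewrite wS; case: hx => ->; move: w1; qlra.
  have hy' : p.2 <= y' /\ y' + Hh n.+1 <= p.2 + Hh n by rewrite hS; case: hy => ->; move: h1; qlra.
  by case: hx' hy' => [a b] [c d]; exists (x', y'); split=> //=; move: i1 i2 i3 i4 a b c d; qlra.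
(* The states carry their invariant, so dependent choice along the bisection becomes iteration of
   one function on [T]. *)
pose T := {p : nat * (R * R) | I p.1 p.2 /\ B p.1 p.2}.
have I0 : I 0%N (x, y) by rewrite /I /W /Hh expr0 !divr1.
have B0 : B 0%N (x, y) by rewrite /B /W /Hh expr0 !divr1.
have nxt (p : T) : exists q : T, [/\ (sval q).1 = (sval p).1.+1, (sval p).2.1 <= (sval q).2.1,
    (sval q).2.1 + W (sval q).1 <= (sval p).2.1 + W (sval p).1, (sval p).2.2 <= (sval q).2.2
    & (sval q).2.2 + Hh (sval q).1 <= (sval p).2.2 + Hh (sval p).1].
  case: p => -[n p] /= [Ip Bp]; have [q [Iq Bq a b [c d]]] := step n p Ip Bp.
  by exists (exist _ (n.+1, q) (conj Iq Bq)).
have [F HF] := choice nxt.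
pose s n : T := iter n F (exist _ (0%N, (x, y)) (conj I0 B0)).
have sn n : (sval (s n)).1 = n.
  by elim: n => //= n IH; have [-> _ _ _ _] := HF (s n); rewrite IH.
pose X n := (sval (s n)).2.1; pose Y n := (sval (s n)).2.2.
have mono n m : (n <= m)%N -> [/\ X n <= X m, X m + W m <= X n + W n, Y n <= Y m & Y m + Hh m <= Y n + Hh n].
  move=> /subnK <-; elim: (m - n)%N => [|j [a b c d]]; first by rewrite add0n.
  have [_] := HF (s (j + n)%N); have -> : F (s (j + n)%N) = s (j + n).+1 by [].
  rewrite !sn.
  rewrite -/(X (j + n)%N) -/(Y (j + n)%N) -/(X (j + n).+1) -/(Y (j + n).+1) addSn.
  by move: a b c d; qlra.
have [x0 Hx0] := nested_intervals W0 (fun n m nm => let: And4 a b _ _ := mono n m nm in conj a b).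
have [y0 Hy0] := nested_intervals H0 (fun n m nm => let: And4 _ _ a b := mono n m nm in conj a b).
have In n : I n (X n, Y n) by have := (svalP (s n)).1; rewrite sn.
have Bn n : B n (X n, Y n) by have := (svalP (s n)).2; rewrite sn.
have [l Hl] : exists l, cdv k (mkC x0 y0) l.
  have := Hx0 0%N; have := Hy0 0%N; have [] := In 0%N => /= a b c d e1 e2.
  by apply: H; move: a b c d e1 e2; qlra.
have [d d0 Hd] := rect_local Hl e0.
have wh : 0 < w + h by lra.
have [n nd] : exists n, W n + Hh n < d.
  have [n hn] : exists n : nat, (w + h) / d < 2 ^+ n.
    exists (Num.truncn ((w + h) / d)).+1; apply: lt_trans (truncnS_gt _) _.
    by rewrite -natrX ltr_nat ltn_expl.
  by exists n; rewrite /W /Hh -mulrDl ltr_pdivrMr ?exprn_gt0// mulrC -ltr_pdivrMr.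
have [i1 i2 i3 i4] := In n.
have Hn : hol_on k (X n) (Y n) (W n) (Hh n) by apply: hol_sub H _ _ _ _.
have := Hd _ _ _ _ (W0 n) (H0 n) nd (Hx0 n) (Hy0 n) Hn.
have := Bn n; rewrite /B /=.
have : 0 < e * ((W n + Hh n) * (W n + Hh n)) by rewrite !mulr_gt0// addr_gt0.
move=> p b1 b2; have := lt_le_trans b1 b2.
rewrite (_ : 5 * e * (W n + Hh n) * (W n + Hh n) = 4 * e * (W n + Hh n) * (W n + Hh n) + e * ((W n + Hh n) * (W n + Hh n))); last by ring.
by rewrite gtrDl => /lt_trans /(_ p); rewrite ltxx.
Qed.

End Goursat.

(** * Cauchy's formula for the derivative on circles *)

Section Circle.

Variable R : realType.
Local Notation C := (Cplx R).
Implicit Types (k : C -> C) (z l c : C) (x y e r t : R).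

Lemma rlin_coord (g : nat) (i : 'I_g) : rlin (fun v : 'cV[C]_g => v i ord0).
Proof.
split; first by move=> v w; rewrite mxE.
split; first by move=> h v; rewrite mxE.
by exists 1 => v; rewrite mul1r cn_le_vn.
Qed.

(** The exponential is smooth as a function on C^1 and satisfies the Cauchy-Riemann equation, so its
    complex derivative is read off from the real one. *)
Lemma cdv_cexp z : cdv (@cexp R) z (cexp z).
Proof.
pose f (v : 'cV[C]_1) := cexp (v ord0 ord0).
have sf : sm setT f by apply: sm_cexp; [exact: vopenT|apply: sm_rlin; [exact: vopenT|exact: rlin_coord]].
pose v : 'cV[C]_1 := const_mx z.
have pdf d : pd d f v = d ord0 ord0 * cexp z.
  by apply: haspd_pd; have := haspd_cexp (haspd_rlin v d (rlin_coord (@ord0 0))); rewrite mxE.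
have df : differentiable f v.
  apply: (sm_differentiable (@vopenT R 1) sf) => // i.
  by rewrite !pdf !mxE; ring.
have := differentiable_cdir (const_mx 1) df.
have e1 : 'D_(const_mx 1) f v = cexp z.
  have h : haspd f v (const_mx 1) ('D_(const_mx 1) f v).
    apply/iscdP => e /(differentiable_cdir (const_mx 1) df) [d d0 H]; exists d => // h hd.
    by have := H (toC h); rewrite cn_toC add0r sc0 addr0 /sc; exact.
  by rewrite -(haspd_pd h) pdf mxE mul1r.
rewrite e1 => H e /H [d d0 Hd]; exists d => // c /Hd.
by rewrite /f !mxE mulr1.
Qed.

Lemma cdv_comp k k' z l l' : cdv k (k' z) l -> cdv k' z l' -> cdv (fun w => k (k' w)) z (l * l').
Proof.
move=> H H' e e0.
have L0 := cn_ge0 l; have L0' := cn_ge0 l'.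
pose e1 := e / (2 * (cn l' + 1)); pose e2 := Num.min 1 (e / (2 * (cn l + 1))).
have e10 : 0 < e1 by rewrite divr_gt0// mulr_gt0//; lra.
have e20 : 0 < e2 by rewrite lt_min ltr01 divr_gt0// mulr_gt0//; lra.
have [d1 d10 H1] := H e1 e10; have [d2 d20 H2] := H' e2 e20.
exists (Num.min d2 (d1 / (cn l' + 1))) => [|c]; first by rewrite lt_min d20 divr_gt0//; lra.
rewrite lt_min ltr_pdivlMr; last by lra.
move=> /andP[/H2 c2 c1]; set D := k' (z + c) - k' z in c2.
have nc := cn_ge0 c.
have m1 : e2 <= 1 by rewrite ge_min lexx.
have DL : cn D <= (cn l' + 1) * cn c.
  have := cnD (D - c * l') (c * l'); rewrite subrK.
  have := cnM c l'; have : e2 * cn c <= 1 * cn c by rewrite ler_wpM2r.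
  move: c2; clra.
have Dd : cn D < d1 by apply: le_lt_trans DL _; rewrite mulrC.
have := H1 D Dd; rewrite /D (addrC (k' z)) subrK -/D => h1.
rewrite (_ : _ - _ - _ = (k (k' (z + c)) - k (k' z) - D * l) + (D - c * l') * l); last by ring.
apply: le_trans (cnD _ _) _.
have h3 : cn ((D - c * l') * l) <= e2 * cn c * cn l.
  by apply: le_trans (cnM _ _) _; rewrite ler_wpM2r.
have h4 : e1 * cn D <= e / 2 * cn c.
  apply: le_trans (_ : e1 * ((cn l' + 1) * cn c) <= _); first by rewrite ler_wpM2l// ltW.
  rewrite le_eqVlt /e1; apply/orP; left; apply/eqP; field; apply/eqP; lra.
have h5 : e2 * cn c * cn l <= e / 2 * cn c.
  rewrite mulrAC ler_wpM2r//.
  have : e2 <= e / (2 * (cn l + 1)) by rewrite ge_min lexx orbT.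
  move=> h; apply: le_trans (_ : e / (2 * (cn l + 1)) * cn l <= _); first by rewrite ler_wpM2r.
  rewrite mulrAC ler_pdivrMr; last by lra.
  have : 0 <= e by rewrite ltW.
  move: L0; clear; move: (cn l) => a; nra.
move: h1 h3 h4 h5; clra.
Qed.

Lemma cdvM k k' z l l' : cdv k z l -> cdv k' z l' -> cdv (fun w => k w * k' w) z (l * k' z + k z * l').
Proof.
move=> H H' e e0.
have L0 := cn_ge0 l; have K0 := cn_ge0 (k z); have K0' := cn_ge0 (k' z).
pose B := 1 + cn l + cn (k z) + cn (k' z) + 1.
have B1 : 1 <= B by rewrite /B; lra.
have q : 0 < e / (2 * B) by rewrite divr_gt0//; lra.
have m0 : 0 < Num.min 1 (e / (2 * B)) by rewrite lt_min ltr01.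
have [d1 d10 H1] := H _ m0; have [d2 d20 H2] := H' _ q.
have [d3 d30 H3] := cdv_cont H' q.
exists (Num.min d1 (Num.min d2 d3)) => [|c]; first by rewrite !lt_min d10 d20.
rewrite !lt_min => /and3P[/H1 c1 /H2 c2 /H3 c3].
rewrite (_ : _ - _ - _ = (k (z + c) - k z - c * l) * k' z + k z * (k' (z + c) - k' z - c * l')
  + ((k (z + c) - k z - c * l) + c * l) * (k' (z + c) - k' z)); last by ring.
set P := k (z + c) - k z - c * l in c1 *; set Q := k' (z + c) - k' z - c * l' in c2 *.
set S := k' (z + c) - k' z in c3 *.
have nc := cn_ge0 c.
have t1 := cnD (P * k' z + k z * Q) ((P + c * l) * S).
have t2 := cnD (P * k' z) (k z * Q).
have t3 := cnM P (k' z); have t4 := cnM (k z) Q; have t5 := cnM (P + c * l) S.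
have t6 := cnD P (c * l); have t7 := cnM c l.
have m1 : Num.min 1 (e / (2 * B)) <= 1 by rewrite ge_min lexx.
have m2 : Num.min 1 (e / (2 * B)) <= e / (2 * B) by rewrite ge_min lexx orbT.
have p1 : cn P <= e / (2 * B) * cn c by apply: le_trans c1 _; rewrite ler_wpM2r.
have p2 : cn P <= cn c by apply: le_trans c1 _; rewrite -[X in _ <= X]mul1r ler_wpM2r.
have a1 : cn P * cn (k' z) <= e / (2 * B) * cn c * cn (k' z) by rewrite ler_wpM2r.
have a2 : cn (k z) * cn Q <= cn (k z) * (e / (2 * B) * cn c) by rewrite ler_wpM2l.
have a3 : cn (P + c * l) * cn S <= (cn c + cn c * cn l) * (e / (2 * B)).
  apply: ler_pM; rewrite ?cn_ge0//; last exact: ltW.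
  by apply: le_trans t6 _; apply: lerD.
have E : e = e / (2 * B) * (2 * B) by rewrite divfK//; apply/eqP; lra.
have q0 := ltW q; rewrite [X in _ <= X * _]E.
have pos : 0 <= e / (2 * B) * cn c by rewrite mulr_ge0.
have pk := mulr_ge0 pos K0; have pk' := mulr_ge0 pos K0'; have pl := mulr_ge0 pos L0.
apply: le_trans t1 _; apply: le_trans (lerD t2 t5) _; apply: le_trans (lerD (lerD t3 t4) (lexx _)) _.
apply: le_trans (lerD (lerD a1 a2) a3) _.
move: pk pk' pl pos; rewrite /B; move: (e / _) => b.
repeat match goal with |- context [@cn ?r ?x] => let a := fresh "a" in generalize (@cn r x); intro a end.
clear; intros; lra.
Qed.

Lemma cdvN z : cdv (fun w => - w) z (-1).
Proof.
move=> e e0; exists 1 => // x _; rewrite mulrN1 opprK opprD opprK (addrAC (- z)) addNr add0r addNr cn0.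
by rewrite mulr_ge0 ?cn_ge0 ?ltW.
Qed.

Definition cis t : C := cexp (ci R * toC t).

Lemma iscd_cis t : iscd cis t (ci R * cis t).
Proof.
have := iscd_cexp (iscdZ (ci R) (iscd_id t)); rewrite mulr1; exact.
Qed.
Lemma cn_cis t : cn (cis t) <= 2. Proof. exact: cn_cexpi. Qed.
Lemma cisD t r : cis (t + r) = cis t * cis r.
Proof. by rewrite /cis toCD mulrDr cexpD. Qed.
Lemma cis0 : cis 0 = 1. Proof. by rewrite /cis toC0 mulr0 cexp0. Qed.
Lemma cisN t : cis (- t) = (cis t)^-1.
Proof. by rewrite /cis toCN mulrN cexpN. Qed.
Lemma cis_neq0 t : cis t != 0. Proof. exact: cexp_neq0. Qed.
Lemma cisNK t : cis t * cis (- t) = 1.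
Proof. by rewrite cisN divff ?cis_neq0. Qed.
Lemma cis2pi : cis (2 * pi) = 1.
Proof.
apply: ceq; rewrite /cis /cexp !reimE !mul0r !mul1r ?mulr0 ?subrr ?addr0 ?subr0 ?add0r expR0 !mul1r mulr_natl.
  by rewrite cos2pi.
by rewrite sin2pi.
Qed.
Lemma ccont_cis t : ccont cis t. Proof. exact: iscd_cont (iscd_cis t). Qed.
Lemma iscd_cisN t : iscd (fun s => cis (- s)) t (- (ci R * cis (- t))).
Proof.
have := iscd_cexp (iscdZ (ci R) (iscdN (iscd_id t))).
move=> h; apply: (iscd_eq (iscd_ext _ h)); first by move=> x; rewrite /cis toCN.
by rewrite /cis toCN; ring.
Qed.
Lemma ccont_cisN t : ccont (fun s => cis (- s)) t. Proof. exact: iscd_cont (iscd_cisN t). Qed.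

Lemma int_cisN : cI 0 (2 * pi) (fun t => cis (- t)) = 0.
Proof.
have p0 : 0 < 2 * pi :> R by rewrite mulr_gt0// pi_gt0.
rewrite (cI_FTC (U := fun t => ci R * cis (- t)) p0).
- by rewrite cisN cis2pi invr1 oppr0 cis0 subrr.
- by move=> t _; exact: ccont_cisN.
- by move=> t _; apply: ccontM; [exact: ccont_cst|exact: ccont_cisN].
move=> t _; apply: iscd_eq (iscdZ (ci R) (iscd_cisN t)) _.
by rewrite mulrN mulrA ci2 mulN1r opprK.
Qed.

(** Up to the factor i / r, the contour integral of k(z) / z^2 over the circle of radius r. *)
Definition cint k r := cI 0 (2 * pi) (fun t => k (toC r * cis t) * cis (- t)).

Lemma cexp_polar x t : cexp (mkC x t) = toC (expR x) * cis t.
Proof. by rewrite mkCE cexpD cexp_toC. Qed.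

Lemma cn_polar r t : 0 <= r -> cn (toC r * cis t) <= 2 * r.
Proof.
by move=> r0; rewrite cnMtoC ger0_norm// mulrC ler_wpM2r// cn_cis.
Qed.

(** Goursat for k(e^z) e^(-z) on a rectangle of height 2 pi: the horizontal sides cancel by
    periodicity and the vertical ones are circle integrals. The exponential chart keeps away from
    the singularity at 0. *)
Lemma cint_const k (x w rho : R) : 0 < w -> 2 * expR (x + w) < rho ->
  (forall z, cn z < rho -> exists l, cdv k z l) ->
  toC (expR x)^-1 * cint k (expR x) = toC (expR (x + w))^-1 * cint k (expR (x + w)).
Proof.
move=> w0 hx H.
pose q z := k (cexp z) * cexp (- z).
have p0 : 0 < 2 * pi :> R by rewrite mulr_gt0// pi_gt0.
have hol : hol_on q x 0 w (2 * pi).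
  move=> s t hs _.
  have [l Hl] : exists l, cdv k (cexp (mkC s t)) l.
    apply: H; rewrite cexp_polar; apply: le_lt_trans (cn_polar _ (expR_ge0 _)) _.
    apply: le_lt_trans hx; rewrite ler_pM2l// ler_expR; lra.
  have h1 := cdv_comp Hl (cdv_cexp (mkC s t)).
  have h2 := cdv_comp (cdv_cexp (- mkC s t)) (cdvN (mkC s t)).
  by exists (l * cexp (mkC s t) * cexp (- mkC s t) + k (cexp (mkC s t)) * (cexp (- mkC s t) * -1)); exact: cdvM h1 h2.
have := goursat w0 p0 hol; rewrite /rect !add0r.
have -> : (fun t => q (mkC t (2 * pi))) = (fun t => q (mkC t 0)).
  apply/funext => t; rewrite /q !cexpN !cexp_polar cis2pi cis0//.
have v s : x <= s <= x + w -> cI 0 (2 * pi) (fun t => q (mkC s t)) = toC (expR s)^-1 * cint k (expR s).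
  move=> hs; rewrite /cint -cIZ.
    apply: cI_ext => t _; rewrite /q cexpN cexp_polar invfM -toCV cisN; ring.
  move=> t ht; have ht' : 0 <= t <= 0 + 2 * pi by rewrite add0r.
  have h := hol_ccOn_v hol hs ht'.
  have := ccontM (ccont_cst (toC (expR s)) t) h.
  apply: ccont_ext => t'; rewrite /q cexpN cexp_polar invfM -toCV cisN.
  have e0 : toC (expR s) != 0 :> C by rewrite toC_eq0 gt_eqF ?expR_gt0.
  by rewrite toCV; field; rewrite e0 cis_neq0.
have q1 : x <= x <= x + w by lra.
have q2 : x <= x + w <= x + w by lra.
rewrite (v _ q1) (v _ q2); move: (cI x _ _) => A /eqP.
rewrite (addrC A) addrK subr_eq0 => /eqP h.
have i0 : ci R != 0 by rewrite -cn_eq0 cn_ci oner_eq0.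
exact: (mulfI i0 (esym h)).
Qed.

(** Against [cis (- t)] the constant term of k integrates to 0 and the linear term to 2 pi r l, so
    only the remainder of the derivative at 0 has to be estimated. *)
Lemma cint_lim k l e : cdv k 0 l -> 0 < e -> exists2 d : R, 0 < d & forall r, 0 < r -> 2 * r < d ->
  ccOn 0 (2 * pi) (fun t => k (toC r * cis t)) ->
  cn (toC r^-1 * cint k r - toC (2 * pi) * l) <= e.
Proof.
move=> Hk e0; have p0 : 0 < pi :> R := pi_gt0 R.
pose e1 := e / (16 * pi); have e10 : 0 < e1 by rewrite divr_gt0// mulr_gt0.
have [d d0 H] := Hk e1 e10; exists d => // r r0 rd cc.
have p2 : 0 <= 2 * pi :> R by lra.
have c1 : ccOn 0 (2 * pi) (fun t => k (toC r * cis t) * cis (- t)).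
  by apply: ccOnM => // t _; exact: ccont_cisN.
have c0 : ccOn 0 (2 * pi) (fun t => k 0 * cis (- t)).
  by apply: ccOnM => // t _; [exact: ccont_cst|exact: ccont_cisN].
have cl : ccOn 0 (2 * pi) (fun=> toC r * l) by exact: ccOn_cst.
have rn : toC r != 0 :> C by rewrite toC_eq0 gt_eqF.
have e2 : toC r^-1 * cint k r - toC (2 * pi) * l = toC r^-1 *
   cI 0 (2 * pi) (fun t => k (toC r * cis t) * cis (- t) - k 0 * cis (- t) - toC r * l).
  have c01 : ccOn 0 (2 * pi) (fun t => k (toC r * cis t) * cis (- t) - k 0 * cis (- t)).
    by apply: ccOnD => //; exact: ccOnN.
  rewrite (cIB c01 cl) (cIB c1 c0) cIZ; last by move=> t _; exact: ccont_cisN.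
  rewrite int_cisN mulr0 subr0 cI_cst// mulrBr subr0 toCV; congr (_ - _).
  by rewrite mulrCA mulKf.
rewrite e2 cnMtoC gtr0_norm ?invr_gt0// ler_pdivrMl//.
have b : cn (cI 0 (2 * pi) (fun t => k (toC r * cis t) * cis (- t) - k 0 * cis (- t) - toC r * l)) <= 2 * (4 * e1 * r) * (2 * pi - 0).
  apply: cI_norm => //.
    by apply: ccOnD; [apply: ccOnD => //; exact: ccOnN|exact: ccOnN].
  move=> t _; have := H (toC r * cis t); rewrite add0r => h.
  have h1 := cn_polar t (ltW r0).
  have {}h := h (le_lt_trans h1 rd).
  rewrite (_ : _ - _ - _ = (k (toC r * cis t) - k 0 - toC r * cis t * l) * cis (- t)); last first.
    have := cisNK t; move: (cis t) (cis (- t)) (k _) => a b kk ab.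
    by rewrite !mulrBl (mulrAC _ l) -(mulrA (toC r)) ab mulr1.
  apply: le_trans (cnM _ _) _; have h2 := cn_cis (- t).
  apply: le_trans (ler_pM (cn_ge0 _) (cn_ge0 _) h h2) _.
  have : e1 * cn (toC r * cis t) <= e1 * (2 * r) by rewrite ler_wpM2l// ltW.
  lra.
apply: le_trans b _; rewrite subr0 /e1.
by rewrite le_eqVlt; apply/orP; left; apply/eqP; field; apply/eqP; lra.
Qed.

(** The integral divided by the radius does not depend on the radius and tends to 2 pi l as the
    radius tends to 0. *)
Lemma circle_formula k l (rho r : R) : 0 < r -> 2 * r < rho ->
  (forall z, cn z < rho -> exists l, cdv k z l) -> cdv k 0 l ->
  cint k r = toC (2 * pi * r) * l.
Proof.
move=> r0 rr H Hl.
have rn : toC r != 0 :> C by rewrite toC_eq0 gt_eqF.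
apply: (mulfI (invr_neq0 rn)); rewrite (mulrC (2 * pi)) toCM mulrA mulKf// -toCV.
apply/eqP; rewrite -subr_eq0 -cn_eq0; apply/eqP/le_anti; rewrite cn_ge0 andbT.
apply/ler_addgt0Pr => e e0; rewrite add0r.
have [d d0 Hd] := cint_lim Hl e0.
pose s := Num.min (r / 2) (d / 4).
have s0 : 0 < s by rewrite lt_min !divr_gt0.
have sr : s < r by rewrite gt_min; apply/orP; left; lra.
have sd : 2 * s < d by have : s <= d / 4; [rewrite ge_min lexx orbT|lra].
have lsr : 0 < ln r - ln s by rewrite subr_gt0 ltr_ln ?posrE.
have e1 : ln s + (ln r - ln s) = ln r by rewrite addrC subrK.
have := @cint_const k (ln s) (ln r - ln s) rho lsr.
rewrite e1 (lnK (x := r)) ?posrE// (lnK (x := s)) ?posrE//.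
move=> h; rewrite -(h rr H).
apply: (Hd _ s0 sd) => t _.
have [l' Hl'] : exists l, cdv k (toC s * cis t) l.
  by apply: H; apply: le_lt_trans (cn_polar t (ltW s0)) _; apply: lt_trans rr; rewrite ltr_pM2l.
apply: (cdv_ccont (u := fun t => toC s * cis t) Hl').
by apply: ccontM; [exact: ccont_cst|exact: ccont_cis].
Qed.

End Circle.

(** * Holomorphic functions are smooth *)

Section Holomorphic.

Variables (R : realType) (g : nat).
Local Notation C := (Cplx R).
Local Notation V := 'cV[C]_g.
Implicit Types (f : V -> C) (U : set V) (v w d p : V) (h t M r : R).

(** Continuity and complex derivatives along every complex line, without regularity of these
    derivatives: what differentiability over C gives directly. *)
Definition chol U f := forall v, U v -> vcont f v /\ forall d, cdir f v d (pd d f v).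

Lemma cdir_haspd f v d l : cdir f v d l -> haspd f v d l.
Proof.
move=> H; apply/iscdP => e /H [x x0 Hx]; exists x => // h hd.
by have := Hx (toC h); rewrite cn_toC add0r sc0 addr0 /sc; exact.
Qed.

Lemma diff_chol U f : (forall v, U v -> differentiable f v) -> chol U f.
Proof.
move=> H v /H df; split; first exact: differentiable_vcont.
move=> d; have h := differentiable_cdir d df.
by rewrite (haspd_pd (cdir_haspd h)).
Qed.

Lemma cdirZ f v d l (c : C) : cdir f v d l -> cdir f v (c *: d) (c * l).
Proof.
move=> H e e0; have c0 := cn_ge0 c.
have q : 0 < e / (cn c + 1) by rewrite divr_gt0//; lra.
have [x x0 Hx] := H _ q; exists (x / (cn c + 1)) => [|z]; first by rewrite divr_gt0//; lra.
rewrite ltr_pdivlMr => [zx|]; last by lra.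
have z0 := cn_ge0 z; have m := cnM z c.
have := Hx (z * c); rewrite -scalerA mulrA => h.
have zc : cn (z * c) < x by apply: le_lt_trans m _; lra.
apply: le_trans (h zc) _; apply: (@le_trans _ _ (e / (cn c + 1) * (cn z * cn c))).
  by rewrite ler_wpM2l// ltW.
rewrite mulrAC ler_pdivrMr; last by lra.
have : 0 <= e * cn z by rewrite mulr_ge0// ltW.
move: (cn z) (cn c); clear; intros; lra.
Qed.

Lemma chol_pdZ U f v d (c : C) : chol U f -> U v -> pd (c *: d) f v = c * pd d f v.
Proof. by move=> H Uv; apply: haspd_pd; apply: cdir_haspd; apply: cdirZ; exact: (H v Uv).2. Qed.

Lemma cdir_cdv f v d (z l : C) : cdir f (v + z *: d) d l -> cdv (fun c : C => f (v + c *: d)) z l.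
Proof.
move=> H e /H [x x0 Hx]; exists x => // c /Hx; by rewrite scalerDl addrA.
Qed.

Definition circ f v d r : C := cI 0 (2 * pi) (fun t => f (v + (toC r * cis t) *: d) * cis (- t)).

Lemma circ_formula U f v d (rho r : R) : chol U f -> 0 < r -> 2 * r < rho ->
  (forall z : C, cn z < rho -> U (v + z *: d)) -> circ f v d r = toC (2 * pi * r) * pd d f v.
Proof.
move=> H r0 rr HU.
have h z : cn z < rho -> cdv (fun c : C => f (v + c *: d)) z (pd d f (v + z *: d)).
  by move=> /HU Uz; apply: cdir_cdv; exact: (H _ Uz).2.
have c0 : cn (0 : C) < rho by rewrite cn0; lra.
have := h 0 c0; rewrite scale0r addr0.
by apply: (circle_formula r0 rr) => z /h; exists (pd d f (v + z *: d)).
Qed.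

Lemma circ_ccOn U f v d r : chol U f -> (forall t, U (v + (toC r * cis t) *: d)) ->
  ccOn 0 (2 * pi) (fun t => f (v + (toC r * cis t) *: d)).
Proof.
move=> H HU t _; have Ut := HU t.
apply: (cdv_ccont (k := fun c : C => f (v + c *: d)) (u := fun t => toC r * cis t) (l := pd d f (v + (toC r * cis t) *: d))).
  by apply: cdir_cdv; exact: (H _ Ut).2.
by apply: ccontM; [exact: ccont_cst|exact: ccont_cis].
Qed.

Lemma room U v d (e : R) : vopen U -> U v -> 0 < e -> exists r x : R, [/\ 0 < r, 0 < x &
  forall w z, vn (w - v) < x -> cn z < 4 * r -> U (w + z *: d) /\ vn (w + z *: d - v) < e].
Proof.
move=> oU Uv e0; have [e1 e10 H] := oU v Uv.
have v1 : 0 < vn d + 1 by have := vn_ge0 d; lra.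
pose m := Num.min e e1; have m0 : 0 < m by rewrite lt_min e0.
exists (m / 8 / (vn d + 1)), (m / 4); split; rewrite ?divr_gt0// => w z wx.
rewrite mulrA ltr_pdivlMr// => zr.
have : vn (w + z *: d - v) < m.
  have := vnD (w - v) (z *: d); rewrite addrAC; have := vn_scale z d.
  have := vn_ge0 d; have := cn_ge0 z; move: zr wx m0; move: m (vn d) (cn z); clear; intros; nra.
by rewrite lt_min => /andP[? ?]; split=> //; exact: H.
Qed.

Lemma chol_lb U f : chol U f -> lb U f.
Proof.
move=> H v Uv; have [d d0 Hd] := (H v Uv).1 1 ltr01.
exists d, (cn (f v) + 1); split=> // w Uw /Hd h.
by have := cnD (f w - f v) (f v); rewrite subrK; lra.
Qed.

Lemma cn_cis_polar r t : 0 < r -> cn (toC r * cis t) < 4 * r.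
Proof. by move=> r0; have := cn_polar t (ltW r0); lra. Qed.

(** Cauchy's estimate, with a radius that serves all base points near v. *)
Lemma chol_lb_pd U f d : vopen U -> chol U f -> lb U (pd d f).
Proof.
move=> oU H v Uv; have [e [M [e0 HM]]] := chol_lb H Uv.
have [r [x [r0 x0 Hr]]] := room d oU Uv e0.
have p0 : 0 < pi :> R := pi_gt0 R.
exists x, (4 * M / r); split=> // w Uw wv.
have Hz z : cn z < 4 * r -> U (w + z *: d) by move=> /(Hr w z wv) [].
have r2 : 2 * r < 4 * r by lra.
have F := circ_formula H r0 r2 Hz.
have b : cn (circ f w d r) <= 2 * (M * 2) * (2 * pi - 0).
  apply: cI_norm; first by lra.
    apply: ccOnM; last by move=> t _; exact: ccont_cisN.
    by apply: (circ_ccOn H) => t; apply: Hz; exact: cn_cis_polar.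
  move=> t _; apply: le_trans (cnM _ _) _; apply: ler_pM; rewrite ?cn_ge0 ?cn_cis//.
  by have [? ?] := Hr w _ wv (cn_cis_polar t r0); exact: HM.
move: b; rewrite F cnMtoC gtr0_norm; last by rewrite !mulr_gt0.
rewrite subr0 ler_pdivlMr// => b.
have p2 : 0 < 2 * pi :> R by lra.
rewrite -(ler_pM2l p2); move: b; move: (cn _) => a; lra.
Qed.

Lemma chol_Cn1 U f : vopen U -> chol U f -> Cn 1 U f.
Proof.
move=> oU H; split; first exact: chol_lb.
move=> d; split; first by move=> v Uv; apply: cdir_haspd; exact: (H v Uv).2.
exact: chol_lb_pd.
Qed.

Lemma chol_lip U f d v : vopen U -> chol U f -> U v -> exists x M : R, [/\ 0 < x, 0 <= M &
  forall p q, vn (p - v) < x -> vn (q - v) < x -> cn (pd d f q - pd d f p) <= M * vn (q - p)].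
Proof.
move=> oU H Uv; have [e [M [e0 M0 HM]]] := lipschitz oU (chol_Cn1 oU H) Uv.
have [r [x [r0 x0 Hr]]] := room d oU Uv e0.
have p0 : 0 < pi :> R := pi_gt0 R.
exists x, (4 * M / r); split=> //; first by rewrite divr_ge0 ?mulr_ge0// ltW.
move=> p q pv qv.
have Hz w z : vn (w - v) < x -> cn z < 4 * r -> U (w + z *: d) by move=> wv /(Hr w z wv) [].
have r2 : 2 * r < 4 * r by lra.
have Fp := circ_formula H r0 r2 (fun z => Hz p z pv).
have Fq := circ_formula H r0 r2 (fun z => Hz q z qv).
have cc w : vn (w - v) < x -> ccOn 0 (2 * pi) (fun t => f (w + (toC r * cis t) *: d) * cis (- t)).
  move=> wv; apply: ccOnM; last by move=> t _; exact: ccont_cisN.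
  by apply: (circ_ccOn H) => t; apply: Hz => //; exact: cn_cis_polar.
have b : cn (circ f q d r - circ f p d r) <= 2 * (M * vn (q - p) * 2) * (2 * pi - 0).
  rewrite /circ -cIB; [|exact: cc|exact: cc].
  apply: cI_norm; first by lra.
    by apply: ccOnD; [exact: cc|apply: ccOnN; exact: cc].
  move=> t _; rewrite -mulrBl; apply: le_trans (cnM _ _) _; apply: ler_pM; rewrite ?cn_ge0 ?cn_cis//.
  have [_ h1] := Hr p _ pv (cn_cis_polar t r0); have [_ h2] := Hr q _ qv (cn_cis_polar t r0).
  have := HM _ _ h1 h2; rewrite opprD addrACA subrr addr0; exact.
move: b; rewrite Fp Fq -mulrBr cnMtoC gtr0_norm; last by rewrite !mulr_gt0.
rewrite subr0 => b; rewrite mulrAC ler_pdivlMr//.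
have p2 : 0 < 2 * pi :> R by lra.
rewrite -(ler_pM2l p2); move: b; move: (cn _) (vn _) => a c; lra.
Qed.

(** The circle formula writes [pd d f] as an integral of f. Expanding the integrand in direction w,
    with a quadratic remainder from the Lipschitz bound on [pd w f], exhibits its complex derivative
    as the circle integral [L0] of [pd w f]. *)
Lemma chol_pd U f d : vopen U -> chol U f -> chol U (pd d f).
Proof.
move=> oU H v Uv; have [x [M [x0 M0 L]]] := chol_lip d oU H Uv.
split.
  move=> e e0; exists (Num.min x (e / (M + 1))); first by rewrite lt_min x0 divr_gt0//; lra.
  move=> w; rewrite lt_min ltr_pdivlMr; last by lra.
  move=> /andP[wx we]; have := L v w; rewrite subrr vn0 => /(_ x0 wx).
  have := vn_ge0 (w - v); move: we; move: (vn _) (cn _); clear; intros; lra.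
move=> w; have [x2 [M2 [x20 M20 L2]]] := chol_lip w oU H Uv.
have x20' : 0 < x2 / 2 by lra.
have [r [y [r0 y0 Hr]]] := room d oU Uv x20'.
have p0 : 0 < pi :> R := pi_gt0 R.
have Hz p z : vn (p - v) < y -> cn z < 4 * r -> U (p + z *: d) by move=> pv /(Hr p z pv) [].
have r2 : 2 * r < 4 * r by lra.
have vv : vn (v - v) < y by rewrite subrr vn0.
pose P t := v + (toC r * cis t) *: d.
have UP t : U (P t) by apply: Hz => //; exact: cn_cis_polar.
have Pv t : vn (P t - v) < x2 / 2 by have [_ ?] := Hr v _ vv (cn_cis_polar t r0).
have cP : ccOn 0 (2 * pi) (fun t => pd w f (P t) * cis (- t)).
  apply: ccOnM; last by move=> t _; exact: ccont_cisN.
  move=> t _; apply/ccontP => e e0.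
  have qq : 0 < e / ((M2 + 1) * (vn d + 1)) by rewrite divr_gt0// mulr_gt0//; have := vn_ge0 d; lra.
  have [s s0 Hs] := (ccontP (fun t => toC r * cis t) t).1 (ccontM (ccont_cst (toC r) t) (ccont_cis t)) _ qq.
  exists s => // t' /Hs.
  rewrite ltr_pdivlMr; last by rewrite mulr_gt0//; have := vn_ge0 d; lra.
  move=> h; have hx : x2 / 2 < x2 by lra.
  apply: le_lt_trans (L2 _ _ (lt_trans (Pv t) hx) (lt_trans (Pv t') hx)) _.
  rewrite /P opprD addrACA subrr add0r -scalerBl.
  have := vn_scale (toC r * cis t' - toC r * cis t) d; have := vn_ge0 d; have := cn_ge0 (toC r * cis t' - toC r * cis t).
  move: h M20; move: (cn _) (vn d) (vn _) => a b c; clear; intros; nra.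
pose L0 := toC (2 * pi * r)^-1 * cI 0 (2 * pi) (fun t => pd w f (P t) * cis (- t)).
suff key : cdir (pd d f) v w L0 by rewrite (haspd_pd (cdir_haspd key)).
have w0 := vn_ge0 w.
pose K := 8 * M2 * vn w / r + 1; have K1 : 1 <= K by rewrite lerDr divr_ge0 ?mulr_ge0// ltW.
move=> e e0; pose s := Num.min (y / (vn w + 1)) (Num.min (x2 / 2 / (vn w + 1)) (e / K)).
have [w1 k0] : 0 < vn w + 1 /\ 0 < K by split; [exact: ltr_wpDl|exact: lt_le_trans K1].
have s0 : 0 < s by rewrite !lt_min !divr_gt0.
exists s => // c; rewrite !lt_min !ltr_pdivlMr//.
move=> /and3P[c1 c2 c3]; have c0 := cn_ge0 c.
have cw := vn_scale c w.
have vc : vn (v + c *: w - v) < y by rewrite (addrC v) addrK; move: cw c0 c1; clra.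
have F1 := circ_formula H r0 r2 (fun z => Hz _ z vc).
have F0 := circ_formula H r0 r2 (fun z => Hz _ z vv).
have q0 : toC (2 * pi * r) != 0 :> C by rewrite toC_eq0 gt_eqF// !mulr_gt0.
have pr0 : 0 < 2 * pi * r by rewrite !mulr_gt0.
have cc p : vn (p - v) < y -> ccOn 0 (2 * pi) (fun t => f (p + (toC r * cis t) *: d) * cis (- t)).
  move=> wv; apply: ccOnM; last by move=> t _; exact: ccont_cisN.
  by apply: (circ_ccOn H) => t; apply: Hz => //; exact: cn_cis_polar.
have E : pd d f (v + c *: w) - pd d f v - c * L0 = toC (2 * pi * r)^-1 *
   cI 0 (2 * pi) (fun t => f (v + c *: w + (toC r * cis t) *: d) * cis (- t) - f (P t) * cis (- t) - c * (pd w f (P t) * cis (- t))).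
  have cz : ccOn 0 (2 * pi) (fun t => c * (pd w f (P t) * cis (- t))) by apply: ccOnM => //; exact: ccOn_cst.
  rewrite (cIB (ccOnD (cc _ vc) (ccOnN (cc _ vv))) cz) (cIB (cc _ vc) (cc _ vv)) cIZ//.
  rewrite -/(circ f (v + c *: w) d r) -/(circ f v d r) F1 F0 /L0 toCV !mulrBr !mulKf//.
  by rewrite (mulrCA c).
rewrite E cnMtoC gtr0_norm ?invr_gt0// ler_pdivrMl//.
have b : cn (cI 0 (2 * pi) (fun t => f (v + c *: w + (toC r * cis t) *: d) * cis (- t) - f (P t) * cis (- t) - c * (pd w f (P t) * cis (- t))))
   <= 2 * (2 * (M2 * vn w * cn c * cn c) * (1 - 0) * 2) * (2 * pi - 0).
  have cz : ccOn 0 (2 * pi) (fun t => c * (pd w f (P t) * cis (- t))) by apply: ccOnM => //; exact: ccOn_cst.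
  apply: cI_norm; first by rewrite mulr_ge0 ?pi_ge0.
    by apply: ccOnD; [apply: ccOnD; [exact: cc|apply: ccOnN; exact: cc]|exact: ccOnN].
  move=> t _; rewrite mulrA -!mulrBl; apply: le_trans (cnM _ _) _; apply: ler_pM; rewrite ?cn_ge0 ?cn_cis//.
  have -> : v + c *: w + (toC r * cis t) *: d = P t + c *: w by rewrite /P addrAC.
  have near s' : 0 <= s' <= 1 -> vn (P t + sc (s' * 1) (c *: w) - v) < x2 /\ vn (sc (s' * 1) (c *: w)) <= cn c * vn w.
    move=> s01; have h : vn (sc (s' * 1) (c *: w)) <= cn c * vn w.
      rewrite vn_sc mulr1 ger0_norm; last by case/andP: s01.
      by apply: le_trans cw; rewrite ler_piMl ?vn_ge0//; case/andP: s01.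
    split=> //; have := vnD (P t - v) (sc (s' * 1) (c *: w)); rewrite addrAC.
    have := Pv t; move: c0 c2 h.
    by move: (cn c) (vn w) (vn (sc _ _)) (vn (P t - v)) (vn (_ - v)); qlra.
  have Px : vn (P t - v) < x2 by have := Pv t; move: x20; clra.
  have [e1 e10 He1] : exists2 e1 : R, 0 < e1 & forall s', 0 <= s' <= 1 -> U (P t + sc (s' * 1) (c *: w)).
    exists 1 => // s' s01; rewrite /P -addrA (addrC ((toC r * cis t) *: d)) addrA.
    apply: (Hz _ (toC r * cis t)); last exact: cn_cis_polar.
    have [_ h] := near s' s01; rewrite (addrC v) addrK; move: h c0 c1; clra.
  have := @cmvt R (fun s' => f (P t + sc (s' * 1) (c *: w)) - toC s' * (c * pd w f (P t)))
     (fun s' => c * (pd w f (P t + sc (s' * 1) (c *: w)) - pd w f (P t))) 0 1 (M2 * vn w * cn c * cn c) ler01 _ _.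
  rewrite toC0 toC1 !mul1r !mul0r sc0 sc1 addr0 !subr0 mulr1.
  rewrite [X in cn X <= _](_ : _ = f (P t + c *: w) - f (P t) - c * pd w f (P t)); last by ring.
  apply.
    move=> s' s01; have U' := He1 s' s01.
    have h1 : haspd f (P t + sc (s' * 1) (c *: w)) (c *: w) (c * pd w f (P t + sc (s' * 1) (c *: w))).
      by apply: cdir_haspd; apply: cdirZ; exact: (H _ U').2.
    have := iscdB (haspd_line_scale h1) (iscdM (iscd_id s') (iscd_cst (c * pd w f (P t)) s')).
    by move=> hh; apply: (iscd_eq hh); rewrite toC1 mulr1 mulr0 addr0 mul1r mulrBr.
  move=> s' s01; have [n1 n2] := near s' s01.
  apply: le_trans (cnM _ _) _; rewrite mulrC ler_wpM2r//.
  apply: le_trans (L2 _ _ Px n1) _; rewrite (addrC (P t)) addrK.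
  apply: le_trans (ler_wpM2l M20 n2) _.
  by rewrite le_eqVlt; apply/orP; left; apply/eqP; ring.
apply: le_trans b _; rewrite !subr0 mulr1.
rewrite -mulrA; have h2 : 2 * pi * r * (e * cn c) = 2 * pi * (r * e * cn c) by ring.
rewrite h2 (_ : _ * _ = 2 * pi * (8 * M2 * vn w * cn c * cn c)); last by ring.
rewrite ler_pM2l ?mulr_gt0 ?pi_gt0//.
rewrite ler_wpM2r// mulrC.
have rk : r * (cn c * K) <= r * e by rewrite ler_wpM2l// ltW.
apply: le_trans rk; rewrite /K mulrDr mulr1 mulrDr.
rewrite (_ : r * (cn c * (8 * M2 * vn w / r)) = cn c * (8 * M2 * vn w)); last by field; rewrite gt_eqF.
by rewrite lerDl mulr_ge0// ltW.
Qed.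

Theorem chol_sm U f : vopen U -> chol U f -> sm U f.
Proof.
move=> oU H n; elim: n f H => [|n IH] f H; first exact: chol_lb.
split; first exact: chol_lb.
move=> d; split; first by move=> v Uv; apply: cdir_haspd; exact: (H v Uv).2.
by apply: IH; exact: chol_pd.
Qed.

Lemma differentiable_sm U f : vopen U -> (forall v, U v -> differentiable f v) -> sm U f.
Proof. by move=> oU /diff_chol; exact: chol_sm. Qed.

Lemma differentiable_CR U f v d (c : C) : (forall v, U v -> differentiable f v) -> U v ->
  pd (c *: d) f v = c * pd d f v.
Proof. by move=> /diff_chol; exact: chol_pdZ. Qed.

End Holomorphic.

(** * Continuity along curves in a complex line *)

Section Curves2.

Variables (R : realType) (g : nat).
Local Notation C := (Cplx R).
Local Notation V := 'cV[C]_g.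

Lemma vcont_curve (f : V -> C) (q v : V) (c : R -> C) (t : R) :
  vcont f (v + c t *: q) -> ccont c t -> ccont (fun s => f (v + c s *: q)) t.
Proof.
move=> cf /ccontP cc; apply/ccontP => e /cf [d d0 H].
have v1 : 0 < vn q + 1 by have := vn_ge0 q; lra.
have [x x0 Hx] := cc (d / (vn q + 1)) (divr_gt0 d0 v1).
exists x => // s /Hx; rewrite ltr_pdivlMr// => h; apply: H.
rewrite opprD addrACA subrr add0r -scalerBl.
have := vn_scale (c s - c t) q; have := cn_ge0 (c s - c t); move: h; move: (cn _) (vn _) (vn _); clear; intros; lra.
Qed.

End Curves2.

(** Forms are functions rather than matrices, so that sign change, scaling and the rank-one
    modification of the local argument are immediate; [hfK] records continuity. Definiteness is not
    part of the structure, as the signs are what the index depends on. *)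
Record hermform (R : realType) (g : nat) := HermForm {
  hf :> 'cV[Cplx R]_g -> 'cV[Cplx R]_g -> Cplx R;
  hfD : forall u v w, hf (u + v) w = hf u w + hf v w;
  hfZ : forall (c : Cplx R) v w, hf (c *: v) w = c * hf v w;
  hfC : forall v w, hf w v = cconj (hf v w);
  hfK : exists K : R, 0 <= K /\ forall v w, cn (hf v w) <= K * vn v * vn w }.

(** * The unitary connection of a Hermitian form *)

Section Connection.

Variables (R : realType) (g : nat) (h : hermform R g).
Local Notation C := (Cplx R).
Local Notation V := 'cV[C]_g.
Implicit Types (f : V -> C) (U : set V) (v w d p q : V).

Lemma hfDr u v w : h w (u + v) = h w u + h w v.
Proof. by rewrite hfC hfD cconjD -!hfC. Qed.
Lemma hfZr (c : C) v w : h w (c *: v) = cconj c * h w v.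
Proof. by rewrite hfC hfZ cconjM -hfC. Qed.
Lemma hf0 w : h 0 w = 0. Proof. by rewrite -(scale0r w) hfZ mul0r. Qed.
Lemma hfN v w : h (- v) w = - h v w. Proof. by rewrite -scaleN1r hfZ mulN1r. Qed.
Lemma hf_im0 v : im (h v v) = 0.
Proof. by have := congr1 (@im R) (hfC h v v); rewrite im_conj; lra. Qed.

(** The connection form of a unitary connection with curvature 2 i Im h; [cexp (cA v l)] is at the
    same time the factor of automorphy. Being purely imaginary, it makes every gauge factor
    unimodular. *)
Definition cA v w : C := ci R * toC (im (h v w)).

Lemma cAD u v w : cA (u + v) w = cA u w + cA v w.
Proof. by rewrite /cA hfD imD toCD mulrDr. Qed.
Lemma cADr u v w : cA w (u + v) = cA w u + cA w v.
Proof. by rewrite /cA hfDr imD toCD mulrDr. Qed.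
Lemma cAN v w : cA (- v) w = - cA v w.
Proof. by rewrite /cA hfN imN toCN mulrN. Qed.
Lemma cAB u v w : cA (u - v) w = cA u w - cA v w. Proof. by rewrite cAD cAN. Qed.
Lemma cAsc x v w : cA (sc x v) w = toC x * cA v w.
Proof.
rewrite /cA hfZ mulrCA -toCM; congr (_ * toC _).
by rewrite !reimE; ring.
Qed.
Lemma cAC v w : cA w v = - cA v w.
Proof. by rewrite /cA hfC im_conj toCN mulrN. Qed.
Lemma cAscr x v w : cA w (sc x v) = toC x * cA w v.
Proof. by rewrite cAC cAsc cAC mulrN opprK. Qed.
Lemma cA0 w : cA 0 w = 0. Proof. by rewrite /cA hf0 im0 toC0 mulr0. Qed.
Lemma cA_same v : cA v v = 0. Proof. by rewrite /cA hf_im0 toC0 mulr0. Qed.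

Lemma rlin_cA d : rlin (fun v => cA v d).
Proof.
split; first by move=> v w; exact: cAD.
split; first by move=> x v; exact: cAsc.
have [K [K0 HK]] := hfK h; exists (K * vn d) => v.
rewrite cnMci cn_toC; apply: le_trans (im_le_cn _) _.
by apply: le_trans (HK _ _) _; rewrite mulrAC.
Qed.

Lemma cn_cexpA v w : cn (cexp (cA v w)) <= 2. Proof. exact: cn_cexpi. Qed.

Definition nabla d f v : C := pd d f v + cA v d * f v.
Definition dbar q f v : C := 2^-1 * (nabla q f v + ci R * nabla (ci R *: q) f v).

Lemma sm_nabla U f d : vopen U -> sm U f -> sm U (nabla d f).
Proof.
move=> oU sf; apply: smD => //; first exact: sm_pd.
by apply: smM => //; apply: sm_rlin => //; exact: rlin_cA.
Qed.

Lemma sm_dbar U f q : vopen U -> sm U f -> sm U (dbar q f).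
Proof.
move=> oU sf; apply: smZ => //; apply: smD => //; first exact: sm_nabla.
by apply: smZ => //; exact: sm_nabla.
Qed.

Lemma nabla_ext U f f' d v : vopen U -> U v -> (forall w, U w -> f w = f' w) ->
  nabla d f v = nabla d f' v.
Proof. by move=> oU Uv e; rewrite /nabla (pd_ext _ oU Uv e) e. Qed.

Lemma dbar_ext U f f' q v : vopen U -> U v -> (forall w, U w -> f w = f' w) ->
  dbar q f v = dbar q f' v.
Proof. by move=> oU Uv e; rewrite /dbar !(nabla_ext _ oU Uv e). Qed.

Lemma nablaD U f f' d v : sm U f -> sm U f' -> U v ->
  nabla d (fun w => f w + f' w) v = nabla d f v + nabla d f' v.
Proof.
move=> sf sf' Uv; rewrite /nabla (haspd_pd (haspdD (sm_has d sf Uv) (sm_has d sf' Uv))).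
ring.
Qed.

Lemma dbarD U f f' q v : sm U f -> sm U f' -> U v ->
  dbar q (fun w => f w + f' w) v = dbar q f v + dbar q f' v.
Proof.
move=> sf sf' Uv; rewrite /dbar !(nablaD _ sf sf' Uv).
generalize (nabla q f v) (nabla q f' v) (nabla (ci R *: q) f v) (nabla (ci R *: q) f' v) => *; ring.
Qed.

Lemma dbarM U f (p : V -> C) q v : sm U f -> sm U p -> U v ->
  dbar q (fun w => p w * f w) v =
  2^-1 * (pd q p v + ci R * pd (ci R *: q) p v) * f v + p v * dbar q f v.
Proof.
move=> sf sp Uv; rewrite /dbar /nabla !(haspd_pd (haspdM (sm_has _ sp Uv) (sm_has _ sf Uv))).
generalize (pd q p v) (pd q f v) (pd (ci R *: q) p v) (pd (ci R *: q) f v) => *; ring.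
Qed.

Lemma dbarZ U f q v (c : C) : sm U f -> U v ->
  dbar q (fun w => c * f w) v = c * dbar q f v.
Proof.
move=> sf Uv; rewrite /dbar /nabla !(haspd_pd (haspdZ c (sm_has _ sf Uv))).
generalize (pd q f v) (pd (ci R *: q) f v) => *; ring.
Qed.

(** As h is antilinear in its second argument, the connection terms along q and i q add up to the
    full value of h: [dbar q] is the usual Cauchy-Riemann operator plus h(v, q) / 2. *)
Lemma dbar_formula q f v :
  dbar q f v = 2^-1 * (pd q f v + ci R * pd (ci R *: q) f v) + 2^-1 * h v q * f v.
Proof.
rewrite /dbar /nabla /cA hfZr cconj_ci {3}(reimC (h v q)).
rewrite (_ : im (- ci R * _) = - re (h v q)); last by rewrite !reimE; ring.
rewrite toCN.
have := ci2 R; move: (ci R) (toC (re _)) (toC (im _)) (pd _ _ _) (pd _ _ _) (f v) => i x y a b c i2.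
have -> : b + i * y * c + i * (a + i * - x * c) = b + i * a + (i * y - i * i * x) * c by ring.
rewrite i2; ring.
Qed.

End Connection.

Ltac gen_pd := repeat match goal with
  | |- context [@nabla ?r ?n ?h ?d ?f ?v] => generalize (@nabla r n h d f v); intro
  | |- context [@pd ?r ?n ?d ?f ?v] => generalize (@pd r n d f v); intro
  end.

(** * The chain rule along complex lines *)

Section Chain.

Variables (R : realType) (g : nat).
Local Notation C := (Cplx R).
Local Notation V := 'cV[C]_g.
Implicit Types (f : V -> C) (U : set V) (v w d p q : V).

Lemma pd_cplx f U v q (c : C) : vopen U -> Cn 2 U f -> U v ->
  pd (c *: q) f v = toC (re c) * pd q f v + toC (im c) * pd (ci R *: q) f v.
Proof.
move=> oU fC Uv; rewrite {1}(reimC c) scalerDl [ci R * _]mulrC -scalerA.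
by rewrite (pdD _ _ oU fC Uv) !(pd_sc _ _ (CnW fC) Uv).
Qed.

Lemma scaleC_sc (c : C) q : c *: q = sc (re c) q + sc (im c) (ci R *: q).
Proof. by rewrite {1}(reimC c) scalerDl [ci R * _]mulrC -scalerA. Qed.

(** Passing from c(t) to c(t + h) moves two real coordinates, along q and along i q, so the
    two-direction Taylor estimate at v + c(t) q applies. *)
Lemma iscd_curve f U v q (c : R -> C) t c' : vopen U -> Cn 2 U f -> U (v + c t *: q) ->
  iscd c t c' -> iscd (fun s => f (v + c s *: q)) t (pd (c' *: q) f (v + c t *: q)).
Proof.
move=> oU fC Uv dc; set p := v + c t *: q.
have [e [M [e0 M0 H]]] := taylor2 q (ci R *: q) oU fC Uv.
set P := cn (pd q f p) + cn (pd (ci R *: q) f p).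
have P0 : 0 <= P by rewrite addr_ge0 ?cn_ge0.
set c1 := cn c' + 1; have c10 : 0 < c1 by rewrite /c1; have := cn_ge0 c'; lra.
apply/iscdP => x x0.
have x1 : 0 < Num.min 1 (x / (2 * (P + 1))).
  by rewrite lt_min ltr01 divr_gt0 // mulr_gt0 //; lra.
have [d d0 Hd] := (iscdP _ _ _).1 dc _ x1.
exists (Num.min d (Num.min (e / c1) (x / (2 * (M + 1) * c1 * c1)))).
  by rewrite !lt_min d0 !divr_gt0 //; rewrite !mulr_gt0 //; lra.
move=> h; rewrite !lt_min => /andP[/Hd hd /andP[he hx]].
set z := c (t + h) - c t in hd *.
have h0 := normr_ge0 h.
have zb : cn z <= c1 * `|h|.
  rewrite (_ : z = (z - toC h * c') + toC h * c'); last by rewrite subrK.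
  apply: le_trans (cnD _ _) _; rewrite cnMtoC.
  apply: le_trans (lerD hd (lexx _)) _.
  have : Num.min 1 (x / (2 * (P + 1))) <= 1 by rewrite ge_min lexx.
  rewrite /c1; move: (Num.min _ _) (cn _) h0 => a b h0 a1; nra.
have zE : v + c (t + h) *: q = p + sc (re z) q + sc (im z) (ci R *: q).
  by rewrite -addrA -scaleC_sc /p /z -addrA -scalerDl (addrC (c t)) subrK.
have cnz : cn z = `|re z| + `|im z| by [].
have := H (re z) (im z); rewrite -zE -cnz -/p => {}H.
have {}H := H (le_lt_trans zb _); rewrite mulrC -ltr_pdivlMr// in H; have {}H := H he.
rewrite (pd_cplx _ _ oU fC Uv) -/p.
set r := z - toC h * c' in hd.
rewrite (_ : _ - toC h * _ = (f (v + c (t + h) *: q) - f p - toC (re z) * pd q f p - toC (im z) * pd (ci R *: q) f p)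
   + (toC (re r) * pd q f p + toC (im r) * pd (ci R *: q) f p)); last first.
  rewrite /r [re (z - _)]reD [im (z - _)]imD reN imN !toCD !toCN !reM !imM !re_toC !im_toC !mul0r subr0 addr0 !toCM.
  generalize (toC (re z)) (toC (im z)) (toC (re c')) (toC (im c')) (toC h) (f p) (f (v + c (t + h) *: q)).
  by generalize (pd q f p) (pd (ci R *: q) f p) => *; ring.
apply: le_trans (cnD _ _) _; apply: le_trans (lerD H (cnD _ _)) _.
rewrite (cnMtoC _ (pd q f p)) (cnMtoC _ (pd (ci R *: q) f p)).
have rb : `|re r| * cn (pd q f p) + `|im r| * cn (pd (ci R *: q) f p) <= cn r * P.
  rewrite /P [cn r]/cn; have := cn_ge0 (pd q f p); have := cn_ge0 (pd (ci R *: q) f p).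
  have := normr_ge0 (re r); have := normr_ge0 (im r).
  move: (cn _) (cn _) (`|_|) (`|_|); clear; intros; nra.
apply: le_trans (lerD (lexx _) rb) _.
have k1 : cn r * P <= x / 2 * `|h|.
  apply: le_trans (ler_wpM2r P0 hd) _.
  have k : Num.min 1 (x / (2 * (P + 1))) * P <= x / 2.
    apply: (@le_trans _ _ (x / (2 * (P + 1)) * P)).
      by rewrite ler_wpM2r// ge_min lexx orbT.
    rewrite invfM mulrA -mulrA ler_piMr//; first by move: x0; qlra.
    by rewrite ler_pdivrMl; move: P0; qlra.
  by rewrite mulrAC ler_wpM2r.
have k2 : M * cn z * cn z <= x / 2 * `|h|.
  have a1 : cn z * cn z <= c1 * `|h| * (c1 * `|h|) by rewrite ler_pM ?cn_ge0.
  apply: (@le_trans _ _ ((M + 1) * (c1 * `|h| * (c1 * `|h|)))).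
    by rewrite -mulrA ler_pM ?mulr_ge0 ?cn_ge0//; move: M0; qlra.
  have M1 : 0 < 2 * (M + 1) * c1 * c1 by rewrite !mulr_gt0 //; move: M0; qlra.
  move: hx; rewrite ltr_pdivlMr// => hx.
  rewrite (_ : _ * _ = (`|h| * (2 * (M + 1) * c1 * c1)) / 2 * `|h|); last by field.
  by rewrite ler_wpM2r// ler_wpM2r ?invr_ge0 // ltW.
have := lerD k2 k1; move: (M * _ * _) (cn r * P) => A B; qlra.
Qed.

End Chain.

(** * Functions with bounded covariant derivatives *)

Section Bounded.

Variables (R : realType) (g : nat) (h : hermform R g).
Local Notation C := (Cplx R).
Local Notation V := 'cV[C]_g.
Local Notation cA := (cA h).
Local Notation nabla := (nabla h).
Local Notation dbar := (dbar h).
Implicit Types (f : V -> C) (U : set V) (v w d p q : V).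

Definition bdd U f := exists2 M : R, 0 <= M & forall v, U v -> cn (f v) <= M.

(** Boundedness is asked of covariant derivatives because the coefficient [cA v d] grows with v: for
    a quasi-periodic f it is [nabla d f], and not [pd d f], that is again quasi-periodic and hence
    bounded on C^g. *)
Fixpoint BC n U f : Prop :=
  bdd U f /\ match n with
  | 0 => True
  | n'.+1 => forall d, (forall v, U v -> haspd f v d (pd d f v)) /\ BC n' U (nabla d f)
  end.

Lemma BC_bdd n U f : BC n U f -> bdd U f. Proof. by case: n => [|n] []. Qed.
Lemma BC_nabla n U f d : BC n.+1 U f -> BC n U (nabla d f).
Proof. by case=> _ /(_ d) []. Qed.
Lemma BC_has n U f d v : BC n.+1 U f -> U v -> haspd f v d (pd d f v).
Proof. by case=> _ /(_ d) [+ _] => /[apply]. Qed.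
Lemma BCW n U f : BC n.+1 U f -> BC n U f.
Proof.
elim: n f => [|n IH] f [b H]; first by split; [exact: b|exact: I].
split; [exact: b|move=> d; have [h1 h2] := H d; split; [exact: h1|exact: IH]].
Qed.
Lemma BC_le m n U f : (m <= n)%N -> BC n U f -> BC m U f.
Proof.
move=> mn; rewrite -(subnK mn); elim: (n - m)%N => [|k IH]; first by rewrite add0n.
by rewrite addSn => /BCW; exact: IH.
Qed.

Lemma bdd_lb U f : bdd U f -> lb U f.
Proof. by move=> [M M0 H] v Uv; exists 1, M; split=> // w Uw _; exact: H. Qed.

Lemma BC_Cn n U f : vopen U -> BC n U f -> Cn n U f.
Proof.
move=> oU; elim: n f => [|n IH] f H; first exact: bdd_lb (BC_bdd H).
split; first exact: bdd_lb (BC_bdd H).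
move=> d; split; first by move=> v; exact: BC_has H.
apply: (@Cn_ext _ _ n U (fun v => nabla d f v + (- cA v d) * f v)) => //.
  by move=> w _; rewrite /nabla mulNr addrK.
apply: CnD => //; first exact/IH/BC_nabla.
apply: CnM => //; last exact/IH/BCW.
have : sm U (fun v => - cA v d) by apply: smN => //; exact: sm_rlin (rlin_cA h d).
by apply.
Qed.

Lemma bddD U f f' : bdd U f -> bdd U f' -> bdd U (fun v => f v + f' v).
Proof.
move=> [M M0 H] [M' M0' H']; exists (M + M'); first by rewrite addr_ge0.
by move=> v Uv; apply: le_trans (cnD _ _) (lerD (H _ Uv) (H' _ Uv)).
Qed.
Lemma bddM U f f' : bdd U f -> bdd U f' -> bdd U (fun v => f v * f' v).
Proof.
move=> [M M0 H] [M' M0' H']; exists (M * M'); first by rewrite mulr_ge0.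
by move=> v Uv; apply: le_trans (cnM _ _) _; apply: ler_pM; rewrite ?cn_ge0 ?H ?H'.
Qed.
Lemma bdd_cst U c : bdd U (fun=> c).
Proof. by exists (cn c); rewrite ?cn_ge0. Qed.
Lemma bdd_ext U f f' : (forall w, U w -> f w = f' w) -> bdd U f -> bdd U f'.
Proof. by move=> e [M M0 H]; exists M => // v Uv; rewrite -e// H. Qed.

Lemma BC_ext n U f f' : vopen U -> (forall w, U w -> f w = f' w) -> BC n U f -> BC n U f'.
Proof.
move=> oU; elim: n f f' => [|n IH] f f' e [b H].
  by split; [exact: bdd_ext b|exact: I].
split; [exact: bdd_ext b|move=> d]; have [h1 h2] := H d; split.
  by move=> v Uv; rewrite -(pd_ext _ oU Uv e); apply: (haspd_ext oU Uv e); exact: h1.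
by apply: (IH _ _ _ h2) => w Uw; exact: nabla_ext e.
Qed.

Lemma BCD n U f f' : vopen U -> BC n U f -> BC n U f' -> BC n U (fun v => f v + f' v).
Proof.
move=> oU; elim: n f f' => [|n IH] f f' Hf Hf'; (split; first exact: (bddD (BC_bdd Hf) (BC_bdd Hf'))).
  exact: I.
move=> d; have k v (Uv : U v) := haspdD (BC_has d Hf Uv) (BC_has d Hf' Uv).
split; first by move=> v Uv; exact: haspd_ok (k v Uv).
apply: (BC_ext oU _ (IH _ _ (BC_nabla d Hf) (BC_nabla d Hf'))) => w Uw.
rewrite /nabla (haspd_pd (k w Uw)); ring.
Qed.

Lemma BCZ n U f c : vopen U -> BC n U f -> BC n U (fun v => c * f v).
Proof.
move=> oU; elim: n f => [|n IH] f Hf; (split; first exact: (bddM (bdd_cst U c) (BC_bdd Hf))).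
  exact: I.
move=> d; have k v (Uv : U v) := haspdZ c (BC_has d Hf Uv).
split; first by move=> v Uv; exact: haspd_ok (k v Uv).
apply: (BC_ext oU _ (IH _ (BC_nabla d Hf))) => w Uw.
rewrite /nabla (haspd_pd (k w Uw)); ring.
Qed.

Lemma BC_dbar n U f q : vopen U -> BC n.+1 U f -> BC n U (dbar q f).
Proof.
move=> oU Hf; apply: BCZ => //; apply: BCD => //; first exact: BC_nabla.
by apply: BCZ => //; exact: BC_nabla.
Qed.

Definition SB U f := forall n, BC n U f.
Lemma SB_sm U f : vopen U -> SB U f -> sm U f.
Proof. by move=> oU H n; apply: BC_Cn. Qed.
Lemma SB_dbar U f q : vopen U -> SB U f -> SB U (dbar q f).
Proof. by move=> oU H n; apply: BC_dbar. Qed.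
Lemma SB_ext U f f' : vopen U -> (forall w, U w -> f w = f' w) -> SB U f -> SB U f'.
Proof. by move=> oU e H n; apply: BC_ext e (H n). Qed.
Lemma SB_nabla U f d : SB U f -> SB U (nabla d f).
Proof. by move=> H n; apply: BC_nabla. Qed.
Lemma SBD U f f' : vopen U -> SB U f -> SB U f' -> SB U (fun v => f v + f' v).
Proof. by move=> oU H H' n; apply: BCD. Qed.
Lemma SBZ U f c : vopen U -> SB U f -> SB U (fun v => c * f v).
Proof. by move=> oU H n; apply: BCZ. Qed.
End Bounded.

(** * Twisted convolution in polar coordinates *)

Section Operator.

Variables (R : realType) (g : nat) (h : hermform R g) (q : 'cV[Cplx R]_g).
Local Notation C := (Cplx R).
Local Notation V := 'cV[C]_g.
Local Notation cA := (cA h).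
Local Notation nabla := (nabla h).
Local Notation dbar := (dbar h).
Implicit Types (f : V -> C) (U : set V) (v w d p : V) (z : C) (s t : R).

(* [rad] compactifies the radius: s in [0, 1) stands for rad s in [0, oo). *)
Definition rad s : R := s / (1 - s).
Definition zt s t : C := toC (rad s) * cis t.
Definition Ek z v : C := cexp (cA (z *: q) v).
(** Translation by z q combined with a phase, as in the action of a Heisenberg group. The phase is
    what preserves the factors of automorphy; a plain translation would change them. *)
Definition Gk f v z : C := f (v - z *: q) * Ek z v.

Record nk (k : R -> R -> C) : Prop := {
  nk_t : forall s t, ccont (k s) t;
  nk_s : forall s t, s < 1 -> ccont (k^~ t) s;
  nk1 : forall s t, 1 <= s -> k s t = 0;
  nkb : forall n, exists2 M : R, 0 <= M &
    forall s t, -1 < s < 1 -> cn (k s t) <= M * (1 - s) ^+ n }.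

Definition inn k f v s : C := cI 0 (2 * pi) (fun t => Gk f v (zt s t) * k s t).
Definition Jk k f v : C := cI 0 1 (inn k f v).

Lemma ccont_rlin (l : V -> C) (c : R -> C) t : rlin l -> ccont c t -> ccont (fun x => l (c x *: q)) t.
Proof.
move=> [lD [lS _]] cc.
apply: (@ccont_ext _ (fun x => toC (re (c x)) * l q + toC (im (c x)) * l (ci R *: q))).
  by move=> x; rewrite (scaleC_sc (c x)) lD !lS.
by apply: ccontD; apply: ccontM; try exact: ccont_cst; apply: ccont_toC; case: cc.
Qed.

Lemma ccont_cexp (c : R -> C) t : ccont c t -> ccont (fun x => cexp (c x)) t.
Proof. by move=> cc; apply: cdv_ccont (cdv_cexp _) cc. Qed.

Lemma ccont_Gk U f v (c : R -> C) t : vopen U -> Cn 1 U f -> U (v - c t *: q) -> ccont c t ->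
  ccont (fun x => Gk f v (c x)) t.
Proof.
move=> oU fC Uv cc; apply: ccontM; last first.
  by apply: ccont_cexp; apply: (ccont_rlin (rlin_cA h v) cc).
apply: (@ccont_ext _ (fun x => f (v + (- c x) *: q))); first by move=> x; rewrite scaleNr.
apply: vcont_curve; last exact: ccontN.
by rewrite scaleNr; apply: Cn_vcont oU fC Uv.
Qed.

Lemma ccont_zt_t s t : ccont (zt s) t.
Proof. by apply: ccontM; [exact: ccont_cst|exact: ccont_cis]. Qed.

Lemma is_derive_rho s : s < 1 -> is_derive s (1:R) rad ((1 - s) ^- 2).
Proof.
move=> s1; have n0 : 1 - s != 0 by rewrite subr_eq0 gt_eqF.
have dB : is_derive s (1:R) (fun x : R => 1 - x) (-1).
  have -> : (fun x : R => 1 - x) = (cst 1 - id) by [].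
  by apply: is_derive_eq; rewrite sub0r.
have dV : is_derive s (1:R) (fun x : R => (1 - x)^-1) ((1 - s) ^- 2).
  have hV := is_deriveV (f := fun x : R => 1 - x) n0 dB.
  by apply: (is_derive_eq hV); rewrite /GRing.scale /= mulrN1 opprK.
have hM := is_deriveM (is_derive_id s (1:R)) dV.
by apply: (is_derive_eq hM); rewrite /GRing.scale /=; field.
Qed.

Lemma iscd_rho s : s < 1 -> iscd (fun x => toC (rad x)) s (toC ((1 - s) ^- 2)).
Proof. by move=> s1; apply: iscd_toC; exact: is_derive_rho. Qed.

Lemma iscd_zt_s s t : s < 1 -> iscd (fun x => zt x t) s (toC ((1 - s) ^- 2) * cis t).
Proof.
move=> s1; apply: iscd_eq (iscdM (iscd_rho s1) (iscd_cst (cis t) s)) _.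
by rewrite mulr0 addr0.
Qed.

Lemma ccont_zt_s s t : s < 1 -> ccont (zt^~ t) s.
Proof. by move=> /iscd_zt_s => H; exact: iscd_cont (H t). Qed.

Lemma cn_zt s t : -1 < s < 1 -> cn (zt s t) <= 2 * (1 - s)^-1.
Proof.
move=> /andP[s0 s1]; have p : 0 < 1 - s by rewrite subr_gt0.
rewrite /zt cnMtoC /rad normrM (gtr0_norm (_ : 0 < (1 - s)^-1)) ?invr_gt0//.
have i0 : 0 <= (1 - s)^-1 by rewrite invr_ge0 ltW.
apply: (@le_trans _ _ (`|s| / (1 - s) * 2)).
  by apply: ler_wpM2l (cn_cis t); rewrite mulr_ge0.
rewrite mulrC ler_wpM2l// ler_piMl// ler_norml; lra.
Qed.

Lemma nk_bd k : nk k -> exists2 M : R, 0 <= M & forall s t, 0 <= s <= 1 -> cn (k s t) <= M.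
Proof.
move=> kn; have [M M0 H] := nkb kn 0; exists M => // s t /andP[s0].
rewrite le_eqVlt => /orP[/eqP ->|s1]; first by rewrite (nk1 kn)// cn0.
by have := H s t; rewrite expr0 mulr1; apply; lra.
Qed.

(** The factor l(z q) grows like 1 / (1 - s); the bound of order n for the product uses the one of
    order n + 1 for k. *)
Lemma nk_rlin l k : rlin l -> nk k -> nk (fun s t => l (zt s t *: q) * k s t).
Proof.
move=> rl kn; split.
- move=> s t; apply: ccontM; last exact: (nk_t kn).
  by apply: ccont_rlin rl _; exact: ccont_zt_t.
- move=> s t s1; apply: ccontM; last exact: (nk_s kn).
  by apply: (@ccont_rlin l (zt^~ t)) rl _; exact: ccont_zt_s.
- by move=> s t s1; rewrite (nk1 kn)// mulr0.
move=> n; have [_ [_ [K HK]]] := rl; have [M M0 H] := nkb kn n.+1.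
exists (`|K| * 2 * vn q * M); first by rewrite !mulr_ge0 ?vn_ge0.
move=> s t si; apply: le_trans (cnM _ _) _.
have p : 0 < 1 - s by move/andP: si; lra.
have l1 : cn (l (zt s t *: q)) <= `|K| * 2 * vn q * (1 - s)^-1.
  apply: le_trans (HK _) _; apply: le_trans (ler_wpM2r (vn_ge0 _) (ler_norm K)) _.
  rewrite (_ : _ / _ = `|K| * (2 * (1 - s)^-1 * vn q)); last by ring.
  apply: ler_wpM2l => //; apply: le_trans (vn_scale _ _) _.
  by apply: ler_wpM2r; [exact: vn_ge0|exact: cn_zt].
apply: le_trans (ler_pM (cn_ge0 _) (cn_ge0 _) l1 (H s t si)) _.
rewrite exprS le_eqVlt; apply/orP; left; apply/eqP; field; lra.
Qed.

Lemma nkD k k' : nk k -> nk k' -> nk (fun s t => k s t + k' s t).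
Proof.
move=> kn kn'; split.
- by move=> s t; apply: ccontD; [exact: (nk_t kn)|exact: (nk_t kn')].
- by move=> s t s1; apply: ccontD; [exact: (nk_s kn)|exact: (nk_s kn')].
- by move=> s t s1; rewrite (nk1 kn)// (nk1 kn')// addr0.
move=> n; have [M M0 H] := nkb kn n; have [M' M0' H'] := nkb kn' n.
exists (M + M'); first by rewrite addr_ge0.
by move=> s t si; apply: le_trans (cnD _ _) _; rewrite mulrDl lerD ?H ?H'.
Qed.

Lemma nkZ k c : nk k -> nk (fun s t => c * k s t).
Proof.
move=> kn; split.
- by move=> s t; apply: ccontM; [exact: ccont_cst|exact: (nk_t kn)].
- by move=> s t s1; apply: ccontM; [exact: ccont_cst|exact: (nk_s kn)].
- by move=> s t s1; rewrite (nk1 kn)// mulr0.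
move=> n; have [M M0 H] := nkb kn n; exists (cn c * M); first by rewrite mulr_ge0 ?cn_ge0.
by move=> s t si; apply: le_trans (cnM _ _) _; rewrite -mulrA ler_wpM2l ?cn_ge0 ?H.
Qed.

(** The convolution at v integrates over the whole line v + C q, so it is defined on unions of such
    lines. *)
Definition cyl U := forall v z, U v -> U (v - z *: q).

Section Cyl.

Variables (U : set V).
Hypotheses (oU : vopen U) (cU : cyl U).

Lemma ccont_inn_t k f v s t : nk k -> Cn 1 U f -> U v -> ccont (fun t => Gk f v (zt s t) * k s t) t.
Proof.
move=> kn fC Uv; apply: ccontM; last exact: (nk_t kn).
by apply: ccont_Gk oU fC (cU _ Uv) _; exact: ccont_zt_t.
Qed.

Lemma cn_Gk f v z M : (forall w, U w -> cn (f w) <= M) -> U v -> cn (Gk f v z) <= M * 2.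
Proof.
move=> H Uv; apply: le_trans (cnM _ _) _.
by apply: ler_pM; rewrite ?cn_ge0 ?cn_cexpA// H//; exact: cU.
Qed.

Let pi0 : 0 <= 2 * pi :> R. Proof. by rewrite mulr_ge0 ?pi_ge0. Qed.

(** For s tending to 1 the point [zt s t] escapes to infinity, and continuity there comes from the
    decay of the kernel alone; elsewhere it is dominated convergence. *)
Lemma ccont_inn k f v s : nk k -> BC h 1 U f -> U v -> 0 <= s <= 1 -> ccont (inn k f v) s.
Proof.
move=> kn fB Uv /andP[s0]; have [B B0 HB] := BC_bdd fB; have fC := BC_Cn oU fB.
have gb z := cn_Gk z HB Uv.
rewrite le_eqVlt => /orP[/eqP ->|s1].
  have [M M0 H] := nkb kn 1.
  have N0 : 0 <= 2 * (B * 2 * M) * (2 * pi) by rewrite !mulr_ge0 ?pi_ge0.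
  apply/ccontP => e e0; exists (Num.min 1 (e / (2 * (B * 2 * M) * (2 * pi) + 1))).
    by rewrite lt_min ltr01 divr_gt0 //; lra.
  move=> x; rewrite lt_min => /andP[x1]; rewrite ltr_pdivlMr; last by lra.
  move=> x2; rewrite {2}/inn (_ : cI _ _ _ = 0); last first.
    rewrite (@cI_ext _ _ _ _ (fun=> 0)) ?cI_cst ?mulr0// => t _.
    by rewrite (nk1 kn)// mulr0.
  rewrite subr0; case: (leP 1 x) => [x3|x3].
    rewrite /inn (@cI_ext _ _ _ _ (fun=> 0)) ?cI_cst ?mulr0 ?cn0// => t _.
    by rewrite (nk1 kn)// mulr0.
  have xi : -1 < x < 1 by move: x1; rewrite ltr_norml; lra.
  have := @cI_norm _ 0 (2 * pi) (fun t => Gk f v (zt x t) * k x t) (B * 2 * (M * `|x - 1|)) pi0.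
  rewrite subr0 => /(_ _ _)/le_lt_trans; apply.
  - by move=> t _; exact: ccont_inn_t.
  - move=> t _; apply: le_trans (cnM _ _) _; apply: ler_pM; rewrite ?cn_ge0 ?gb//.
    have -> : `|x - 1| = (1 - x) ^+ 1 by rewrite expr1 distrC gtr0_norm// subr_gt0.
    exact: H.
  by move: N0 x2 (normr_ge0 (x - 1)); move: (`|x - 1|) (2 * pi) => y p; clear => *; nra.
have [M M0 H] := nkb kn 0.
apply: (@cI_cont _ 0 (2 * pi) s (1 - s) (B * 2 * M)); first by rewrite subr_gt0.
- by move=> x _ t _; exact: ccont_inn_t.
- move=> x t; rewrite ltr_norml => xs _; have x1 : x < 1 by lra.
  by apply: ccontM; [apply: ccont_Gk oU fC (cU _ Uv) _; exact: ccont_zt_s|exact: (nk_s kn)].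
move=> x t; rewrite ltr_norml => xs _; apply: le_trans (cnM _ _) _.
apply: ler_pM; rewrite ?cn_ge0 ?gb//; have := H x t; rewrite expr0 mulr1; apply; lra.
Qed.

Lemma ccOn_inn k f v : nk k -> BC h 1 U f -> U v -> ccOn 0 1 (inn k f v).
Proof. by move=> kn fB Uv t; exact: ccont_inn. Qed.

Lemma ccOn_inn_t k f v s : nk k -> BC h 1 U f -> U v ->
  ccOn 0 (2 * pi) (fun t => Gk f v (zt s t) * k s t).
Proof. by move=> kn fB Uv t _; apply: ccont_inn_t kn (BC_Cn oU fB) Uv. Qed.

Lemma cn_inn k f v s (B M : R) : nk k -> BC h 1 U f -> U v -> (forall w, U w -> cn (f w) <= B) ->
  (forall t, cn (k s t) <= M) -> cn (inn k f v s) <= 2 * (B * 2 * M) * (2 * pi).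
Proof.
move=> kn fB Uv HB HM.
have := @cI_norm _ 0 (2 * pi) (fun t => Gk f v (zt s t) * k s t) (B * 2 * M) pi0.
rewrite subr0; apply; first exact: ccOn_inn_t.
move=> t _; apply: le_trans (cnM _ _) _; apply: ler_pM; rewrite ?cn_ge0 ?HM//; exact: cn_Gk.
Qed.

Lemma Jk_bound k : nk k -> exists2 K : R, 0 <= K & forall f B v, BC h 1 U f ->
  (forall w, U w -> cn (f w) <= B) -> U v -> cn (Jk k f v) <= K * B.
Proof.
move=> kn; have [M M0 H] := nk_bd kn; exists (16 * pi * M); first by rewrite !mulr_ge0 ?pi_ge0.
move=> f B v fB HB Uv.
have := @cI_norm _ 0 1 (inn k f v) (2 * (B * 2 * M) * (2 * pi)) ler01 (ccOn_inn kn fB Uv).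
move=> /(_ _)/le_trans; apply; last by rewrite le_eqVlt; apply/orP; left; apply/eqP; ring.
by move=> t t01; apply: cn_inn => // x; exact: H.
Qed.

Lemma Jk_bdd k f : nk k -> BC h 1 U f -> bdd U (Jk k f).
Proof.
move=> kn fB; have [K K0 H] := Jk_bound kn; have [B B0 HB] := BC_bdd fB.
by exists (K * B); rewrite ?mulr_ge0// => v Uv; exact: H.
Qed.

Lemma Jk_ext k f f' v : (forall w, U w -> f w = f' w) -> U v -> Jk k f v = Jk k f' v.
Proof.
move=> e Uv; apply: cI_ext => s _; apply: cI_ext => t _.
by rewrite /Gk e//; exact: cU.
Qed.

Lemma Jk_extk k k' f v : (forall s t, k s t = k' s t) -> Jk k f v = Jk k' f v.
Proof. by move=> e; apply: cI_ext => s _; apply: cI_ext => t _; rewrite e. Qed.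

Lemma JkD k f f' v : nk k -> BC h 1 U f -> BC h 1 U f' -> U v ->
  Jk k (fun w => f w + f' w) v = Jk k f v + Jk k f' v.
Proof.
move=> kn fB fB' Uv; rewrite /Jk -cID; try exact: ccOn_inn.
apply: cI_ext => s _; rewrite /inn -cID; try exact: ccOn_inn_t.
by apply: cI_ext => t _; rewrite /Gk !mulrDl.
Qed.

Lemma JkZ k f c v : nk k -> BC h 1 U f -> U v -> Jk k (fun w => c * f w) v = c * Jk k f v.
Proof.
move=> kn fB Uv; rewrite /Jk -cIZ; try exact: ccOn_inn.
apply: cI_ext => s _; rewrite /inn -cIZ; try exact: ccOn_inn_t.
by apply: cI_ext => t _; rewrite /Gk !mulrA.
Qed.

Lemma JkDk k k' f v : nk k -> nk k' -> BC h 1 U f -> U v ->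
  Jk (fun s t => k s t + k' s t) f v = Jk k f v + Jk k' f v.
Proof.
move=> kn kn' fB Uv; rewrite /Jk -cID; try exact: ccOn_inn.
apply: cI_ext => s _; rewrite /inn -cID; try exact: ccOn_inn_t.
by apply: cI_ext => t _; rewrite mulrDr.
Qed.

Lemma JkZk k f c v : nk k -> BC h 1 U f -> U v ->
  Jk (fun s t => c * k s t) f v = c * Jk k f v.
Proof.
move=> kn fB Uv; rewrite /Jk -cIZ; try exact: ccOn_inn.
apply: cI_ext => s _; rewrite /inn -cIZ; try exact: ccOn_inn_t.
by apply: cI_ext => t _; rewrite mulrCA.
Qed.

End Cyl.

End Operator.

(** * Covariant derivatives of convolutions *)

Section OperatorDerivatives.

Variables (R : realType) (g : nat) (h : hermform R g) (q : 'cV[Cplx R]_g).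
Local Notation C := (Cplx R).
Local Notation V := 'cV[C]_g.
Local Notation cA := (cA h).
Local Notation nabla := (nabla h).
Local Notation dbar := (dbar h).
Local Notation nk := (@nk R).
Local Notation Gk := (Gk h q).
Local Notation inn := (inn h q).
Local Notation Jk := (Jk h q).
Local Notation zt := (@zt R).
Variables (U : set V) (oU : vopen U) (cU : cyl q U).
Implicit Types (f : V -> C) (v w d p : V) (z : C) (s t : R) (k : R -> R -> C).

Lemma rlin_cAr w : rlin (fun v => cA w v).
Proof.
split; first by move=> u v; exact: cADr.
split; first by move=> x v; exact: cAscr.
have [_ [_ [K HK]]] := rlin_cA h w; exists K => v.
by rewrite cAC cnN.
Qed.

(** The kernel that curvature produces when a covariant derivative passes the twisted
    translation. *)
Definition ell d k s t : C := 2 * cA (zt s t *: q) d * k s t.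

Lemma nk_ell d k : nk k -> nk (ell d k).
Proof.
move=> kn; apply: (@nk_rlin _ _ q (fun v => 2 * cA v d)) => //.
have [lD [lS [K HK]]] := rlin_cA h d.
split; first by move=> u v; rewrite lD mulrDr.
split; first by move=> x v; rewrite lS mulrCA.
exists (2 * K) => v; apply: le_trans (cnM _ _) _.
rewrite -toC_nat cn_toC ger0_norm// -mulrA ler_wpM2l//.
Qed.

Lemma nk_zt k : nk k -> nk (fun s t => zt s t * k s t).
Proof.
move=> kn; split.
- by move=> s t; apply: ccontM; [exact: ccont_zt_t|exact: (nk_t kn)].
- by move=> s t s1; apply: ccontM; [exact: ccont_zt_s|exact: (nk_s kn)].
- by move=> s t s1; rewrite (nk1 kn)// mulr0.
move=> n; have [M M0 H] := nkb kn n.+1; exists (2 * M); first by rewrite mulr_ge0.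
move=> s t si; apply: le_trans (cnM _ _) _.
have p : 0 < 1 - s by move/andP: si; lra.
apply: le_trans (ler_pM (cn_ge0 _) (cn_ge0 _) (cn_zt t si) (H s t si)) _.
rewrite exprS le_eqVlt; apply/orP; left; apply/eqP; field; lra.
Qed.

(** The factor 2 has two equal sources: the derivative of the phase, and the difference of the
    connection forms at v and at v - z q. *)
Lemma haspd_Gk f v d z : BC h 1 U f -> U v ->
  haspd (fun v => Gk f v z) v d
   (Gk (nabla d f) v z + 2 * cA (z *: q) d * Gk f v z - cA v d * Gk f v z).
Proof.
move=> fB Uv.
have h1 : haspd (fun w => f (w - z *: q)) v d (pd d f (v - z *: q)).
  by apply: haspd_shift; apply: BC_has fB _; exact: cU.
have h2 := haspd_cexp (haspd_rlin v d (rlin_cAr (z *: q))).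
apply: (iscd_eq (haspdM h1 h2)); rewrite /Gk /nabla /Ek cAB; ring.
Qed.

(** Leibniz's rule under both integrals. The parameter is kept in |x| < [dl] <= 1 so that v + x d
    stays in U and [cA], the only unbounded coefficient, stays bounded. *)
Lemma Jk_nabla_has k f v d : nk k -> BC h 2 U f -> U v ->
  haspd (Jk k f) v d (Jk k (nabla d f) v + Jk (ell d k) f v - cA v d * Jk k f v).
Proof.
move=> kn fB Uv; have fB1 := BCW fB; have nB := BC_nabla d fB.
have kn' := nk_ell d kn.
have [B0 B00 HB0] := BC_bdd fB; have [B1 B10 HB1] := BC_bdd nB.
have [M0 M00 HM0] := nk_bd kn; have [M1 M10 HM1] := nk_bd kn'.
have [_ [_ [K HK]]] := rlin_cA h d.
have [e e0 He] := oU Uv.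
have vd1 : 0 < vn d + 1 by have := vn_ge0 d; lra.
set dl := Num.min 1 (e / (vn d + 1)).
have dl0 : 0 < dl by rewrite lt_min ltr01 divr_gt0.
have Ux x : `|x - 0| < dl -> U (v + sc x d).
  rewrite subr0 lt_min ltr_pdivlMr// => /andP[_ xe]; apply: He.
  rewrite addrAC subrr add0r vn_sc; apply: le_lt_trans xe.
  by rewrite ler_wpM2l// lerDl.
have cAx x : `|x - 0| < dl -> cn (cA (v + sc x d) d) <= `|K| * (vn v + vn d).
  rewrite subr0 lt_min => /andP[x1 _].
  apply: le_trans (HK _) _; apply: le_trans (ler_wpM2r (vn_ge0 _) (ler_norm K)) _.
  apply: ler_wpM2l => //; apply: le_trans (vnD _ _) _; rewrite vn_sc lerD2l.
  by rewrite ler_piMl ?vn_ge0// ltW.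
have rn : 0 <= `|K| * (vn v + vn d) by rewrite mulr_ge0 ?addr_ge0 ?vn_ge0.
pose D x s t := Gk (nabla d f) (v + sc x d) (zt s t) * k s t
  + Gk f (v + sc x d) (zt s t) * ell d k s t
  - cA (v + sc x d) d * (Gk f (v + sc x d) (zt s t) * k s t).
pose B := B1 * 2 * M0 + B0 * 2 * M1 + `|K| * (vn v + vn d) * (B0 * 2 * M0).
have Dc x s : `|x - 0| < dl -> ccOn 0 (2 * pi) (D x s).
  move=> /Ux Uw; apply: ccOnD; first apply: ccOnD.
  - exact: (ccOn_inn_t oU cU s kn nB Uw).
  - exact: (ccOn_inn_t oU cU s kn' fB1 Uw).
  by apply: ccOnN; apply: ccOnM; [exact: ccOn_cst|exact: (ccOn_inn_t oU cU s kn fB1 Uw)].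
have Db x s t : `|x - 0| < dl -> 0 <= s <= 1 -> cn (D x s t) <= B.
  move=> xd s01; have Uw := Ux x xd.
  have g0 := cn_Gk h cU (zt s t) HB0 Uw; have g1 := cn_Gk h cU (zt s t) HB1 Uw.
  apply: le_trans (cnB _ _) _; apply: lerD; first apply: le_trans (cnD _ _) _; first apply: lerD.
  - by apply: le_trans (cnM _ _) _; apply: ler_pM; rewrite ?cn_ge0 ?HM0.
  - by apply: le_trans (cnM _ _) _; apply: ler_pM; rewrite ?cn_ge0 ?HM1.
  apply: le_trans (cnM _ _) _; apply: ler_pM; rewrite ?cn_ge0 ?cAx//.
  by apply: le_trans (cnM _ _) _; apply: ler_pM; rewrite ?cn_ge0 ?HM0.
have pi0 : 0 <= 2 * pi :> R by rewrite mulr_ge0 ?pi_ge0.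
have idif s x : 0 <= s <= 1 -> `|x - 0| < dl ->
    iscd (fun y => inn k f (v + sc y d) s) x (cI 0 (2 * pi) (D x s)).
  move=> s01 xd.
  apply: (@cI_diff _ _ _ x (dl - `|x - 0|) B (fun y t => Gk f (v + sc y d) (zt s t) * k s t) (fun y => D y s)).
  - by rewrite subr_gt0.
  - move=> y yx; apply: (ccOn_inn_t oU cU s kn fB1); apply: Ux.
    by have := ler_normD (y - x) (x - 0); rewrite addrA subrK; move: yx; clear; lra.
  - move=> y t yx _; have yd : `|y - 0| < dl.
      by have := ler_normD (y - x) (x - 0); rewrite addrA subrK; move: yx; clear; lra.
    have hh := haspd_line (haspd_Gk d (zt s t) fB1 (Ux y yd)).
    apply: (iscd_eq (iscdM hh (iscd_cst (k s t) y))); rewrite /D /ell; ring.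
  - move=> y t yx _; apply: Db => //.
    by have := ler_normD (y - x) (x - 0); rewrite addrA subrK; move: yx; clear; lra.
have odif : iscd (fun y => Jk k f (v + sc y d)) 0 (cI 0 1 (fun s => cI 0 (2 * pi) (D 0 s))).
  apply: (@cI_diff _ _ _ 0 dl (2 * B * (2 * pi)) (fun y => inn k f (v + sc y d)) (fun y s => cI 0 (2 * pi) (D y s)) dl0).
  - by move=> y yd; exact: (ccOn_inn oU cU kn fB1 (Ux y yd)).
  - by move=> y s yd s01; exact: (idif s y s01 yd).
  - move=> y s yd s01; have := @cI_norm _ 0 (2 * pi) (D y s) B pi0 (Dc y s yd).
    by rewrite subr0; apply=> t _; exact: Db.
apply: (iscd_eq odif).
have o1 := ccOn_inn oU cU kn nB Uv; have o2 := ccOn_inn oU cU kn' fB1 Uv.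
have o3 := ccOn_inn oU cU kn fB1 Uv.
have o4 : ccOn 0 1 (fun s => cA v d * inn k f v s).
  by apply: ccOnM; [exact: ccOn_cst|exact: o3].
have i1 s := ccOn_inn_t oU cU s kn nB Uv; have i2 s := ccOn_inn_t oU cU s kn' fB1 Uv.
have i3 s := ccOn_inn_t oU cU s kn fB1 Uv.
have i4 s : ccOn 0 (2 * pi) (fun t => cA v d * (Gk f v (zt s t) * k s t)).
  by apply: ccOnM; [exact: ccOn_cst|exact: i3].
rewrite /Jk -(cID o1 o2) -(cIZ _ o3) -(cIB (ccOnD o1 o2) o4).
apply: cI_ext => s _; rewrite /inn /D sc0 addr0.
by rewrite -(cID (i1 s) (i2 s)) -(cIZ _ (i3 s)) -(cIB (ccOnD (i1 s) (i2 s)) (i4 s)).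
Qed.

Lemma nabla_Jk k f v d : nk k -> BC h 2 U f -> U v ->
  nabla d (Jk k f) v = Jk k (nabla d f) v + Jk (ell d k) f v.
Proof. by move=> kn fB Uv; rewrite /nabla (haspd_pd (Jk_nabla_has d kn fB Uv)) subrK. Qed.

Lemma BC_Jk n k f : nk k -> BC h n.+1 U f -> BC h n U (Jk k f).
Proof.
elim: n k f => [|n IH] k f kn fB; have fB1 := BC_le (ltn0Sn _ : (1 <= _.+1)%N) fB.
  by split; [exact: (Jk_bdd oU cU)|exact: I].
split; first exact: (Jk_bdd oU cU).
have fB2 : BC h 2 U f by apply: BC_le fB.
move=> d; split; first by move=> v Uv; exact: haspd_ok (Jk_nabla_has d kn fB2 Uv).
apply: (BC_ext oU _ (BCD oU (IH k _ kn (BC_nabla d fB)) (IH _ f (nk_ell d kn) (BCW fB)))).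
by move=> w Uw; rewrite nabla_Jk.
Qed.

Lemma SB_Jk k f : nk k -> SB h U f -> SB h U (Jk k f).
Proof. by move=> kn fS n; apply: BC_Jk. Qed.

Lemma bell_formula w p : cA w p + ci R * cA w (ci R *: p) = h w p.
Proof.
rewrite [RHS]reimC /cA hfZr cconj_ci.
rewrite (_ : im (- ci R * _) = - re (h w p)); last by rewrite !reimE; ring.
by rewrite toCN mulrA ci2; ring.
Qed.

(** By [bell_formula] the curvature kernels along p and i p combine into 2 h(z q, p), so the
    commutator of [dbar p] with the convolution multiplies the kernel by z h(q, p). It vanishes for
    p orthogonal to q; for p = q it shifts the Gaussian kernels by one step. *)
Lemma dbar_Jk k f v p : nk k -> BC h 2 U f -> U v ->
  dbar p (Jk k f) v = Jk k (dbar p f) v + h q p * Jk (fun s t => zt s t * k s t) f v.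
Proof.
move=> kn fB Uv; have fB1 := BCW fB.
have nB d := BC_nabla d fB.
have kl := nk_ell p kn; have kl' := nk_ell (ci R *: p) kn.
rewrite {1}/dbar (nabla_Jk _ kn fB Uv) (nabla_Jk _ kn fB Uv).
have nC : BC h 1 U (fun w => ci R * nabla (ci R *: p) f w) by exact: (BCZ (ci R) oU (nB _)).
rewrite (_ : Jk k (dbar p f) v = 2^-1 * (Jk k (nabla p f) v + ci R * Jk k (nabla (ci R *: p) f) v)); last first.
  rewrite /dbar (JkZ oU cU _ kn (BCD oU (nB p) nC) Uv) (JkD oU cU kn (nB p) nC Uv).
  by rewrite (JkZ oU cU _ kn (nB _) Uv).
suff -> : h q p * Jk (fun s t => zt s t * k s t) f v =
    2^-1 * (Jk (ell p k) f v + ci R * Jk (ell (ci R *: p) k) f v).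
  generalize (Jk k (nabla p f) v) (Jk (ell p k) f v) (Jk k (nabla (ci R *: p) f) v)
    (Jk (ell (ci R *: p) k) f v) => *; clear; ring.
have kc := nkZ (ci R) kl'.
rewrite -(JkZk oU cU (ci R) kl' fB1 Uv) -(JkDk oU cU kl kc fB1 Uv).
rewrite -(JkZk oU cU (h q p) (nk_zt kn) fB1 Uv) -(JkZk oU cU (2^-1) (nkD kl kc) fB1 Uv).
apply: Jk_extk => s t.
by rewrite mulrA (mulrC (h q p)) -hfZ -bell_formula /ell; field.
Qed.

End OperatorDerivatives.

(** * Gaussian kernels *)

Section GaussKernel.

Variables (R : realType) (al : R) (al0 : 0 < al).
Local Notation C := (Cplx R).
Implicit Types (s t m : R).

(** The factor (1 - s)^-2 is the derivative of [rad], so this is the density r^n exp(- al r^2 / 2)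
    dr. With the angular factor and relative to the area r dr dt, [gk 1 0] is the Gaussian,
    [gk 0 (-1)] the Gaussian times the Cauchy kernel 1 / z, and [gk 2 1] the Gaussian times z. *)
Definition gw n s : R := rad s ^+ n * (1 - s) ^- 2 * expR (- (al * rad s ^+ 2 / 2)).
Definition gk n m s t : C := if s < 1 then toC (gw n s) * cis (m * t) else 0.

Lemma exp_poly n : exists2 M : R, 0 <= M & forall u : R, 0 < u -> u ^+ n <= M * expR u.
Proof.
case: n => [|n].
  by exists 1 => // u u0; rewrite expr0 mul1r -expR0 ler_expR ltW.
exists (n.+1%:R ^+ n.+1); first by rewrite exprn_ge0.
move=> u u0; rewrite {2}(_ : u = n.+1%:R * (u / n.+1%:R)); last by field.
rewrite expRM_natl -exprMn; apply: lerXn2r; rewrite ?nnegrE; first exact: ltW.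
  by rewrite mulr_ge0 ?expR_ge0.
rewrite mulrC -ler_pdivrMr//; apply: le_trans (expR_ge1Dx (u / n.+1%:R)); by rewrite lerDr.
Qed.

(** In terms of u = 1 / (1 - s) the radius is u - 1. Completing the square bounds the Gaussian
    exponent by 1 + 1 / (2 al) - u, and exp(- u) beats every power of u. *)
Lemma gw_bound n N : exists2 M : R, 0 <= M & forall s, -1 < s < 1 ->
  `|gw n s| <= M * (1 - s) ^+ N.
Proof.
have [M M0 HM] := exp_poly (n + 2 + N).
exists (M * expR (1 + al^-1 / 2)); first by rewrite mulr_ge0 ?expR_ge0.
move=> s /andP[s0 s1]; have p : 0 < 1 - s by lra.
set u := (1 - s)^-1; have u0 : 0 < u by rewrite invr_gt0.
have ru : rad s = u - 1 by rewrite /rad /u; field; lra.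
have u2 : 2^-1 < u by rewrite ltf_pV2 ?posrE; lra.
have rb : `|rad s| <= u by rewrite ru ler_norml; lra.
have eb : expR (- (al * rad s ^+ 2 / 2)) <= expR (1 + al^-1 / 2) * expR (- u).
  rewrite -expRD ler_expR -subr_ge0.
  rewrite (_ : _ - _ = (al * rad s - 1) ^+ 2 * (al^-1 / 2)); last first.
    by rewrite ru; field; rewrite gt_eqF.
  by rewrite mulr_ge0 ?sqr_ge0// divr_ge0// invr_ge0 ltW.
rewrite /gw !normrM normrX (ger0_norm (expR_ge0 _)).
rewrite (_ : (1 - s) ^- 2 = u ^+ 2); last by rewrite /u exprVn.
rewrite (ger0_norm (exprn_ge0 _ (ltW u0))).
rewrite (_ : 1 - s = u^-1); last by rewrite /u invrK.
apply: (@le_trans _ _ (u ^+ n * u ^+ 2 * (expR (1 + al^-1 / 2) * expR (- u)))).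
  apply: ler_pM => //; first by rewrite mulr_ge0 ?exprn_ge0// ltW.
  by apply: ler_wpM2r; [exact/exprn_ge0/ltW|apply: lerXn2r => //; rewrite nnegrE ltW].
have := HM u u0; rewrite !exprD => HH.
have uN : 0 < u ^+ N by rewrite exprn_gt0.
have eK : expR u * expR (- u) = 1 by rewrite -expRD subrr expR0.
rewrite (exprVn u N) ler_pdivlMr//.
apply: (@le_trans _ _ (u ^+ n * u ^+ 2 * u ^+ N * (expR (1 + al^-1 / 2) * expR (- u)))).
  by rewrite le_eqVlt; apply/orP; left; apply/eqP; ring.
apply: le_trans (ler_wpM2r _ HH) _; first by rewrite mulr_ge0 ?expR_ge0.
rewrite le_eqVlt; apply/orP; left; apply/eqP.
have -> : M * expR u * (expR (1 + al^-1 / 2) * expR (- u)) = M * expR (1 + al^-1 / 2) * (expR u * expR (- u)) by ring.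
by rewrite eK mulr1.
Qed.

Lemma is_derive_gauss s : s < 1 -> is_derive s (1:R) (fun x => expR (- (al * rad x ^+ 2 / 2)))
  (- al * rad s * (1 - s) ^- 2 * expR (- (al * rad s ^+ 2 / 2))).
Proof.
move=> s1; have dr := is_derive_rho s1.
have d2 := is_deriveZ (- al / 2) (is_deriveM dr dr).
have d3 := is_derive1_comp (is_derive_expR _) d2.
have -> : (fun x => expR (- (al * rad x ^+ 2 / 2))) = expR \o ((- al / 2) \*: (@rad R * @rad R)).
  by apply/funext => x /=; congr expR; rewrite /GRing.scale /= expr2 fctE; field.
apply: (is_derive_eq d3); rewrite /GRing.scale /= !fctE.
rewrite (_ : - al / 2 *: (rad s * rad s) = - (al * rad s ^+ 2 / 2)); first by field; lra.
by rewrite /GRing.scale /=; field.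
Qed.

Lemma near_lt1 s : s < 1 -> \forall x \near s, x < 1.
Proof. by move=> s1; near=> x; near: x; exact: lt_nbhsl. Unshelve. all: by end_near. Qed.

Lemma cX (f : R -> R) s n : {for s, continuous f} -> {for s, continuous (fun x => f x ^+ n)}.
Proof.
move=> cf; elim: n => [|n IH]; first by exact: cst_continuous.
rewrite (_ : (fun x => _) = (fun x => f x * f x ^+ n)); first exact: continuousM.
by apply/funext => x; rewrite exprS.
Qed.

Lemma nk_gk n m : nk (gk n m).
Proof.
have cm t : {for t, continuous (fun x : R => m * x)}.
  by apply: continuousM; [exact: cst_continuous|exact: cvg_id].
split.
- move=> s t; have [s1|s1] := ltP s 1; last first.
    by apply: (@ccont_ext _ (fun=> 0)); [move=> x; rewrite /gk ltNge s1|exact: ccont_cst].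
  apply: (@ccont_ext _ (fun x => toC (gw n s) * cis (m * x))); first by move=> x; rewrite /gk s1.
  apply: ccontM; first exact: ccont_cst.
  by apply: ccont_cexp; apply: ccontM; [exact: ccont_cst|apply: ccont_toC].
- move=> s t s1.
  apply: (@ccont_near _ (fun x => toC (gw n x) * cis (m * t))).
    by near=> x; rewrite /gk ifT//; near: x; exact: near_lt1.
  apply: ccontM; last exact: ccont_cst.
  apply: ccont_toC; rewrite /gw.
  have dr := is_derive_cont (is_derive_rho s1).
  have dg := is_derive_cont (is_derive_gauss s1).
  apply: continuousM => //; apply: continuousM.
    exact: cX.
  apply: continuousV; first by rewrite expf_eq0 /= subr_eq0 gt_eqF.
  apply: (cX (f := fun x => 1 - x)); apply: continuousB; [exact: cst_continuous|exact: cvg_id].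
- by move=> s t s1; rewrite /gk ltNge s1.
move=> N; have [M M0 H] := gw_bound n N; exists (M * 2); first by rewrite mulr_ge0.
move=> s t si; rewrite /gk; have /andP[_ s1] := si; rewrite s1 cnMtoC mulrAC.
by apply: ler_pM; rewrite ?cn_ge0 ?cn_cis ?H.
Unshelve. all: by end_near.
Qed.

Lemma zt_gk n m s t : zt s t * gk n m s t = gk n.+1 (m + 1) s t.
Proof.
rewrite /gk; case: ifP => _; last by rewrite mulr0.
by rewrite /zt /gw [(m + 1) * t]mulrDl mul1r cisD [rad s ^+ n.+1]exprS !toCM; ring.
Qed.

End GaussKernel.

(** * Integration by parts in polar coordinates *)

Section Polar.

Variables (R : realType) (g : nat) (h : hermform R g) (q : 'cV[Cplx R]_g) (a : R).
Hypothesis hqq : h q q = toC a.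
Local Notation C := (Cplx R).
Local Notation V := 'cV[C]_g.
Local Notation cA := (cA h).
Local Notation nabla := (nabla h).
Local Notation dbar := (dbar h).
Local Notation Gk := (Gk h q).
Local Notation inn := (inn h q).
Local Notation Jk := (Jk h q).
Local Notation zt := (@zt R).
Variables (U : set V) (oU : vopen U) (cU : cyl q U).
Implicit Types (f : V -> C) (v w d p : V) (z : C) (s t : R).

Lemma iscd_Gk f v (c : R -> C) c' t : BC h 2 U f -> U v -> iscd c t c' ->
  iscd (fun x => Gk f v (c x)) t
    (- Gk (nabla (c' *: q) f) v (c t) - cA (c t *: q) (c' *: q) * Gk f v (c t)).
Proof.
move=> fB Uv dc; have fC := BC_Cn oU fB.
have U1 : U (v + (- c t) *: q) by rewrite scaleNr; exact: cU.
have h1 := iscd_curve oU fC U1 (iscdN dc).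
have h1' : iscd (fun x => f (v - c x *: q)) t (- pd (c' *: q) f (v - c t *: q)).
  apply: (@iscd_ext _ (fun s => f (v + (- c s) *: q))); first by move=> x; rewrite scaleNr.
  apply: (iscd_eq h1); rewrite !scaleNr (_ : - (c' *: q) = sc (-1) (c' *: q)).
    by rewrite (pd_sc _ _ (CnW fC) (cU _ Uv)) toCN toC1 mulN1r.
  by rewrite /sc toCN toC1 scaleN1r.
have h2 : iscd (fun x => cA (c x *: q) v) t (cA (c' *: q) v).
  rewrite /cA; apply: iscdZ.
  apply: (@iscd_ext _ (fun x => toC (im (c x * h q v)))); first by move=> x; rewrite hfZ.
  rewrite hfZ; apply: iscd_toC.
  by case: (iscdM dc (iscd_cst (h q v) t)); rewrite mulr0 addr0.
apply: (iscd_eq (iscdM h1' (iscd_cexp h2))); rewrite /Gk /Ek /nabla cAB (cAC h v (c' *: q)); ring.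
Qed.

Lemma cconj_cis t : cconj (cis t) = cis (- t) :> C.
Proof. by rewrite /cis cconj_cexp cconjM cconj_ci cconj_toC toCN mulrN mulNr. Qed.

Lemma nabla_cplx f v c : Cn 2 U f -> U v ->
  nabla (c *: q) f v = toC (re c) * nabla q f v + toC (im c) * nabla (ci R *: q) f v.
Proof.
move=> fC Uv; rewrite /nabla (pd_cplx _ _ oU fC Uv) (scaleC_sc c q) cADr !cAscr; gen_pd; ring.
Qed.

(** The Cauchy-Riemann operator in polar coordinates: [cis t *: q] is the radial direction and
    [(ci R * cis t) *: q] the angular one. *)
Lemma nabla_cis f v t : Cn 2 U f -> U v ->
  nabla (cis t *: q) f v + ci R * nabla ((ci R * cis t) *: q) f v = 2 * (cis (- t) * dbar q f v).
Proof.
move=> fC Uv; rewrite (nabla_cplx (cis t) fC Uv) (nabla_cplx (ci R * cis t) fC Uv) -cconj_cis /dbar.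
rewrite (_ : cconj (cis t) = toC (re (cis t)) - ci R * toC (im (cis t))); last first.
  by rewrite [LHS]reimC re_conj im_conj toCN mulrN.
rewrite (_ : re (ci R * cis t) = - im (cis t)); last by rewrite !reimE; ring.
rewrite (_ : im (ci R * cis t) = re (cis t)); last by rewrite !reimE; ring.
rewrite toCN; have := ci2 R.
move: (ci R) (toC _) (toC _) (nabla _ _ _) (nabla _ _ _) => i y x n2 n1 i2.
have -> : 2 * ((x - i * y) * (2^-1 * (n1 + i * n2))) = x * n1 + i * x * n2 - i * y * n1 - (i * i) * y * n2 by field.
rewrite i2; ring.
Qed.

Lemma cA_line z (c : C) : cA (z *: q) (c *: q) = ci R * toC (im (z * cconj c) * a).
Proof. by rewrite /cA hfZ hfZr hqq mulrA !reimE mulr0 add0r. Qed.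

Lemma cis_conj t : cis t * cconj (cis t) = 1 :> C.
Proof. by rewrite cconj_cis cisNK. Qed.

Lemma iscd_Gk_s f v s t : BC h 2 U f -> U v -> s < 1 ->
  iscd (fun x => Gk f v (zt x t)) s (- toC ((1 - s) ^- 2) * Gk (nabla (cis t *: q) f) v (zt s t)).
Proof.
move=> fB Uv s1; have fC := BC_Cn oU fB.
apply: (iscd_eq (iscd_Gk fB Uv (iscd_zt_s t s1))).
rewrite cA_line (_ : zt s t * _ = toC (rad s * (1 - s) ^- 2)); last first.
  by rewrite cconjM cconj_toC /zt -[RHS]mulr1 -(cis_conj t) toCM; ring.
rewrite im_toC mul0r toC0 mulr0 mul0r subr0.
rewrite /Gk -scalerA -/(sc _ _) (_ : nabla (sc _ _) _ _ = toC ((1 - s) ^- 2) * nabla (cis t *: q) f (v - zt s t *: q)).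
  by ring.
by rewrite /nabla (pd_sc _ _ (CnW fC) (cU _ Uv)) cAscr; ring.
Qed.

Lemma iscd_Gk_t f v s t : BC h 2 U f -> U v ->
  iscd (fun x => Gk f v (zt s x)) t (- toC (rad s) * Gk (nabla ((ci R * cis t) *: q) f) v (zt s t)
     + ci R * toC (rad s ^+ 2 * a) * Gk f v (zt s t)).
Proof.
move=> fB Uv; have fC := BC_Cn oU fB.
have dz : iscd (zt s) t (toC (rad s) * (ci R * cis t)).
  by apply: (iscd_eq (iscdM (iscd_cst (toC (rad s)) t) (iscd_cis t))); rewrite mul0r add0r.
apply: (iscd_eq (iscd_Gk fB Uv dz)).
rewrite cA_line !cconjM cconj_toC cconj_ci.
rewrite (_ : zt s t * _ = - ci R * toC (rad s ^+ 2)); last first.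
  rewrite /zt -[RHS]mulr1 -(cis_conj t) expr2 toCM; ring.
rewrite (_ : im _ = - rad s ^+ 2); last by rewrite !reimE; ring.
rewrite /Gk -scalerA -/(sc _ _) (_ : nabla (sc _ _) _ _ = toC (rad s) * nabla ((ci R * cis t) *: q) f (v - zt s t *: q)).
  by rewrite mulNr toCN; ring.
by rewrite /nabla (pd_sc _ _ (CnW fC) (cU _ Uv)) cAscr; ring.
Qed.

Lemma Gk_polar f v s t : BC h 2 U f -> U v ->
  2 * toC (rad s) * (cis (- t) * Gk (dbar q f) v (zt s t)) =
  toC (rad s) * Gk (nabla (cis t *: q) f) v (zt s t) + ci R * (toC (rad s) * Gk (nabla ((ci R * cis t) *: q) f) v (zt s t)).
Proof.
move=> fB Uv; have := nabla_cis t (BC_Cn oU fB) (cU (zt s t) Uv); rewrite /Gk.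
move: (nabla _ _ _) (nabla _ _ _) (dbar _ _ _) => n1 n2 d e.
have -> : 2 * toC (rad s) * (cis (- t) * (d * Ek h q (zt s t) v)) = toC (rad s) * Ek h q (zt s t) v * (2 * (cis (- t) * d)) by ring.
by rewrite -e; ring.
Qed.

Variables (al : R) (al0 : 0 < al).
Local Notation gw := (gw al).
Local Notation gk := (gk al).

(** An angular Fourier coefficient of the twisted translates of f on the circle of radius
    [rad s]. *)
Definition Phi n f v s : C := cI 0 (2 * pi) (fun t => cis (n%:R * t) * Gk f v (zt s t)).

Let pi0 : 0 <= 2 * pi :> R. Proof. by rewrite mulr_ge0 ?pi_ge0. Qed.
Let pi1 : 0 < 2 * pi :> R. Proof. by rewrite mulr_gt0 ?pi_gt0. Qed.

Lemma iscd_cisn (m : R) t : iscd (fun x => cis (m * x)) t (ci R * toC m * cis (m * t)).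
Proof.
have dm : is_derive t (1:R) (fun x : R => m * x) m.
  have -> : (fun x : R => m * x) = m \*: (@id R) by [].
  by apply: is_derive_eq; rewrite /GRing.scale /= mulr1.
by apply: (iscd_eq (iscd_comp (iscd_cis (m * t)) dm)); ring.
Qed.

Lemma cis2pin n : cis (n%:R * (2 * pi)) = 1 :> C.
Proof.
elim: n => [|n IH]; first by rewrite mul0r cis0.
by rewrite -addn1 natrD [(_ + _) * _]mulrDl cisD IH !mul1r cis2pi.
Qed.

Lemma cc_cisG n f v s t : BC h 1 U f -> U v -> ccont (fun t => cis (n%:R * t) * Gk f v (zt s t)) t.
Proof.
move=> fB Uv; apply: ccontM; first exact: iscd_cont (iscd_cisn _ _).
by apply: (ccont_Gk h oU (BC_Cn oU fB) (cU _ Uv)); exact: ccont_zt_t.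
Qed.

Lemma cc_dirG f v s (c : R -> C) t : BC h 2 U f -> U v -> ccont c t ->
  ccont (fun t => Gk (nabla (c t *: q) f) v (zt s t)) t.
Proof.
move=> fB Uv cc; have fC := BC_Cn oU fB.
apply: (@ccont_ext _ (fun t => toC (re (c t)) * Gk (nabla q f) v (zt s t)
   + toC (im (c t)) * Gk (nabla (ci R *: q) f) v (zt s t))).
  by move=> x; rewrite /Gk (nabla_cplx (c x) fC (cU (zt s x) Uv)); gen_pd; ring.
apply: ccontD; apply: ccontM; try by apply: ccont_toC; case: cc.
  by apply: (ccont_Gk h oU (BC_Cn oU (BC_nabla q fB)) (cU _ Uv)); exact: ccont_zt_t.
by apply: (ccont_Gk h oU (BC_Cn oU (BC_nabla (ci R *: q) fB)) (cU _ Uv)); exact: ccont_zt_t.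
Qed.

Lemma cn_dirG f v : BC h 2 U f -> U v -> exists2 B : R, 0 <= B &
  forall s t, cn (Gk (nabla (cis t *: q) f) v (zt s t)) <= B.
Proof.
move=> fB Uv; have fC := BC_Cn oU fB.
have [B1 B10 H1] := BC_bdd (BC_nabla q fB).
have [B2 B20 H2] := BC_bdd (BC_nabla (ci R *: q) fB).
exists (2 * (B1 * 2) + 2 * (B2 * 2)); first by rewrite addr_ge0// !mulr_ge0.
move=> s t; rewrite /Gk (nabla_cplx (cis t) fC (cU (zt s t) Uv)) mulrDl.
rewrite -(mulrA (toC (re _))) -(mulrA (toC (im _))).
have ct := cn_cis t; have r1 := re_le_cn (cis t : C); have i1 := im_le_cn (cis t : C).
apply: le_trans (cnD _ _) (lerD _ _); rewrite cnMtoC; apply: (ler_pM (normr_ge0 _) (cn_ge0 _)).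
- exact: le_trans r1 ct.
- exact: (cn_Gk h cU (zt s t) H1 Uv).
- exact: le_trans i1 ct.
exact: (cn_Gk h cU (zt s t) H2 Uv).
Qed.

Lemma cc_cisn (n : nat) t : ccont (fun x => cis (n%:R * x) : C) t.
Proof. exact: iscd_cont (iscd_cisn _ _). Qed.

Lemma cc_icis t : ccont (fun x => ci R * cis x) t.
Proof. by apply: ccontM; [exact: ccont_cst|exact: ccont_cis]. Qed.

(** The t-derivative of the integrand has integral 0 over a period. Besides the angular covariant
    derivative it contains n, from the character, and a r^2, from the curvature. *)
Lemma Phi_t n f v s : BC h 2 U f -> U v ->
  toC (rad s) * (ci R * cI 0 (2 * pi) (fun t => cis (n%:R * t) * Gk (nabla ((ci R * cis t) *: q) f) v (zt s t)))
   = - (n%:R + toC (rad s ^+ 2 * a)) * Phi n f v s.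
Proof.
move=> fB Uv; have fB1 := BCW fB.
set P := fun t => cis (n%:R * t) * Gk f v (zt s t).
set Q := fun t => cis (n%:R * t) * Gk (nabla ((ci R * cis t) *: q) f) v (zt s t).
have cP : ccOn 0 (2 * pi) P by move=> t _; exact: cc_cisG.
have cQ : ccOn 0 (2 * pi) Q.
  by move=> t _; apply: ccontM; [exact: cc_cisn|apply: (cc_dirG s fB Uv); exact: cc_icis].
have cP' := ccOnM (ccOn_cst (a := 0) (b := 2 * pi) (ci R * (n%:R + toC (rad s ^+ 2 * a)))) cP.
have cQ' := ccOnM (ccOn_cst (a := 0) (b := 2 * pi) (- toC (rad s))) cQ.
have := @cI_FTC _ 0 (2 * pi) _ P pi1 (ccOnD cQ' cP') cP.
have -> : P (2 * pi) - P 0 = 0.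
  by rewrite /P cis2pin mulr0 cis0 /zt cis2pi cis0 subrr.
have dP t : 0 < t < 2 * pi -> iscd P t (- toC (rad s) * Q t + ci R * (n%:R + toC (rad s ^+ 2 * a)) * P t).
  move=> _; apply: (iscd_eq (iscdM (iscd_cisn n%:R t) (iscd_Gk_t s t fB Uv))).
  by rewrite /P /Q toC_nat; ring.
move=> /(_ dP); rewrite (cID cQ' cP') (cIZ _ cP) (cIZ _ cQ) -/(Phi n f v s) => e.
have {}e : ci R * (- toC (rad s) * cI 0 (2 * pi) Q + ci R * (n%:R + toC (rad s ^+ 2 * a)) * Phi n f v s) = 0.
  by rewrite e mulr0.
apply/eqP; rewrite -subr_eq0 -oppr_eq0 -e; apply/eqP.
move: (cI _ _ Q) (Phi n f v s) (toC (rad s)) (n%:R + toC (rad s ^+ 2 * a)) => x p r k.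
have -> : ci R * (- r * x + ci R * k * p) = - (r * (ci R * x)) + ci R * ci R * k * p by ring.
rewrite ci2; ring.
Qed.

Lemma Phi_s n f v s : BC h 2 U f -> U v -> s < 1 -> iscd (Phi n f v) s
  (- toC ((1 - s) ^- 2) * cI 0 (2 * pi) (fun t => cis (n%:R * t) * Gk (nabla (cis t *: q) f) v (zt s t))).
Proof.
move=> fB Uv s1; have fB1 := BCW fB; have [B B0 HB] := cn_dirG fB Uv.
have d0 : 0 < (1 - s) / 2 by lra.
set Q := fun x t => cis (n%:R * t) * Gk (nabla (cis t *: q) f) v (zt x t).
have cQ x : ccOn 0 (2 * pi) (Q x).
  by move=> t _; apply: ccontM; [exact: cc_cisn|apply: (cc_dirG x fB Uv); exact: ccont_cis].
rewrite -(cIZ _ (cQ s)).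
apply: (@cI_diff _ _ _ s ((1 - s) / 2) (((1 - s) / 2) ^- 2 * (2 * B))
  (fun x t => cis (n%:R * t) * Gk f v (zt x t)) (fun x t => - toC ((1 - x) ^- 2) * Q x t)) => //.
- by move=> x _ t _; exact: cc_cisG.
- move=> x t; rewrite ltr_norml => xs _; have x1 : x < 1 by move: xs d0; move: (x) (s) => ? ? *; lra.
  apply: (iscd_eq (iscdM (iscd_cst (cis (n%:R * t)) x) (iscd_Gk_s t fB Uv x1))).
  by rewrite /Q; ring.
move=> x t; rewrite ltr_norml => xs _.
have x1 : (1 - s) / 2 < 1 - x by move: xs; move: (x) (s) => ? ? *; lra.
rewrite mulNr cnN cnMtoC; apply: ler_pM; rewrite ?cn_ge0//.
  rewrite ger0_norm ?invr_ge0 ?exprn_ge0 ?(ltW (lt_trans d0 x1))//.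
  rewrite lef_pV2 ?posrE ?exprn_gt0 ?(lt_trans d0 x1)//.
  by apply: lerXn2r; rewrite ?nnegrE ltW// (lt_trans d0).
apply: le_trans (cnM _ _) _; apply: ler_pM; rewrite ?cn_ge0 ?HB//; exact: cn_cis.
Qed.

Definition Wn n s : R := rad s ^+ n * expR (- (al * rad s ^+ 2 / 2)).

Lemma is_derive_Wn n s : s < 1 -> rad s != 0 -> is_derive s (1:R) (Wn n)
  ((n%:R * rad s ^+ n / rad s - al * rad s * rad s ^+ n) * (1 - s) ^- 2 * expR (- (al * rad s ^+ 2 / 2))).
Proof.
move=> s1 r0.
have dX : is_derive s (1:R) (fun x => rad x ^+ n) (n%:R * rad s ^+ n / rad s * (1 - s) ^- 2).
  elim: n => [|n IH].
    rewrite (_ : (fun x => _) = cst 1); last by apply/funext.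
    by apply: is_derive_eq; rewrite !mul0r.
  rewrite (_ : (fun x => _) = @rad R * (fun x => rad x ^+ n)); last by apply/funext => x; rewrite exprS.
  have hM := is_deriveM (is_derive_rho s1) IH.
  apply: (is_derive_eq hM); rewrite /GRing.scale /= [rad s ^+ n.+1]exprS -natr1; field.
  by rewrite r0; lra.
have hM := is_deriveM dX (is_derive_gauss al s1).
rewrite /Wn (_ : (fun s => _) = (fun x => rad x ^+ n) * (fun x => expR (- (al * rad x ^+ 2 / 2)))) //.
apply: (is_derive_eq hM); rewrite /GRing.scale /=.
by move: (expR _) => E; field; rewrite r0; lra.
Qed.

Definition Up n f v s : C := if s < 1 then - toC (Wn n s) * Phi n f v s else 0.

Lemma inn_Phi n f v s : BC h 2 U f -> U v -> s < 1 ->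
  inn (gk n.+1 n%:R) f v s = toC (gw n.+1 s) * Phi n f v s.
Proof.
move=> fB Uv s1; have cc : ccOn 0 (2 * pi) (fun t => cis (n%:R * t) * Gk f v (zt s t)).
  by move=> t _; exact: cc_cisG (BCW fB) Uv.
rewrite /Phi -(cIZ (toC (gw n.+1 s)) cc).
by apply: cI_ext => t _; rewrite /gk s1; move: (Gk f v (zt s t)) => x; ring.
Qed.

Lemma polar_alg (r G c e x y z i : C) : 2 * r * (e * x) = r * y + i * (r * z) ->
  2 * r * (x * (G * (c * e))) = G * (r * (c * y) + r * (i * (c * z))).
Proof.
move=> p; have -> : 2 * r * (x * (G * (c * e))) = G * c * (2 * r * (e * x)) by ring.
by rewrite p; ring.
Qed.

(** The radial covariant derivative is traded for [dbar] and the angular one, and the latter is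
    known from [Phi_t]. The term n r^(n - 1) of the weight then cancels the n of the angular
    integration, and only the quadratic terms, with al from the Gaussian and a from the curvature,
    are left. *)
Lemma iscd_Up n f v s : BC h 3 U f -> U v -> 0 < s < 1 ->
  iscd (Up n f v) s (2 * inn (gk n (n%:R - 1)) (dbar q f) v s + toC (al + a) * inn (gk n.+1 n%:R) f v s).
Proof.
move=> fB3 Uv /andP[s0 s1]; have fB := BCW fB3; have fB1 := BCW fB.
have r0 : 0 < rad s by rewrite divr_gt0// subr_gt0.
have rn0 : rad s != 0 by rewrite gt_eqF.
apply: (@iscd_near _ (fun x => - toC (Wn n x) * Phi n f v x)).
  by near=> x; rewrite /Up ifT//; near: x; exact: near_lt1.
apply: (iscd_eq (iscdM (iscdN (iscd_toC (is_derive_Wn n s1 rn0))) (Phi_s n fB Uv s1))).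
rewrite (inn_Phi _ fB Uv s1).
have cA1 : ccOn 0 (2 * pi) (fun t => cis (n%:R * t) * Gk (nabla (cis t *: q) f) v (zt s t)).
  by move=> t _; apply: ccontM; [exact: cc_cisn|apply: (cc_dirG s fB Uv); exact: ccont_cis].
have cB1 : ccOn 0 (2 * pi) (fun t => cis (n%:R * t) * Gk (nabla ((ci R * cis t) *: q) f) v (zt s t)).
  by move=> t _; apply: ccontM; [exact: cc_cisn|apply: (cc_dirG s fB Uv); exact: cc_icis].
have cI1 : ccOn 0 (2 * pi) (fun t => Gk (dbar q f) v (zt s t) * gk n (n%:R - 1) s t).
  exact: (ccOn_inn_t oU cU s (nk_gk al0 n _) (BC_dbar q oU fB) Uv).
have e : 2 * toC (rad s) * inn (gk n (n%:R - 1)) (dbar q f) v s =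
  toC (gw n s) * (toC (rad s) * cI 0 (2 * pi) (fun t => cis (n%:R * t) * Gk (nabla (cis t *: q) f) v (zt s t))
   + toC (rad s) * (ci R * cI 0 (2 * pi) (fun t => cis (n%:R * t) * Gk (nabla ((ci R * cis t) *: q) f) v (zt s t)))).
  have c1 := ccOnM (ccOn_cst (a := 0) (b := 2 * pi) (toC (rad s))) cA1.
  have c2 := ccOnM (ccOn_cst (a := 0) (b := 2 * pi) (ci R)) cB1.
  have c3 := ccOnM (ccOn_cst (a := 0) (b := 2 * pi) (toC (rad s))) c2.
  rewrite /inn -(cIZ _ cI1) -(cIZ _ cA1) -(cIZ _ cB1) -(cIZ _ c2) -(cID c1 c3) -(cIZ _ (ccOnD c1 c3)).
  apply: cI_ext => t _; rewrite /gk s1.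
  have p := Gk_polar s t fB Uv.
  by rewrite [(n%:R - 1) * t]mulrBl mul1r cisD; exact: polar_alg p.
rewrite (Phi_t n s fB Uv) in e.
move: e; move: (cI 0 (2 * pi) (fun t => cis (n%:R * t) * Gk (nabla (cis t *: q) f) v (zt s t)))
  (Phi n f v s) (inn (gk n (n%:R - 1)) (dbar q f) v s) => x p i e.
have rC : toC (rad s) != 0 :> C by rewrite toC_eq0.
apply: (mulfI rC).
have -> : toC (rad s) * (2 * i + toC (al + a) * (toC (gw n.+1 s) * p)) =
  2 * toC (rad s) * i + toC (al + a) * (toC (rad s * gw n.+1 s) * p) by rewrite toCM; ring.
rewrite e /gw exprS; set E := expR _; set S := (1 - s) ^- 2.
have -> : toC (rad s) * (- toC ((n%:R * rad s ^+ n / rad s - al * rad s * rad s ^+ n) * S * E) * p + - toC (Wn n s) * (- toC S * x)) =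
  - toC (rad s * ((n%:R * rad s ^+ n / rad s - al * rad s * rad s ^+ n) * S * E)) * p + toC (rad s * (Wn n s * S)) * x.
  by rewrite !toCM; ring.
have -> : rad s * ((n%:R * rad s ^+ n / rad s - al * rad s * rad s ^+ n) * S * E) =
  (n%:R - al * rad s ^+ 2) * rad s ^+ n * S * E by field.
rewrite /Wn -/E -(toC_nat R n) [rad s ^+ n.+1]exprS expr2; move: E S (rad s ^+ n) => E S P.
by rewrite !(toCM, toCD, toCN); ring.
Unshelve. all: by end_near.
Qed.

Lemma bdd_Phi n f v : BC h 1 U f -> U v -> exists2 B : R, 0 <= B & forall s, cn (Phi n f v s) <= B.
Proof.
move=> fB Uv; have [B B0 HB] := BC_bdd fB.
exists (2 * (2 * (B * 2)) * (2 * pi)); first by rewrite !mulr_ge0 ?pi_ge0.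
move=> s; have cc : ccOn 0 (2 * pi) (fun t => cis (n%:R * t) * Gk f v (zt s t)).
  by move=> t _; exact: cc_cisG fB Uv.
have := @cI_norm _ 0 (2 * pi) _ (2 * (B * 2)) pi0 cc; rewrite subr0; apply=> t _.
apply: le_trans (cnM _ _) _; apply: ler_pM; rewrite ?cn_ge0//; first exact: cn_cis.
exact: (cn_Gk h cU (zt s t) HB Uv).
Qed.

Lemma ccOn_Up n f v : BC h 3 U f -> U v -> ccOn 0 1 (Up n f v).
Proof.
move=> fB3 Uv t /andP[t0]; have fB := BCW fB3; have fB1 := BCW fB.
rewrite le_eqVlt => /orP[/eqP ->|t1].
  have [B B0 HB] := bdd_Phi n fB1 Uv; have [M M0 HM] := gw_bound al0 n 1.
  have K0 : 0 <= M * B by rewrite mulr_ge0.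
  apply/ccontP => e e0; exists (Num.min 1 (e / (M * B + 1))).
    by rewrite lt_min ltr01 divr_gt0 //; lra.
  move=> x; rewrite lt_min => /andP[x1]; rewrite ltr_pdivlMr; last by lra.
  move=> x2; rewrite {2}/Up ltxx subr0 /Up; case: ifP => x3; last by rewrite cn0.
  have xi : -1 < x < 1 by move: x1; rewrite ltr_norml; lra.
  have p : 0 < 1 - x by rewrite subr_gt0.
  have e1 : `|x - 1| = 1 - x by rewrite distrC gtr0_norm.
  rewrite e1 in x1 x2.
  have Wb : `|Wn n x| <= M * (1 - x).
    have -> : Wn n x = gw n x * (1 - x) ^+ 2 by rewrite /Wn /gw; field; rewrite gt_eqF.
    rewrite normrM (ger0_norm (exprn_ge0 _ (ltW p))).
    have := HM x xi; rewrite expr1 => hm; apply: le_trans hm.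
    by rewrite ler_piMr// expr_le1// ltW.
  rewrite mulNr cnN cnMtoC; apply: le_lt_trans x2.
  apply: le_trans (ler_pM (normr_ge0 _) (cn_ge0 _) Wb (HB x)) _.
  by rewrite mulrAC mulrC ler_wpM2l// ?lerDl// ltW.
apply: (@ccont_near _ (fun x => - toC (Wn n x) * Phi n f v x)).
  by near=> x; rewrite /Up ifT//; near: x; exact: near_lt1.
apply: ccontM; last exact: iscd_cont (Phi_s n fB Uv t1).
apply: ccontN; apply: ccont_toC; rewrite /Wn; apply: continuousM.
  by apply: cX; exact: is_derive_cont (is_derive_rho t1).
exact: is_derive_cont (is_derive_gauss al t1).
Unshelve. all: by end_near.
Qed.

(** Integral of the radial derivative of [Up], which vanishes at s = 1 and at s = 0 is - 2 pi f(v)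
    for n = 0 and 0 otherwise. For al = |a| the coefficient al + a is 2 a or 0 according to the sign
    of a; this alternative is the source of the index. The case n = 0 serves [dbar_T], the case n =
    1 serves [dbar_S]. *)
Lemma polar n f v : BC h 3 U f -> U v ->
  2 * Jk (gk n (n%:R - 1)) (dbar q f) v + toC (al + a) * Jk (gk n.+1 n%:R) f v =
  if n == 0%N then toC (2 * pi) * f v else 0.
Proof.
move=> fB3 Uv; have fB := BCW fB3; have fB1 := BCW fB.
have c1 := ccOn_inn oU cU (nk_gk al0 n (n%:R - 1)) (BC_dbar q oU fB) Uv.
have c2 := ccOn_inn oU cU (nk_gk al0 n.+1 n%:R) fB1 Uv.
have c1' := ccOnM (ccOn_cst (a := 0) (b := 1) (2 : C)) c1.
have c2' := ccOnM (ccOn_cst (a := 0) (b := 1) (toC (al + a))) c2.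
rewrite /Jk -(cIZ _ c1) -(cIZ _ c2) -(cID c1' c2').
rewrite (cI_FTC ltr01 (ccOnD c1' c2') (ccOn_Up n fB3 Uv)); last first.
  by move=> t t01; exact: iscd_Up.
rewrite /Up ltxx ltr01 /Wn /rad mul0r expr0n sub0r mulNr opprK.
case: n {c1 c2 c1' c2'} => [|n] /=; last by rewrite mul0r toC0 mul0r.
rewrite mul1r (_ : _ / 2 = 0); last by rewrite expr0n /= mulr0 mul0r.
rewrite oppr0 expR0 toC1 mul1r /Phi (@cI_ext _ _ _ _ (fun=> f v)).
  by rewrite cI_cst// subr0.
move=> t _; rewrite mul0r cis0 mul1r /zt /rad mul0r toC0 mul0r /Gk /Ek scale0r subr0 cA0 cexp0 mulr1 //.
Qed.

End Polar.

(** * Complex conjugation and change of sign of the form *)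

Section Conjugation.

Variables (R : realType) (g : nat).
Local Notation C := (Cplx R).
Local Notation V := 'cV[C]_g.
Implicit Types (h : hermform R g) (f : V -> C) (U : set V) (v w d p q : V).

Program Definition hneg h := @HermForm R g (fun v w => - h v w) _ _ _ _.
Next Obligation. by move=> h u v w /=; rewrite hfD opprD. Qed.
Next Obligation. by move=> h c v w /=; rewrite hfZ mulrN. Qed.
Next Obligation. by move=> h v w /=; rewrite hfC cconjN. Qed.
Next Obligation. by move=> h; have [K [K0 H]] := hfK h; exists K; split=> // v w; rewrite cnN. Qed.

Definition cf f v : C := cconj (f v).
(** The (1,0)-part of the connection along q. Conjugation turns it into [dbar] for the opposite
    form, so that statements about it for a < 0 follow from those about [dbar] for a > 0. *)
Definition dop h q f v : C := 2^-1 * (nabla h q f v - ci R * nabla h (ci R *: q) f v).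

Lemma cA_neg h v w : cA (hneg h) v w = cconj (cA h v w).
Proof. by rewrite /cA /= imN toCN cconjM cconj_ci cconj_toC mulNr mulrN. Qed.

Lemma nabla_neg h d f v l : haspd f v d l -> nabla (hneg h) d (cf f) v = cconj (nabla h d f v).
Proof.
move=> H; rewrite /nabla (haspd_pd (haspd_conj H)) -(haspd_pd H) cconjD cconjM.
by rewrite cA_neg.
Qed.

Lemma BC_neg n h U f : vopen U -> BC h n U f -> BC (hneg h) n U (cf f).
Proof.
move=> oU; elim: n f => [|n IH] f Hf.
  split; [|exact: I]; have [M M0 H] := BC_bdd Hf; exists M => // v Uv.
  by rewrite /cf cn_conj H.
split.
  by have [M M0 H] := BC_bdd Hf; exists M => // v Uv; rewrite /cf cn_conj H.
move=> d; split; first by move=> v Uv; exact: haspd_ok (haspd_conj (BC_has d Hf Uv)).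
apply: (BC_ext oU _ (IH _ (BC_nabla d Hf))) => w Uw.
by rewrite (nabla_neg _ (BC_has d Hf Uw)).
Qed.

Lemma dop_neg h U q f v : BC h 1 U f -> U v -> dop h q f v = cconj (dbar (hneg h) q (cf f) v).
Proof.
move=> Hf Uv; rewrite /dbar (nabla_neg _ (BC_has q Hf Uv)) (nabla_neg _ (BC_has (ci R *: q) Hf Uv)).
rewrite /dop (cconjM 2^-1) cconjD (cconjM (ci R)) (cconjK (nabla h q f v)).
rewrite (cconjK (nabla h (ci R *: q) f v)) cconj_ci mulNr; congr (_ * _).
by rewrite -[2]toC_nat -toCV cconj_toC.
Qed.

End Conjugation.

(** * Gaussian inverses and projections *)

Section TandS.

Variables (R : realType) (g : nat).
Local Notation C := (Cplx R).
Local Notation V := 'cV[C]_g.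
Variables (U : set V) (oU : vopen U).
Implicit Types (h : hermform R g) (f : V -> C) (v w d p q : V) (a : R).

(** Twisted convolution with exp(- |a| |z|^2 / 2) / (pi z), a damped Cauchy kernel. The kernel |a|
    exp(- |a| |z|^2 / 2) / pi of [Sop] is the reproducing kernel of a Bargmann-Fock space. *)
Definition Top h q a f v : C := (toC pi)^-1 * Jk h q (gk `|a| 0 (-1)) f v.
Definition Sop h q a f v : C := toC (`|a| / pi) * Jk h q (gk `|a| 1 0) f v.

Lemma nab0 a : a != 0 -> 0 < `|a|. Proof. by rewrite normr_gt0. Qed.

Lemma SB_Top h q a f : cyl q U -> a != 0 -> SB h U f -> SB h U (Top h q a f).
Proof. by move=> cU a0 Hf; apply: SBZ => //; apply: SB_Jk => //; exact: nk_gk (nab0 a0) _ _. Qed.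
Lemma SB_Sop h q a f : cyl q U -> a != 0 -> SB h U f -> SB h U (Sop h q a f).
Proof. by move=> cU a0 Hf; apply: SBZ => //; apply: SB_Jk => //; exact: nk_gk (nab0 a0) _ _. Qed.

Lemma piC0 : (toC pi : C) != 0. Proof. by rewrite toC_eq0 gt_eqF// pi_gt0. Qed.

(** The case n = 0 of [polar] gives T dbar, and the commutator formula, with z times [gk 0 (-1)]
    equal to [gk 1 0], gives dbar T. Their difference is S up to sign, and the sign of a decides
    which of the two has it as a defect. *)
Lemma dbar_T h q a f v : h q q = toC a -> cyl q U -> a != 0 -> SB h U f -> U v ->
  Top h q a (dbar h q f) v = (if 0 < a then f v - Sop h q a f v else f v) /\
  dbar h q (Top h q a f) v = if 0 < a then f v else f v - Sop h q a f v.
Proof.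
move=> hqq cU a0 Hf Uv; have al0 := nab0 a0.
have := polar hqq oU cU al0 0 (Hf 3) Uv; rewrite /= sub0r => P0.
have N0 := nk_gk al0 0 (-1).
have e : dbar h q (Top h q a f) v = (toC pi)^-1 *
   (Jk h q (gk `|a| 0 (-1)) (dbar h q f) v + toC a * Jk h q (gk `|a| 1 0) f v).
  rewrite (dbarZ _ _ _ (SB_sm oU (SB_Jk oU cU N0 Hf)) Uv) (dbar_Jk oU cU q N0 (Hf 2) Uv) hqq.
  rewrite (@Jk_extk _ _ h q (fun s t => zt s t * gk `|a| 0 (-1) s t) (gk `|a| 1 0))//.
  by move=> s t; rewrite zt_gk addNr.
rewrite e /Top /Sop; move: P0; move: (Jk h q (gk `|a| 0 (-1)) (dbar h q f) v) (Jk h q (gk `|a| 1 0) f v) (f v) => x y z.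
have := piC0; have t0 : (2 : C) != 0 by rewrite pnatr_eq0.
move: (pi : R) => P p0; case: ltP => sa; [rewrite (gtr0_norm sa)|rewrite (ler0_norm sa)];
  rewrite !(toCD, toCM, toCV, toCN) ?toC1; move: (toC a) (toC P) p0 => A p p0 P0.
  have -> : x = p * z - A * y.
    apply: (mulfI t0); have -> : 2 * x = 2 * x + (A + A) * y - (A + A) * y by ring.
    by rewrite P0; ring.
  by split; field.
have -> : x = p * z.
  apply: (mulfI t0); have -> : 2 * x = 2 * x + (- A + A) * y by ring.
  by rewrite P0; ring.
by split; field.
Qed.

(** The case n = 1 of [polar]. For a < 0 the result is a convolution of f itself, without
    derivatives, and this becomes a gradient bound for sections with S f = f. *)
Lemma dbar_S h q a f v : h q q = toC a -> cyl q U -> a != 0 -> SB h U f -> U v ->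
  dbar h q (Sop h q a f) v = if 0 < a then 0 else
    toC (`|a| / pi * a) * Jk h q (gk `|a| 2 1) f v.
Proof.
move=> hqq cU a0 Hf Uv; have al0 := nab0 a0.
have := polar hqq oU cU al0 1 (Hf 3) Uv; rewrite /= subrr => P0.
have N0 := nk_gk al0 1 0.
rewrite (dbarZ _ _ _ (SB_sm oU (SB_Jk oU cU N0 Hf)) Uv) (dbar_Jk oU cU q N0 (Hf 2) Uv) hqq.
rewrite (@Jk_extk _ _ h q (fun s t => zt s t * gk `|a| 1 0 s t) (gk `|a| 2 1)); last first.
  by move=> s t; rewrite zt_gk add0r.
move: P0; move: (Jk h q (gk `|a| 1 0) (dbar h q f) v) (Jk h q (gk `|a| 2 1) f v) => x y.
have t0 : (2 : C) != 0 by rewrite pnatr_eq0.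
case: ltP => sa; [rewrite (gtr0_norm sa)|rewrite (ler0_norm sa)].
  rewrite toCD => P0; have -> : x + toC a * y = 2^-1 * (2 * x + (toC a + toC a) * y) by field.
  by rewrite P0 !mulr0.
rewrite addNr toC0 mul0r addr0 => /eqP; rewrite mulf_eq0 (negbTE t0) /= => /eqP ->.
by rewrite add0r mulrA -toCM.
Qed.

Lemma cA_ortho h q d (z : C) : h q d = 0 -> cA h (z *: q) d = 0.
Proof. by move=> e; rewrite /cA hfZ e mulr0 im0 toC0 mulr0. Qed.

Lemma nabla_Jk_ortho h q k f v d : h q d = 0 -> cyl q U -> nk k -> BC h 2 U f -> U v ->
  nabla h d (Jk h q k f) v = Jk h q k (nabla h d f) v.
Proof.
move=> e cU kn Hf Uv; rewrite (nabla_Jk oU cU d kn Hf Uv).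
rewrite (@Jk_extk _ _ h q (ell h q d k) (fun s t => 0 * k s t)); last first.
  by move=> s t; rewrite /ell (cA_ortho _ e) mulr0 mul0r.
by rewrite (JkZk oU cU 0 kn (BCW Hf) Uv) mul0r addr0.
Qed.

Lemma dbar_Jk_ortho h q k f v p : h q p = 0 -> cyl q U -> nk k -> BC h 2 U f -> U v ->
  dbar h p (Jk h q k f) v = Jk h q k (dbar h p f) v.
Proof. by move=> e cU kn Hf Uv; rewrite (dbar_Jk oU cU p kn Hf Uv) e mul0r addr0. Qed.

Lemma dbar_Top h q a f v p : h q p = 0 -> cyl q U -> a != 0 -> SB h U f -> U v ->
  dbar h p (Top h q a f) v = Top h q a (dbar h p f) v.
Proof.
move=> e cU a0 Hf Uv; have N0 := nk_gk (nab0 a0) 0 (-1).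
by rewrite (dbarZ _ _ _ (SB_sm oU (SB_Jk oU cU N0 Hf)) Uv) (dbar_Jk_ortho e cU N0 (Hf 2) Uv).
Qed.

Lemma nabla_Sop h q a f v d : h q d = 0 -> cyl q U -> a != 0 -> SB h U f -> U v ->
  nabla h d (Sop h q a f) v = Sop h q a (nabla h d f) v.
Proof.
move=> e cU a0 Hf Uv; have N0 := nk_gk (nab0 a0) 1 0.
rewrite {1}/nabla (haspd_pd (haspdZ _ (BC_has d (BC_Jk oU cU N0 (Hf 2)) Uv))).
rewrite /Sop -(nabla_Jk_ortho e cU N0 (Hf 2) Uv) /nabla; ring.
Qed.

Lemma Top_ext h q a f f' v : cyl q U -> (forall w, U w -> f w = f' w) -> U v -> Top h q a f v = Top h q a f' v.
Proof. by move=> cU e Uv; rewrite /Top (Jk_ext h cU _ e Uv). Qed.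
Lemma Sop_ext h q a f f' v : cyl q U -> (forall w, U w -> f w = f' w) -> U v -> Sop h q a f v = Sop h q a f' v.
Proof. by move=> cU e Uv; rewrite /Sop (Jk_ext h cU _ e Uv). Qed.

Lemma TopD h q a f f' v : cyl q U -> a != 0 -> SB h U f -> SB h U f' -> U v ->
  Top h q a (fun w => f w + f' w) v = Top h q a f v + Top h q a f' v.
Proof. by move=> cU a0 H H' Uv; rewrite /Top (JkD oU cU (nk_gk (nab0 a0) _ _) (H 1%N) (H' 1%N) Uv) mulrDr. Qed.
Lemma TopZ h q a f c v : cyl q U -> a != 0 -> SB h U f -> U v ->
  Top h q a (fun w => c * f w) v = c * Top h q a f v.
Proof. by move=> cU a0 H Uv; rewrite /Top (JkZ oU cU c (nk_gk (nab0 a0) _ _) (H 1%N) Uv) mulrCA. Qed.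
Lemma SopD h q a f f' v : cyl q U -> a != 0 -> SB h U f -> SB h U f' -> U v ->
  Sop h q a (fun w => f w + f' w) v = Sop h q a f v + Sop h q a f' v.
Proof. by move=> cU a0 H H' Uv; rewrite /Sop (JkD oU cU (nk_gk (nab0 a0) _ _) (H 1%N) (H' 1%N) Uv) mulrDr. Qed.
Lemma SopZ h q a f c v : cyl q U -> a != 0 -> SB h U f -> U v ->
  Sop h q a (fun w => c * f w) v = c * Sop h q a f v.
Proof. by move=> cU a0 H Uv; rewrite /Sop (JkZ oU cU c (nk_gk (nab0 a0) _ _) (H 1%N) Uv) mulrCA. Qed.

Lemma Sop_neg h q a f v : cyl q U -> a != 0 -> SB h U f -> U v ->
  cconj (Sop h q a f v) = Sop (hneg h) q (- a) (cf f) v.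
Proof.
move=> cU a0 Hf Uv; have N0 := nk_gk (nab0 a0) 1 0.
rewrite /Sop normrN cconjM cconj_toC; congr (_ * _).
rewrite /Jk -(cI_conj (ccOn_inn oU cU N0 (Hf 1%N) Uv)); apply: cI_ext => s _.
rewrite /inn -(cI_conj (ccOn_inn_t oU cU s N0 (Hf 1%N) Uv)); apply: cI_ext => t _.
rewrite !cconjM /Gk /Ek cconj_cexp -cA_neg; congr (_ * _ * _).
by rewrite /gk; case: ifP => _; rewrite ?cconj0// mul0r cis0 mulr1 cconj_toC.
Qed.

Definition auto h (l : V) f := forall v, U v -> f (v + l) = cexp (cA h v l) * f v.

(** The factor of automorphy at v - z q differs from that at v by exp(- cA(z q, l)), which the
    change of the phase [Ek] from v to v + l compensates. *)
Lemma Jk_auto h q k f l : cyl q U -> nk k -> SB h U f ->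
  auto h l f -> auto h l (Jk h q k f).
Proof.
move=> cU kn Hf H v Uv; rewrite /Jk -(cIZ _ (ccOn_inn oU cU kn (Hf 1%N) Uv)); apply: cI_ext => s _.
rewrite /inn -(cIZ _ (ccOn_inn_t oU cU s kn (Hf 1%N) Uv)); apply: cI_ext => t _.
rewrite /Gk /Ek addrAC H; last exact: cU.
rewrite cAB cADr !cexpD; have := cexpNK (cA h (zt s t *: q) l).
move: (cexp (cA h (zt s t *: q) l)) (cexp (- _)) (f _) => x y z xy.
have -> : cexp (cA h v l) * y * z * (cexp (cA h (zt s t *: q) v) * x) * k s t =
  x * y * (cexp (cA h v l) * (z * cexp (cA h (zt s t *: q) v) * k s t)) by ring.
by rewrite xy mul1r.
Qed.

Lemma autoZ h l f c : auto h l f -> auto h l (fun v => c * f v).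
Proof. by move=> H v Uv; rewrite H// mulrCA. Qed.

Lemma Top_auto h q a f l : cyl q U -> a != 0 -> SB h U f -> auto h l f -> auto h l (Top h q a f).
Proof. by move=> cU a0 Hf H; apply: autoZ; apply: Jk_auto => //; exact: nk_gk (nab0 a0) _ _. Qed.
Lemma Sop_auto h q a f l : cyl q U -> a != 0 -> SB h U f -> auto h l f -> auto h l (Sop h q a f).
Proof. by move=> cU a0 Hf H; apply: autoZ; apply: Jk_auto => //; exact: nk_gk (nab0 a0) _ _. Qed.

(* Sections killed by [sdb] in a direction are exactly the fixed points of the
   Gaussian average [Sop]: holomorphic if a > 0, antiholomorphic if a < 0. *)
Definition sdb h q a f v : C := if 0 < a then dbar h q f v else dop h q f v.

Lemma SB_neg h f : SB h U f -> SB (hneg h) U (cf f).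
Proof. by move=> H n; apply: BC_neg. Qed.

Lemma sdb_neg h q a f v : a != 0 -> SB h U f -> U v ->
  sdb h q a f v = if 0 < a then dbar h q f v else cconj (sdb (hneg h) q (- a) (cf f) v).
Proof.
move=> a0 Hf Uv; rewrite /sdb; case: ltP => // sa.
by rewrite oppr_gt0 lt_neqAle a0 sa /= (dop_neg _ (Hf 1%N) Uv).
Qed.

Lemma hneg_qq h q a : h q q = toC a -> hneg h q q = toC (- a).
Proof. by move=> e; rewrite /= e toCN. Qed.

Lemma sdb_S h q a f v : h q q = toC a -> cyl q U -> a != 0 -> SB h U f -> U v ->
  sdb h q a (Sop h q a f) v = 0.
Proof.
move=> hqq cU a0 Hf Uv; rewrite /sdb; case: ltP => sa.
  by rewrite (dbar_S hqq cU a0 Hf Uv) sa.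
rewrite (dop_neg _ (SB_Sop cU a0 Hf 1%N) Uv).
have e w : U w -> cf (Sop h q a f) w = Sop (hneg h) q (- a) (cf f) w by move=> Uw; exact: Sop_neg.
rewrite (dbar_ext _ _ oU Uv e).
have na : - a != 0 by rewrite oppr_eq0.
rewrite (dbar_S (hneg_qq hqq) cU na (SB_neg Hf) Uv).
by rewrite oppr_gt0 lt_neqAle a0 sa /= cconj0.
Qed.

Lemma Top0 h q a f v : cyl q U -> a != 0 -> SB h U f -> U v ->
  (forall w, U w -> f w = 0) -> Top h q a f v = 0.
Proof.
move=> cU a0 Hf Uv e; rewrite (@Top_ext _ _ _ _ (fun w => 0 * f w) _ cU _ Uv).
  by rewrite TopZ// mul0r.
by move=> w Uw; rewrite mul0r e.
Qed.

Lemma dbar0_S h q a f v : h q q = toC a -> cyl q U -> 0 < a -> SB h U f -> U v ->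
  (forall w, U w -> dbar h q f w = 0) -> Sop h q a f v = f v.
Proof.
move=> hqq cU sa Hf Uv e; have a0 : a != 0 by rewrite gt_eqF.
have := (dbar_T hqq cU a0 Hf Uv).1; rewrite sa (Top0 cU a0 (SB_dbar q oU Hf) Uv e).
by move=> /esym/eqP; rewrite subr_eq0 => /eqP ->.
Qed.

Lemma sdb0_S h q a f v : h q q = toC a -> cyl q U -> a != 0 -> SB h U f -> U v ->
  (forall w, U w -> sdb h q a f w = 0) -> Sop h q a f v = f v.
Proof.
move=> hqq cU a0 Hf Uv; rewrite /sdb; case: ltP => sa e; first exact: dbar0_S.
rewrite -[LHS]cconjK (Sop_neg cU a0 Hf Uv) (dbar0_S (hneg_qq hqq) cU _ (SB_neg Hf) Uv).
- by rewrite /cf cconjK.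
- by rewrite oppr_gt0 lt_neqAle a0 sa.
by move=> w Uw; rewrite -[LHS]cconjK -(dop_neg _ (Hf 1%N) Uw) e// cconj0.
Qed.

Lemma sdb_S_ortho h q a p b f v : h q p = 0 -> cyl q U -> a != 0 -> SB h U f -> U v ->
  sdb h p b (Sop h q a f) v = Sop h q a (sdb h p b f) v.
Proof.
move=> e cU a0 Hf Uv; have e' : h q (ci R *: p) = 0 by rewrite hfZr e mulr0.
have n1 := SB_nabla p Hf; have n2 := SBZ (ci R) oU (SB_nabla (ci R *: p) Hf).
have n3 : SB h U (fun w => - (ci R * nabla h (ci R *: p) f w)).
  by apply: (SB_ext oU _ (SBZ (-1) oU n2)) => w _; rewrite mulN1r.
rewrite /sdb; case: ltP => _.
  rewrite /dbar (nabla_Sop e cU a0 Hf Uv) (nabla_Sop e' cU a0 Hf Uv).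
  by rewrite (SopZ _ cU a0 (SBD oU n1 n2) Uv) (SopD cU a0 n1 n2 Uv) (SopZ _ cU a0 (SB_nabla (ci R *: p) Hf) Uv).
rewrite /dop (nabla_Sop e cU a0 Hf Uv) (nabla_Sop e' cU a0 Hf Uv).
rewrite (SopZ _ cU a0 (SBD oU n1 n3) Uv) (SopD cU a0 n1 n3 Uv); congr (_ * (_ + _)).
rewrite (@Sop_ext _ _ _ (fun w => - (ci R * nabla h (ci R *: p) f w)) (fun w => (- ci R) * nabla h (ci R *: p) f w) _ cU _ Uv).
  by rewrite (SopZ _ cU a0 (SB_nabla (ci R *: p) Hf) Uv) mulNr.
by move=> w _; rewrite mulNr.
Qed.

Lemma dbarS_bound h q a : h q q = toC a -> cyl q U -> a < 0 -> exists2 K : R, 0 <= K & forall f B v, SB h U f ->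
  (forall w, U w -> cn (f w) <= B) -> (forall w, U w -> Sop h q a f w = f w) -> U v ->
  cn (dbar h q f v) <= K * B.
Proof.
move=> hqq cU sa; have a0 : a != 0 by rewrite lt_eqF.
have [K K0 H] := Jk_bound h oU cU (nk_gk (nab0 a0) 2 1).
exists (`| (`|a| / pi * a) | * K); first by rewrite mulr_ge0.
move=> f B v Hf HB e Uv; rewrite -(dbar_ext _ _ oU Uv e) (dbar_S hqq cU a0 Hf Uv) ltNge (ltW sa) /=.
by rewrite cnMtoC -(mulrA _ K) ler_wpM2l// H.
Qed.

(** Such an f equals S f, and one of the components [dbar q], [dop q] of its gradient is zero. The
    other is a derivative of S f, hence a convolution of f by [dbar_S]. Sum and difference of the
    components are the two covariant derivatives, up to a factor i. *)
Lemma grad_bound h q a : h q q = toC a -> cyl q U -> a != 0 -> exists2 K : R, 0 <= K & forall f B v, SB h U f ->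
  (forall w, U w -> cn (f w) <= B) -> (forall w, U w -> sdb h q a f w = 0) -> U v ->
  cn (nabla h q f v) <= K * B /\ cn (nabla h (ci R *: q) f v) <= K * B.
Proof.
move=> hqq cU a0.
have nE f v : nabla h q f v = dbar h q f v + dop h q f v by rewrite /dbar /dop; gen_pd; field.
have nE' f v : ci R * nabla h (ci R *: q) f v = dbar h q f v - dop h q f v by rewrite /dbar /dop; gen_pd; field.
have [sa|sa] := ltP 0 a.
  have na : - a < 0 by rewrite oppr_lt0.
  have [K K0 H] := dbarS_bound (hneg_qq hqq) cU na; exists K => // f B v Hf HB e Uv.
  have k : cn (dop h q f v) <= K * B.
    rewrite (dop_neg _ (Hf 1%N) Uv) cn_conj; apply: H => //; first exact: SB_neg.
      by move=> w Uw; rewrite /cf cn_conj HB.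
    by move=> w Uw; rewrite -(Sop_neg cU a0 Hf Uw) (sdb0_S hqq cU a0 Hf Uw e).
  have := e v Uv; rewrite /sdb sa => e0.
  by rewrite -(cnMci (nabla h (ci R *: q) f v)) nE nE' e0 add0r sub0r cnN.
have na : a < 0 by rewrite lt_neqAle a0.
have [K K0 H] := dbarS_bound hqq cU na; exists K => // f B v Hf HB e Uv.
have k : cn (dbar h q f v) <= K * B.
  by apply: H => // w Uw; exact: (sdb0_S hqq cU a0 Hf Uw e).
have := e v Uv; rewrite /sdb ltNge sa /= => e0.
by rewrite -(cnMci (nabla h (ci R *: q) f v)) nE nE' e0 addr0 subr0.
Qed.

End TandS.

(** * Cech cohomology of sheaves of functions *)

Section Cech.

Variables (V : choiceType) (K : fieldType).
Implicit Types (U : set V) (W : V -> set V) (f : V -> K) (s t : seq V) (x y : V) (p n : nat).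

(** The alternating Cech differential: either the head is omitted or it is kept and the differential
    acts on the tail with the opposite sign. Recursion on lists replaces face maps and sign
    bookkeeping. *)
Fixpoint dl (c : seq V -> K) (s : seq V) : K :=
  if s is x :: s' then c s' - dl (fun t => c (x :: t)) s' else 0.

(** The prism operator for the change of index map from the identity to tau. *)
Fixpoint hmt (tau : V -> V) (c : seq V -> K) (s : seq V) : K :=
  if s is x :: s' then c (x :: tau x :: map tau s') - hmt tau (fun t => c (x :: t)) s' else 0.

Lemma dl_lin a c c' s : dl (fun t => c t + a * c' t) s = dl c s + a * dl c' s.
Proof. by elim: s c c' => [|x s IH] c c' /=; rewrite ?mulr0 ?addr0// IH; ring. Qed.

Lemma hmt_lin tau a c c' s : hmt tau (fun t => c t + a * c' t) s = hmt tau c s + a * hmt tau c' s.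
Proof. by elim: s c c' => [|x s IH] c c' /=; rewrite ?mulr0 ?addr0// IH; ring. Qed.

Lemma sub_cons x s t : {subset t <= s} -> {subset x :: t <= x :: s}.
Proof. by move=> ts z; rewrite !inE => /orP[->//|/ts ->]; rewrite orbT. Qed.

Lemma sub_cons_map tau x s t : {subset t <= s ++ map tau s} ->
  {subset x :: t <= (x :: s) ++ map tau (x :: s)}.
Proof.
move=> ts z; rewrite inE => /orP[/eqP ->|/ts]; first by rewrite inE eqxx.
by rewrite !mem_cat !inE => /orP[->|->]; rewrite ?orbT.
Qed.

Lemma dl_ext n c c' s : size s = n.+1 -> (forall t, {subset t <= s} -> size t = n -> c t = c' t) ->
  dl c s = dl c' s.
Proof.
elim: s n c c' => [|x s IH] // n c c' /= [sz] e.
rewrite e//; last by move=> y ys; rewrite inE ys orbT.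
congr (_ - _); case: s IH sz e => [|y s] IH // sz e.
apply: (IH (size s)) => // t ts tz; apply: e; last by rewrite /= tz -sz.
exact: sub_cons.
Qed.

Lemma hmt_ext tau n c c' s : size s = n.+1 ->
  (forall t, {subset t <= s ++ map tau s} -> size t = n.+2 -> c t = c' t) ->
  hmt tau c s = hmt tau c' s.
Proof.
elim: s n c c' => [|x s IH] // n c c' /= [sz] e.
rewrite e; last by rewrite /= size_map sz.
  congr (_ - _); case: s IH sz e => [|y s] IH // sz e.
  apply: (IH (size s)) => // t ts tz; apply: e; last by rewrite /= tz -sz.
  exact: (@sub_cons_map tau x (y :: s) t ts).
move=> z; rewrite !inE mem_cat !inE => /or3P[->|->|->]; rewrite ?orbT//.
Qed.

Lemma dl0 s : dl (fun=> 0) s = 0.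
Proof. by elim: s => [|x s IH] //=; rewrite IH subrr. Qed.
Lemma hmt0 tau s : hmt tau (fun=> 0) s = 0.
Proof. by elim: s => [|x s IH] //=; rewrite IH subrr. Qed.

Lemma dl_eq c c' s : c =1 c' -> dl c s = dl c' s.
Proof. by move=> /funext ->. Qed.

Lemma dlB c c' s : dl (fun t => c t - c' t) s = dl c s - dl c' s.
Proof. by rewrite -mulN1r -dl_lin; apply: dl_eq => t; rewrite mulN1r. Qed.
Lemma hmtB tau c c' s : hmt tau (fun t => c t - c' t) s = hmt tau c s - hmt tau c' s.
Proof. by rewrite -mulN1r -hmt_lin; congr (hmt _ _ s); apply/funext => t; rewrite mulN1r. Qed.

Lemma dldl c s : dl (dl c) s = 0.
Proof.
elim: s c => [|x s IH] c //=.
by rewrite (dlB c (fun t => dl (fun t => c (x :: t)) t)) IH subr0 subrr.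
Qed.

Lemma dl_map tau c s : dl (fun t => c (map tau t)) s = dl c (map tau s).
Proof. by elim: s c => [|x s IH] c //=; rewrite (IH (fun t => c (tau x :: t))). Qed.

Lemma homotopy tau c s : dl (hmt tau c) s + hmt tau (dl c) s = c (map tau s) - c s.
Proof.
elim: s c => [|x s IH] c /=; first by rewrite addr0 subrr.
rewrite (dlB (fun t => c [:: x, tau x & map tau t])) (dl_map tau (fun t => c [:: x, tau x & t])).
rewrite (hmtB tau c (fun t => dl (fun t => c (x :: t)) t)).
have := IH (fun t => c (x :: t)); move: (dl _ _) (hmt _ _ _) (dl _ _) (hmt _ _ _) => a b d e.
move=> h; have -> : c (tau x :: map tau s) - c (x :: s) =
  c (tau x :: map tau s) - c (x :: map tau s) + (c (x :: map tau s) - c (x :: s)) by ring.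
by rewrite -h; ring.
Qed.

Variable opn : set V -> Prop.
Hypotheses (opnT : opn setT) (opnI : forall U U', opn U -> opn U' -> opn (U `&` U')).

Definition cov (W : V -> set V) := forall x, opn (W x) /\ W x x.
Definition ov (W : V -> set V) s : set V := [set v | forall x, x \in s -> W x v].

Lemma ov_cons W x s : ov W (x :: s) = W x `&` ov W s.
Proof.
apply/seteqP; split=> v /= h.
  by split; [apply: h; rewrite inE eqxx|move=> y ys; apply: h; rewrite inE ys orbT].
by move=> y; rewrite inE => /orP[/eqP ->|]; [exact: h.1|exact: h.2].
Qed.

Lemma opn_ov W s : cov W -> opn (ov W s).
Proof.
move=> cW; elim: s => [|x s IH]; last by rewrite ov_cons; apply: opnI => //; case: (cW x).
by rewrite (_ : ov W [::] = setT)//; apply/seteqP; split.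
Qed.

Lemma ov_sub W s t : {subset t <= s} -> ov W s `<=` ov W t.
Proof. by move=> ts v h x /ts; exact: h. Qed.

Lemma ov_mono W W' s : (forall x, W' x `<=` W x) -> ov W' s `<=` ov W s.
Proof. by move=> h v H x /H; exact: h. Qed.

Definition capc W W' : V -> set V := fun x => W x `&` W' x.
Lemma cov_cap W W' : cov W -> cov W' -> cov (capc W W').
Proof. by move=> h h' x; have [? ?] := h x; have [? ?] := h' x; split; [exact: opnI|]. Qed.
Lemma capl W W' x : capc W W' x `<=` W x. Proof. by move=> v []. Qed.
Lemma capr W W' x : capc W W' x `<=` W' x. Proof. by move=> v []. Qed.
Lemma covT : cov (fun=> setT). Proof. by move=> x; split. Qed.

(** Sheaves of subspaces of K-valued functions: sections are total functions that count only on U,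
    so that restriction is the identity on functions and gluing reduces to the local nature of the
    defining condition. *)
Record sheaf := Sheaf {
  sec :> set V -> (V -> K) -> Prop;
  sec_sub : forall U U' f, opn U' -> U' `<=` U -> sec U f -> sec U' f;
  sec_ext : forall U f f', opn U -> (forall v, U v -> f v = f' v) -> sec U f -> sec U f';
  sec_lin : forall U f f' a, opn U -> sec U f -> sec U f' -> sec U (fun v => f v + a * f' v);
  sec0 : forall U, opn U -> sec U (fun=> 0);
  sec_loc : forall U f, opn U ->
    (forall v, U v -> exists U', [/\ opn U', U' v & sec (U `&` U') f]) -> sec U f }.

Record isop (F : sheaf) (D : (V -> K) -> V -> K) : Prop := IsOp {
  op_sec : forall U f, opn U -> F U f -> F U (D f);
  op_ext : forall U f f', opn U -> (forall v, U v -> f v = f' v) -> F U f ->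
    forall v, U v -> D f v = D f' v;
  op_lin : forall U f f' a, opn U -> F U f -> F U f' -> forall v, U v ->
    D (fun v => f v + a * f' v) v = D f v + a * D f' v }.

Lemma sec_dl (F : sheaf) U n (c : seq V -> V -> K) s : opn U -> size s = n.+1 ->
  (forall t, {subset t <= s} -> size t = n -> F U (c t)) -> F U (fun v => dl (c^~ v) s).
Proof.
move=> oU; elim: s n c => [|x s IH] // n c /= [sz] e.
have h1 : F U (c s) by apply: e => // y ys; rewrite inE ys orbT.
case: s IH sz e h1 => [|y s] IH sz e h1.
  by apply: (sec_ext oU _ h1) => v _ /=; rewrite subr0.
have h2 := IH (size s) (fun t => c (x :: t)) erefl.
apply: (sec_ext oU _ (sec_lin (-1) oU h1 (h2 _))); first by move=> v _; rewrite mulN1r.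
move=> t ts tz; apply: e; last by rewrite /= tz -sz.
exact: sub_cons.
Qed.

Lemma sec_hmt (F : sheaf) U tau n (c : seq V -> V -> K) s : opn U -> size s = n.+1 ->
  (forall t, {subset t <= s ++ map tau s} -> size t = n.+2 -> F U (c t)) ->
  F U (fun v => hmt tau (c^~ v) s).
Proof.
move=> oU; elim: s n c => [|x s IH] // n c /= [sz] e.
have h1 : F U (c [:: x, tau x & map tau s]).
  apply: e; last by rewrite /= size_map sz.
  by move=> z; rewrite !inE mem_cat !inE => /or3P[->|->|->]; rewrite ?orbT.
case: s IH sz e h1 => [|y s] IH sz e h1.
  by apply: (sec_ext oU _ h1) => v _ /=; rewrite subr0.
have h2 := IH (size s) (fun t => c (x :: t)) erefl.
apply: (sec_ext oU _ (sec_lin (-1) oU h1 (h2 _))); first by move=> v _; rewrite mulN1r.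
move=> t ts tz; apply: e; last by rewrite /= tz -sz.
exact: (@sub_cons_map tau x (y :: s) t ts).
Qed.

Lemma op_dl (F : sheaf) D U n (c : seq V -> V -> K) s : isop F D -> opn U -> size s = n.+1 ->
  (forall t, {subset t <= s} -> size t = n -> F U (c t)) -> forall v, U v ->
  D (fun v => dl (c^~ v) s) v = dl (fun t => D (c t) v) s.
Proof.
move=> iD oU; elim: s n c => [|x s IH] // n c /= [sz] e v Uv.
have h1 : F U (c s) by apply: e => // y ys; rewrite inE ys orbT.
case: s IH sz e h1 => [|y s] IH sz e h1.
  rewrite subr0; apply/esym.
  by apply: (op_ext iD oU _ h1) => // w _ /=; rewrite subr0.
have es t : {subset t <= y :: s} -> size t = size s -> F U (c (x :: t)).
  move=> ts tz; apply: e; last by rewrite /= tz -sz.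
  exact: sub_cons.
have h2 := sec_dl oU (erefl (size (y :: s))) es.
rewrite -(IH (size s) (fun t => c (x :: t)) erefl es v Uv) -mulN1r -(op_lin iD _ oU h1 h2 Uv).
by apply/esym/(op_ext iD oU _ (sec_lin (-1) oU h1 h2)) => // w _; rewrite mulN1r.
Qed.

Definition cch := seq V -> V -> K.
Implicit Types (c b e : cch) (F : sheaf).

Definition lc c (a : K) c' : cch := fun s v => c s v + a * c' s v.
Definition dC c : cch := fun s v => dl (c^~ v) s.
Definition opC (D : (V -> K) -> V -> K) c : cch := fun s => D (c s).
Definition mapC tau c : cch := fun s => c (map tau s).
Definition isC F W p c := forall s, size s = p.+1 -> F (ov W s) (c s).
Definition eqc W p c c' := forall s v, size s = p.+1 -> ov W s v -> c s v = c' s v.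
Definition zc : cch := fun _ _ => 0.

Definition Zc F p c := exists W, [/\ cov W, isC F W p c & eqc W p.+1 (dC c) zc].
Definition Bc F p c := match p with
  | 0 => exists W, cov W /\ eqc W 0 c zc
  | p'.+1 => exists W b, [/\ cov W, isC F W p' b & eqc W p'.+1 c (dC b)]
  end.

Lemma isC_sub F W W' p c : cov W' -> (forall x, W' x `<=` W x) -> isC F W p c -> isC F W' p c.
Proof. by move=> cW' h H s sz; apply: sec_sub (H s sz); [exact: opn_ov|exact: ov_mono]. Qed.
Lemma eqc_sub W W' p c c' : (forall x, W' x `<=` W x) -> eqc W p c c' -> eqc W' p c c'.
Proof. by move=> h H s v sz /(ov_mono h); exact: H. Qed.
Lemma isC_ext F W p c c' : cov W -> eqc W p c c' -> isC F W p c -> isC F W p c'.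
Proof. by move=> cW e H s sz; apply: sec_ext (H s sz); [exact: opn_ov|move=> v; exact: e]. Qed.
Lemma isC_lc F W p c a c' : cov W -> isC F W p c -> isC F W p c' -> isC F W p (lc c a c').
Proof. by move=> cW H H' s sz; apply: sec_lin; [exact: opn_ov|exact: H|exact: H']. Qed.
Lemma isC0 F W p : cov W -> isC F W p zc.
Proof. by move=> cW s sz; apply: sec0; exact: opn_ov. Qed.
Lemma eqc_sym W p c c' : eqc W p c c' -> eqc W p c' c.
Proof. by move=> e s v sz vs; rewrite e. Qed.
Lemma eqc_lc W p a c c' b b' : eqc W p c b -> eqc W p c' b' -> eqc W p (lc c a c') (lc b a b').
Proof. by move=> e e' s v sz vs; rewrite /lc e// e'. Qed.
Lemma eqc_trans W p b c c' : eqc W p c b -> eqc W p b c' -> eqc W p c c'.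
Proof. by move=> e e' s v sz vs; rewrite e// e'. Qed.

Lemma dC_lc c a c' : dC (lc c a c') = lc (dC c) a (dC c').
Proof. by apply/funext => s; apply/funext => v; exact: dl_lin. Qed.
Lemma dC0 : dC zc = zc. Proof. by apply/funext => s; apply/funext => v; exact: dl0. Qed.
Lemma dCdC c : dC (dC c) = zc. Proof. by apply/funext => s; apply/funext => v; exact: dldl. Qed.
Lemma dC_map tau c : dC (mapC tau c) = mapC tau (dC c).
Proof. by apply/funext => s; apply/funext => v; exact: (dl_map tau (c^~ v)). Qed.
Lemma lc0 c a : lc c a zc = c.
Proof. by apply/funext => s; apply/funext => v; rewrite /lc mulr0 addr0. Qed.
Lemma lcN c : lc c (-1) c = zc.
Proof. by apply/funext => s; apply/funext => v; rewrite /lc mulN1r subrr. Qed.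

Lemma dC_isC F W p c : cov W -> isC F W p c -> isC F W p.+1 (dC c).
Proof.
move=> cW H s sz; apply: (sec_dl _ sz); first exact: opn_ov.
by move=> t ts tz; apply: sec_sub (H t tz); [exact: opn_ov|exact: ov_sub].
Qed.

Lemma dC_eqc W p c c' : eqc W p c c' -> eqc W p.+1 (dC c) (dC c').
Proof.
move=> e s v sz vs; apply: (dl_ext sz) => t ts tz; apply: e => //.
exact: ov_sub ts _ vs.
Qed.

Lemma opC_isC F D W p c : isop F D -> cov W -> isC F W p c -> isC F W p (opC D c).
Proof. by move=> iD cW H s sz; apply: (op_sec iD); [exact: opn_ov|exact: H]. Qed.

Lemma opC_eqc F D W p c c' : isop F D -> cov W -> isC F W p c -> eqc W p c c' ->
  eqc W p (opC D c) (opC D c').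
Proof.
move=> iD cW H e s v sz vs; apply: (op_ext iD _ _ (H s sz)) vs; first exact: opn_ov.
by move=> w; exact: e.
Qed.

Lemma opC_lc F D W p c a c' : isop F D -> cov W -> isC F W p c -> isC F W p c' ->
  eqc W p (opC D (lc c a c')) (lc (opC D c) a (opC D c')).
Proof. by move=> iD cW H H' s v sz vs; apply: (op_lin iD a _ (H s sz) (H' s sz)) vs; exact: opn_ov. Qed.

Lemma opC_dC F D W p c : isop F D -> cov W -> isC F W p c ->
  eqc W p.+1 (opC D (dC c)) (dC (opC D c)).
Proof.
move=> iD cW H s v sz vs; apply: (op_dl iD _ sz) vs; first exact: opn_ov.
by move=> t ts tz; apply: sec_sub (H t tz); [exact: opn_ov|exact: ov_sub].
Qed.

Lemma op0 F D U v : isop F D -> opn U -> U v -> D (fun=> 0) v = 0.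
Proof.
move=> iD oU Uv; have h := sec0 F oU.
have e : D (fun w => 0 + -1 * 0) v = 0 by rewrite (op_lin iD (-1) oU h h Uv) mulN1r subrr.
by rewrite -[RHS]e; apply: (op_ext iD oU _ h) => // w _; rewrite mulr0 addr0.
Qed.

Lemma opC0 F D W p c : isop F D -> cov W -> eqc W p c zc -> eqc W p (opC D c) zc.
Proof.
move=> iD cW e; have z := @isC0 F W p cW.
apply: (eqc_trans (eqc_sym (opC_eqc iD cW z (eqc_sym e)))) => s v sz vs.
exact: op0 iD (opn_ov s cW) vs.
Qed.

Lemma Zc_lc F p c a c' : Zc F p c -> Zc F p c' -> Zc F p (lc c a c').
Proof.
move=> [W [cW H e]] [W' [cW' H' e']]; have cc := cov_cap cW cW'; exists (capc W W'); split=> //.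
  by apply: isC_lc => //; [apply: isC_sub H|apply: isC_sub H'] => // x; [exact: capl|exact: capr].
rewrite dC_lc -(lc0 zc a); apply: eqc_lc; [apply: eqc_sub e|apply: eqc_sub e'] => x; [exact: capl|exact: capr].
Qed.

Lemma Bc_lc F p c a c' : Bc F p c -> Bc F p c' -> Bc F p (lc c a c').
Proof.
case: p => [|p] /=.
  move=> [W [cW e]] [W' [cW' e']]; have cc := cov_cap cW cW'; exists (capc W W'); split=> //.
  by rewrite -(lc0 zc a); apply: eqc_lc; [apply: eqc_sub e|apply: eqc_sub e'] => x; [exact: capl|exact: capr].
move=> [W [b [cW H e]]] [W' [b' [cW' H' e']]]; have cc := cov_cap cW cW'.
exists (capc W W'), (lc b a b'); split=> //.
  by apply: isC_lc => //; [apply: isC_sub H|apply: isC_sub H'] => // x; [exact: capl|exact: capr].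
by rewrite dC_lc; apply: eqc_lc; [apply: eqc_sub e|apply: eqc_sub e'] => x; [exact: capl|exact: capr].
Qed.

Lemma Bc_eqc F p W c : cov W -> eqc W p c zc -> Bc F p c.
Proof.
move=> cW; case: p => [|p] e /=; first by exists W.
by exists W, zc; split=> //; [exact: isC0|rewrite dC0].
Qed.

Lemma Bc_ext F p W c c' : cov W -> eqc W p c c' -> Bc F p c -> Bc F p c'.
Proof.
move=> cW e H; have k : Bc F p (lc c' (-1) c).
  by apply: (Bc_eqc F cW) => s v sz vs; rewrite /lc mulN1r e// subrr.
have := Bc_lc 1 H k; congr (Bc F p _); apply/funext => s; apply/funext => v.
by rewrite /lc mulN1r mul1r addrC subrK.
Qed.

Lemma Zc_ext F p W c c' : cov W -> eqc W p c c' -> Zc F p c -> Zc F p c'.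
Proof.
move=> cW e [W' [cW' H z]]; have cc := cov_cap cW cW'; exists (capc W W'); split=> //.
  apply: (isC_ext cc) (isC_sub cc _ H); last by move=> x; exact: capr.
  by apply: eqc_sub e => x; exact: capl.
apply: eqc_trans (eqc_sub _ z); last by move=> x; exact: capr.
by apply: dC_eqc; apply: eqc_sub (eqc_sym e) => x; exact: capl.
Qed.

(** The prism operator writes c o tau - c as a coboundary plus its value on [dC c], which is zero
    because the indices of both kinds overlap within W. In degree 0 the coboundary term is itself
    zero. *)
Lemma refineB F p W W' tau c : cov W -> cov W' -> (forall x, W' x `<=` W x `&` W (tau x)) ->
  isC F W p c -> eqc W p.+1 (dC c) zc -> Bc F p (lc (mapC tau c) (-1) c).
Proof.
move=> cW cW' h H z.
have ovt s : ov W' s `<=` ov W (s ++ map tau s).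
  move=> v vs x; rewrite mem_cat => /orP[/vs/h[]//|/mapP[y /vs/h[_ ?] ->//]].
have zero s v : size s = p.+1 -> ov W' s v -> hmt tau (dl (c^~ v)) s = 0.
  move=> sz vs; rewrite (@hmt_ext tau p _ (fun=> 0) s sz) ?hmt0// => t ts tz.
  by apply: z => //; exact: ov_sub ts _ (ovt _ _ vs).
case: p H z zero => [|p] H z zero.
  exists W'; split=> // s v sz vs; rewrite /lc mulN1r /mapC -(homotopy tau (c^~ v)) zero// addr0.
  by case: s sz vs => [|x [|y s]] //= _ vs; rewrite subrr.
exists W', (fun s v => hmt tau (c^~ v) s); split=> //.
  move=> s sz; apply: (sec_hmt _ sz); first exact: opn_ov.
  move=> t ts tz; apply: sec_sub (H t tz); first exact: opn_ov.
  by move=> v /ovt; exact: ov_sub.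
by move=> s v sz vs; rewrite /lc mulN1r /mapC -(homotopy tau (c^~ v)) zero// addr0.
Qed.

Lemma isC_map F W W' tau p c : cov W' -> (forall x, W' x `<=` W (tau x)) -> isC F W p c ->
  isC F W' p (mapC tau c).
Proof.
move=> cW' h H s sz; have sz' : size (map tau s) = p.+1 by rewrite size_map.
apply: sec_sub (H _ sz'); first exact: opn_ov.
by move=> v vs _ /mapP[y ys ->]; apply: h; exact: vs.
Qed.

Lemma eqc_map W W' tau p c c' : (forall x, W' x `<=` W (tau x)) -> eqc W p c c' ->
  eqc W' p (mapC tau c) (mapC tau c').
Proof.
move=> h e s v sz vs; apply: e; first by rewrite size_map.
by move=> _ /mapP[y ys ->]; apply: h; exact: vs.
Qed.

(** What is used of compactness and normality: open shrinkings N, finitely many of which cover, with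
    the closure of N y contained in W y. *)
Hypothesis shrink : forall W, cov W -> exists (I : seq V) (N : V -> set V) (tau : V -> V),
  [/\ (forall x, opn (N x)), (forall x, N x `<=` W x), (forall x, tau x \in I /\ N (tau x) x)
    & forall y x, W y x \/ exists U', [/\ opn U', U' x & forall v, U' v -> ~ N y v]].

Definition lsurj F (D : (V -> K) -> V -> K) := forall U f x, opn U -> F U f -> U x ->
  exists U' u, [/\ opn U', U' x, U' `<=` U, F U' u & forall v, U' v -> D u v = f v].

Lemma fin_nbhd (T : Type) (l : seq T) (P : T -> set V -> Prop) x :
  (forall (t : T) U U', P t U -> opn U' -> U' `<=` U -> P t U') ->
  (forall t : T, exists U, [/\ opn U, U x & P t U]) ->
  exists U, [/\ opn U, U x & forall n (t0 : T), (n < size l)%N -> P (nth t0 l n) U].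
Proof.
move=> mono ex; elim: l => [|t l [U [oU Ux H]]]; first by exists setT; split.
have [U' [oU' Ux' H']] := ex t; exists (U `&` U'); split; [exact: opnI|by []|].
move=> [|n] t0 /= ln.
  by apply: mono H' _ _; [exact: opnI|move=> v []].
by apply: mono (H n t0 ln) _ _; [exact: opnI|move=> v []].
Qed.

Fixpoint allseqs (I : seq V) n : seq (seq V) :=
  if n is n'.+1 then [seq x :: t | x <- I, t <- allseqs I n'] else [:: [::]].

Lemma allseqsP I n t : size t = n -> {subset t <= I} -> t \in allseqs I n.
Proof.
elim: n t => [|n IH] [|x t] //= [sz] ts; apply/allpairsP; exists (x, t); split=> //=.
  by apply: ts; rewrite inE eqxx.
by apply: IH => // y yt; apply: ts; rewrite inE yt orbT.
Qed.

(** Local solvability gives a solution near each point for one tuple of indices at a time. With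
    indices in the finite set [I] there are finitely many tuples of the given length, so every x has
    a neighbourhood that suits all of them: a tuple is either solved there, or has an overlap of
    shrinkings that misses it. The map tau brings arbitrary indices into [I]. *)
Lemma lift_cochain F D W p e : cov W -> isC F W p e -> lsurj F D -> exists W' tau e',
  [/\ cov W', forall x, W' x `<=` W x `&` W (tau x), isC F W' p e' &
    eqc W' p (opC D e') (mapC tau e)].
Proof.
move=> cW H ls; have [I [N [tau [oN NW tN sep]]]] := shrink cW.
pose ovN s := ov N s.
pose P (t : seq V) (U : set V) := size t = p.+1 -> 
  (exists u, forall U', opn U' -> U' `<=` U -> U' `<=` ov W t -> F U' u /\ forall v, U' v -> D u v = e t v)
  \/ (forall v, U v -> ~ ovN t v).
have ex x : exists U, [/\ opn U, U x & forall n t0, (n < size (allseqs I p.+1))%N -> P (nth t0 (allseqs I p.+1) n) U].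
  apply: fin_nbhd => [t U U' Pt oU' s sz|t].
    case: (Pt sz) => [[u Hu]|Hn]; [left|right=> v /s; exact: Hn].
    by exists u => U2 o2 s2; apply: Hu => //; exact: subset_trans s.
  have [sz|sz] := eqVneq (size t) p.+1; last first.
    by exists setT; split=> // sz'; rewrite sz' eqxx in sz.
  have [[y yt [U [oU Ux Hn]]]|nex] := pselect (exists2 y, y \in t & exists U', [/\ opn U', U' x & forall v, U' v -> ~ N y v]).
    by exists U; split=> // _; right=> v Uv Nv; apply: (Hn v Uv); apply: Nv.
  have Wx : ov W t x.
    by move=> y yt; case: (sep y x) => // ?; case: nex; exists y.
  have [U [u [oU Ux sU Fu Du]]] := ls _ _ _ (opn_ov t cW) (H t sz) Wx.
  exists U; split=> // _; left; exists u => U' oU' s' _; split; first exact: sec_sub Fu.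
  by move=> v /s'; exact: Du.
have [U HU] := choice ex.
pose W' x := (W x `&` N (tau x)) `&` U x.
have cW' : cov W'.
  move=> x; have [oW Wx] := cW x; have [oU Ux _] := HU x; have [_ Nx] := tN x.
  by split; [apply: opnI => //; apply: opnI|].
have sol s : exists u, size s = p.+1 -> F (ov W' s) u /\ forall v, ov W' s v -> D u v = e (map tau s) v.
  case: s => [|x s]; first by exists (fun=> 0).
  have [oU Ux HP] := HU x.
  have [sz|sz] := eqVneq (size (x :: s)) p.+1; last by exists (fun=> 0) => sz'; rewrite sz' eqxx in sz.
  have mt : map tau (x :: s) \in allseqs I p.+1.
    apply: allseqsP; first by rewrite size_map.
    by move=> _ /mapP[y _ ->]; case: (tN y).
  have := HP (index (map tau (x :: s)) (allseqs I p.+1)) [::].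
  rewrite index_mem nth_index// => /(_ mt); rewrite /P size_map => /(_ sz).
  have sN : ov W' (x :: s) `<=` ovN (map tau (x :: s)).
    by move=> v vs _ /mapP[y ys ->]; case: (vs y ys) => [[]].
  have sW : ov W' (x :: s) `<=` ov W (map tau (x :: s)).
    by move=> v vs _ /mapP[y ys ->]; apply: NW; case: (vs y ys) => [[]].
  have sU : ov W' (x :: s) `<=` U x by rewrite ov_cons => v [[]].
  case=> [[u Hu]|Hn].
    by exists u => _; apply: Hu => //; exact: opn_ov.
  exists (fun=> 0) => _; split; first by apply: sec0; exact: opn_ov.
  by move=> v vs; case: (Hn v (sU v vs) (sN v vs)).
have [e' He'] := choice sol.
exists W', tau, e'; split=> //.
- by move=> x v [[Wv Nv] _]; split=> //; exact: NW.
- by move=> s sz; case: (He' s sz).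
by move=> s v sz vs; case: (He' s sz) => _; exact.
Qed.

Lemma glue F c : Zc F 0 c -> exists W f, [/\ cov W, F setT f & eqc W 0 c (fun=> f)].
Proof.
move=> [W [cW H z]]; exists W, (fun v => c [:: v] v).
have e x v : W x v -> c [:: x] v = c [:: v] v.
  move=> Wx; have := z [:: x; v] v erefl; rewrite /dC /zc /= subr0 => zz.
  apply/esym/eqP; rewrite -subr_eq0; apply/eqP; apply: zz => y.
  by rewrite !inE => /orP[/eqP ->//|/eqP ->]; case: (cW v).
split=> //; last first.
  by move=> s v; case: s => [|x [|y s]] //= _ vs; apply: e; apply: vs; rewrite inE.
apply: sec_loc => // x _; have [oW Wx] := cW x; exists (W x); split=> //.
rewrite setTI; have := H [:: x] erefl; rewrite (_ : ov W [:: x] = W x).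
  by apply: sec_ext => // v; exact: e.
rewrite ov_cons (_ : ov W [::] = setT) ?setIT//; by apply/seteqP; split=> // v _ y; rewrite in_nil.
Qed.

Lemma dC_glob f s v : size s = 2 -> dC (fun=> f) s v = 0.
Proof. by case: s => [|x [|y [|z s]]]//= _; rewrite /dC /= subr0 subrr. Qed.

Section Kernel.

Variables (F : sheaf) (D : (V -> K) -> V -> K) (iD : isop F D).

Program Definition kerS : sheaf := @Sheaf (fun U f => F U f /\ forall v, U v -> D f v = 0) _ _ _ _ _.
Next Obligation.
by move=> U U' f oU' s [Ff z]; split; [exact: sec_sub Ff|move=> v /s; exact: z].
Qed.
Next Obligation.
move=> U f f' oU e [Ff z]; split; first exact: sec_ext Ff.
by move=> v Uv; rewrite -(op_ext iD oU e Ff Uv) z.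
Qed.
Next Obligation.
move=> U f f' a oU [Ff z] [Ff' z']; split; first exact: sec_lin.
by move=> v Uv; rewrite (op_lin iD a oU Ff Ff' Uv) z// z'// mulr0 addr0.
Qed.
Next Obligation.
by move=> U oU; have h := sec0 F oU; split=> // v Uv; exact: (op0 iD oU Uv).
Qed.
Next Obligation.
move=> U f oU H; have Ff : F U f.
  by apply: sec_loc => // v /H [U' [? ? []]]; exists U'.
split=> // v Uv; have [U' [oU' U'v [_ z]]] := H v Uv.
by apply: z.
Qed.

Lemma kerS_isC W p c : cov W -> isC F W p c -> eqc W p (opC D c) zc -> isC kerS W p c.
Proof. by move=> cW H z s sz; split; [exact: H|move=> v; exact: z]. Qed.

Lemma kerS_Z p c : Zc kerS p c -> Zc F p c /\ exists W, [/\ cov W, isC F W p c & eqc W p (opC D c) zc].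
Proof.
move=> [W [cW H z]]; have h : isC F W p c by move=> s /H [].
by split; exists W; split=> // s v /H [_ k]; exact: k.
Qed.

Hypothesis ls : lsurj F D.

(** The connecting map applied to a trivial class: if D b = dC e and e' is a lift of e after
    refinement, then b o tau - dC e' has values in the kernel of D and the coboundary of b o tau.
    [refineB] removes tau. In degree 0 the hypothesis already says D b = 0. *)
Lemma descend W p b : cov W -> isC F W p b -> Bc F p (opC D b) -> Bc kerS p.+1 (dC b).
Proof.
move=> cW Hb; case: p Hb => [|p] Hb.
  move=> [W0 [cW0 z]]; have cc := cov_cap cW cW0.
  exists (capc W W0), b; split=> //; apply: kerS_isC => //.
    by apply: isC_sub Hb => // x; exact: capl.
  by apply: eqc_sub z => x; exact: capr.
move=> [W1 [e [cW1 He z]]]; have cc := cov_cap cW cW1; set W2 := capc W W1 in cc.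
have Hb2 : isC F W2 p.+1 b by apply: isC_sub Hb => // x; exact: capl.
have He2 : isC F W2 p e by apply: isC_sub He => // x; exact: capr.
have z2 : eqc W2 p.+1 (opC D b) (dC e) by apply: eqc_sub z => x; exact: capr.
have [W' [tau [e' [cW' h He' De']]]] := lift_cochain cc He2 ls.
have h1 x : W' x `<=` W2 (tau x) by move=> v /h[].
have bt : isC F W' p.+1 (mapC tau b) by exact: isC_map Hb2.
have de : isC F W' p.+1 (dC e') by exact: dC_isC.
pose b2 := lc (mapC tau b) (-1) (dC e').
have b2F : isC F W' p.+1 b2 by exact: isC_lc.
have b2k : isC kerS W' p.+1 b2.
  apply: kerS_isC => //; apply: eqc_trans (opC_lc (-1) iD cW' bt de) _.
  rewrite -(lcN (dC (mapC tau e))); apply: eqc_lc.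
    by rewrite dC_map; apply: (eqc_map h1 z2).
  by apply: eqc_trans (opC_dC iD cW' He') _; exact: dC_eqc.
have Zb : Zc kerS p.+2 (dC b).
  exists W2; split=> //; last by rewrite dCdC.
  apply: kerS_isC => //; first exact: dC_isC.
  apply: eqc_trans (opC_dC iD cc Hb2) _; apply: eqc_trans (dC_eqc z2) _; by rewrite dCdC.
have kb : isC kerS W2 p.+2 (dC b).
  apply: kerS_isC => //; first exact: dC_isC.
  apply: eqc_trans (opC_dC iD cc Hb2) _; apply: eqc_trans (dC_eqc z2) _; by rewrite dCdC.
have rB : Bc kerS p.+2 (lc (mapC tau (dC b)) (-1) (dC b)).
  by apply: (refineB cc cW' h kb); rewrite dCdC.
have B2 : Bc kerS p.+2 (dC b2) by exists W', b2.
have := Bc_lc (-1) B2 rB; congr (Bc kerS _ _).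
apply/funext => s; apply/funext => v; rewrite /b2 dC_lc dCdC dC_map lc0 /lc.
by rewrite !mulN1r opprB addrC subrK.
Qed.

(** In degree 1 the cochain D b is a cocycle of degree 0, that is, a global section f; a global
    solution of D u = f is subtracted from b. In higher degrees the acyclicity of F plays this role,
    through [descend]. *)
Lemma kerS_acyclic : (forall f, F setT f -> exists u, F setT u /\ forall v, D u v = f v) ->
  (forall p c, Zc F p.+1 c -> Bc F p.+1 c) -> forall p c, Zc kerS p.+1 c -> Bc kerS p.+1 c.
Proof.
move=> gs van p c Zk; have [ZF [W0 [cW0 H0 z0]]] := kerS_Z Zk.
have [W1 [b [cW1 Hb e]]] := van _ _ ZF.
have cc := cov_cap cW0 cW1; set W := capc W0 W1 in cc.
have Hb' : isC F W p b by apply: isC_sub Hb => // x; exact: capr.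
have e' : eqc W p.+1 c (dC b) by apply: eqc_sub e => x; exact: capr.
have H0' : isC F W p.+1 c by apply: isC_sub H0 => // x; exact: capl.
have z0' : eqc W p.+1 (opC D c) zc by apply: eqc_sub z0 => x; exact: capl.
have Db : eqc W p.+1 (dC (opC D b)) zc.
  apply: eqc_trans (eqc_sym (opC_dC iD cc Hb')) _; apply: eqc_trans (eqc_sym (opC_eqc iD cc H0' e')) _.
  exact: z0'.
have ZDb : Zc F p (opC D b) by exists W; split=> //; exact: opC_isC.
apply: (Bc_ext cc (eqc_sym e')); case: p b Hb' e' ZDb Db {Zk ZF e Hb H0 z0 H0' z0'} => [|p] b Hb' e' ZDb Db; last first.
  by apply: (descend cc Hb'); exact: van.
have [W2 [f [cW2 Ff ef]]] := glue ZDb; have [u [Fu Du]] := gs f Ff.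
have c3 := cov_cap cc cW2; set W3 := capc W W2 in c3.
have Hb3 : isC F W3 0 b by apply: isC_sub Hb' => // x; exact: capl.
have Hu : isC F W3 0 (fun=> u) by move=> s _; apply: sec_sub Fu => //; exact: opn_ov.
exists W3, (lc b (-1) (fun=> u)); split=> //.
  apply: kerS_isC => //; first exact: isC_lc.
  apply: eqc_trans (opC_lc (-1) iD c3 Hb3 Hu) _; rewrite -(lcN (fun=> f)).
  apply: eqc_lc; first by apply: eqc_sub ef => x; exact: capr.
  by move=> s v _ _; rewrite /opC Du.
rewrite dC_lc => s v sz vs.
by rewrite /lc (dC_glob u v sz) mulr0 addr0.
Qed.

(* [pack F i Gam N r]: the cohomology of F vanishes outside degree i, and r
   induces an isomorphism of the cohomology in degree i with Gam / N. *)
Record pack (F : sheaf) (i : nat) (Gam N : (V -> K) -> Prop) (r : cch -> (V -> K) -> Prop) : Prop := Pack {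
  pk_van : forall p c, p <> i -> Zc F p c -> Bc F p c;
  pk_Z : forall c f, r c f -> Zc F i c /\ Gam f;
  pk_tot : forall c, Zc F i c -> exists f, r c f;
  pk_sur : forall f, Gam f -> exists c, r c f;
  pk_lin : forall c f a c' f', r c f -> r c' f' -> r (lc c a c') (fun v => f v + a * f' v);
  pk_B : forall c f, r c f -> (Bc F i c <-> N f);
  pk_mod : forall c c' f, r c f -> Zc F i c' -> Bc F i (lc c' (-1) c) -> r c' f }.

Definition compat (r : cch -> (V -> K) -> Prop) (E : (V -> K) -> V -> K) :=
  forall c f, r c f -> r (opC E c) (E f).

Lemma pk_eqc G i Gam N r W c c' f : pack G i Gam N r -> cov W -> eqc W i c c' -> r c f -> r c' f.
Proof.
move=> pk cW e h; apply: (pk_mod pk h); first exact: (Zc_ext cW e (pk_Z pk h).1).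
apply: (@Bc_eqc G i W _ cW); rewrite -(lcN c); apply: eqc_lc => //; exact: eqc_sym.
Qed.

Section Step.

Variables (i : nat) (Gam N : (V -> K) -> Prop) (r : cch -> (V -> K) -> Prop).

Hypotheses (pk : pack F i Gam N r) (GD : forall f, Gam f -> Gam (D f)) (cD : compat r D)
  (inj : forall f, Gam f -> N (D f) -> N f).

(** Membership in N + D Gam: the new space of classes is the cokernel of D on Gam / N. *)
Definition stepN f := exists2 u, Gam u & N (fun v => f v + -1 * D u v).
(** The inverse of the connecting map as a relation: up to a coboundary, c is [dC b] with D b
    represented by f. *)
Definition stepr c f := Zc kerS i.+1 c /\ exists b,
  [/\ exists W, cov W /\ isC F W i b, r (opC D b) f & Bc kerS i.+1 (lc c (-1) (dC b))].

Lemma ker_dC p c W b : Zc kerS p.+1 c -> cov W -> isC F W p b -> eqc W p.+1 c (dC b) ->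
  Zc F p (opC D b).
Proof.
move=> Zk cW Hb e; have [ZF [W0 [cW0 H0 z0]]] := kerS_Z Zk.
have cc := cov_cap cW0 cW; exists (capc W0 W).
have Hb' : isC F (capc W0 W) p b by apply: isC_sub Hb => // x; exact: capr.
have H0' : isC F (capc W0 W) p.+1 c by apply: isC_sub H0 => // x; exact: capl.
split=> //; first exact: opC_isC.
apply: eqc_trans (eqc_sym (opC_dC iD cc Hb')) _; apply: eqc_trans (eqc_sym (opC_eqc iD cc H0' _)) _.
  by apply: eqc_sub e => x; exact: capr.
by apply: eqc_sub z0 => x; exact: capl.
Qed.

(** Long exact sequence of 0 -> ker D -> F -> F -> 0: F has cohomology in degree i only, and there D
    is injective by [inj], so nothing is left outside degree i + 1. *)
Lemma step_van p c : p <> i.+1 -> Zc kerS p c -> Bc kerS p c.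
Proof.
move=> pi Zk; have [ZF [W0 [cW0 H0 z0]]] := kerS_Z Zk.
have BF : Bc F p c.
  have [e|ne] := eqVneq p i; last by apply: (pk_van pk) => //; exact/eqP.
  rewrite e in ZF *; have [f rf] := pk_tot pk ZF.
  apply/(pk_B pk rf)/inj; first exact: (pk_Z pk rf).2.
  by apply/(pk_B pk (cD rf))/(@Bc_eqc F i W0 _ cW0); rewrite -e.
case: p pi Zk {ZF H0 z0} BF => [|p] pi Zk; first by [].
move=> [W [b [cW Hb e]]]; apply: (Bc_ext cW (eqc_sym e)); apply: (descend cW Hb).
apply: (pk_van pk); first by move=> pi'; apply: pi; rewrite pi'.
exact: ker_dC Zk cW Hb e.
Qed.

(** Exactness through representatives: every class is a connecting image because F has no cohomology
    in degree i + 1, every f occurs because cochains lift through D, and [descend] recognizes the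
    trivial classes. *)
Lemma step_pack : pack kerS i.+1 Gam stepN stepr.
Proof.
split.
- exact: step_van.
- by move=> c f [Zk [b [_ rb _]]]; split=> //; exact: (pk_Z pk rb).2.
- move=> c Zk; have [ZF _] := kerS_Z Zk.
  have ne : i.+1 <> i by move=> e; have := ltnn i; rewrite -{2}e ltnSn.
  have [W [b [cW Hb e]]] := pk_van pk ne ZF.
  have [f rf] := pk_tot pk (ker_dC Zk cW Hb e).
  exists f; split=> //; exists b; split=> //; first by exists W.
  by apply: (@Bc_eqc kerS _ W _ cW); rewrite -(lcN (dC b)); apply: eqc_lc.
- move=> f Gf; have [c rc] := pk_sur pk Gf; have [[W [cW Hc z]] _] := pk_Z pk rc.
  have [W' [tau [e' [cW' h He' De']]]] := lift_cochain cW Hc ls.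
  have h1 x : W' x `<=` W (tau x) by move=> v /h[].
  have rt : r (mapC tau c) f.
    apply: (pk_mod pk rc); last exact: (refineB cW cW' h Hc z).
    exists W'; split=> //; first exact: isC_map Hc.
    by rewrite dC_map -[zc]/(mapC tau zc); apply: eqc_map h1 z.
  exists (dC e'); split.
    exists W'; split=> //; last by rewrite dCdC.
    apply: kerS_isC => //; first exact: dC_isC.
    apply: eqc_trans (opC_dC iD cW' He') _; apply: eqc_trans (dC_eqc De') _.
    by rewrite dC_map -[zc]/(mapC tau zc); apply: eqc_map h1 z.
  exists e'; split; [by exists W'|exact: pk_eqc pk cW' (eqc_sym De') rt|].
  by apply: (@Bc_eqc kerS _ W' _ cW'); rewrite lcN.
- move=> c f a c' f' [Zk [b [[W [cW Hb]] rb B]]] [Zk' [b' [[W' [cW' Hb']] rb' B']]].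
  split; first exact: Zc_lc.
  have cc := cov_cap cW cW'.
  have k : isC F (capc W W') i b by apply: isC_sub Hb => // x; exact: capl.
  have k' : isC F (capc W W') i b' by apply: isC_sub Hb' => // x; exact: capr.
  exists (lc b a b'); split; first by exists (capc W W'); split=> //; exact: isC_lc.
    exact: (pk_eqc pk cc (eqc_sym (opC_lc a iD cc k k')) (pk_lin pk a rb rb')).
  have := Bc_lc a B B'; congr (Bc _ _ _); apply/funext => s; apply/funext => v.
  by rewrite dC_lc /lc; ring.
- move=> c f [Zk [b [[W [cW Hb]] rb B]]]; split.
    move=> Bk; have := Bc_lc (-1) Bk B.
    have -> : lc c (-1) (lc c (-1) (dC b)) = dC b.
      by apply/funext => s; apply/funext => v; rewrite /lc; ring.
    move=> [W1 [b1 [cW1 Hb1 e1]]].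
    have cc := cov_cap cW cW1.
    have k : isC F (capc W W1) i b by apply: isC_sub Hb => // x; exact: capl.
    have k1 : isC kerS (capc W W1) i b1 by apply: isC_sub Hb1 => // x; exact: capr.
    have k1F : isC F (capc W W1) i b1 by move=> s /k1[].
    have z1 : eqc (capc W W1) i (opC D b1) zc by move=> s v /k1[_ h] vs; exact: h.
    have Zbb : Zc F i (lc b (-1) b1).
      exists (capc W W1); split=> //; first exact: isC_lc.
      rewrite dC_lc -(lcN (dC b1)); apply: eqc_lc => //.
      by apply: eqc_sub e1 => x; exact: capr.
    have [u ru] := pk_tot pk Zbb.
    have ru2 : r (opC D b) (D u).
      apply: (pk_eqc pk cc _ (cD ru)).
      apply: eqc_trans (opC_lc (-1) iD cc k k1F) _; rewrite -[X in eqc _ _ _ X](lc0 _ (-1)).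
      by apply: eqc_lc.
    exists u; first exact: (pk_Z pk ru).2.
    have := pk_lin pk (-1) rb ru2; rewrite lcN => r0.
    by apply/(pk_B pk r0)/(@Bc_eqc F i W _ cW).
  move=> [u Gu Nu]; have [c1 rc1] := pk_sur pk Gu.
  have [[W1 [cW1 Hc1 z1]] _] := pk_Z pk rc1.
  have cc := cov_cap cW cW1.
  have k : isC F (capc W W1) i b by apply: isC_sub Hb => // x; exact: capl.
  have k1 : isC F (capc W W1) i c1 by apply: isC_sub Hc1 => // x; exact: capr.
  have r1 := pk_lin pk (-1) rb (cD rc1).
  have B1 : Bc F i (opC D (lc b (-1) c1)).
    apply: (Bc_ext cc (eqc_sym (opC_lc (-1) iD cc k k1))).
    exact/(pk_B pk r1).
  have B2 := descend cc (isC_lc (-1) cc k k1) B1.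
  have B3 : Bc kerS i.+1 (dC b).
    apply: (Bc_ext cc _ B2); rewrite dC_lc -[X in eqc _ _ _ X](lc0 _ (-1)).
    by apply: eqc_lc => //; apply: eqc_sub z1 => x; exact: capr.
  have := Bc_lc 1 B B3; congr (Bc _ _ _); apply/funext => s; apply/funext => v.
  by rewrite /lc; ring.
move=> c c' f [Zk [b [Hb rb B]]] Zk' B'; split=> //; exists b; split=> //.
have := Bc_lc 1 B' B; congr (Bc _ _ _); apply/funext => s; apply/funext => v.
by rewrite /lc; ring.
Qed.

Variables (E : (V -> K) -> V -> K).

Hypotheses (iE : isop F E) (cE : compat r E)
  (ED : forall U f, opn U -> F U f -> forall v, U v -> D (E f) v = E (D f) v).

Lemma kerS_isop : isop kerS E.
Proof.
split.
- move=> U f oU [Ff z]; split; first exact: op_sec iE _ _ oU Ff.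
  move=> v Uv; rewrite (ED oU Ff Uv) -(op0 iE oU Uv).
  exact: (op_ext iE oU z (op_sec iD oU Ff)).
- by move=> U f f' oU e [Ff _]; exact: op_ext iE _ _ _ oU e Ff.
- by move=> U f f' a oU [Ff _] [Ff' _]; exact: op_lin iE _ _ _ _ oU Ff Ff'.
Qed.

Lemma opC_Z F' p c : isop F' E -> Zc F' p c -> Zc F' p (opC E c).
Proof.
move=> iE' [W [cW H z]]; exists W; split=> //; first exact: opC_isC.
by apply: eqc_trans (eqc_sym (opC_dC iE' cW H)) _; exact: opC0 iE' cW z.
Qed.

Lemma opC_B F' p c : isop F' E -> Bc F' p c -> Bc F' p (opC E c).
Proof.
move=> iE'; case: p => [|p] /=.
  by move=> [W [cW z]]; exists W; split=> //; exact: opC0 iE' cW z.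
move=> [W [b [cW H e]]]; exists W, (opC E b); split=> //; first exact: opC_isC.
apply: eqc_trans (opC_dC iE' cW H); apply: eqc_sym.
by apply: opC_eqc iE' cW (dC_isC cW H) (eqc_sym e).
Qed.

(** An operator commuting with D acts on the kernel compatibly with the representatives. It carries
    the operators of the remaining directions through the induction. *)
Lemma step_compat : compat stepr E.
Proof.
move=> c f [Zk [b [[W [cW Hb]] rb B]]]; split; first exact: opC_Z kerS_isop Zk.
exists (opC E b); split; first by exists W; split=> //; exact: opC_isC.
  apply: (pk_eqc pk cW _ (cE rb)) => s v sz vs.
  by rewrite /opC (ED (opn_ov s cW) (Hb s sz) vs).
have [W0 [cW0 H0 _]] := Zk.
have cc := cov_cap cW0 cW.
have H0' : isC kerS (capc W0 W) i.+1 c by apply: isC_sub H0 => // x; exact: capl.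
have H0F : isC F (capc W0 W) i.+1 c by move=> s /H0'[].
have Hb' : isC F (capc W0 W) i b by apply: isC_sub Hb => // x; exact: capr.
apply: (Bc_ext cc _ (opC_B kerS_isop B)).
apply: eqc_trans (opC_lc (-1) iE cc H0F (dC_isC cc Hb')) _.
by apply: eqc_lc => //; exact: opC_dC iE cc Hb'.
Qed.

End Step.

End Kernel.

Section Start.

Variable F : sheaf.
Hypothesis van : forall p c, Zc F p.+1 c -> Bc F p.+1 c.

Definition startr c f := F setT f /\ exists W, cov W /\ eqc W 0 c (fun=> f).

Lemma start_Z c f : startr c f -> Zc F 0 c.
Proof.
move=> [Ff [W [cW e]]]; exists W; split=> //.
  by apply: (isC_ext cW (eqc_sym e)) => s _; apply: sec_sub Ff => //; exact: opn_ov.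
by apply: eqc_trans (dC_eqc e) _ => s v sz _; exact: dC_glob.
Qed.

Lemma start_pack : pack F 0 (F setT) (fun f => forall v, f v = 0) startr.
Proof.
split.
- by case=> [|p] c // _; exact: van.
- by move=> c f rf; split; [exact: start_Z rf|exact: rf.1].
- by move=> c /glue[W [f [cW Ff e]]]; exists f; split=> //; exists W.
- by move=> f Ff; exists (fun=> f); split=> //; exists (fun=> setT); split=> //; exact: covT.
- move=> c f a c' f' [Ff [W [cW e]]] [Ff' [W' [cW' e']]]; split; first exact: sec_lin.
  exists (capc W W'); split; first exact: cov_cap.
  by apply: (eqc_lc a (b := fun=> f) (b' := fun=> f')); [apply: eqc_sub e|apply: eqc_sub e'] => x; [exact: capl|exact: capr].
- move=> c f [Ff [W [cW e]]]; split.
    move=> [W' [cW' z]] v; have sv : ov W [:: v] v by move=> x; rewrite inE => /eqP ->; case: (cW v).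
    have sv' : ov W' [:: v] v by move=> x; rewrite inE => /eqP ->; case: (cW' v).
    by rewrite -(e [:: v] v erefl sv) z.
  by move=> z; exists W; split=> //; apply: eqc_trans e _ => s v _ _; exact: z.
move=> c c' f [Ff [W [cW e]]] _ [W' [cW' z]]; split=> //; exists (capc W W'); split; first exact: cov_cap.
move=> s v sz vs; rewrite -(e s v sz); last by apply: ov_mono vs => x; exact: capl.
have := z s v sz (ov_mono (@capr W W') vs).
by rewrite /lc /zc mulN1r => /eqP; rewrite subr_eq0 => /eqP.
Qed.

Lemma start_compat E : isop F E -> compat startr E.
Proof.
move=> iE c f [Ff [W [cW e]]]; split; first exact: op_sec iE _ _ opnT Ff.
exists W; split=> //; have z : isC F W 0 (fun=> f) by move=> s _; apply: sec_sub Ff => //; exact: opn_ov.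
by apply: eqc_sym; apply: (opC_eqc iE cW z (eqc_sym e)).
Qed.
End Start.

Section Fine.

Variable F : sheaf.

Hypothesis pou : forall W, cov W -> exists (I : seq V) (ph : V -> V -> K),
  [/\ forall v, \sum_(i <- I) ph i v = 1, forall i v, ph i v != 0 -> W i v &
    forall i U f, opn U -> F (W i `&` U) f -> F U (fun v => ph i v * f v)].

Lemma dl_sum (I : seq V) (ph : V -> K) (c : V -> seq V -> K) s :
  dl (fun t => \sum_(i <- I) ph i * c i t) s = \sum_(i <- I) ph i * dl (c i) s.
Proof.
elim: I => [|i I IH].
  by rewrite big_nil (@dl_eq _ (fun=> 0)) ?dl0// => t; rewrite big_nil.
rewrite big_cons -IH (@dl_eq _ (fun t => (\sum_(i <- I) ph i * c i t) + ph i * c i t)).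
  by rewrite dl_lin addrC.
by move=> t; rewrite big_cons addrC.
Qed.

(** The contracting homotopy b(s) = sum_i ph_i c(i :: s). By the last clause of [pou] each product
    extends by zero from W i to the whole overlap of s. *)
Lemma fine_acyclic p c : Zc F p.+1 c -> Bc F p.+1 c.
Proof.
move=> [W [cW H z]]; have [I [ph [s1 sup mul]]] := pou cW.
exists W, (fun s v => \sum_(i <- I) ph i v * c (i :: s) v); split=> //.
  move=> s sz; have oU := opn_ov s cW.
  have h i : F (ov W s) (fun v => ph i v * c (i :: s) v).
    by apply: mul => //; rewrite -ov_cons; apply: H; rewrite /= sz.
  elim: I {s1} => [|i I IH].
    by apply: (sec_ext oU _ (sec0 F oU)) => v _; rewrite big_nil.
  apply: (sec_ext oU _ (sec_lin 1 oU (h i) IH)) => v _.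
  by rewrite big_cons mul1r.
move=> s v sz vs; rewrite /dC (dl_sum I (ph^~ v) (fun i t => c (i :: t) v)).
rewrite -[LHS]mul1r -(s1 v) mulr_suml; apply: eq_bigr => i _.
have [->|nz] := eqVneq (ph i v) 0; first by rewrite !mul0r.
congr (_ * _); have := z (i :: s) v; rewrite /dC /zc /= sz => zz.
by apply/eqP; rewrite -subr_eq0 zz// ov_cons; split=> //; exact: sup.
Qed.
End Fine.

End Cech.

(** * Bump functions *)

Section Bump.

Variable R : realType.
Local Notation C := (Cplx R).

(* These functions, for p a polynomial, form a family closed under derivation. *)
Definition eta (p : {poly R}) (s : R) : R := if 0 < s then p.[s^-1] * expR (- s^-1) else 0.

Lemma poly_exp_bound (p : {poly R}) : exists2 M : R, 0 <= M & forall u : R, 0 < u ->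
  `|p.[u]| <= M * expR u.
Proof.
have ex n : exists M : R, 0 <= M /\ forall u : R, 0 < u -> u ^+ n <= M * expR u.
  by have [M M0 H] := exp_poly R n; exists M.
have [K HK] := choice ex.
exists (\sum_(i < size p) `|p`_i| * K i).
  by apply: sumr_ge0 => i _; rewrite mulr_ge0//; case: (HK i).
move=> u u0; rewrite horner_coef mulr_suml; apply: le_trans (ler_norm_sum _ _ _) _.
apply: ler_sum => i _; rewrite normrM -mulrA ler_wpM2l//.
by rewrite normrX gtr0_norm//; case: (HK i) => _; apply.
Qed.

Lemma eta_bound n p : exists2 M : R, 0 <= M & forall s, `|eta p s| <= M * `|s| ^+ n.
Proof.
have [M M0 H] := poly_exp_bound (p * 'X^n); exists M => // s.
rewrite /eta; case: ltP => s0; last by rewrite normr0 mulr_ge0// exprn_ge0.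
have u0 : 0 < s^-1 by rewrite invr_gt0.
have := H _ u0; rewrite hornerM hornerXn normrM normrX (gtr0_norm u0) (gtr0_norm s0) => h.
rewrite normrM (gtr0_norm (expR_gt0 _)) expRN ler_pdivrMr ?expR_gt0//.
rewrite mulrAC -ler_pdivrMr ?exprn_gt0// -exprVn //.
Qed.

Lemma eta_bdd p : exists2 M : R, 0 <= M & forall s, `|eta p s| <= M.
Proof. by have [M M0 H] := eta_bound 0 p; exists M => // s; have := H s; rewrite expr0 mulr1. Qed.

(** With u = 1 / s, the derivative of p(u) exp(- u) with respect to s is u^2 (p - p')(u) exp(-
    u). *)
Definition deta (p : {poly R}) := 'X^2 * (p - p^`()).

(** At s = 0 the flatness bound with exponent 2 makes the difference quotient tend to 0. *)
Lemma is_derive_eta p s : is_derive s (1:R) (eta p) (eta (deta p) s).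
Proof.
have [s0|s0|s0] := ltgtP 0 s.
- have dV : is_derive s (1:R) (fun x : R => x^-1) (- s^-2).
    have hV := is_deriveV (f := @id R) (lt0r_neq0 s0) (is_derive_id s (1:R)).
    by apply: (is_derive_eq hV); rewrite /GRing.scale /= mulr1.
  have d1 := is_derive1_comp (is_derive_poly p s^-1) dV.
  have dVN : is_derive s (1:R) (fun x : R => - x^-1) (s^-2).
    by apply: (is_derive_eq (is_deriveN dV)); rewrite opprK.
  have d2 := @is_derive1_comp _ expR (fun x : R => - x^-1) s _ _ (is_derive_expR (- s^-1)) dVN.
  have d3 := is_deriveM d1 d2.
  have e : \near s, ((horner p \o (fun x : R => x^-1)) * (expR \o (fun x : R => - x^-1))) s = eta p s.
    near=> x; rewrite /eta ifT//; near: x; exact: lt_nbhsr.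
  apply: (is_derive_eq (near_eq_is_derive e d3)).
  rewrite /eta s0 /deta !hornerE /GRing.scale /=; field; exact: lt0r_neq0.
- rewrite {2}/eta ltNge (ltW s0) /=.
  have e : \near s, cst 0 s = eta p s.
    by near=> x; rewrite /eta ltNge ltW//; near: x; exact: lt_nbhsl.
  exact: (near_eq_is_derive e (is_derive_cst 0 s (1:R))).
rewrite -s0 {2}/eta ltxx; apply/is_deriveP => e e0.
have [M M0 H] := eta_bound 2 p; exists (e / (M + 1)).
  by rewrite divr_gt0//; lra.
move=> x; rewrite ltr_pdivlMr; last by lra.
move=> xe; rewrite add0r mulr0 subr0 {2}/eta ltxx subr0.
apply: le_trans (H x) _; rewrite expr2 mulrA; apply: ler_wpM2r => //.
have := normr_ge0 x; move: (`|x|) xe; clear -M0; move=> y *; nra.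
Unshelve. all: by end_near.
Qed.

Variable g : nat.
Local Notation V := 'cV[C]_g.

(** The chain rule stays inside the family [eta], so the induction on n runs over all polynomials p
    at once. *)
Lemma Cn_eta n (U : set V) (r : V -> R) p : vopen U -> Cn n U (fun v => toC (r v)) ->
  Cn n U (fun v => toC (eta p (r v))).
Proof.
move=> oU; have lbe q : lb U (fun v : V => toC (eta q (r v))).
  have [M M0 H] := eta_bdd q; move=> v Uv; exists 1, M; split=> // w _ _.
  by rewrite cn_toC.
elim: n p => [|n IH] p Cr; first exact: lbe.
have Cr' : Cn n U (fun v => toC (r v)) by exact: CnW.
have dd d v : U v -> haspd (fun v => toC (eta p (r v))) v d (toC (eta (deta p) (r v)) * pd d (fun v => toC (r v)) v).
  move=> Uv; have [h1 h2] := Cn_has d Cr Uv.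
  have h3 : is_derive (0:R) (1:R) (fun t => r (v + sc t d)) (re (pd d (fun v => toC (r v)) v)).
    by move: h1; under eq_fun do rewrite re_toC.
  have im0 : im (pd d (fun v => toC (r v)) v) = 0.
    have : is_derive (0:R) (1:R) (fun t => im (toC (r (v + sc t d)))) 0.
      rewrite (_ : (fun t => _) = cst 0); first exact: is_derive_cst.
      by apply/funext => t; rewrite im_toC.
    by move=> h4; rewrite -(@derive_val _ _ _ _ _ _ _ h2) (@derive_val _ _ _ _ _ _ _ h4).
  have e0 : r (v + sc 0 d) = r v by rewrite sc0 addr0.
  have d1 := is_derive_eta p (r (v + sc 0 d)).
  have d2 := iscd_comp (iscd_toC d1) h3.
  apply: (iscd_eq d2); rewrite e0 [in RHS](reimC (pd _ _ _)) im0 toC0 mulr0 addr0 //.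
split; first exact: lbe.
move=> d; split; first by move=> v Uv; exact: haspd_ok (dd d v Uv).
apply: (Cn_ext oU _ (CnM oU (IH (deta p) Cr') (Cn_pd d Cr))) => w Uw.
by rewrite (haspd_pd (dd d w Uw)).
Qed.

Lemma sm_eta (U : set V) (r : V -> R) p : vopen U -> sm U (fun v => toC (r v)) ->
  sm U (fun v => toC (eta p (r v))).
Proof. by move=> oU H n; apply: Cn_eta. Qed.

Lemma smV_cont (U : set V) f : vopen U -> sm U f -> (forall v, U v -> f v != 0) ->
  sm U (fun v => (f v)^-1).
Proof.
move=> oU sf nz; apply: smV => // v Uv.
have fv : 0 < cn (f v) by rewrite lt_neqAle cn_ge0 eq_sym cn_eq0 nz.
have f2 : 0 < cn (f v) / 2 by rewrite divr_gt0.
have [d d0 H] := Cn_vcont oU (sf 1%N) Uv f2.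
exists d, (4 * (cn (f v))^-1); split=> // w Uw wd.
have fw : cn (f v) / 2 <= cn (f w).
  have := cnD (f v - f w) (f w); rewrite subrK cnBC => h; have := H w wd; move: h.
  by move: (cn _) (cn _) (cn _) => x y z; lra.
have w0 : 0 < cn (f w) by apply: lt_le_trans fw.
apply: (@le_trans _ _ (2 * (cn (f w))^-1)).
  have nz' := nz w Uw; have ns : 0 < nsq (f w).
    by rewrite lt_neqAle eq_sym nsq_eq0 nz' /nsq addr_ge0 ?sqr_ge0.
  rewrite cinvE// cnMtoC cn_conj gtr0_norm ?invr_gt0// mulrC ler_pdivrMr// mulrC mulrA ler_pdivlMr//.
  rewrite mulrC /nsq /cn; move: (re _) (im _) => x y.
  rewrite -(real_normK (num_real x)) -(real_normK (num_real y)).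
  by move: (`|x|) (`|y|) => X Y; have := sqr_ge0 (X - Y); clear; rewrite !expr2; lra.
rewrite (_ : 4 = 2 * 2 :> R); last by ring.
by rewrite -mulrA ler_wpM2l// -[2]invrK -invfM lef_pV2 ?posrE ?mulr_gt0 ?invr_gt0// mulrC.
Qed.

End Bump.

Lemma toC_cos (R : realType) (y : R) : toC (cos y) = 2^-1 * (cexp (ci R * toC y) + cexp (- (ci R * toC y))).
Proof.
have h2 : (2^-1 : Cplx R) = toC 2^-1 by rewrite toCV toC_nat.
rewrite h2 /cexp; apply: ceq; rewrite !reimE !(mul0r, mul1r, mulr0, add0r, addr0, subr0, oppr0) expR0.
  by rewrite cosN; field.
by rewrite sinN; field.
Qed.

(** * Coordinates, neighbourhoods and compactness of the torus *)

Section LatticeCoordinates.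

Variables (R : realType) (g : nat) (b : 'I_(2 * g) -> 'cV[Cplx R]_g).
Local Notation C := (Cplx R).
Local Notation V := 'cV[C]_g.
Hypothesis bfree : real_free b.
Implicit Types (v w x l : V) (U : set V).

Definition lat : set V := [set \sum_i (n i)%:~R *: b i | n in [set: 'I_(2 * g) -> int]].

Definition rcv v : 'rV[R]_(g + g) := row_mx (\row_j re (v j ord0)) (\row_j im (v j ord0)).
Definition bmx : 'M[R]_(2 * g, g + g) := \matrix_i rcv (b i).
(** The real coordinates in the lattice basis. The pseudo-inverse is used because [2 * g] and
    [g + g] are not convertible, so that [bmx] does not have a square matrix type. *)
Definition tl (i : 'I_(2 * g)) v : R := (rcv v *m pinvmx bmx) ord0 i.

Lemma rcvD v w : rcv (v + w) = rcv v + rcv w.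
Proof.
rewrite /rcv add_row_mx; congr row_mx; apply/rowP => j; rewrite !mxE.
  by rewrite reD.
by rewrite imD.
Qed.
Lemma rcvZ (x : R) v : rcv (sc x v) = x *: rcv v.
Proof.
rewrite /rcv scale_row_mx; congr row_mx; apply/rowP => j; rewrite !mxE.
  by rewrite reM re_toC im_toC mul0r subr0.
by rewrite imM re_toC im_toC mul0r addr0.
Qed.
Lemma rcv_inj : injective rcv.
Proof.
move=> v w /eq_row_mx[/rowP h1 /rowP h2]; apply/matrixP => i j; rewrite ord1.
by apply: ceq; [have := h1 i|have := h2 i]; rewrite !mxE.
Qed.
Lemma rcv_sum (a : 'I_(2 * g) -> R) : rcv (\sum_i sc (a i) (b i)) = (\row_i a i) *m bmx.
Proof.
rewrite mulmx_sum_row; elim/big_rec2: _ => [|i x y _ <-].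
  by rewrite -(sc0 0) rcvZ scale0r.
by rewrite rcvD rcvZ mxE rowK.
Qed.

Lemma bmx_full : row_full bmx.
Proof.
have : row_free bmx.
  apply: inj_row_free => u u0; apply/rowP => i; rewrite mxE; apply: bfree i.
  apply: rcv_inj; rewrite rcv_sum -(sc0 0) rcvZ scale0r -[RHS]u0; congr (_ *m _).
  by apply/rowP => i; rewrite mxE.
by rewrite /row_free /row_full => /eqP ->; rewrite mul2n -addnn.
Qed.

Lemma tlE v : v = \sum_i sc (tl i v) (b i).
Proof.
apply: rcv_inj; rewrite rcv_sum (_ : \row_i _ = rcv v *m pinvmx bmx).
  by rewrite mulmxKpV// submx_full// bmx_full.
by apply/rowP => i; rewrite mxE.
Qed.

Lemma tlD i v w : tl i (v + w) = tl i v + tl i w.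
Proof. by rewrite /tl rcvD mulmxDl mxE. Qed.
Lemma tlZ i (x : R) v : tl i (sc x v) = x * tl i v.
Proof. by rewrite /tl rcvZ -scalemxAl mxE. Qed.
Lemma tlN i v : tl i (- v) = - tl i v.
Proof. by rewrite -mulN1r -tlZ scN sc1. Qed.
Lemma tlB i v w : tl i (v - w) = tl i v - tl i w. Proof. by rewrite tlD tlN. Qed.
Lemma tl_shift i v l x : tl i (v + l - x) = tl i (v - x) + tl i l.
Proof. by rewrite !tlB tlD addrAC. Qed.
Lemma tl0 i : tl i 0 = 0. Proof. by rewrite -(sc0 0) tlZ mul0r. Qed.

Lemma tl_uniq i (a : 'I_(2 * g) -> R) : tl i (\sum_j sc (a j) (b j)) = a i.
Proof.
set v := \sum_j _; apply/eqP; rewrite -subr_eq0; apply/eqP.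
apply: (bfree (a := fun i => tl i v - a i)).
rewrite (_ : \sum_i _ = \sum_i sc (tl i v) (b i) - \sum_i sc (a i) (b i)).
  by rewrite -tlE subrr.
by rewrite -sumrB; apply: eq_bigr => j _; rewrite toCD toCN scalerBl.
Qed.

Lemma tl_bound : exists2 K : R, 0 <= K & forall i v, `|tl i v| <= K * vn v.
Proof.
exists (\sum_j \sum_i `|pinvmx bmx j i|).
  by apply: sumr_ge0 => j _; apply: sumr_ge0.
move=> i v; rewrite /tl mxE mulr_suml; apply: le_trans (ler_norm_sum _ _ _) _.
apply: ler_sum => j _; rewrite normrM mulrC; apply: ler_pM => //.
  by rewrite (bigD1 i)//= lerDl; apply: sumr_ge0.
rewrite /rcv; case: (split_ordP j) => k ->; rewrite ?row_mxEl ?row_mxEr mxE.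
  by apply: le_trans (re_le_cn _) (cn_le_vn _ _).
by apply: le_trans (im_le_cn _) (cn_le_vn _ _).
Qed.

Lemma rlin_tl i : rlin (fun v => toC (tl i v)).
Proof.
split; first by move=> v w; rewrite tlD toCD.
split; first by move=> x v; rewrite tlZ toCM.
by have [K _ H] := tl_bound; exists K => v; rewrite cn_toC.
Qed.

Lemma latP l : lat l <-> forall i, exists n : int, tl i l = n%:~R.
Proof.
split.
  move=> [n _ <-] i; exists (n i); rewrite -[RHS](tl_uniq i (fun i => (n i)%:~R)).
  by congr tl; apply: eq_bigr => j _; rewrite /sc toC_int.
move=> /choice[n Hn]; exists n => //; rewrite [RHS]tlE.
by apply: eq_bigr => j _; rewrite Hn /sc toC_int.
Qed.

Lemma latD l l' : lat l -> lat l' -> lat (l + l').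
Proof.
move=> /latP h /latP h'; apply/latP => i; have [n e] := h i; have [n' e'] := h' i.
by exists (n + n'); rewrite tlD e e' intrD.
Qed.
Lemma latN l : lat l -> lat (- l).
Proof. by move=> /latP h; apply/latP => i; have [n e] := h i; exists (- n); rewrite tlN e intrN. Qed.
Lemma lat0 : lat 0. Proof. by apply/latP => i; exists 0; rewrite tl0. Qed.

Definition rnd (s : R) : int := Num.floor (s + 2^-1).
Lemma rnd_itv s : - 2^-1 <= s - (rnd s)%:~R < 2^-1.
Proof. by have := floor_itv (s + 2^-1); rewrite -/(rnd s) intrD => /andP[]; lra. Qed.
Lemma rndD s (n : int) : rnd (s + n%:~R) = rnd s + n.
Proof.
apply: floor_def; have /andP[] := rnd_itv s; rewrite !intrD; lra.
Qed.

(** The lattice vector obtained by rounding the coordinates of v - x: v - [lam x v] is the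
    representative of v in the box of radius 1/2 about x. *)
Definition lam x v : V := \sum_i (rnd (tl i (v - x)))%:~R *: b i.
Lemma lam_lat x v : lat (lam x v). Proof. by exists (fun i => rnd (tl i (v - x))). Qed.
Lemma tl_lam i x v : tl i (lam x v) = (rnd (tl i (v - x)))%:~R.
Proof.
rewrite -[RHS](tl_uniq i (fun i => (rnd (tl i (v - x)))%:~R)).
by congr tl; apply: eq_bigr => j _; rewrite /sc toC_int.
Qed.
Lemma lamD x v l : lat l -> lam x (v + l) = lam x v + l.
Proof.
move=> /latP/choice[n Hn]; rewrite [in RHS](tlE l) /lam -big_split; apply: eq_bigr => i _ /=.
by rewrite tl_shift Hn rndD intrD scalerDl /sc toC_int.
Qed.

(** Smooth, lattice-invariant and zero exactly on x + lattice: a substitute for the squared distance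
    to x on the torus, suited as an argument of bump functions, where rounding would be
    discontinuous. *)
Definition kap x v : R := \sum_i (1 - cos (2 * pi * tl i (v - x))).

Lemma cos_int s (n : int) : cos (2 * pi * (s + n%:~R)) = cos (2 * pi * s) :> R.
Proof.
have pn (m : nat) (u : R) : cos (2 * pi * (u + m%:R)) = cos (2 * pi * u).
  elim: m u => [|m IH] u; first by rewrite addr0.
  rewrite -(IH u) -(cosD2pi (2 * pi * (u + m%:R))) -mulr_natl; congr cos.
  by rewrite -natr1; ring.
case: n => m; first exact: pn.
by rewrite NegzE intrN -[in RHS](subrK m.+1%:R s) pn.
Qed.

Lemma pi_itv (e : R) : 0 <= e <= 2^-1 -> 2 * pi * e \in `[0, (pi : R)].
Proof.
move=> /andP[e0 e1]; have p0 := ltW (pi_gt0 R); rewrite in_itv /=; apply/andP; split.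
  by rewrite !mulr_ge0.
by rewrite -mulrA mulrCA ler_piMr//; lra.
Qed.

Lemma cos_lt (e r : R) : 0 <= e <= 2^-1 -> `|r| <= 2^-1 ->
  cos (2 * pi * e) < cos (2 * pi * r) -> `|r| < e.
Proof.
move=> e01 r01; have p0 := pi_gt0 R.
rewrite -(cos_norm (2 * pi * r)) normrM gtr0_norm; last by rewrite mulr_gt0.
rewrite ltr_cos; first by rewrite ltr_pM2l// mulr_gt0.
  by apply: pi_itv; rewrite ?normr_ge0.
by apply: pi_itv; rewrite ?normr_ge0.
Qed.

Lemma kap_ge0 x v : 0 <= kap x v.
Proof. by apply: sumr_ge0 => i _; rewrite subr_ge0 cos_le1. Qed.
Lemma kap_self x : kap x x = 0.
Proof. by rewrite /kap big1// => i _; rewrite subrr tl0 mulr0 cos0 subrr. Qed.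
Lemma kap_lat x v l : lat l -> kap x (v + l) = kap x v.
Proof.
move=> /latP h; apply: eq_bigr => i _; have [n e] := h i.
by rewrite tl_shift e cos_int.
Qed.

(* On the set where [kap x] is smaller than 1 - cos (2 pi e), the vector
   v - lam x v lies in the box of radius e around x. *)
Lemma kap_box x v e : 0 <= e <= 2^-1 -> kap x v < 1 - cos (2 * pi * e) ->
  forall i, `|tl i (v - lam x v - x)| < e.
Proof.
move=> e01 k i; have r2 : tl i (v - lam x v - x) = tl i (v - x) - (rnd (tl i (v - x)))%:~R.
  by rewrite !tlB tl_lam tlB addrAC.
have hr := rnd_itv (tl i (v - x)); apply: cos_lt => //.
  by rewrite r2 ler_norml; lra.
rewrite r2 -intrN cos_int.
have : 1 - cos (2 * pi * tl i (v - x)) <= kap x v.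
  by rewrite /kap (bigD1 i)//= lerDl; apply: sumr_ge0 => j _; rewrite subr_ge0 cos_le1.
lra.
Qed.

Lemma sm_kap U x : vopen U -> sm U (fun v => toC (kap x v)).
Proof.
move=> oU; apply: (sm_ext oU (f := fun v => \sum_i (1 - 2^-1 * (cexp (ci R * toC (2 * pi) * (toC (tl i v) - toC (tl i x))) + cexp (- ci R * toC (2 * pi) * (toC (tl i v) - toC (tl i x))))))).
  move=> v _; rewrite /kap toC_sum; apply: eq_bigr => i _; rewrite toCD toC1 toCN; congr (_ - _).
  have e (c : C) : c * toC (2 * pi) * (toC (tl i v) - toC (tl i x)) = c * toC (2 * pi * tl i (v - x)).
    by rewrite tlB [toC (2 * pi * _)]toCM toCD toCN mulrA.
  by rewrite !e mulNr toC_cos.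
apply: sm_sum => // i _; apply: smB => //; first exact: sm_cst.
apply: smZ => //.
have k : sm U (fun v => toC (tl i v) - toC (tl i x)).
  by apply: smB => //; [exact: sm_rlin (rlin_tl i)|exact: sm_cst].
by apply: smD => //; apply: sm_cexp => //; apply: smZ.
Qed.

Lemma kap_cont x v (e : R) : 0 < e -> exists2 d : R, 0 < d &
  forall w, vn (w - v) < d -> `|kap x w - kap x v| < e.
Proof.
move=> e0; have [d d0 H] := Cn_vcont (@vopenT R g) (sm_kap x (@vopenT R g) 1%N) (I : setT v) e0.
by exists d => // w /H; rewrite -toCN -toCD cn_toC.
Qed.

Lemma kap_lt_open x e : vopen [set v | kap x v < e].
Proof.
move=> v /= h; have e0 : 0 < e - kap x v by rewrite subr_gt0.
have [d d0 H] := kap_cont x v e0; exists d => // w /H.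
by rewrite ltr_norml => /andP[_]; rewrite ltrBlDr subrK.
Qed.

Lemma kap_gt_open x e : vopen [set v | e < kap x v].
Proof.
move=> v /= h; have e0 : 0 < kap x v - e by rewrite subr_gt0.
have [d d0 H] := kap_cont x v e0; exists d => // w /H.
by rewrite ltr_norml => /andP[+ _]; rewrite opprB ltrBrDr subrK.
Qed.

(* Lattice-invariant open sets, i.e. the open sets of the torus. *)
Definition lopen U := vopen U /\ forall v l, lat l -> U v -> U (v + l).
Lemma lopenT : lopen setT. Proof. by split=> //; exact: vopenT. Qed.
Lemma lopenI U U' : lopen U -> lopen U' -> lopen (U `&` U').
Proof.
move=> [oU iU] [oU' iU']; split; first exact: vopenI.
by move=> v l ll [h h']; split; [exact: iU|exact: iU'].
Qed.
Lemma lopen_lt x e : lopen [set v | kap x v < e].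
Proof. by split; [exact: kap_lt_open|move=> v l ll /=; rewrite kap_lat]. Qed.
Lemma lopen_gt x e : lopen [set v | e < kap x v].
Proof. by split; [exact: kap_gt_open|move=> v l ll /=; rewrite kap_lat]. Qed.

Lemma kap_basis x e : 0 < e -> exists2 d : R, 0 < d & forall v, kap x v < d -> vn (v - lam x v - x) < e.
Proof.
move=> e0; set B := \sum_i vn (b i).
have B0 : 0 <= B by apply: sumr_ge0 => i _; exact: vn_ge0.
set r := Num.min 2^-1 (e / (B + 1)).
have r0 : 0 < r by rewrite lt_min invr_gt0 ltr0n divr_gt0//; lra.
have r2 : 0 <= r <= 2^-1 by rewrite (ltW r0) ge_min lexx.
exists (1 - cos (2 * pi * r)).
  have p0 := pi_gt0 R; rewrite subr_gt0 -[X in _ < X]cos0 ltr_cos ?mulr_gt0//.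
    by rewrite in_itv /= lexx (ltW p0).
  exact: pi_itv.
move=> v k; have h := kap_box r2 k; rewrite [X in vn X]tlE.
have vs (F : 'I_(2 * g) -> V) : vn (\sum_i F i) <= \sum_i vn (F i).
  elim/big_rec2: _ => [|i y z _ IH]; first by rewrite vn0.
  by apply: le_trans (vnD _ _) _; rewrite lerD2l.
apply: le_lt_trans (vs _) _; apply: (@le_lt_trans _ _ (r * B)).
  rewrite mulr_sumr; apply: ler_sum => i _; rewrite vn_sc ler_wpM2r ?vn_ge0//.
  exact/ltW/h.
apply: (@le_lt_trans _ _ (e / (B + 1) * B)).
  by rewrite ler_wpM2r// ge_min lexx orbT.
by rewrite mulrAC ltr_pdivrMr; [rewrite ltr_pM2l//; lra|lra].
Qed.

Lemma lopen_basis U x : lopen U -> U x -> exists2 d : R, 0 < d & forall v, kap x v < d -> U v.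
Proof.
move=> [oU iU] Ux; have [e e0 He] := oU x Ux.
have [d d0 Hd] := kap_basis x e0; exists d => // v /Hd /He h.
by have := iU _ _ (lam_lat x v) h; rewrite subrK.
Qed.

Definition cube (x : V) (r : R) : set V := [set v | forall i, `|tl i (v - x)| <= r].

Lemma vn_sumle (F : 'I_(2 * g) -> V) : vn (\sum_i F i) <= \sum_i vn (F i).
Proof.
elim/big_rec2: _ => [|i y z _ IH]; first by rewrite vn0.
by apply: le_trans (vnD _ _) _; rewrite lerD2l.
Qed.

(** Compactness of a product of segments in R^(2g), transported along the lattice coordinates. *)
Lemma cube_cover (W : V -> set V) (x : V) (r : R) :
  (forall y, cube x r y -> vopen (W y) /\ W y y) ->
  exists I : seq V, (forall y, y \in I -> cube x r y) /\ forall v, cube x r v -> exists2 y, y \in I & W y v.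
Proof.
move=> cW; pose P (u : 'rV[R]_(2 * g)) : V := x + \sum_i sc (u ord0 i) (b i).
pose A := [set u : 'rV[R]_(2 * g) | forall i, `[- r, r]%classic (u ord0 i)].
have cA : compact A.
  by apply: (@rV_compact _ _ (fun=> `[- r, r]%classic)) => i; exact: segment_compact.
rewrite compact_cover in cA.
have oP y : cube x r y -> open (P @^-1` W y).
  move=> cy; rewrite openE => u Wu; have [oW _] := cW y cy; have [e e0 He] := oW _ Wu.
  set B := \sum_i vn (b i); have B0 : 0 <= B by apply: sumr_ge0 => i _; exact: vn_ge0.
  apply/nbhs_ballP; exists (e / (B + 1)); first by rewrite /= divr_gt0//; lra.
  move=> w /= hb; apply: He; rewrite /P opprD addrACA subrr add0r -sumrB.
  apply: le_lt_trans (vn_sumle _) _; apply: (@le_lt_trans _ _ (e / (B + 1) * B)).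
    rewrite mulr_sumr; apply: ler_sum => i _; rewrite -scN -scD vn_sc ler_wpM2r ?vn_ge0//.
    have := hb.2 ord0 i; rewrite -ball_normE /ball_ /= distrC; exact: ltW.
  by rewrite mulrAC ltr_pdivrMr; [rewrite ltr_pM2l//; lra|lra].
have PA v : cube x r v -> exists2 u, A u & P u = v.
  move=> cv; exists (\row_i tl i (v - x)).
    by move=> i; rewrite /= in_itv /= mxE -ler_norml.
  rewrite /P -[RHS](subrKC x); congr (_ + _); rewrite [RHS]tlE.
  by apply: eq_bigr => i _; rewrite mxE.
have AP u : A u -> cube x r (P u).
  move=> Au i; rewrite /P addrAC subrr add0r tl_uniq.
  by have := Au i; rewrite /= in_itv /= ler_norml.
have [|D' sD cov] := cA V (cube x r) (fun y => P @^-1` W y) oP.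
  by move=> u Au; exists (P u); [exact: AP|case: (cW _ (AP u Au))].
exists (finmap.enum_fset D'); split.
  by move=> y yD; have := sD y yD; rewrite inE.
by move=> v /PA[u Au <-]; have [y Dy Wy] := cov u Au; exists y.
Qed.

Lemma lb_cube U f x r : lb U f -> cube x r `<=` U -> bdd (cube x r) f.
Proof.
move=> lf sU; have ex y : exists eM : R * R, cube x r y -> 0 < eM.1 /\ forall w, U w -> vn (w - y) < eM.1 -> cn (f w) <= eM.2.
  have [cy|ncy] := pselect (cube x r y); last by exists (0, 0).
  by have [e [M [e0 H]]] := lf y (sU y cy); exists (e, M).
have [eM HeM] := choice ex.
have [|I [sI HI]] := @cube_cover (fun y => [set w | vn (w - y) < (eM y).1]) x r.
  by move=> y cy; split; [exact: vopen_ball|rewrite /= subrr vn0; case: (HeM y cy)].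
exists (\sum_(y <- I) `|(eM y).2|); first by apply: sumr_ge0.
move=> v cv; have [y yI yv] := HI v cv; have [_ H] := HeM y (sI y yI).
apply: le_trans (H v (sU v cv) yv) _; apply: le_trans (ler_norm _) _.
by rewrite (big_rem y yI) /= lerDl; apply: sumr_ge0.
Qed.

Lemma cube_lat v : exists2 l, lat l & cube 0 1 (v - l).
Proof.
exists (\sum_i (Num.floor (tl i v))%:~R *: b i); first by exists (fun i => Num.floor (tl i v)).
move=> i; rewrite subr0 tlB (_ : tl i (\sum_i _) = (Num.floor (tl i v))%:~R).
  by have /andP[] := floor_itv (tl i v); rewrite intrD ler_norml; lra.
rewrite -[RHS](tl_uniq i (fun i => (Num.floor (tl i v))%:~R)).
by congr tl; apply: eq_bigr => j _; rewrite /sc toC_int.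
Qed.

Lemma finite_cover (W : V -> set V) : (forall x, lopen (W x) /\ W x x) ->
  exists I : seq V, forall v, exists2 x, x \in I & W x v.
Proof.
move=> cW; have [|I [_ HI]] := @cube_cover W 0 1; first by move=> y _; case: (cW y) => [[]].
exists I => v; have [l ll cl] := cube_lat v; have [x xI Wx] := HI _ cl; exists x => //.
by have [[_ iW] _] := cW x; have := iW _ _ ll Wx; rewrite subrK.
Qed.

Lemma vn_tl v : vn v <= \sum_i `|tl i v| * vn (b i).
Proof.
by rewrite {1}(tlE v); apply: le_trans (vn_sumle _) _; apply: ler_sum => i _; rewrite vn_sc.
Qed.

Lemma cube_small x (e : R) : 0 < e -> exists2 r : R, 0 < r & forall v, cube x r v -> vn (v - x) < e.
Proof.
move=> e0; set B := \sum_i vn (b i); have B0 : 0 <= B by apply: sumr_ge0 => i _; exact: vn_ge0.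
exists (e / (B + 1)); first by rewrite divr_gt0//; lra.
move=> v cv; apply: le_lt_trans (vn_tl _) _; apply: (@le_lt_trans _ _ (e / (B + 1) * B)).
  by rewrite mulr_sumr; apply: ler_sum => i _; rewrite ler_wpM2r ?vn_ge0.
by rewrite mulrAC ltr_pdivrMr; [rewrite ltr_pM2l//; lra|lra].
Qed.

Lemma ball_cube x (r : R) : 0 < r -> exists2 e : R, 0 < e & forall v, vn (v - x) < e -> cube x r v.
Proof.
move=> r0; have [K K0 H] := tl_bound; exists (r / (K + 1)); first by rewrite divr_gt0//; lra.
move=> v; rewrite ltr_pdivlMr; last by lra.
move=> hv i; apply: le_trans (H i _) _; have := vn_ge0 (v - x).
by move: (vn _) hv => y; clear -K0; nra.
Qed.

(** Sublevel sets of radius [d x] fit into W x while those of half the radius still cover; the gap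
    between the two radii provides both separated shrinkings and supports for bump functions. *)
Lemma lat_shrink (W : V -> set V) : (forall x, lopen (W x) /\ W x x) ->
  exists d : V -> R, (forall x, 0 < d x) /\ (forall x v, kap x v < d x -> W x v) /\
   exists I : seq V, forall v, exists2 x, x \in I & kap x v < d x / 2.
Proof.
move=> cW; have ex x : exists d : R, 0 < d /\ forall v, kap x v < d -> W x v.
  by have [oW Wx] := cW x; have [d d0 H] := lopen_basis oW Wx; exists d.
have [d Hd] := choice ex; exists d; split; first by move=> x; case: (Hd x).
split; first by move=> x; case: (Hd x).
apply: (@finite_cover (fun x => [set v | kap x v < d x / 2])) => x; split; first exact: lopen_lt.
by rewrite /= kap_self; have [d0 _] := Hd x; lra.
Qed.

End LatticeCoordinates.

(** * Quasi-periodic functions and their sheaves *)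

Section Automorphic.

Variables (R : realType) (g : nat) (h : hermform R g).
Local Notation C := (Cplx R).
Local Notation V := 'cV[C]_g.
Local Notation cA := (cA h).
Local Notation nabla := (nabla h).
Local Notation dbar := (dbar h).
Implicit Types (f u : V -> C) (U : set V) (v w d e l p q : V).

(** Lattice translation with its factor of automorphy. It commutes with [nabla], and quasi-periodic
    functions are its fixed points. *)
Definition tr l u v : C := cexp (cA v l) * u (v - l).

Lemma haspd_tr l u v d m : haspd u (v - l) d m ->
  haspd (tr l u) v d (cexp (cA v l) * (m + cA d l * u (v - l))).
Proof.
move=> H; have h1 : haspd (fun w => u (w - l)) v d m by exact: haspd_shift.
have h2 := haspd_cexp (haspd_rlin v d (rlin_cA h l)).
by apply: (iscd_eq (haspdM h2 h1)); ring.
Qed.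

Lemma nabla_tr l u v d m : haspd u (v - l) d m -> nabla d (tr l u) v = tr l (nabla d u) v.
Proof.
move=> H; rewrite /nabla (haspd_pd (haspd_tr H)) /tr (haspd_pd H) cAB (cAC h d l); ring.
Qed.

Lemma dbar_tr l u v q U : sm U u -> U (v - l) -> dbar q (tr l u) v = tr l (dbar q u) v.
Proof.
move=> su Uv; rewrite /dbar (nabla_tr (sm_has q su Uv)) (nabla_tr (sm_has (ci R *: q) su Uv)) /tr; gen_pd; ring.
Qed.

Lemma sm_tr U l u : vopen U -> sm U u -> sm [set v | U (v - l)] (tr l u).
Proof.
move=> oU su; have oU' : vopen [set v | U (v - l)].
  move=> v /oU[e e0 H]; exists e => // w wv; apply: H.
  by rewrite opprB addrA subrK.
apply: smM => //; first by apply: sm_cexp => //; exact: sm_rlin (rlin_cA h l).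
by move=> n; apply: Cn_shift.
Qed.

Lemma nabla2 U f v d e : vopen U -> sm U f -> U v ->
  nabla d (nabla e f) v = pd d (pd e f) v + cA d e * f v + cA v e * pd d f v
    + cA v d * (pd e f v + cA v e * f v).
Proof.
move=> oU sf Uv.
have k : haspd (nabla e f) v d (pd d (pd e f) v + (cA d e * f v + cA v e * pd d f v)).
  exact: haspdD (sm_has d (sm_pd e sf) Uv) (haspdM (haspd_rlin v d (rlin_cA h e)) (sm_has d sf Uv)).
by rewrite {1}/nabla (haspd_pd k) /nabla; gen_pd; ring.
Qed.

(** Ordinary second derivatives commute, so only the constant curvature remains. *)
Lemma nabla_comm U f v d e : vopen U -> sm U f -> U v ->
  nabla d (nabla e f) v = nabla e (nabla d f) v + 2 * cA d e * f v.
Proof.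
move=> oU sf Uv; rewrite (nabla2 d e oU sf Uv) (nabla2 e d oU sf Uv).
rewrite (pd_comm d e oU (sf 3) Uv) (cAC h d e); gen_pd; ring.
Qed.

Lemma nablaZ U f v d c : sm U f -> U v -> nabla d (fun w => c * f w) v = c * nabla d f v.
Proof. by move=> sf Uv; rewrite /nabla (haspd_pd (haspdZ c (sm_has d sf Uv))); ring. Qed.

Lemma dbarC_alg (i A B C' D x y z w m : C) : x + i * y + i * (z + i * w) = 0 ->
  2^-1 * (2^-1 * (A + 2 * x * m + i * (B + 2 * y * m)) + i * (2^-1 * (C' + 2 * z * m + i * (D + 2 * w * m)))) =
  2^-1 * (2^-1 * (A + i * C') + i * (2^-1 * (B + i * D))).
Proof.
move=> k; rewrite -[RHS]addr0 -(mulr0 (2^-1 * m)) -k; by field.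
Qed.

(** The curvature is of type (1,1): the combination that would form its (0,2)-part is h(p, q) + i
    h(i p, q) = 0. *)
Lemma dbarC U f v p q : vopen U -> sm U f -> U v -> dbar p (dbar q f) v = dbar q (dbar p f) v.
Proof.
move=> oU sf Uv.
have s1 d := sm_nabla h d oU sf.
have ex d p' : nabla d (dbar p' f) v = 2^-1 * (nabla d (nabla p' f) v + ci R * nabla d (nabla (ci R *: p') f) v).
  have s2 := smZ (ci R) oU (s1 (ci R *: p')).
  rewrite /(dbar p' f) (nablaZ _ _ (smD oU (s1 p') s2) Uv) (nablaD _ _ (s1 p') s2 Uv).
  by rewrite (nablaZ _ _ (s1 _) Uv).
rewrite {1}/dbar {3}/dbar !ex.
rewrite (nabla_comm p q oU sf Uv) (nabla_comm p (ci R *: q) oU sf Uv).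
rewrite (nabla_comm (ci R *: p) q oU sf Uv) (nabla_comm (ci R *: p) (ci R *: q) oU sf Uv).
have := bell_formula h p q; have := bell_formula h (ci R *: p) q; rewrite hfZ => e2 e1.
have k : cA p q + ci R * cA p (ci R *: q) + ci R * (cA (ci R *: p) q + ci R * cA (ci R *: p) (ci R *: q)) = 0.
  by rewrite e1 e2 mulrA ci2 mulN1r subrr.
exact: dbarC_alg.
Qed.

Variable b : 'I_(2 * g) -> V.
Hypothesis bfree : real_free b.
(** The cocycle condition: the factor of automorphy of l + l' is the product of those of l and l'
    precisely when this phase is trivial. *)
Hypothesis hL : forall l l', lat b l -> lat b l' -> cexp (cA l l') = 1.
Local Notation lat := (lat b).
Local Notation lopen := (lopen b).
Local Notation kap := (kap b).

Definition lauto U f := forall l, lat l -> auto U h l f.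

Lemma lauto_ext U f f' : lopen U -> (forall v, U v -> f v = f' v) -> lauto U f -> lauto U f'.
Proof. by move=> [_ iU] e H l ll v Uv; rewrite -!e ?H//; exact: iU. Qed.

Lemma lauto_tr U f l v : lopen U -> lauto U f -> lat l -> U v -> f v = tr l f v.
Proof.
move=> [oU iU] H ll Uv; have Uv' := iU _ _ (latN bfree ll) Uv.
rewrite /tr -{1}(subrK l v) (H l ll _ Uv') cAB cA_same subr0 //.
Qed.

Lemma lauto_nabla U f d : lopen U -> sm U f -> lauto U f -> lauto U (nabla d f).
Proof.
move=> lU sf H l ll v Uv; have [oU iU] := lU.
have Uvl := iU _ _ ll Uv.
have e w : U w -> f w = tr l f w by move=> Uw; exact: lauto_tr lU H ll Uw.
rewrite (nabla_ext h d oU Uvl e).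
have Uv' : U (v + l - l) by rewrite addrK.
rewrite (nabla_tr (sm_has d sf Uv')) /tr addrK cAD cA_same addr0 //.
Qed.

Lemma lauto_lin U f f' a : lauto U f -> lauto U f' -> lauto U (fun v => f v + a * f' v).
Proof. by move=> H H' l ll v Uv; rewrite H// H'//; ring. Qed.

Lemma lauto_dbar U f q : lopen U -> sm U f -> lauto U f -> lauto U (dbar q f).
Proof.
move=> lU sf H l ll v Uv; rewrite /dbar (lauto_nabla q lU sf H ll Uv).
by rewrite (lauto_nabla (ci R *: q) lU sf H ll Uv); gen_pd; ring.
Qed.

Lemma lauto_dop U f q : lopen U -> sm U f -> lauto U f -> lauto U (dop h q f).
Proof.
move=> lU sf H l ll v Uv; rewrite /dop (lauto_nabla q lU sf H ll Uv).
by rewrite (lauto_nabla (ci R *: q) lU sf H ll Uv); gen_pd; ring.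
Qed.

Lemma dbar0 q v : dbar q (fun=> 0) v = 0.
Proof. by rewrite /dbar /nabla !(haspd_pd (haspd_cst 0 v _)) !mulr0 addr0 mulr0 addr0 mulr0. Qed.

Definition secS (S : seq V) U f :=
  [/\ sm U f, lauto U f & forall q, q \in S -> forall v, U v -> dbar q f v = 0].

Lemma dbar_lin U f f' c q v : vopen U -> sm U f -> sm U f' -> U v ->
  dbar q (fun w => f w + c * f' w) v = dbar q f v + c * dbar q f' v.
Proof. by move=> oU sf sf' Uv; rewrite (dbarD _ _ sf (smZ c oU sf') Uv) (dbarZ _ _ _ sf' Uv). Qed.

Program Definition shS (S : seq V) : @sheaf V C lopen := @Sheaf V C lopen (secS S) _ _ _ _ _.
Next Obligation.
move=> S U U' f [oU' iU'] s [sf af df]; split; first exact: sm_sub sf.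
  by move=> l ll v /s; exact: af.
by move=> q qS v /s; exact: df.
Qed.
Next Obligation.
move=> S U f f' lU e [sf af df]; have [oU iU] := lU; split; first exact: sm_ext sf.
  exact: lauto_ext af.
by move=> q qS v Uv; rewrite -(dbar_ext _ _ oU Uv e) df.
Qed.
Next Obligation.
move=> S U f f' a lU [sf af df] [sf' af' df']; have [oU iU] := lU; split.
- by apply: smD => //; exact: smZ.
- exact: lauto_lin.
by move=> q qS v Uv; rewrite (dbar_lin a q oU sf sf' Uv) (df q qS v Uv) (df' q qS v Uv) mulr0 addr0.
Qed.
Next Obligation.
move=> S U lU; have [oU iU] := lU; split; first exact: sm_cst.
  by move=> l ll v Uv; rewrite mulr0.
by move=> q qS v Uv; exact: dbar0.
Qed.
Next Obligation.
move=> S U f lU H; have [oU iU] := lU; split.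
- apply: sm_loc => v Uv; have [U' [[oU' _] U'v [sf _ _]]] := H v Uv; exists (U `&` U').
  have oo : vopen (U `&` U') by exact: vopenI.
  have uu : (U `&` U') v by split.
  split; [exact: oo|exact: uu|exact: sf].
- by move=> l ll v Uv; have [U' [lU' U'v [_ af _]]] := H v Uv; apply: af.
by move=> q qS v Uv; have [U' [lU' U'v [_ _ df]]] := H v Uv; apply: df.
Qed.

Lemma shS_isop S q : isop (shS S) (dbar q).
Proof.
split.
- move=> U f lU [sf af df]; have [oU iU] := lU; split; first exact: sm_dbar.
    exact: lauto_dbar.
  move=> p pS v Uv; rewrite (dbarC p q oU sf Uv).
  rewrite (dbar_ext _ _ oU Uv (df p pS)); exact: dbar0.
- by move=> U f f' [oU iU] e _ v Uv; exact: (dbar_ext _ _ oU Uv e).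
- by move=> U f f' a [oU _] [sf _ _] [sf' _ _] v Uv; exact: (dbar_lin a q oU sf sf' Uv).
Qed.

(** Equality, beyond equivalence, so that statements about a kernel sheaf can be rewritten along
    [kerS_shS] at every step of the inductions on directions. *)
Lemma sheaf_eq (F F' : @sheaf V C lopen) : (forall U f, F U f <-> F' U f) -> F = F'.
Proof.
case: F => s a1 a2 a3 a4 a5; case: F' => s' b1 b2 b3 b4 b5 /= e.
have es : s = s' by apply/funext => U; apply/funext => f; exact/propext.
by subst s'; congr Sheaf; exact: Prop_irrelevance.
Qed.

Lemma kerS_shS S q : kerS (shS_isop S q) = shS (q :: S).
Proof.
apply: sheaf_eq => U f /=; split.
  move=> [[sf af df] z]; split; [exact: sf|exact: af|].
  by move=> p; rewrite inE => /orP[/eqP ->|]; [exact: z|exact: df].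
move=> [sf af df]; split; last by apply: df; rewrite inE eqxx.
by split; [exact: sf|exact: af|move=> p pS; apply: df; rewrite inE pS orbT].
Qed.

Lemma lat_sep (W : V -> set V) : (forall x, lopen (W x) /\ W x x) ->
  exists (I : seq V) (N : V -> set V) (tau : V -> V),
  [/\ (forall x, lopen (N x)), (forall x, N x `<=` W x), (forall x, tau x \in I /\ N (tau x) x)
    & forall y x, W y x \/ exists U', [/\ lopen U', U' x & forall v, U' v -> ~ N y v]].
Proof.
move=> cW; have [d [d0 [dW [I HI]]]] := lat_shrink bfree cW.
have ex x : exists t, t \in I /\ kap t x < d t / 2 by have [t tI ht] := HI x; exists t.
have [tau Ht] := choice ex.
exists I, (fun x => [set v | kap x v < d x / 2]), tau; split.
- by move=> x; exact: lopen_lt.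
- by move=> x v /= hh; apply: dW; have := d0 x; lra.
- by move=> x; exact: Ht.
move=> y x; case: (ltP (kap y x) (d y)) => hh; first by left; exact: dW.
right; exists [set v | d y / 2 < kap y v]; split; first exact: lopen_gt.
  by rewrite /=; have := d0 y; lra.
by move=> v /= k1 k2; lra.
Qed.

(** Bump functions of [kap i], nonzero only for kap i < d i / 2 and hence well inside W i, divided
    by their sum. Off W i a product ph_i f is smooth because it vanishes on the open set where kap i
    > d i / 2. *)
Lemma lat_pou (W : V -> set V) : (forall x, lopen (W x) /\ W x x) ->
  exists (I : seq V) (ph : V -> V -> C),
  [/\ forall v, \sum_(i <- I) ph i v = 1, forall i v, ph i v != 0 -> W i v &
    forall i U f, lopen U -> shS [::] (W i `&` U) f -> shS [::] U (fun v => ph i v * f v)].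
Proof.
move=> cW; have [d [d0 [dW [I HI]]]] := lat_shrink bfree cW.
pose ps i v := eta 1 (d i / 2 - kap i v).
have eta_pos s : 0 < s -> 0 < eta 1 s :> R by move=> s0; rewrite /eta s0 hornerC mul1r expR_gt0.
have ps0 i v : 0 <= ps i v.
  by rewrite /ps; case: (ltP 0 (d i / 2 - kap i v)) => k; [exact/ltW/eta_pos|rewrite /eta ltNge k].
have psW i v : ps i v != 0 -> kap i v < d i / 2.
  by rewrite /ps /eta; case: ltP => k; [move=> _; lra|rewrite eqxx].
have sps U i : vopen U -> sm U (fun v => toC (ps i v)).
  move=> oU; apply: sm_eta => //; apply: (sm_ext oU (f := fun v => toC (d i / 2) - toC (kap i v))).
    by move=> v _; rewrite -toCN -toCD.
  by apply: smB => //; [exact: sm_cst|exact: sm_kap].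
pose Ps v := \sum_(i <- I) ps i v.
have Ps0 v : 0 < Ps v.
  have [x xI hx] := HI v; rewrite /Ps (big_rem x xI) /=; apply: ltr_pwDl; last by apply: sumr_ge0.
  by apply: eta_pos; rewrite subr_gt0.
have PsC v : toC (Ps v) != 0 :> C by rewrite toC_eq0 gt_eqF.
have psl i v l : lat l -> ps i (v + l) = ps i v by move=> ll; rewrite /ps kap_lat.
have Psl v l : lat l -> Ps (v + l) = Ps v by move=> ll; apply: eq_bigr => i _; exact: psl.
have sPs U : vopen U -> sm U (fun v => toC (Ps v)).
  move=> oU; apply: (sm_ext oU (f := fun v => \sum_(i <- I) toC (ps i v))).
    by move=> v _; rewrite /Ps toC_sum.
  by apply: sm_sum => // i _; exact: sps.
exists I, (fun i v => toC (ps i v) * (toC (Ps v))^-1); split.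
- by move=> v; rewrite -mulr_suml -toC_sum; exact: mulfV (PsC v).
- move=> i v; rewrite mulf_eq0 negb_or => /andP[+ _]; rewrite toC_eq0 => /psW k.
  by apply: dW; have := d0 i; lra.
move=> i U f lU [sf af _]; have [oU iU] := lU; have [[oW iW] _] := cW i; split.
- apply: sm_loc => v Uv; have [Wv|nW] := pselect (W i v).
    exists (W i `&` U); split=> //; first exact: vopenI.
    have oo : vopen (W i `&` U) by exact: vopenI.
    apply: smM => //; apply: smM => //; first exact: sps.
    by apply: smV_cont => //; exact: sPs.
  exists (U `&` [set v | d i / 2 < kap i v]); split.
  + by apply: vopenI => //; exact: kap_gt_open.
  + split=> //=; case: (ltP (d i / 2) (kap i v)) => // k; case: nW; apply: dW; have := d0 i; lra.
  apply: (sm_ext _ (f := fun=> 0)); first by apply: vopenI => //; exact: kap_gt_open.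
    move=> w [_ /= k]; case: (eqVneq (ps i w) 0) => [->|/psW k']; last by have := lt_trans k k'; rewrite ltxx.
    by rewrite toC0 !mul0r.
  by apply: sm_cst; apply: vopenI => //; exact: kap_gt_open.
- move=> l ll v Uv; rewrite psl// Psl//.
  case: (eqVneq (ps i v) 0) => [->|/psW k]; first by rewrite toC0 !mul0r mulr0.
  rewrite af//; first by ring.
  by split=> //; apply: dW; have := d0 i; lra.
by move=> q; rewrite in_nil.
Qed.

Lemma lauto_bdd f : lb setT f -> lauto setT f -> bdd setT f.
Proof.
move=> lf af; have [M M0 H] := lb_cube bfree lf (subsetT (cube b 0 1)).
exists (2 * M); first by rewrite mulr_ge0.
move=> v _; have [l ll cl] := cube_lat bfree v.
rewrite -(subrK l v) af//; apply: le_trans (cnM _ _) _.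
by apply: ler_pM; rewrite ?cn_ge0 ?cn_cexpA ?H.
Qed.

(** Up to the factor 2 of the l1 norm, the size of a quasi-periodic function is determined on a
    period cube, where compactness bounds it; its covariant derivatives are quasi-periodic again. *)
Lemma lauto_SB f : sm setT f -> lauto setT f -> SB h setT f.
Proof.
move=> sf af n; elim: n f sf af => [|n IH] f sf af.
  by split; [exact: lauto_bdd (sf 0%N) af|exact: I].
split; first exact: lauto_bdd (sf 0%N) af.
move=> d; split; first by move=> v Uv; exact: sm_has.
apply: IH; first by apply: sm_nabla => //; exact: vopenT.
by apply: lauto_nabla => //; exact: lopenT.
Qed.

End Automorphic.

(** * Local solution of one Cauchy-Riemann equation *)

Section LocalSolution.

Variables (R : realType) (g : nat) (h : hermform R g).
Local Notation C := (Cplx R).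
Local Notation V := 'cV[C]_g.
Variables (q : 'I_g -> V) (a : 'I_g -> R).
Hypotheses (hq : forall i j, h (q i) (q j) = if i == j then toC (a i) else 0) (a0 : forall i, a i != 0).
Implicit Types (f u : V -> C) (U : set V) (v w d e l p x : V) (i j k : 'I_g).

Definition zc_ i v : C := h v (q i) * (toC (a i))^-1.
Hypothesis zspan : forall v, v = \sum_i zc_ i v *: q i.

Lemma aC i : toC (a i) != 0 :> C. Proof. by rewrite toC_eq0. Qed.
Lemma zD i v w : zc_ i (v + w) = zc_ i v + zc_ i w. Proof. by rewrite /zc_ hfD mulrDl. Qed.
Lemma zZ i (c : C) v : zc_ i (c *: v) = c * zc_ i v. Proof. by rewrite /zc_ hfZ mulrA. Qed.
Lemma zB i v w : zc_ i (v - w) = zc_ i v - zc_ i w.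
Proof. by rewrite zD -scaleN1r zZ mulN1r. Qed.
Lemma zq i j : zc_ i (q j) = (i == j)%:R.
Proof. by rewrite /zc_ hq eq_sym; case: eqP => [->|_]; rewrite ?mulfV ?aC ?mul0r. Qed.

Lemma z_bound : exists2 K : R, 0 <= K & forall i v, cn (zc_ i v) <= K * vn v.
Proof.
have [K [K0 HK]] := hfK h; exists (\sum_j K * vn (q j) * cn (toC (a j))^-1).
  by apply: sumr_ge0 => j _; rewrite !mulr_ge0 ?vn_ge0 ?cn_ge0.
move=> i v; apply: le_trans (cnM _ _) _.
apply: (@le_trans _ _ (K * vn (q i) * cn (toC (a i))^-1 * vn v)).
  by rewrite mulrAC ler_wpM2r ?cn_ge0// mulrAC; exact: HK.
rewrite ler_wpM2r ?vn_ge0// (bigD1 i)//= lerDl; apply: sumr_ge0 => j _.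
by rewrite !mulr_ge0 ?vn_ge0 ?cn_ge0.
Qed.

Lemma rlin_z i : rlin (zc_ i).
Proof.
split; first exact: zD.
split; first by move=> c v; exact: zZ.
by have [K K0 H] := z_bound; exists K.
Qed.

Lemma vn_z v : vn v <= \sum_i cn (zc_ i v) * vn (q i).
Proof.
rewrite {1}(zspan v); elim/big_rec2: _ => [|i y z _ IH]; first by rewrite vn0.
by apply: le_trans (vnD _ _) _; apply: lerD => //; exact: vn_scale.
Qed.

Lemma z_small (e : R) : 0 < e -> exists2 r : R, 0 < r & forall v, (forall i, cn (zc_ i v) < r) -> vn v < e.
Proof.
move=> e0; set B := \sum_i vn (q i); have B0 : 0 <= B by apply: sumr_ge0 => i _; exact: vn_ge0.
exists (e / (B + 1)); first by rewrite divr_gt0//; lra.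
move=> v Hv; apply: le_lt_trans (vn_z _) _; apply: (@le_lt_trans _ _ (e / (B + 1) * B)).
  by rewrite mulr_sumr; apply: ler_sum => i _; rewrite ler_wpM2r ?vn_ge0// ltW.
by rewrite mulrAC ltr_pdivrMr; [rewrite ltr_pM2l//; lra|lra].
Qed.

Lemma toC_nsq (z : C) : toC (nsq z) = z * cconj z.
Proof. by apply: ceq; rewrite !reimE /nsq; ring. Qed.
Lemma nsq_cn (z : C) : cn z ^+ 2 <= 2 * nsq z /\ nsq z <= cn z ^+ 2.
Proof.
rewrite /nsq /cn -(real_normK (num_real (re z))) -(real_normK (num_real (im z))).
have := normr_ge0 (re z); have := normr_ge0 (im z); move: (`|re z|) (`|im z|) => X Y.
have := sqr_ge0 (X - Y); have : forall u w : R, 0 <= u -> 0 <= w -> 0 <= u * w by move=> *; rewrite mulr_ge0.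
by move=> P S y x; have := P _ _ x y; move: S; rewrite !expr2; split; lra.
Qed.

(* Adding c |z_k|^2 to the form while multiplying sections by [gau]
   does not change [dbar]. *)
Program Definition hmod (c : R) k : hermform R g :=
  @HermForm R g (fun v w => h v w + toC c * (zc_ k v * cconj (zc_ k w))) _ _ _ _.
Next Obligation. by move=> c k u v w /=; rewrite hfD zD; ring. Qed.
Next Obligation. by move=> c k s v w /=; rewrite hfZ zZ; ring. Qed.
Next Obligation. move=> c k v w /=; rewrite (hfC h v w) cconjD (cconjM (toC c)) (cconjM (zc_ k v)) cconjK cconj_toC.
ring.
Qed.
Next Obligation.
move=> c k; have [K [K0 HK]] := hfK h; have [M M0 HM] := z_bound.
exists (K + `|c| * (M * M)); split; first by rewrite addr_ge0 ?mulr_ge0.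
move=> v w; apply: le_trans (cnD _ _) _; rewrite !mulrDl lerD ?HK//.
rewrite cnMtoC (_ : _ * vn w = `|c| * ((M * vn v) * (M * vn w))); last by ring.
apply: ler_wpM2l => //; apply: le_trans (cnM _ _) _; rewrite cn_conj.
by apply: ler_pM; rewrite ?cn_ge0 ?HM.
Qed.

Definition gau (c : R) k v : C := cexp (toC (- (c / 2)) * (zc_ k v * cconj (zc_ k v))).

Lemma sm_gau c k U : vopen U -> sm U (gau c k).
Proof.
move=> oU; apply: sm_cexp => //; apply: smZ => //.
by have s := sm_rlin oU (rlin_z k); apply: smM => //; exact: sm_conj.
Qed.

Lemma gau_neq0 c k v : gau c k v != 0. Proof. exact: cexp_neq0. Qed.

Lemma haspd_gau c k v d : haspd (gau c k) v d
  (toC (- (c / 2)) * (zc_ k d * cconj (zc_ k v) + zc_ k v * cconj (zc_ k d)) * gau c k v).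
Proof.
have h1 := haspd_rlin v d (rlin_z k).
exact: haspd_cexp (haspdZ _ (haspdM h1 (haspd_conj h1))).
Qed.

Lemma gau_alg (i c' zp zv zp' zv' G F A B H : C) : i * i = -1 ->
  2^-1 * ((- (c' * 2^-1) * (zp * zv' + zv * zp') * G * F + G * A) +
     i * (- (c' * 2^-1) * (i * zp * zv' + zv * (- i * zp')) * G * F + G * B)) +
  2^-1 * (H + c' * (zv * zp')) * (G * F) =
  G * (2^-1 * (A + i * B) + 2^-1 * H * F).
Proof.
move=> i2; have -> : i * (- (c' * 2^-1) * (i * zp * zv' + zv * (- i * zp')) * G * F + G * B) =
   - (c' * 2^-1) * (i * i) * (zp * zv' - zv * zp') * G * F + i * (G * B) by ring.
by rewrite i2; field.
Qed.

Lemma dbar_gau c k U f p v : sm U f -> U v ->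
  dbar (hmod c k) p (fun w => gau c k w * f w) v = gau c k v * dbar h p f v.
Proof.
move=> sf Uv; rewrite !dbar_formula /=.
rewrite (haspd_pd (haspdM (haspd_gau c k v p) (sm_has p sf Uv))).
rewrite (haspd_pd (haspdM (haspd_gau c k v (ci R *: p)) (sm_has (ci R *: p) sf Uv))).
rewrite zZ cconjM cconj_ci toCN toCM toCV (toC_nat R 2).
exact: gau_alg (ci2 R).
Qed.

Lemma eta1_gt0 (s : R) : 0 < s -> 0 < eta 1 s.
Proof. by move=> s0; rewrite /eta s0 hornerC mul1r expR_gt0. Qed.
Lemma eta1_0 (s : R) : s <= 0 -> eta 1 s = 0.
Proof. by move=> s0; rewrite /eta ltNge s0. Qed.
Lemma eta1_ge0 (s : R) : 0 <= eta 1 s.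
Proof. by case: (ltP 0 s) => k; [exact/ltW/eta1_gt0|rewrite eta1_0]. Qed.

Lemma pl_den (s : R) : 0 < eta 1 (1 - s) + eta 1 (s - 2^-1).
Proof.
have := eta1_ge0 (1 - s); have := eta1_ge0 (s - 2^-1); case: (ltP s 1) => k.
  by have := @eta1_gt0 (1 - s); lra.
by have := @eta1_gt0 (s - 2^-1); lra.
Qed.

(** A smooth cut-off falling from 1 to 0 between 1/2 and 1; the two terms of the denominator never
    vanish together. *)
Definition pla (s : R) : R := eta 1 (1 - s) / (eta 1 (1 - s) + eta 1 (s - 2^-1)).

Lemma pla1 s : s <= 2^-1 -> pla s = 1.
Proof.
move=> s1; rewrite /pla (eta1_0 (s := s - _)) ?subr_le0// addr0 divff// gt_eqF// eta1_gt0//.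
lra.
Qed.

Lemma pla0 s : 1 <= s -> pla s = 0.
Proof. by move=> s1; rewrite /pla eta1_0 ?subr_le0// mul0r. Qed.

Lemma sm_pla (U : set V) (r : V -> R) : vopen U -> sm U (fun v => toC (r v)) -> sm U (fun v => toC (pla (r v))).
Proof.
move=> oU s.
have s1 : sm U (fun v => toC (eta 1 (1 - r v))).
  apply: sm_eta => //; apply: (sm_ext oU (f := fun v => 1 - toC (r v))).
    by move=> v _; rewrite toCD toCN toC1.
  by apply: smB => //; exact: sm_cst.
have s2 : sm U (fun v => toC (eta 1 (r v - 2^-1))).
  apply: sm_eta => //; apply: (sm_ext oU (f := fun v => toC (r v) - toC 2^-1)).
    by move=> v _; rewrite toCD toCN.
  by apply: smB => //; exact: sm_cst.
have s3 : sm U (fun v => (toC (eta 1 (1 - r v) + eta 1 (r v - 2^-1)))^-1).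
  apply: smV_cont => //.
    by apply: (sm_ext oU _ (smD oU s1 s2)) => v _; rewrite toCD.
  by move=> v _; rewrite toC_eq0 gt_eqF// pl_den.
by apply: (sm_ext oU _ (smM oU s1 s3)) => v _; rewrite -toCV -toCM.
Qed.

Definition pl (e : R) (v : V) k x : R := pla (nsq (zc_ k (v - x)) / e).

Lemma rlin_z_shift U k x : vopen U -> sm U (fun v => zc_ k (v - x)).
Proof.
move=> oU; apply: (sm_ext oU (f := fun v => zc_ k v - zc_ k x)); first by move=> v _; rewrite zB.
by apply: smB => //; [exact: sm_rlin (rlin_z k)|exact: sm_cst].
Qed.

Lemma sm_nsqz U k x : vopen U -> sm U (fun v => toC (nsq (zc_ k (v - x)))).
Proof.
move=> oU; have s := rlin_z_shift k x oU.
apply: (sm_ext oU (f := fun v => zc_ k (v - x) * cconj (zc_ k (v - x)))).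
  by move=> v _; rewrite toC_nsq.
by apply: smM => //; exact: sm_conj.
Qed.

Lemma sm_pl U (e : R) k x : vopen U -> sm U (fun v => toC (pl e v k x)).
Proof.
move=> oU; apply: sm_pla => //; apply: (sm_ext oU (f := fun v => toC e^-1 * toC (nsq (zc_ k (v - x))))).
  by move=> v _; rewrite -toCM mulrC.
by apply: smZ => //; exact: sm_nsqz.
Qed.

Lemma haspd_pl (e : R) k x v p : zc_ k p = 0 -> haspd (fun v => toC (pl e v k x)) v p 0.
Proof.
move=> zp; apply: (iscd_ext (u := fun=> toC (pl e v k x))); last exact: iscd_cst.
move=> t; have e1 : zc_ k (v + sc t p - x) = zc_ k (v - x) by rewrite !zB zD /sc zZ zp mulr0 addr0.
by rewrite /pl e1.
Qed.

Lemma dbar_pl U (e : R) k x f p v : zc_ k p = 0 -> sm U f -> U v -> vopen U ->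
  dbar h p (fun w => toC (pl e w k x) * f w) v = toC (pl e v k x) * dbar h p f v.
Proof.
move=> zp sf Uv oU; rewrite (dbarM _ _ sf (sm_pl e k x oU) Uv).
rewrite (haspd_pd (haspd_pl e x v zp)) (haspd_pd (haspd_pl e x v _)) ?zZ ?zp ?mulr0//.
by rewrite addr0 mulr0 mul0r add0r.
Qed.

Lemma vopen_z (P : pred 'I_g) x (r : R) : vopen [set v | forall j, P j -> cn (zc_ j (v - x)) < r].
Proof.
move=> v /= Hv; have [K K0 HK] := z_bound.
have ex j : exists e : R, 0 < e /\ (P j -> cn (zc_ j (v - x)) + K * e < r).
  case: (boolP (P j)) => Pj; last by exists 1; split.
  exists ((r - cn (zc_ j (v - x))) / (K + 1)); have := Hv j Pj; move: (cn _) => y yr.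
  split; first by rewrite divr_gt0//; lra.
  move=> _; rewrite mulrCA -ltrBrDl gtr_pMr; last by lra.
  by rewrite ltr_pdivrMr; lra.
have [e He] := choice ex.
pose m := \big[Num.min/1]_j e j.
have m0 : 0 < m.
  apply: (big_ind (fun y : R => 0 < y)) => [//|y z y0 z0|j _]; first by rewrite lt_min y0.
  by case: (He j).
have mj j : m <= e j by rewrite /m (bigD1 j)//= ge_min lexx.
exists m => // w wv j Pj; have [_ /(_ Pj) hj] := He j; apply: le_lt_trans hj.
rewrite (_ : w - x = (v - x) + (w - v)); last by rewrite [RHS]addrC addrA subrK.
rewrite zD; apply: le_trans (cnD _ _) _; rewrite lerD2l; apply: le_trans (HK _ _) _.
by apply: ler_wpM2l => //; apply: le_trans (ltW wv) (mj j).
Qed.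

Lemma nsq_cont_gt k x (e : R) : vopen [set v | e < nsq (zc_ k (v - x))].
Proof.
move=> v /= hv; have e0 : 0 < nsq (zc_ k (v - x)) - e by rewrite subr_gt0.
have [d d0 H] := Cn_vcont (@vopenT R g) (sm_nsqz k x (@vopenT R g) 1%N) (I : setT v) e0.
exists d => // w /H; rewrite -toCN -toCD cn_toC ltr_norml => /andP[+ _].
by rewrite opprB ltrBrDr subrK.
Qed.

Lemma nsq_cont_lt k x (e : R) : vopen [set v | nsq (zc_ k (v - x)) < e].
Proof.
move=> v /= hv; have e0 : 0 < e - nsq (zc_ k (v - x)) by rewrite subr_gt0.
have [d d0 H] := Cn_vcont (@vopenT R g) (sm_nsqz k x (@vopenT R g) 1%N) (I : setT v) e0.
exists d => // w /H; rewrite -toCN -toCD cn_toC ltr_norml => /andP[_].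
by rewrite ltrBlDr subrK.
Qed.

Variable b : 'I_(2 * g) -> V.
Hypothesis bfree : real_free b.

(** The cut-off of f depends on z_k alone, so the equations in the other directions of S survive,
    and extension by zero gives a function on a cylinder over a polydisc in the other coordinates.
    [hmod] and [gau] change the k-th diagonal value to 1, where [Top] is a right inverse of the k-th
    operator commuting with the others; the change is undone at the end. *)
Lemma local_solution U f x k (S : pred 'I_g) : vopen U -> sm U f -> U x -> ~~ S k ->
  (forall j, S j -> forall v, U v -> dbar h (q j) f v = 0) ->
  exists U' u, [/\ vopen U', U' x, U' `<=` U, sm U' u &
    forall v, U' v -> dbar h (q k) u v = f v /\ forall j, S j -> dbar h (q j) u v = 0].
Proof.
move=> oU sf Ux Sk df; have [e0 e00 He0] := oU x Ux.
have [e1 e10 He1] := z_small e00; have [K K0 HK] := z_bound.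
have [r r0 Hr] := cube_small bfree x (divr_gt0 e10 (ltr_wpDl K0 ltr01)).
have [e2 e20 He2] := ball_cube b x r0.
have [e3 e30 He3] := z_small e20.
pose ep := Num.min e1 e3; have ep0 : 0 < ep by rewrite lt_min e10 e30.
(* As cn^2 <= 2 nsq, a coordinate with cn >= ep has nsq >= ep^2 / 2 > e and lies beyond the support
   of the cut-off. *)
pose e := ep ^+ 2 / 4; have ee0 : 0 < e by rewrite divr_gt0// exprn_gt0.
pose PD r' := [set v : V | forall j, xpredT j -> cn (zc_ j (v - x)) < r'].
pose Cy r' := [set v : V | forall j, j != k -> cn (zc_ j (v - x)) < r'].
have PDU : PD e1 `<=` U by move=> v Hv; apply: He0; apply: He1 => j; exact: Hv.
have cubePD : cube b x r `<=` PD e1.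
  move=> v /Hr hv j _; apply: le_lt_trans (HK _ _) _.
  apply: (@le_lt_trans _ _ (K * (e1 / (K + 1)))); first by rewrite ler_wpM2l// ltW.
  by rewrite mulrCA gtr_pMr// ltr_pdivrMr; lra.
have oC r' : vopen (Cy r') by exact: (@vopen_z (fun j => j != k) x r').
have oP r' : vopen (PD r') by exact: (@vopen_z xpredT x r').
have cC r' : cyl (q k) (Cy r').
  move=> v z Hv j jk; rewrite addrAC zB zZ zq (negbTE jk) mulr0 subr0; exact: Hv.
have Csub : Cy ep `<=` Cy e1.
  by move=> v Hv j jk; apply: lt_le_trans (Hv j jk) _; rewrite ge_min lexx.
pose B v := toC (pl e v k x) * f v.
have caseC v : Cy e1 v -> PD e1 v \/ e < nsq (zc_ k (v - x)).
  move=> Cv; case: (ltP (cn (zc_ k (v - x))) e1) => hk.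
    by left=> j _; case: (eqVneq j k) => [->//|]; exact: Cv.
  right; have [n1 _] := nsq_cn (zc_ k (v - x)).
  have : ep <= cn (zc_ k (v - x)) by apply: le_trans hk; rewrite ge_min lexx.
  rewrite /e; move: n1; move: (cn _) (nsq _) => y n n1 ey.
  have : ep ^+ 2 <= y ^+ 2 by rewrite lerXn2r ?nnegrE ?(ltW ep0)// (le_trans (ltW ep0)).
  have : 0 < ep ^+ 2 by rewrite exprn_gt0.
  lra.
have B0 v : e < nsq (zc_ k (v - x)) -> B v = 0.
  by move=> hn; rewrite /B /pl pla0 ?toC0 ?mul0r// ler_pdivlMr// mul1r ltW.
have sB : sm (Cy e1) B.
  apply: sm_loc => v /caseC[Pv|hn].
    exists (PD e1); split; [exact: oP|exact: Pv|].
    by apply: smM; [exact: oP|exact: sm_pl|exact: sm_sub PDU sf].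
  exists [set v | e < nsq (zc_ k (v - x))]; split; [exact: nsq_cont_gt|exact: hn|].
  have e' w : e < nsq (zc_ k (w - x)) -> 0 = B w by move=> hw; rewrite B0.
  exact: (sm_ext (@nsq_cont_gt k x e) e' (sm_cst (0 : C) (@nsq_cont_gt k x e))).
have dB j v : S j -> Cy e1 v -> dbar h (q j) B v = 0.
  move=> Sj /caseC[Pv|hn].
    have jk : j != k by apply: contra Sk => /eqP <-.
    rewrite (dbar_pl e x _ (sm_sub PDU sf) Pv (oP e1)) ?zq ?(eq_sym k) ?(negbTE jk)//.
    by rewrite (df j Sj v (PDU v Pv)) mulr0.
  have e' w : e < nsq (zc_ k (w - x)) -> B w = 0 by move=> hw; rewrite B0.
  by rewrite (dbar_ext h (q j) (@nsq_cont_gt k x e) hn e') dbar0.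
(* This c makes the diagonal value of the new form at q_k equal to a_k + c = 1. *)
pose c := 1 - a k; set h' := hmod c k.
pose f1 v := gau c k v * B v.
have sf1 : sm (Cy e1) f1 by apply: smM => //; exact: sm_gau.
(* A class of functions stable under [nabla] whose members are bounded on the smaller cylinder: they
   vanish for large z_k, and what remains lies in a compact cube. *)
pose Pc (u : V -> C) := sm (Cy e1) u /\ forall v, Cy e1 v -> e < nsq (zc_ k (v - x)) -> u v = 0.
have bP u : Pc u -> bdd (Cy ep) u.
  move=> [su zu]; have cub : cube b x r `<=` Cy e1 by move=> v /cubePD Pv j _; exact: Pv.
  have [M M0 HM] := lb_cube bfree (su 0%N) cub; exists M => // v Cv.
  case: (ltP e (nsq (zc_ k (v - x)))) => hn; first by rewrite zu ?cn0//; exact: Csub.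
  apply: HM; apply: He2; apply: He3 => j.
  apply: (@lt_le_trans _ _ ep); last by rewrite ge_min lexx orbT.
  case: (eqVneq j k) => [->|jk]; last exact: Cv.
  have [n1 _] := nsq_cn (zc_ k (v - x)); move: n1 hn; rewrite /e.
  have y0 := cn_ge0 (zc_ k (v - x)); move: (cn _) y0 (nsq _) => y y0 n n1 hn.
  rewrite ltNge; apply/negP => ey.
  have : ep ^+ 2 <= y ^+ 2 by rewrite lerXn2r ?nnegrE ?(ltW ep0).
  have : 0 < ep ^+ 2 by rewrite exprn_gt0.
  lra.
have nP u d : Pc u -> Pc (nabla h' d u).
  move=> [su zu]; split; first exact: sm_nabla.
  move=> v Cv hn; have oo := vopenI (oC e1) (@nsq_cont_gt k x e).
  have e' w : (Cy e1 `&` [set v | e < nsq (zc_ k (v - x))]) w -> u w = 0 by move=> [? ?]; exact: zu.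
  rewrite (nabla_ext h' d oo (conj Cv hn) e').
  by rewrite /nabla (haspd_pd (haspd_cst 0 v d)) mulr0 addr0.
have SP u : Pc u -> SB h' (Cy ep) u.
  move=> Pu n; elim: n u Pu => [|n IH] u Pu; first by split; [exact: bP|exact: I].
  split; [exact: bP|move=> d; split; last by apply: IH; exact: nP].
  by move=> v /Csub Cv; case: Pu => su _; exact: sm_has su Cv.
have Pf1 : Pc f1 by split=> // v _ hn; rewrite /f1 B0// mulr0.
have S1 := SP f1 Pf1.
have h'k : h' (q k) (q k) = toC 1.
  by rewrite /= hq eqxx zq eqxx mul1r -toC1 cconj_toC toC1 mulr1 -toCD /c addrC subrK.
have one0 : (1 : R) != 0 by rewrite oner_eq0.
pose u1 := Top h' (q k) 1 f1.
have su1 : sm (Cy ep) u1 := SB_sm (oC ep) (SB_Top (oC ep) (cC ep) one0 S1).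
pose u v := gau (- c) k v * u1 v.
have gg v : gau c k v * gau (- c) k v = 1.
  by rewrite /gau -cexpD -mulrDl -toCD mulNr opprK addNr toC0 mul0r cexp0.
have su : sm (Cy ep) u by apply: smM => //; exact: sm_gau.
have ud p v : Cy ep v -> gau c k v * dbar h p u v = dbar h' p u1 v.
  move=> Cv; rewrite -(dbar_gau c k p su Cv); apply: (dbar_ext _ _ (oC ep) Cv) => w _.
  by rewrite /u mulrA gg mul1r.
exists (U `&` (Cy ep `&` [set v | nsq (zc_ k (v - x)) < e / 2])), u; split.
- by apply: vopenI => //; apply: vopenI => //; exact: nsq_cont_lt.
- split=> //; split; first by move=> j _; rewrite subrr /zc_ hf0 mul0r cn0.
  by rewrite /= subrr /zc_ hf0 mul0r /nsq re0 im0 expr0n addr0 divr_gt0.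
- by move=> v [].
- by apply: sm_sub su => v [_ []].
move=> v [Uv [Cv /= hn]]; split.
  apply: (mulfI (gau_neq0 c k v)); rewrite ud// /u1.
  rewrite (dbar_T (oC ep) h'k (cC ep) one0 S1 Cv).2 ltr01 /f1 /B /pl pla1 ?toC1 ?mul1r//.
  by rewrite ler_pdivrMr// mulrC ltW.
move=> j Sj; apply: (mulfI (gau_neq0 c k v)); rewrite mulr0 ud// /u1.
have jk : j != k by apply: contra Sk => /eqP <-.
have o1 : h' (q k) (q j) = 0.
  by rewrite /= hq (eq_sym k) (negbTE jk) zq [zc_ k (q j)]zq (eq_sym k j) (negbTE jk) -toC0 cconj_toC toC0 !mulr0 addr0.
rewrite (dbar_Top (oC ep) o1 (cC ep) one0 S1 Cv).
apply: (Top0 (oC ep) (cC ep) one0 (SB_dbar _ (oC ep) S1) Cv) => w Cw.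
by rewrite (dbar_gau c k (q j) sB (Csub w Cw)) dB ?mulr0//; exact: Csub.
Qed.

End LocalSolution.

(** * Cohomology computed one direction at a time *)

Section IndexTheorem.

Variables (R : realType) (g : nat) (h : hermform R g).
Local Notation C := (Cplx R).
Local Notation V := 'cV[C]_g.
Variables (b : 'I_(2 * g) -> V) (bfree : real_free b).
Hypothesis hL : forall l l', lat b l -> lat b l' -> cexp (cA h l l') = 1.
Variables (q : 'I_g -> V) (a : 'I_g -> R).
Hypotheses (hq : forall i j, h (q i) (q j) = if i == j then toC (a i) else 0) (a0 : forall i, a i != 0).
Hypothesis zspan : forall v, v = \sum_i zc_ h q a i v *: q i.
Implicit Types (f u : V -> C) (U : set V) (v w d l p x : V) (i j k : 'I_g) (s N P : seq 'I_g).
Local Notation lat := (lat b).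
Local Notation lopen := (lopen b).
Local Notation kap := (kap b).
Local Notation lam := (lam b).
Local Notation tl := (tl b).
Local Notation lauto := (lauto h b).
Local Notation F s := (shS h b (map q s)).
Local Notation D k := (dbar h (q k)).

(** The bound 1 is 1 - cos(2 pi / 4): below it the coordinates of v - [lam x v] - x stay under 1/4
    in absolute value, and rounding cannot jump to another integer nearby. *)
Lemma lam_const x v : kap x v < 1 -> exists2 e : R, 0 < e & forall w, vn (w - v) < e -> kap x w < 1 ->
  lam x w = lam x v.
Proof.
have p0 := pi_gt0 R.
have q4 : 0 <= (4^-1 : R) <= 2^-1.
  by apply/andP; split; rewrite ?invr_ge0 ?ler0n// lef_pV2 ?posrE ?ltr0n// ler_nat.
have c1 : 1 - cos (2 * pi * 4^-1) = 1 :> R.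
  by rewrite (_ : 2 * pi * 4^-1 = pi / 2) ?cos_pihalf ?subr0//; field.
move=> kv; have [K K0 HK] := tl_bound b; exists (2 * (K + 1))^-1.
  by rewrite invr_gt0 mulr_gt0//; lra.
move=> w wv kw; apply: eq_bigr => i _; congr (_%:~R *: _).
have E (y : V) : tl i (y - lam x y - x) = tl i (y - x) - (rnd (tl i (y - x)))%:~R.
  by rewrite addrAC (tlB b i (y - x)) (tl_lam bfree).
have bv := kap_box bfree (x := x) (v := v) q4; rewrite c1 in bv; have := bv kv i; rewrite (E v).
have bw := kap_box bfree (x := x) (v := w) q4; rewrite c1 in bw; have := bw kw i; rewrite (E w).
have dw : `|tl i (w - x) - tl i (v - x)| < 2^-1.
  rewrite -tlB opprB addrA subrK; apply: le_lt_trans (HK i _) _.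
  have := vn_ge0 (w - v); move: (vn _) wv => y; rewrite invfM => yK y0.
  apply: (@le_lt_trans _ _ ((K + 1) * y)); first by rewrite ler_wpM2r//; lra.
  by rewrite mulrC -ltr_pdivlMr//; lra.
move: dw; set n := rnd (tl i (w - x)); set m := rnd (tl i (v - x)).
move: n m (tl i (w - x)) (tl i (v - x)) => n m y z; rewrite !ltr_norml => h1 h2 h3.
have : (n%:~R : R) < (m + 1)%:~R by rewrite intrD; lra.
have : (m%:~R : R) < (n + 1)%:~R by rewrite intrD; lra.
by rewrite !ltr_int !ltzD1 => mn nm; apply/eqP; rewrite eq_le nm mn.
Qed.

(** Any u, read at the representative v - [lam x v] with the corresponding phase, becomes
    quasi-periodic; [hL] disposes of the phase between l and [lam x v]. *)
Lemma tr_auto x u l v : lat l -> cexp (cA h (v + l) (lam x (v + l))) * u (v + l - lam x (v + l)) =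
  cexp (cA h v l) * (cexp (cA h v (lam x v)) * u (v - lam x v)).
Proof.
move=> ll; rewrite lamD// cADr !cAD cA_same addr0 opprD addrACA subrr addr0.
rewrite mulrA -cexpD; congr (_ * _).
by rewrite !cexpD (hL ll (lam_lat b x v)) mulr1 mulrC.
Qed.

(** A local solution on C^g is spread over the lattice translates of a neighbourhood of x. Since
    [lam x] is locally constant there, the result is locally a single translate [tr] of the solution
    and satisfies the same equations. *)
Lemma F_lsurj s k : k \notin s -> lsurj (F s) (D k).
Proof.
move=> ks U f x lU [sf af df] Ux; have [oU iU] := lU.
have dz j : j \in s -> forall v, U v -> dbar h (q j) f v = 0.
  by move=> js v Uv; apply: df Uv; exact: map_f.
have [U1 [u [oU1 U1x sU1 su Du]]] :=
  local_solution hq a0 zspan bfree (S := fun j => j \in s) oU sf Ux ks dz.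
have [e e0 He] := oU1 x U1x; have [d d0 Hd] := kap_basis bfree x e0.
pose dl := Num.min d 1; pose U' := U `&` [set v | kap x v < dl].
have lU' : lopen U' by apply: lopenI => //; exact: lopen_lt.
have inU1 v : kap x v < dl -> U1 (v - lam x v).
  by rewrite lt_min => /andP[/Hd/He].
pose ut v := tr h (lam x v) u v.
have loc v : U' v -> exists O, [/\ vopen O, O v & forall w, O w -> U' w /\ ut w = tr h (lam x v) u w /\ U1 (w - lam x v)].
  move=> [Uv kv]; have k1 : kap x v < 1 by move: kv; rewrite /= lt_min => /andP[].
  have [r r0 Hr] := lam_const k1.
  exists (U' `&` [set w | vn (w - v) < r]); split.
  - by apply: vopenI; [case: lU'|exact: vopen_ball].
  - by split=> //=; rewrite subrr vn0.
  move=> w [[Uw kw] /= wv]; have kw1 : kap x w < 1 by move: kw; rewrite /= lt_min => /andP[].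
  have e1 := Hr w wv kw1; split; [by split|split; [by rewrite /ut e1|]].
  by rewrite -e1; exact: inU1.
have dut p v : U' v -> dbar h p ut v = cexp (cA h v (lam x v)) * dbar h p u (v - lam x v).
  move=> U'v; have [Q [oO Ov HO]] := loc v U'v.
  have e1 w : Q w -> ut w = tr h (lam x v) u w by move=> /HO[_ []].
  have [_ [_ Uv1]] := HO v Ov.
  by rewrite (dbar_ext h p oO Ov e1) (dbar_tr h p su Uv1).
exists U', ut; split.
- exact: lU'.
- by split=> //=; rewrite kap_self// lt_min d0 ltr01.
- by move=> v [].
- split.
  + apply: sm_loc => v U'v; have [Q [oO Ov HO]] := loc v U'v; exists Q; split; [exact: oO|exact: Ov|].
    have s1 : sm Q (tr h (lam x v) u).
      by apply: sm_sub (sm_tr h (lam x v) oU1 su) => w /HO[_ []].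
    by apply: sm_ext oO _ s1 => w /HO[_ [->]].
  + by move=> l ll v U'v; exact: tr_auto.
  move=> p /mapP[j js ->] v U'v; rewrite dut//.
  have [_ kv] := U'v; have [_ /(_ j js) ->] := Du _ (inU1 v kv).
  by rewrite mulr0.
move=> v U'v; rewrite dut//; have [Uv kv] := U'v; have [-> _] := Du _ (inU1 v kv).
by rewrite [RHS](lauto_tr bfree lU af (lam_lat b x v) Uv).
Qed.

Lemma ortho i j : i != j -> h (q i) (q j) = 0.
Proof. by move=> ij; rewrite hq (negbTE ij). Qed.

Lemma cylT p : cyl p (setT : set V). Proof. by []. Qed.
Lemma hqq i : h (q i) (q i) = toC (a i). Proof. by rewrite hq eqxx. Qed.

Definition T k f := Top h (q k) (a k) f.
Definition S_ k f := Sop h (q k) (a k) f.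
Let oT := @vopenT R g.

Definition Gam s f := F s setT f.

Lemma Gam_SB s f : Gam s f -> SB h setT f.
Proof. by move=> [sf af _]; exact: (lauto_SB bfree). Qed.

Lemma Gam_T s k f : k \notin s -> Gam s f -> Gam s (T k f).
Proof.
move=> ks Gf; have Hf := Gam_SB Gf; have [sf af df] := Gf; split.
- exact: SB_sm oT (SB_Top oT (cylT _) (a0 k) Hf).
- by move=> l ll; apply: (Top_auto oT (cylT _) (a0 k) Hf); exact: af.
move=> p /mapP[j js ->] v _; have kj : k != j by apply: contra ks => /eqP ->.
rewrite (dbar_Top oT (ortho kj) (cylT _) (a0 k) Hf I).
apply: (Top0 oT (cylT _) (a0 k) (SB_dbar _ oT Hf) I) => w _.
by apply: df => //; exact: map_f.
Qed.

Lemma S_0 k v : S_ k (fun=> 0) v = 0.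
Proof.
have B0 : BC h 1 setT (fun=> 0 : C).
  have s0 : shS h b [::] setT (fun=> 0) by exact: sec0 (lopenT b).
  by have [s1 s2 _] := s0; exact: (lauto_SB bfree s1 s2 1%N).
have := JkZ oT (cylT (q k)) 0 (nk_gk (nab0 (a0 k)) 1 0) B0 (I : setT v).
have zz : (fun _ : V => (0 : C) * 0) = fun=> 0 by apply/funext => w; rewrite mulr0.
by rewrite /S_ /Sop zz mul0r => ->; rewrite mulr0.
Qed.

Lemma Gam_S s k f : k \notin s -> Gam s f -> Gam s (S_ k f).
Proof.
move=> ks Gf; have Hf := Gam_SB Gf; have [sf af df] := Gf; split.
- exact: SB_sm oT (SB_Sop oT (cylT _) (a0 k) Hf).
- by move=> l ll; apply: (Sop_auto oT (cylT _) (a0 k) Hf); exact: af.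
move=> p /mapP[j js ->] v _; have kj : k != j by apply: contra ks => /eqP ->.
rewrite /S_ (dbarZ _ _ _ (SB_sm oT (SB_Jk oT (cylT _) (nk_gk (nab0 (a0 k)) 1 0) Hf)) I).
rewrite (dbar_Jk_ortho oT (ortho kj) (cylT _) (nk_gk (nab0 (a0 k)) 1 0) (Hf 2) I).
rewrite (Jk_ext h (cylT (q k)) _ (fun w _ => df _ (map_f q js) w I) I).
exact: S_0.
Qed.

Lemma Gam_lin s f f' c : Gam s f -> Gam s f' -> Gam s (fun v => f v + c * f' v).
Proof. exact: sec_lin (lopenT b). Qed.

Lemma Gam_D s k f : Gam s f -> Gam s (D k f).
Proof. by move=> Gf; exact: op_sec (shS_isop h bfree (map q s) (q k)) _ _ (lopenT b) Gf. Qed.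

Local Notation oI := (@lopenI _ _ b).
Local Notation oTT := (lopenT b).

(** Without equations the sheaf is fine. Each positive direction passes to the kernel of an operator
    that is onto on global sections, with right inverse [T k]. *)
Lemma acyclic_pos P : uniq P -> (forall j, j \in P -> 0 < a j) ->
  forall (n : nat) c, Zc (F P) n.+1 c -> Bc (F P) n.+1 c.
Proof.
elim: P => [|k P IH] /=.
  by move=> _ _ n c; apply: (fine_acyclic oTT oI) => W cW; exact: lat_pou.
move=> /andP[kP uP] pos.
have {}IH := IH uP (fun j jP => pos j (mem_behead (s := k :: P) jP)).
rewrite -(kerS_shS h bfree (map q P) (q k)).
move=> n c; apply: (kerS_acyclic oTT oI (fun W cW => lat_sep bfree cW) (F_lsurj kP) _ IH).
move=> f Gf; exists (T k f); split; first exact: Gam_T.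
move=> v; have := (dbar_T oT (hqq k) (cylT _) (a0 k) (Gam_SB Gf) (I : setT v)).2.
by rewrite pos ?inE ?eqxx.
Qed.

(** The sum of the images of the operators [D k], k in N, with the nested witnesses that iteration
    of [stepN] produces. *)
Fixpoint NN (G : (V -> C) -> Prop) N f : Prop :=
  if N is k :: N' then exists2 u, G u & NN G N' (fun v => f v + -1 * D k u v)
  else forall v, f v = 0.

(** By orthogonality [T k] commutes with [D j] for every j in N, so it passes to the quotient by
    these images. *)
Lemma NN_T P N k f : k \notin N ++ P -> Gam P f -> NN (Gam P) N f -> NN (Gam P) N (T k f).
Proof.
move=> kN; have kP : k \notin P by move: kN; rewrite mem_cat negb_or => /andP[].
elim: N kN f => [|j N IH] kN f Gf /=.
  by move=> z v; apply: (Top0 oT (cylT _) (a0 k) (Gam_SB Gf) I) => w _.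
move: kN; rewrite inE negb_or => /andP[kj kN] [u Gu Nu].
exists (T k u); first exact: Gam_T.
have Gd : Gam P (fun v => f v + -1 * D j u v) by apply: Gam_lin => //; exact: Gam_D.
have := IH kN _ Gd Nu; congr NN; apply/funext => v.
have Hf := Gam_SB Gf; have Hu := Gam_SB Gu; have Hd := SB_dbar (q j) oT Hu.
rewrite /T (TopD oT (cylT _) (a0 k) Hf (SBZ (-1) oT Hd) I) (TopZ oT _ (cylT _) (a0 k) Hd I).
by rewrite (dbar_Top oT (ortho kj) (cylT _) (a0 k) Hu I).
Qed.

Lemma T_D_neg s k f v : a k < 0 -> Gam s f -> T k (D k f) v = f v.
Proof.
move=> sa Gf; have := (dbar_T oT (hqq k) (cylT _) (a0 k) (Gam_SB Gf) (I : setT v)).1.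
by rewrite ltNge (ltW sa).
Qed.

(** For a negative direction k, [T k] is a left inverse of [D k] that preserves [NN]; hence [D k] is
    injective on the surviving group and only its cokernel, one degree higher, remains. *)
Lemma pack_exists N P : uniq (N ++ P) -> (forall j, j \in P -> 0 < a j) -> (forall j, j \in N -> a j < 0) ->
  exists r, pack (F (N ++ P)) (size N) (Gam P) (NN (Gam P) N) r /\ forall j, compat r (D j).
Proof.
elim: N => [|k N IH] /=.
  move=> uP pos _; exists (startr (F P)); split.
    by apply: (start_pack oTT oI) => p c; exact: acyclic_pos.
  by move=> j; apply: (start_compat oTT oI); exact: shS_isop.
move=> /andP[kN uN] pos neg.
have [r [pk cr]] := IH uN pos (fun j jN => neg j (mem_behead (s := k :: N) jN)).
pose iD := shS_isop h bfree (map q (N ++ P)) (q k).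
have inj f : Gam P f -> NN (Gam P) N (D k f) -> NN (Gam P) N f.
  move=> Gf /(NN_T kN (Gam_D k Gf)).
  by rewrite (_ : T k _ = f)//; apply/funext => v; apply: T_D_neg Gf; apply: neg; rewrite inE eqxx.
have pk' := step_pack oTT oI (fun W cW => lat_sep bfree cW) iD (F_lsurj kN) pk (cr k) inj.
exists (stepr iD (size N) r); split.
  by move: pk'; rewrite {1}/iD kerS_shS.
move=> j; apply: (step_compat oTT oI pk _ (cr j)); first exact: shS_isop.
by move=> U f [oU _] [sf _ _] v Uv; exact: dbarC oU sf Uv.
Qed.

Definition Hm f := [/\ sm setT f, lauto setT f & forall j v, sdb h (q j) (a j) f v = 0].
(** The composite of the projections [S_ k] over k in N. It picks harmonic representatives modulo
    [NN]. *)
Definition Pi N f := foldr S_ f N.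

Lemma Gam_Pi P N f : (forall k, k \in N -> k \notin P) -> Gam P f -> Gam P (Pi N f).
Proof.
elim: N => //= k N IH kN Gf; apply: Gam_S; first by apply: kN; rewrite inE eqxx.
by apply: IH => // j jN; apply: kN; rewrite inE jN orbT.
Qed.

Lemma S_lin k f f' c s v : Gam s f -> Gam s f' ->
  S_ k (fun w => f w + c * f' w) v = S_ k f v + c * S_ k f' v.
Proof.
move=> /Gam_SB Hf /Gam_SB Hf'.
by rewrite /S_ (SopD oT (cylT _) (a0 k) Hf (SBZ c oT Hf') I) (SopZ oT _ (cylT _) (a0 k) Hf' I).
Qed.

Lemma Pi_lin P N f f' c : (forall k, k \in N -> k \notin P) -> Gam P f -> Gam P f' -> forall v,
  Pi N (fun w => f w + c * f' w) v = Pi N f v + c * Pi N f' v.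
Proof.
elim: N => //= k N IH kN Gf Gf' v.
have kN' j : j \in N -> j \notin P by move=> jN; apply: kN; rewrite inE jN orbT.
rewrite -(S_lin _ _ _ (Gam_Pi kN' Gf) (Gam_Pi kN' Gf')).
by congr (S_ k _ v); apply/funext => w; exact: IH.
Qed.

Lemma Pi_D P N j f v : j \notin N -> (forall k, k \in N -> k \notin P) -> Gam P f ->
  Pi N (D j f) v = D j (Pi N f) v.
Proof.
elim: N v => //= k N IH v; rewrite inE negb_or => /andP[jk jN] kN Gf.
have kN' i : i \in N -> i \notin P by move=> iN; apply: kN; rewrite inE iN orbT.
have Hu := Gam_SB (Gam_Pi kN' Gf).
rewrite (_ : Pi N (D j f) = D j (Pi N f)); last by apply/funext => w; exact: IH.
have kj : k != j by rewrite eq_sym.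
rewrite /S_ (dbarZ _ _ _ (SB_sm oT (SB_Jk oT (cylT _) (nk_gk (nab0 (a0 k)) 1 0) Hu)) I).
by rewrite (dbar_Jk_ortho oT (ortho kj) (cylT _) (nk_gk (nab0 (a0 k)) 1 0) (Hu 2) I).
Qed.

(** By [dbar_T], D T D = D - S D, and T D is the identity for a negative direction. *)
Lemma S_D_neg s k f v : a k < 0 -> Gam s f -> S_ k (D k f) v = 0.
Proof.
move=> ak Gf; have Hf := Gam_SB Gf; have Hd := SB_dbar (q k) oT Hf.
have e1 := (dbar_T oT (hqq k) (cylT _) (a0 k) Hd (I : setT v)).2.
have e2 := T_D_neg v ak (Gam_D k Gf).
have E : T k (D k f) = f by apply/funext => w; exact: T_D_neg ak Gf.
move: e1; rewrite ltNge (ltW ak) /= -/(T k (D k f)) E => /eqP.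
by rewrite -subr_eq0 opprB addrC addrNK => /eqP.
Qed.

Lemma NN_ext P N f f' : f =1 f' -> NN (Gam P) N f -> NN (Gam P) N f'.
Proof. by move=> /funext ->. Qed.

(** The difference f - Pi f telescopes into terms u - S_k u, and each of them is D_k T_k u. *)
Lemma NN_Pi P N f : uniq N -> (forall k, k \in N -> k \notin P) -> (forall k, k \in N -> a k < 0) ->
  Gam P f -> NN (Gam P) N (fun v => f v + -1 * Pi N f v).
Proof.
elim: N f => [|k N IH] f /=; first by move=> _ _ _ _ v; rewrite mulN1r subrr.
move=> /andP[kN uN] kP neg Gf.
have kP' j : j \in N -> j \notin P by move=> jN; apply: kP; rewrite inE jN orbT.
have ng' j : j \in N -> a j < 0 by move=> jN; apply: neg; rewrite inE jN orbT.
have ak : a k < 0 by apply: neg; rewrite inE eqxx.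
have kP0 : k \notin P by apply: kP; rewrite inE eqxx.
have G1 := Gam_Pi kP' Gf.
exists (T k (Pi N f)); first exact: Gam_T.
apply: NN_ext (IH f uN kP' ng' Gf) => v.
have := (dbar_T oT (hqq k) (cylT _) (a0 k) (Gam_SB G1) (I : setT v)).2.
by rewrite ltNge (ltW ak) /= => ->; rewrite /S_; ring.
Qed.

(** The projections in the other directions of N commute with [D k], and S_k D_k = 0, so [Pi] kills
    each image. *)
Lemma Pi_NN P N f : uniq N -> (forall k, k \in N -> k \notin P) -> (forall k, k \in N -> a k < 0) ->
  Gam P f -> NN (Gam P) N f -> forall v, Pi N f v = 0.
Proof.
elim: N f => [|k N IH] f //= /andP[kN uN] kP neg Gf [u Gu Nu] v.
have kP' j : j \in N -> j \notin P by move=> jN; apply: kP; rewrite inE jN orbT.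
have ng' j : j \in N -> a j < 0 by move=> jN; apply: neg; rewrite inE jN orbT.
have ak : a k < 0 by apply: neg; rewrite inE eqxx.
have z := IH _ uN kP' ng' (Gam_lin _ Gf (Gam_D k Gu)) Nu.
have E : Pi N f = D k (Pi N u).
  apply/funext => w; have := z w; rewrite (Pi_lin _ kP' Gf (Gam_D k Gu)) (Pi_D _ kN kP' Gu).
  by rewrite mulN1r => /eqP; rewrite subr_eq0 => /eqP.
by rewrite E; exact: S_D_neg ak (Gam_Pi kP' Gu).
Qed.

Lemma Pi_Hm P N f : uniq N -> (forall k, k \in N -> k \notin P) -> (forall j, (j \in N) || (j \in P)) ->
  (forall j, j \in P -> 0 < a j) -> Gam P f -> Hm (Pi N f).
Proof.
move=> uN kP all pos Gf.
have GP := Gam_Pi kP Gf; have [s1 a1 d1] := GP; split; [exact: s1|exact: a1|].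
move=> j v; have [jN|jN] := boolP (j \in N); last first.
  have jP : j \in P by have := all j; rewrite (negbTE jN).
  by rewrite /sdb pos//; apply: d1 I; exact: map_f.
elim: N {all s1 a1 d1 GP} uN kP jN v => //= k N IH /andP[kN uN] kP; rewrite inE => jk v.
have kP' i : i \in N -> i \notin P by move=> iN; apply: kP; rewrite inE iN orbT.
have HP := Gam_SB (Gam_Pi kP' Gf).
have [jk1|jk1] := eqVneq j k; first by rewrite jk1; exact: (sdb_S oT (hqq k) (cylT _) (a0 k) HP I).
have kj : k != j by rewrite eq_sym.
have jN : j \in N by move: jk; rewrite (negbTE jk1).
rewrite (sdb_S_ortho oT _ (ortho kj) (cylT _) (a0 k) HP I).
rewrite (_ : sdb _ _ _ _ = (fun=> 0)); last by apply/funext => w; exact: IH.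
exact: S_0.
Qed.

Lemma Hm_Gam P f : (forall j, j \in P -> 0 < a j) -> Hm f -> Gam P f.
Proof.
move=> pos [sf af df]; split; [exact: sf|exact: af|].
by move=> p /mapP[j jP ->] v _; have := df j v; rewrite /sdb pos.
Qed.

Lemma Pi_id N f v : Hm f -> Pi N f v = f v.
Proof.
move=> Hf; have [sf af df] := Hf; elim: N v => //= k N IH v.
rewrite (_ : Pi N f = f); last by apply/funext.
exact: (sdb0_S oT (hqq k) (cylT _) (a0 k) (lauto_SB bfree sf af) I (fun w _ => df k w)).
Qed.

(* The only nonzero cohomology group is in degree #|N| and is isomorphic to
   the space of harmonic sections. *)
Lemma index_pack N P : uniq (N ++ P) -> (forall j, j \in N ++ P) ->
  (forall j, j \in P -> 0 < a j) -> (forall j, j \in N -> a j < 0) ->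
  exists r, pack (F (N ++ P)) (size N) Hm (fun f => forall v, f v = 0) r.
Proof.
move=> uNP all pos neg; have [r [pk _]] := pack_exists uNP pos neg.
have := uNP; rewrite cat_uniq => /and3P[uN /hasPn dis uP].
have kP k : k \in N -> k \notin P by move=> kN; apply: contraL (kN) => /dis.
have all' j : (j \in N) || (j \in P) by rewrite -mem_cat.
exists (fun c f => exists2 f0, r c f0 & f = Pi N f0); split.
- exact: pk_van pk.
- move=> c f [f0 rf ->]; have [z G0] := pk_Z pk rf; split; first exact: z.
  exact: (Pi_Hm uN kP all' pos G0).
- by move=> c /(pk_tot pk)[f rf]; exists (Pi N f), f.
- move=> f Hf; have [c rc] := pk_sur pk (Hm_Gam pos Hf); exists c, f; first exact: rc.
  by apply/funext => v; rewrite Pi_id.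
- move=> c f s c' f' [f0 rf ->] [f0' rf' ->].
  exists (fun v => f0 v + s * f0' v); first exact: (pk_lin pk).
  apply/funext => v; rewrite (Pi_lin _ kP)//; [exact: (pk_Z pk rf).2|exact: (pk_Z pk rf').2].
- move=> c f [f0 rf ->]; have G0 := (pk_Z pk rf).2; rewrite (pk_B pk rf); split.
    exact: Pi_NN.
  move=> z; apply: NN_ext (NN_Pi uN kP neg G0) => v.
  by rewrite z mulr0 addr0.
move=> c c' f [f0 rf ->] z B; exists f0 => //; exact: (pk_mod pk rf).
Qed.

End IndexTheorem.

(** A family of maximal size whose vectors of values at the N points are independent is a basis: by
    maximality the values of any further f depend on those of the family, and f is determined by its
    values. *)
Lemma fin_basis (K : fieldType) (X : Type) (L : (X -> K) -> Prop) N (pt : 'I_N -> X) :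
  L (fun=> 0) -> (forall f f' c, L f -> L f' -> L (fun x => f x + c * f' x)) ->
  (forall f, L f -> (forall j, f (pt j) = 0) -> forall x, f x = 0) ->
  exists n (e : 'I_n -> X -> K), (forall i, L (e i)) /\
    forall f, L f -> exists! a : 'rV[K]_n, forall x, f x = \sum_i a ord0 i * e i x.
Proof.
move=> L0 Ll inj.
pose M n (e : 'I_n -> X -> K) : 'M[K]_(n, N) := \matrix_(i, j) e i (pt j).
pose P n := `[< exists e : 'I_n -> X -> K, (forall i, L (e i)) /\ row_free (M n e) >].
have P0 : exists n, P n.
  by exists 0%N; apply/asboolP; exists (fun _ _ => 0); split=> [[]//|]; rewrite /row_free eqn_leq rank_leq_row.
have Pb n : P n -> (n <= N)%N.
  by move=> /asboolP[e [_ /eqP <-]]; exact: rank_leq_col.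
have [n /asboolP[e [Le fr]] mx] := ex_maxnP P0 Pb.
have Ls (a : 'rV[K]_n) : L (fun x => \sum_i a ord0 i * e i x).
  elim: (index_enum _) => [|i r IH].
    by rewrite (_ : (fun x => _) = fun=> 0)//; apply/funext => x; rewrite big_nil.
  rewrite (_ : (fun x => _) = fun x => (\sum_(i <- r) a ord0 i * e i x) + a ord0 i * e i x); first exact: Ll.
  by apply/funext => x; rewrite big_cons addrC.
exists n, e; split=> // f Lf.
have [/submxP[a ea]|nsub] := boolP ((\row_j f (pt j)) <= M n e)%MS.
  exists a; split=> [x|a' ea'].
    apply/eqP; rewrite -subr_eq0; apply/eqP.
    rewrite -mulN1r; apply: (inj _ (Ll _ _ (-1) Lf (Ls a))) => j.
    have := congr1 (fun A : 'rV_N => A ord0 j) ea; rewrite !mxE => ->; rewrite mulN1r.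
    by apply/eqP; rewrite subr_eq0; apply/eqP; apply: eq_bigr => i _; rewrite mxE.
  apply: (row_free_inj fr); rewrite -ea; apply/rowP => j; rewrite !mxE ea'.
  by apply: eq_bigr => i _; rewrite mxE.
exfalso; have : P n.+1.
  apply/asboolP; exists (fun i : 'I_(1 + n) => if fintype.split i is inr i' then e i' else f); split.
    by move=> i; case: (@fintype.split 1 n i).
  rewrite (_ : M _ _ = col_mx (\row_j f (pt j)) (M n e)); last first.
    by apply/matrixP => i j; rewrite !mxE; case: (@fintype.split 1 n i) => i'; rewrite mxE.
  have rk : \rank (\row_j f (pt j) + M n e)%MS = \rank (col_mx (\row_j f (pt j)) (M n e)) by rewrite addsmxE.
  rewrite /row_free eqn_leq rank_leq_row /=; apply: (leq_trans _ (eq_leq rk)).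
  have [le eq] := mxrank_leqif_sup (addsmxSr (\row_j f (pt j)) (M n e)).
  rewrite addsmx_sub submx_refl andbT (negbTE nsub) in eq.
  by move: fr => /eqP fr; rewrite fr in le eq; rewrite ltn_neqAle eq.
by move=> /mx; rewrite ltnn.
Qed.

(** * Finite dimension of the space of harmonic sections *)

Section FiniteDimension.

Variables (R : realType) (g : nat) (h : hermform R g).
Local Notation C := (Cplx R).
Local Notation V := 'cV[C]_g.
Variables (b : 'I_(2 * g) -> V) (bfree : real_free b).
Variables (q : 'I_g -> V) (a : 'I_g -> R).
Hypotheses (hq : forall i j, h (q i) (q j) = if i == j then toC (a i) else 0) (a0 : forall i, a i != 0).
Hypothesis zspan : forall v, v = \sum_i zc_ h q a i v *: q i.
Implicit Types (f u : V -> C) (U : set V) (v w d l p x : V) (i j k : 'I_g).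
Local Notation Hm := (Hm h b q a).
Let oT := @vopenT R g.

Lemma nabla_addd f v d d' : sm setT f -> nabla h (d + d') f v = nabla h d f v + nabla h d' f v.
Proof. by move=> sf; rewrite /nabla (pdD _ _ oT (sf 2%N) I) cADr mulrDl addrACA. Qed.

Lemma nabla_sumd f v I (r : seq I) (F : I -> V) : sm setT f ->
  nabla h (\sum_(i <- r) F i) f v = \sum_(i <- r) nabla h (F i) f v.
Proof.
move=> sf; elim: r => [|i r IH]; last by rewrite !big_cons nabla_addd ?IH.
rewrite !big_nil; have := nabla_addd v 0 0 sf; rewrite addr0.
by move=> /eqP; rewrite -subr_eq0 opprD addNKr oppr_eq0 => /eqP.
Qed.

(** The bounds along q_j and i q_j extend to all directions, because [nabla] is real linear in the
    direction and the coordinates of d are bounded by [vn d]. *)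
Lemma grad_all : exists2 K : R, 0 <= K & forall f B v d, Hm f -> (forall w, cn (f w) <= B) ->
  cn (nabla h d f v) <= K * vn d * B.
Proof.
have ex j : exists K : R, 0 <= K /\ forall f B v, SB h setT f -> (forall w, cn (f w) <= B) ->
    (forall w, sdb h (q j) (a j) f w = 0) ->
    cn (nabla h (q j) f v) <= K * B /\ cn (nabla h (ci R *: q j) f v) <= K * B.
  have hqq : h (q j) (q j) = toC (a j) by rewrite hq eqxx.
  have [K K0 HK] := grad_bound oT hqq (fun _ _ _ => I) (a0 j).
  by exists K; split=> // f B v Hf HB Hs; apply: (HK f B v Hf _ _ I) => w _; [exact: HB|exact: Hs].
have [K HK] := choice ex; have [M M0 HM] := z_bound h q a.
exists (\sum_j M * K j); first by apply: sumr_ge0 => j _; apply: mulr_ge0 => //; case: (HK j).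
move=> f B v d [sf af df] HB.
have B0 : 0 <= B by apply: le_trans (HB 0); exact: cn_ge0.
have Hf := lauto_SB bfree sf af.
have -> : nabla h d f v = nabla h (\sum_j zc_ h q a j d *: q j) f v by rewrite -zspan.
rewrite nabla_sumd//.
apply: le_trans (cn_sum _ _ _) _; rewrite !mulr_suml; apply: ler_sum => j _.
rewrite (nabla_cplx h (q j) oT (zc_ h q a j d) (sf 2%N) I).
have [K0 /(_ f B v Hf HB (df j))[n1 n2]] := HK j.
apply: le_trans (cnD _ _) _.
rewrite (cnMtoC _ (nabla h (q j) f v)) (cnMtoC _ (nabla h (ci R *: q j) f v)).
have e1 : cn (zc_ h q a j d) <= M * vn d by exact: HM.
apply: (@le_trans _ _ (cn (zc_ h q a j d) * (K j * B))).
  rewrite {3}/cn mulrDl; apply: lerD; [exact: ler_wpM2l n1|exact: ler_wpM2l n2].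
rewrite (_ : M * K j * vn d * B = (M * vn d) * (K j * B)); last by ring.
by apply: ler_wpM2r => //; exact: mulr_ge0.
Qed.

(** Parallel transport from x to v: since [cA] with d = v - x is constant along the segment, a
    linear phase turns the covariant derivative into an ordinary one. The constant 8 consists of
    three factors 2: phase, mean value inequality, phase back. *)
Lemma transport f x v M : sm setT f -> (forall w, cn (nabla h (v - x) f w) <= M) -> f x = 0 ->
  cn (f v) <= 8 * M.
Proof.
move=> sf HM fx; set d := v - x in HM *.
have M0 : 0 <= M by apply: le_trans (HM 0); exact: cn_ge0.
pose F t := cexp (toC t * cA h x d) * f (x + sc t d).
have ce t : cn (cexp (toC t * cA h x d)) <= 2 by rewrite -cAsc; exact: cn_cexpA.
have dF t : iscd F t (cexp (toC t * cA h x d) * nabla h d f (x + sc t d)).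
  have d1 := iscd_cexp (iscdM (iscd_id t) (iscd_cst (cA h x d) t)).
  have d2 := haspd_line (sm_has d sf (I : setT (x + sc t d))).
  apply: iscd_eq (iscdM d1 d2) _.
  by rewrite /nabla cAD cAsc cA_same; ring.
have bF t : cn (cexp (toC t * cA h x d) * nabla h d f (x + sc t d)) <= 2 * M.
  by apply: le_trans (cnM _ _) _; apply: ler_pM; rewrite ?cn_ge0.
have := cmvt (M := 2 * M) (ler01 : 0 <= 1 :> R) (fun t _ => dF t) (fun t _ => bF t).
rewrite {2}/F sc0 addr0 fx mulr0 subr0 subr0 mulr1 /F sc1 => b1.
have fv : f v = cexp (- cA h x d) * (cexp (toC 1 * cA h x d) * f (x + d)).
  by rewrite mulrA -cexpD toC1 mul1r addNr cexp0 mul1r /d addrC subrK.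
rewrite fv; apply: le_trans (cnM _ _) _.
have c2 : cn (cexp (- cA h x d)) <= 2 by rewrite -cAN; exact: cn_cexpA.
rewrite (_ : 8 * M = 2 * (2 * (2 * M))); last by ring.
by apply: ler_pM; rewrite ?cn_ge0.
Qed.

(** If f vanishes on a sufficiently fine finite net, the gradient bound improves sup |f| <= B to B /
    2, and iteration gives f = 0. In the mesh, 32 is 2 from the factor of automorphy, 8 from
    [transport] and 2 for the halving. *)
Lemma harmonic_eval_inj : exists s : seq V, forall f, Hm f -> (forall x, x \in s -> f x = 0) -> forall v, f v = 0.
Proof.
have [K K0 HK] := grad_all; pose e : R := (32 * (K + 1))^-1.
have K1 : 0 < 32 * (K + 1) by rewrite mulr_gt0 ?ltr0n// ltr_pwDr.
have e0 : 0 < e by rewrite invr_gt0.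
have ex x : exists d : R, 0 < d /\ forall v, kap b x v < d -> vn (v - lam b x v - x) < e.
  by have [d d0 Hd] := kap_basis bfree x e0; exists d.
have [d Hd] := choice ex.
have [s Hs] : exists I : seq V, forall v, exists2 x, x \in I & kap b x v < d x.
  apply: (finite_cover bfree (W := fun x => [set v | kap b x v < d x])) => x; split; first exact: lopen_lt.
  by rewrite /= kap_self; case: (Hd x).
exists s => f Hf fs; have [sf af df] := Hf.
have half B : (forall v, cn (f v) <= B) -> forall v, cn (f v) <= B / 2.
  move=> HB v; have B0 : 0 <= B by apply: le_trans (HB 0); exact: cn_ge0.
  have [x xs kx] := Hs v; have [d0 /(_ v kx) vx] := Hd x.
  rewrite (lauto_tr bfree (lopenT b) af (lam_lat b x v) I) /tr.
  apply: le_trans (cnM _ _) _.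
  have := transport sf (fun w => HK f B w (v - lam b x v - x) Hf HB) (fs x xs).
  have := cn_cexpA h v (lam b x v); have := cn_ge0 (f (v - lam b x v)).
  have := cn_ge0 (cexp (cA h v (lam b x v))); have := vn_ge0 (v - lam b x v - x).
  move: (vn _) vx (cn _) (cn _) => y ye c1 c2 y0 c10 c20 c12 c2b.
  apply: (@le_trans _ _ (2 * (8 * (K * y * B)))); first exact: ler_pM.
  rewrite (_ : 2 * _ = (16 * K * y) * B); last by ring.
  rewrite mulrC; apply: ler_wpM2l => //.
  have : 32 * (K + 1) * y <= 1 by rewrite -ler_pdivlMl// mulr1 ltW.
  have : 0 <= K * y by exact: mulr_ge0.
  rewrite mulrDl mul1r => ? ?.
  by move: (K * y) => z; rewrite -!mulrA; lra.
have [B _ HB] := lauto_bdd bfree (h := h) (sf 0%N) af.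
have hn n : forall v, cn (f v) <= B * 2^-1 ^+ n.
  elim: n => [|n IH] v; first by rewrite expr0 mulr1; exact: HB.
  by rewrite exprSr mulrA; exact: half.
move=> v; apply/eqP; rewrite -cn_eq0; apply/eqP/le_anti; rewrite cn_ge0 andbT leNgt; apply/negP => c0.
have B0 : 0 <= B / cn (f v) by apply: divr_ge0; rewrite ?cn_ge0//; apply: le_trans (HB 0 I); exact: cn_ge0.
have := archi_boundP B0; set n := Num.bound _; rewrite ltr_pdivrMr// => h1.
have := hn n v; rewrite exprVn ler_pdivlMr ?exprn_gt0// => h2.
have : (n%:R : R) <= 2 ^+ n by rewrite -natrX ler_nat ltnW// ltn_expl.
rewrite -(ler_pM2r c0) => h3; have := lt_le_trans h1 h3; by rewrite mulrC ltNge h2.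
Qed.

Lemma sdb_lin f f' c j v : sm setT f -> sm setT f' ->
  sdb h (q j) (a j) (fun w => f w + c * f' w) v = sdb h (q j) (a j) f v + c * sdb h (q j) (a j) f' v.
Proof.
move=> sf sf'; rewrite /sdb; case: ifP => _; first exact: (dbar_lin h c (q j) oT sf sf' I).
have sc := smZ c oT sf'.
rewrite /dop !(nablaD _ _ sf sc I) !(nablaZ _ _ _ sf' I).
move: (nabla _ _ _ _) (nabla _ _ _ _) (nabla _ _ _ _) (nabla _ _ _ _) => x1 x2 x3 x4; ring.
Qed.

Lemma Hm_lin f f' c : Hm f -> Hm f' -> Hm (fun v => f v + c * f' v).
Proof.
move=> [sf af df] [sf' af' df']; split.
- by apply: smD => //; exact: smZ.
- exact: lauto_lin.
by move=> j v; rewrite sdb_lin// df df' mulr0 addr0.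
Qed.

Lemma Hm0 : Hm (fun=> 0).
Proof.
have n0 d v : nabla h d (fun=> 0) v = 0 by rewrite /nabla (haspd_pd (haspd_cst 0 v d)) add0r mulr0.
split; [exact: sm_cst|by move=> l _ v _; rewrite mulr0|move=> j v].
by rewrite /sdb /dop /dbar !n0; case: ifP => _; ring.
Qed.

Lemma harmonic_basis : exists n (e : 'I_n -> V -> C), (forall m, Hm (e m)) /\
  forall f, Hm f -> exists! c : 'rV[C]_n, forall x, f x = \sum_m c ord0 m * e m x.
Proof.
have [s Hs] := harmonic_eval_inj.
have z : forall f, Hm f -> (forall j : 'I_(size s), f (nth 0 s j) = 0) -> forall x, f x = 0.
  move=> f Hf z; apply: Hs => // x /(nthP 0)[j js <-]; exact: (z (Ordinal js)).
exact: (fin_basis Hm0 Hm_lin z).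
Qed.

End FiniteDimension.

(** * Bounds uniform in the form *)

Section UniformBounds.

Variables (R : realType) (g : nat).
Local Notation C := (Cplx R).
Local Notation V := 'cV[C]_g.
Implicit Types (f : V -> C) (v w : V).
Let oT := @vopenT R g.

Lemma Jk_le (h : hermform R g) q k f v (B M : R) : nk k -> BC h 1 setT f ->
  (forall w, cn (f w) <= B) -> (forall s t, 0 <= s <= 1 -> cn (k s t) <= M) ->
  cn (Jk h q k f v) <= 2 * (2 * (B * 2 * M) * (2 * pi)).
Proof.
move=> nkk Hf HB HM; have cT : cyl q (setT : set V) by [].
have b1 s : 0 <= s <= 1 -> cn (inn h q k f v s) <= 2 * (B * 2 * M) * (2 * pi).
  by move=> s01; exact: (cn_inn oT cT nkk Hf I (fun w _ => HB w) (fun t => HM s t s01)).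
have := cI_norm (ler01 : 0 <= 1 :> R) (ccOn_inn oT cT nkk Hf I) b1.
by rewrite subr0 mulr1.
Qed.

(** The Gaussian decreases as al grows, so the bound at al0 serves every larger al. *)
Lemma gk_le (al0 : R) n m : 0 < al0 -> exists2 M : R, 0 <= M &
  forall al, al0 <= al -> forall s t, 0 <= s <= 1 -> cn (gk al n m s t) <= M.
Proof.
move=> al00; have [M M0 HM] := nk_bd (nk_gk al00 n m); exists M => // al lal s t s01.
apply: le_trans (HM s t s01); rewrite /gk; case: ifP => // s1.
rewrite !cnMtoC; apply: ler_wpM2r; first exact: cn_ge0.
have r0 : 0 <= rad s by rewrite divr_ge0 ?subr_ge0 ?(ltW s1)//; case/andP: s01.
rewrite /gw !normrM; apply: ler_wpM2l; first by rewrite mulr_ge0.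
rewrite !ger0_norm ?expR_ge0// ler_expR lerN2 ler_wpM2r ?invr_ge0//.
by rewrite ler_wpM2r ?exprn_ge0.
Qed.

Lemma TS_unif (al0 : R) : 0 < al0 -> exists2 K : R, 0 <= K &
  forall (h : hermform R g) q (a : R), al0 <= `|a| -> forall f B v, SB h setT f ->
  (forall w, cn (f w) <= B) -> cn (Top h q a f v) <= K * B /\ cn (Sop h q a f v) <= `|a| * (K * B).
Proof.
move=> al00; have [M M0 HM] := gk_le 0 (-1) al00; have [N N0 HN] := gk_le 1 0 al00.
have p0 := pi_gt0 R; pose K := pi^-1 * (16 * pi * (M + N)); exists K.
  apply: mulr_ge0; first by rewrite invr_ge0 ltW.
  by apply: mulr_ge0; [rewrite mulr_ge0// ltW|exact: addr_ge0].
move=> h q a la f B v Hf HB; have B0 : 0 <= B by apply: le_trans (HB 0); exact: cn_ge0.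
have a0 : 0 < `|a| by exact: lt_le_trans al00 la.
have E (L : R) : 0 <= L -> L <= M + N -> pi^-1 * (2 * (2 * (B * 2 * L) * (2 * pi))) <= K * B.
  move=> L0 LM; rewrite /K -[X in _ <= X]mulrA; apply: ler_wpM2l; first by rewrite invr_ge0 ltW.
  rewrite (_ : 2 * (2 * (B * 2 * L) * (2 * pi)) = 16 * pi * B * L); last by ring.
  rewrite (_ : 16 * pi * (M + N) * B = 16 * pi * B * (M + N)); last by ring.
  have pB : 0 <= 16 * pi * B by apply: mulr_ge0 => //; rewrite mulr_ge0// ltW.
  exact: ler_wpM2l.
split.
  rewrite /Top -toCV cnMtoC ger0_norm ?invr_ge0 ?(ltW p0)//.
  apply: le_trans (E M M0 _); last by rewrite lerDl.
  apply: ler_wpM2l; first by rewrite invr_ge0 ltW.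
  exact: (Jk_le _ _ (nk_gk a0 0 (-1)) (Hf 1%N) HB (HM _ la)).
rewrite /Sop cnMtoC ger0_norm ?divr_ge0 ?(ltW p0) ?(ltW a0)// -mulrA; apply: ler_wpM2l; first exact: ltW.
apply: le_trans (E N N0 _); last by rewrite lerDr.
apply: ler_wpM2l; first by rewrite invr_ge0 ltW.
exact: (Jk_le _ _ (nk_gk a0 1 0) (Hf 1%N) HB (HN _ la)).
Qed.

(** For a > 0 one has f - S f = T dbar f, and a < 0 follows by conjugation. The constant depends
    only on a lower bound for |a|, which permits the form to be scaled up. *)
Lemma S_near (al0 : R) : 0 < al0 -> exists2 K : R, 0 <= K &
  forall (h : hermform R g) q (a : R), h q q = toC a -> al0 <= `|a| -> forall f B v, SB h setT f ->
   ((forall w, cn (f w) <= B) -> cn (Sop h q a f v) <= `|a| * (K * B)) /\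
   ((forall w, cn (sdb h q a f w) <= B) -> cn (Sop h q a f v - f v) <= K * B).
Proof.
move=> al00; have [K K0 HK] := TS_unif al00; exists K => // h q a hqq la f B v Hf; split.
  by move=> HB; exact: (HK h q a la f B v Hf HB).2.
have a0 : a != 0 by rewrite -normr_gt0; exact: lt_le_trans al00 la.
have cT : cyl q (setT : set V) by [].
move=> HB; rewrite cnBC; have [sa|sa] := boolP (0 < a).
  have := (dbar_T oT hqq cT a0 Hf (I : setT v)).1; rewrite sa => <-.
  apply: (HK h q a la _ B v (SB_dbar q oT Hf) _).1 => w.
  by have := HB w; rewrite /sdb sa.
have na : - a != 0 by rewrite oppr_eq0.
have sna : 0 < - a by rewrite oppr_gt0 lt_neqAle a0 leNgt.
have lna : al0 <= `|- a| by rewrite normrN.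
have Hc := SB_neg oT Hf.
have := (dbar_T oT (hneg_qq hqq) cT na Hc (I : setT v)).1.
rewrite sna -(Sop_neg oT cT a0 Hf I) => e.
rewrite -cn_conj /GRing.add /= (_ : cconj _ = cf f v - cconj (Sop h q a f v)); last first.
  by rewrite -cconjN -cconjD.
rewrite -e; apply: (HK (hneg h) q (- a) lna _ B v (SB_dbar q oT Hc) _).1 => w.
by have := HB w; rewrite (sdb_neg q a0 Hf I) (negbTE sa) cn_conj /sdb sna.
Qed.
End UniformBounds.

Lemma gauss_alg1 (K : fieldType) (i k s x y G A B : K) : k = - (s / 2) -> i * i = -1 -> A + i * B = s * x ->
  2%:R != 0 :> K ->
  2^-1 * (k * (1 * y + x * 1) * G + A * G + i * (k * (i * y + x * - i) * G + B * G)) = 0.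
Proof.
move=> -> ii AB n2.
rewrite (_ : 2^-1 * _ = 2^-1 * (- (s / 2) * (y + x + (i * i) * (y - x)) + (A + i * B)) * G); last by ring.
by rewrite ii AB; field.
Qed.

Lemma gauss_alg2 (K : fieldType) (i k s x y G A B : K) : k = s / 2 -> i * i = -1 -> A - i * B = - (s * y) ->
  2%:R != 0 :> K ->
  2^-1 * (k * (1 * y + x * 1) * G + A * G - i * (k * (i * y + x * - i) * G + B * G)) = 0.
Proof.
move=> -> ii AB n2.
rewrite (_ : 2^-1 * _ = 2^-1 * ((s / 2) * (y + x - (i * i) * (y - x)) + (A - i * B)) * G); last by ring.
by rewrite ii AB; field.
Qed.

(** * Scaled forms and the model Gaussian *)

Section Scale.

Variables (R : realType) (g : nat).
Local Notation C := (Cplx R).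
Local Notation V := 'cV[C]_g.
Variables (h : hermform R g) (q : 'I_g -> V) (a : 'I_g -> R).
Hypotheses (hq : forall i j, h (q i) (q j) = if i == j then toC (a i) else 0) (a0 : forall i, a i != 0).
Hypothesis zspan : forall v, v = \sum_i zc_ h q a i v *: q i.
Variables (b : 'I_(2 * g) -> V) (bfree : real_free b).
Implicit Types (f u : V -> C) (U : set V) (v w d l p x : V) (i j k : 'I_g) (c : R).
Local Notation z k v := (zc_ h q a k v).
Let oT := @vopenT R g.

Program Definition hscale c := @HermForm R g (fun v w => toC c * h v w) _ _ _ _.
Next Obligation. by move=> c u v w /=; rewrite hfD mulrDr. Qed.
Next Obligation. by move=> c s v w /=; rewrite hfZ mulrCA. Qed.
Next Obligation. by move=> c v w /=; rewrite (hfC h v w) cconjM cconj_toC. Qed.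
Next Obligation.
move=> c; have [K [K0 HK]] := hfK h; exists (`|c| * K); split; first exact: mulr_ge0.
by move=> v w; rewrite cnMtoC -!mulrA ler_wpM2l// mulrA.
Qed.

Lemma hscale_q c i j : hscale c (q i) (q j) = if i == j then toC (c * a i) else 0.
Proof. by rewrite /= hq; case: ifP => _; rewrite ?mulr0 ?toCM. Qed.

Lemma hscale_z c i v : c != 0 -> zc_ (hscale c) q (fun j => c * a j) i v = z i v.
Proof.
move=> c0; rewrite /zc_ /= toCM invfM mulrACA divff ?mul1r//.
by rewrite toC_eq0.
Qed.

(** The ground state of the scaled form: a product of Gaussians exp(- c |a_k| |z_k|^2 / 2). The
    absolute value makes it decay in every direction while the operator killing it is [dbar] or
    [dop] according to the sign of a_k. *)
Definition gauss c v : C := cexp (\sum_k toC (- (c * `|a k| / 2)) * (z k v * cconj (z k v))).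

Lemma sm_gauss c U : vopen U -> sm U (gauss c).
Proof.
move=> oU; apply: sm_cexp => //; apply: sm_sum => // k _; apply: smZ => //.
have s : sm U (fun v => z k v) by apply: sm_rlin => //; exact: rlin_z.
by apply: smM => //; exact: sm_conj.
Qed.

Lemma gauss0 c : gauss c 0 = 1.
Proof.
rewrite /gauss big1 ?cexp0// => k _; rewrite (_ : z k 0 = 0) ?mul0r ?mulr0//.
by rewrite /zc_ hf0 mul0r.
Qed.

Lemma pd_gauss c v j (s : C) : pd (s *: q j) (gauss c) v =
  toC (- (c * `|a j| / 2)) * (s * cconj (z j v) + z j v * cconj s) * gauss c v.
Proof.
have d1 k := haspd_rlin v (s *: q j) (rlin_z h q a k).
have D : haspd (fun w => \sum_k toC (- (c * `|a k| / 2)) * (z k w * cconj (z k w))) v (s *: q j)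
   (\sum_k toC (- (c * `|a k| / 2)) * (z k (s *: q j) * cconj (z k v) + z k v * cconj (z k (s *: q j)))).
  by apply: iscd_sum => k _; have := haspdZ (toC (- (c * `|a k| / 2))) (haspdM (d1 k) (haspd_conj (d1 k))).
rewrite (haspd_pd (haspd_cexp D)) -/(gauss c v); congr (_ * _).
rewrite (bigD1 j)//= big1 ?addr0 ?(zZ _ _ _ j) ?(zq hq a0) ?eqxx ?mulr1// => k kj.
by rewrite zZ (zq hq a0) (negbTE kj) mulr0 cconj0 mulr0 mul0r addr0 mulr0.
Qed.

Lemma sdb_gauss c j v : 0 < c -> sdb (hscale c) (q j) (c * a j) (gauss c) v = 0.
Proof.
move=> c0; set h' := hscale c.
have e1 := pd_gauss c v j 1; rewrite scale1r in e1.
have e2 := pd_gauss c v j (ci R).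
have e3 : cA h' v (q j) + ci R * cA h' v (ci R *: q j) = h' v (q j) by exact: bell_formula.
have e4 : cA h' v (q j) - ci R * cA h' v (ci R *: q j) = - cconj (h' v (q j)).
  rewrite /cA hfZr; apply: ceq; rewrite !reimE; ring.
have hz : h' v (q j) = toC (c * a j) * z j v.
  by rewrite /= /zc_ toCM; field; rewrite toC_eq0.
have ii := ci2 R; have cc := cconj_ci R.
have c1 : cconj 1 = 1 :> C by rewrite -toC1 cconj_toC.
have n2 : 2%:R != 0 :> C by rewrite pnatr_eq0.
have two : toC 2^-1 = 2^-1 :> C by rewrite toCV (toC_nat R 2).
rewrite /sdb pmulr_rgt0//; case: ifP => [ap|an].
  rewrite /dbar /nabla e1 e2 c1 cc (gtr0_norm ap).
  apply: (@gauss_alg1 C (ci R) _ (toC (c * a j)) _ _ _ _ _ _ ii _ n2); last by rewrite e3 hz.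
  by rewrite toCN (toCM (c * a j)) two.
have an' : a j < 0 by rewrite lt_neqAle a0 leNgt an.
rewrite /dop /nabla e1 e2 c1 cc (ltr0_norm an').
apply: (@gauss_alg2 C (ci R) _ (toC (c * a j)) _ _ _ _ _ _ ii _ n2); last by rewrite e4 hz cconjM cconj_toC.
by rewrite mulrN mulNr opprK (toCM (c * a j)) two.
Qed.

End Scale.

(** * Existence of a nonzero harmonic section *)

Section Nonvanishing.

Variables (R : realType) (g : nat).
Local Notation C := (Cplx R).
Local Notation V := 'cV[C]_g.
Variables (h : hermform R g) (q : 'I_g -> V) (a : 'I_g -> R).
Hypotheses (hq : forall i j, h (q i) (q j) = if i == j then toC (a i) else 0) (a0 : forall i, a i != 0).
Hypothesis zspan : forall v, v = \sum_i zc_ h q a i v *: q i.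
Variables (b : 'I_(2 * g) -> V) (bfree : real_free b).
Implicit Types (f u : V -> C) (U : set V) (v w d l p x : V) (i j k : 'I_g) (c : R).
Local Notation z k v := (zc_ h q a k v).
Local Notation kap := (kap b).
Local Notation lam := (lam b).
Local Notation tl := (tl b).
Local Notation gauss := (gauss h q a).
Local Notation hs c := (hscale h c).
Let oT := @vopenT R g.

(** Equal to 1 for kap 0 v <= 3/8 and to 0 from 3/4 on, below the value 1 up to which [lam 0] is
    locally constant. *)
Definition psi v : R := pla (kap 0 v / (3 / 4)).

Lemma sm_psi U : vopen U -> sm U (fun v => toC (psi v)).
Proof.
move=> oU; apply: sm_pla => //.
have s := smZ (toC (3 / 4)^-1) oU (sm_kap b 0 oU).
by apply: (sm_ext oU _ s) => v _; rewrite -toCM mulrC.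
Qed.

Lemma psi1 v : kap 0 v < 8^-1 -> psi v = 1.
Proof. by move=> kv; apply: pla1; move: (kap 0 v) kv => y ky; lra. Qed.

Lemma psi0 v : 3 / 4 <= kap 0 v -> psi v = 0.
Proof. by move=> kv; apply: pla0; move: (kap 0 v) kv => y ky; lra. Qed.

(** The sum over the lattice of all translates of a cut-off Gaussian, of which the cut-off leaves a
    single term, the translate by [lam 0 v]. *)
Definition Fc c v : C := toC (psi v) * tr (hs c) (lam 0 v) (gauss c) v.

Lemma lam00 : lam 0 0 = 0.
Proof.
have -> : lam 0 0 = \sum_i (rnd (tl i (0 - 0)))%:~R *: b i by [].
rewrite big1// => i _; rewrite subr0 tl0.
have := rnd_itv (0 : R); rewrite sub0r => /andP[h1 h2].
suff -> : rnd (0 : R) = 0 by rewrite scale0r.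
have : ((rnd (0 : R))%:~R : R) < (0 + 1)%:~R by lra.
have : (0%:~R : R) < (rnd (0 : R) + 1)%:~R by rewrite intrD; lra.
by rewrite !ltr_int !ltzD1 => r0 r1; apply/eqP; rewrite eq_le r0 r1.
Qed.

Lemma Fc0 c : Fc c 0 = 1.
Proof.
rewrite /Fc psi1 ?kap_self ?invr_gt0// toC1 mul1r lam00 /tr cA0 cexp0 mul1r subr0.
exact: gauss0.
Qed.

Lemma Fc_near v : kap 0 v < 1 -> exists Q, [/\ vopen Q, Q v &
  forall w, Q w -> forall c, Fc c w = toC (psi w) * tr (hs c) (lam 0 v) (gauss c) w].
Proof.
move=> kv; have [e e0 He] := lam_const bfree kv.
exists ([set w | vn (w - v) < e] `&` [set w | kap 0 w < 1]); split.
- by apply: vopenI; [exact: vopen_ball|exact: kap_lt_open].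
- by split=> //=; rewrite subrr vn0.
by move=> w [we kw] c; rewrite /Fc (He w we kw).
Qed.

Lemma Fc_out c v : 3 / 4 < kap 0 v -> Fc c v = 0.
Proof. by move=> kv; rewrite /Fc psi0 ?ltW// toC0 mul0r. Qed.

Lemma sm_Fc c : sm setT (Fc c).
Proof.
apply: sm_loc => v _; have [kv|kv] := ltP (kap 0 v) 1.
  have [Q [oQ Qv HQ]] := Fc_near kv; exists Q; split; [exact: oQ|exact: Qv|].
  have s1 : sm Q (tr (hs c) (lam 0 v) (gauss c)).
    by apply: sm_sub (sm_tr (hs c) (lam 0 v) oT (sm_gauss h q a c oT)).
  by apply: (sm_ext oQ _ (smM oQ (sm_psi oQ) s1)) => w Qw; rewrite HQ.
have oQ := @kap_gt_open _ _ b 0 (3 / 4).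
have k34 : 3 / 4 < kap 0 v by apply: lt_le_trans kv; lra.
exists [set w | 3 / 4 < kap 0 w]; split; [exact: oQ|exact: k34|].
by apply: (sm_ext oQ _ (sm_cst 0 oQ)) => w kw; rewrite Fc_out.
Qed.

Section Form.

Variables (c : R) (c1 : 1 <= c).
Hypothesis hL : forall l l', lat b l -> lat b l' -> cexp (cA (hs c) l l') = 1.
Local Notation sdbc j := (sdb (hs c) (q j) (c * a j)).

Let c0 : 0 < c. Proof. exact: lt_le_trans c1. Qed.

Lemma Fc_auto : lauto (hs c) b setT (Fc c).
Proof.
move=> l ll v _; have e1 : kap 0 (v + l) = kap 0 v by exact: kap_lat.
have e2 : tr (hs c) (lam 0 (v + l)) (gauss c) (v + l) = cexp (cA (hs c) v l) * tr (hs c) (lam 0 v) (gauss c) v.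
  exact: (tr_auto bfree hL 0 (gauss c) v ll).
by rewrite /Fc /psi e1 e2 (mulrCA (toC _)).
Qed.

Lemma sdb_auto j v : cn (sdbc j (Fc c) v) <= 2 * cn (sdbc j (Fc c) (v - lam 0 v)).
Proof.
have af : lauto (hs c) b setT (sdbc j (Fc c)).
  have [p|p] := boolP (0 < c * a j).
    have -> : sdbc j (Fc c) = dbar (hs c) (q j) (Fc c) by apply/funext => w; rewrite /sdb p.
    exact: (lauto_dbar bfree (q j) (lopenT b) (sm_Fc c) Fc_auto).
  have -> : sdbc j (Fc c) = dop (hs c) (q j) (Fc c) by apply/funext => w; rewrite /sdb (negbTE p).
  exact: (lauto_dop bfree (q j) (lopenT b) (sm_Fc c) Fc_auto).
rewrite (lauto_tr bfree (lopenT b) af (lam_lat b 0 v) I) /tr.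
apply: le_trans (cnM _ _) _; apply: ler_wpM2r; [exact: cn_ge0|exact: cn_cexpA].
Qed.

Lemma sdb_ext j f f' Q v : vopen Q -> Q v -> (forall w, Q w -> f w = f' w) -> sdbc j f v = sdbc j f' v.
Proof.
move=> oQ Qv e; rewrite /sdb; case: ifP => _; first exact: (dbar_ext _ _ oQ Qv e).
by rewrite /dop !(nabla_ext _ _ oQ Qv e).
Qed.

(** The Gaussian is annihilated, so only derivatives of the cut-off contribute. *)
Lemma sdb_psi j v : cn (sdbc j (fun w => toC (psi w) * gauss c w) v) <=
  (cn (pd (q j) (fun w => toC (psi w)) v) + cn (pd (ci R *: q j) (fun w => toC (psi w)) v)) * cn (gauss c v).
Proof.
have sp := sm_psi oT; have sg := sm_gauss h q a c oT.
have np d : nabla (hs c) d (fun w => toC (psi w) * gauss c w) v =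
    pd d (fun w => toC (psi w)) v * gauss c v + toC (psi v) * nabla (hs c) d (gauss c) v.
  by rewrite /nabla (haspd_pd (haspdM (sm_has d sp (I : setT v)) (sm_has d sg (I : setT v)))); ring.
have half (x y y' G : C) : cn y' = cn y -> cn (2^-1 * (x + y') * G) <= (cn x + cn y) * cn G.
  move=> <-.
  apply: le_trans (cnM _ _) _; apply: ler_wpM2r; first exact: cn_ge0.
  have -> : 2^-1 = toC 2^-1 :> C by rewrite toCV (toC_nat R 2).
  rewrite cnMtoC ger0_norm ?invr_ge0//; apply: le_trans (cnD x y'); apply: ler_piMl; first exact: cn_ge0.
  by rewrite invf_le1// ler1n.
have alg (P P' G t y n n' : C) : 2^-1 * (n + y * n') = 0 ->
    2^-1 * (P * G + t * n + y * (P' * G + t * n')) = 2^-1 * (P + y * P') * G.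
  by move=> e; rewrite -[RHS]addr0 -[X in _ = _ + X](mulr0 t) -e; ring.
have z0 := sdb_gauss hq a0 j v c0; move: z0; rewrite /sdb; case: ifP => _.
  rewrite /dbar !np => z0; rewrite (alg _ _ _ _ _ _ _ z0).
  by apply: half; rewrite cnMci.
rewrite /dop !np -!mulNr => z0; rewrite (alg _ _ _ _ _ _ _ z0).
by apply: half; rewrite mulNr cnN cnMci.
Qed.

(** For [lam 0 v = 0] the section is the cut-off Gaussian near v. It is annihilated where the
    cut-off is locally 1 and vanishes for kap 0 v > 3/4, so the error lives where 1/8 <= kap 0 v <
    1. *)
Lemma sdb_Fc_local j v (B : R) : lam 0 v = 0 -> 0 <= B ->
  (8^-1 <= kap 0 v -> cn (sdbc j (fun w => toC (psi w) * gauss c w) v) <= B) ->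
  cn (sdbc j (Fc c) v) <= B.
Proof.
move=> lv B0 HB; have [kv|kv] := ltP (kap 0 v) 1; last first.
  have k34 : 3 / 4 < kap 0 v by apply: lt_le_trans kv; lra.
  rewrite (sdb_ext j (@kap_gt_open _ _ b 0 (3 / 4)) k34 (f' := fun=> 0 * 1)); last first.
    by move=> w kw; rewrite mul0r; exact: Fc_out.
  have n0 d : nabla (hs c) d (fun=> 0 * 1) v = 0.
    by rewrite mul0r /nabla (haspd_pd (haspd_cst 0 v d)) add0r mulr0.
  rewrite /sdb /dop /dbar !n0 !mulr0 subr0 addr0 mulr0; case: ifP => _; by rewrite cn0.
have [Q [oQ Qv HQ]] := Fc_near kv.
have e w : Q w -> Fc c w = toC (psi w) * gauss c w.
  by move=> Qw; rewrite HQ// lv /tr subr0 cAC cA0 oppr0 cexp0 mul1r.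
rewrite (sdb_ext j oQ Qv e); have [k8|k8] := leP 8^-1 (kap 0 v); first exact: HB.
rewrite (sdb_ext j (@kap_lt_open _ _ b 0 8^-1) k8 (f' := gauss c)); last first.
  by move=> w kw; rewrite psi1// toC1 mul1r.
by rewrite (sdb_gauss hq a0 j v c0) cn0.
Qed.

End Form.

Lemma psi_bound j : exists2 B : R, 0 <= B & forall v, lam 0 v = 0 ->
  cn (pd (q j) (fun w => toC (psi w)) v) + cn (pd (ci R *: q j) (fun w => toC (psi w)) v) <= B.
Proof.
have bd d : exists2 B : R, 0 <= B & forall v, lam 0 v = 0 -> cn (pd d (fun w => toC (psi w)) v) <= B.
  have [B B0 HB] := lb_cube (b := b) (x := 0) (r := 1) bfree (sm_pd d (sm_psi oT) 0%N) (fun _ _ => I).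
  exists B => // v lv; apply: HB => i; rewrite subr0.
  have := tl_lam bfree i 0 v; rewrite lv tl0 subr0; have := rnd_itv (tl i v).
  move=> /andP[]; move: (tl i v) ((rnd _)%:~R) => y r h1 h2 e; rewrite -{}e !subr0 in h1 h2.
  rewrite ler_norml; apply/andP; split; lra.
have [B B0 HB] := bd (q j); have [B' B'0 HB'] := bd (ci R *: q j).
exists (B + B'); first exact: addr_ge0.
by move=> v lv; apply: lerD; [exact: HB|exact: HB'].
Qed.

Lemma a_min : exists2 al : R, 0 < al & forall i, al <= `|a i|.
Proof.
have : forall s : seq 'I_g, exists2 al : R, 0 < al & forall i, i \in s -> al <= `|a i|.
  elim=> [|i s [al al0 Hal]]; first by exists 1.
  exists (Num.min al `|a i|); first by rewrite lt_min al0 normr_gt0 a0.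
  by move=> j; rewrite inE => /orP[/eqP ->|/Hal]; rewrite ge_min ?lexx ?orbT// => ->.
by move=> /(_ (enum 'I_g))[al al0 Hal]; exists al => // i; apply: Hal; rewrite mem_enum.
Qed.

(** Where kap 0 v >= 1/8 the vector v is bounded away from 0, hence so is one of its coordinates
    z_i, and the corresponding factor alone is exponentially small in c; the other factors are at
    most 1. *)
Lemma gauss_small : exists2 e : R, 0 < e & forall c v, 1 <= c -> 8^-1 <= kap 0 v -> cn (gauss c v) <= expR (- (e * c)).
Proof.
have [d d0 Hd] := kap_cont b 0 0 (e := 8^-1) ltac:(by rewrite invr_gt0).
have [r r0 Hr] := z_small zspan d0.
have [al al0 Hal] := a_min.
exists (al / 2 * (r ^+ 2 / 2)); first by rewrite !mulr_gt0 ?invr_gt0 ?exprn_gt0.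
move=> c v c1 kv; have c0 : 0 < c by exact: lt_le_trans c1.
have [i zi] : exists i, r <= cn (z i v).
  have [//|no] := pselect (exists i, r <= cn (z i v)).
  have vd : vn v < d by apply: Hr => i; rewrite ltNge; apply/negP => ri; apply: no; exists i.
  have := Hd v; rewrite subr0 => /(_ vd); rewrite kap_self subr0 ger0_norm ?kap_ge0//.
  by rewrite ltNge kv.
rewrite /gauss (_ : \sum_k _ = toC (- \sum_k c * `|a k| / 2 * nsq (z k v))); last first.
  rewrite -sumrN toC_sum; apply: eq_bigr => k _; rewrite -toC_nsq -toCM; congr toC; ring.
rewrite cexp_toC cn_toC ger0_norm ?expR_ge0// ler_expR lerN2.
rewrite (bigD1 i)//=; have := nsq_cn (z i v) => -[h1 _].
have rz : r ^+ 2 <= cn (z i v) ^+ 2 by rewrite ler_sqr ?nnegrE ?cn_ge0 ?(ltW r0).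
have rest : 0 <= \sum_(k | k != i) c * `|a k| / 2 * nsq (z k v).
  apply: sumr_ge0 => k _; apply: mulr_ge0; last by rewrite /nsq addr_ge0 ?sqr_ge0.
  by rewrite !mulr_ge0 ?invr_ge0 ?(ltW c0).
apply: (@le_trans _ _ (c * `|a i| / 2 * nsq (z i v))); last by rewrite lerDl.
rewrite (_ : al / 2 * _ * c = (c * al / 2) * (r ^+ 2 / 2)); last by ring.
apply: ler_pM.
- by rewrite !mulr_ge0 ?invr_ge0 ?(ltW c0) ?(ltW al0).
- by rewrite !mulr_ge0 ?invr_ge0 ?exprn_ge0 ?(ltW r0).
- by rewrite ler_pM2r ?invr_gt0// ler_pM2l.
by rewrite ler_pdivrMr// mulrC; apply: le_trans rz h1.
Qed.

Local Notation Pic c := (Pi (hs c) q (fun j => c * a j)).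

Lemma hsq c i j : hs c (q i) (q j) = if i == j then toC (c * a i) else 0.
Proof. exact: hscale_q. Qed.

Lemma ca_neq0 c i : 1 <= c -> c * a i != 0.
Proof. by move=> c1; rewrite mulf_neq0 ?a0// gt_eqF//; exact: lt_le_trans c1. Qed.

Lemma Pi_near : exists2 Y : R, 1 <= Y & forall c, 1 <= c -> forall f B, Gam (hs c) b q [::] f ->
  0 <= B -> (forall j w, cn (sdb (hs c) (q j) (c * a j) f w) <= B) ->
  forall N v, cn (Pic c N f v - f v) <= B * (c * Y) ^+ size N.
Proof.
have [al al0 Hal] := a_min; have [K K0 HK] := @S_near R g al al0.
pose A := \sum_i `|a i|.
have A0 : 0 <= A by exact: sumr_ge0.
have HA i : `|a i| <= A by rewrite /A (bigD1 i)//= lerDl sumr_ge0.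
have AK : 0 <= A * K by exact: mulr_ge0.
exists (1 + A * K + K); first by rewrite -addrA lerDl addr_ge0.
move=> c c1 f B Gf B0 HB N v; have c0 : 0 < c by exact: lt_le_trans c1.
have ca0 i := ca_neq0 i c1.
have cal i : al <= `|c * a i|.
  by rewrite normrM (gtr0_norm c0); apply: le_trans (Hal i) _; rewrite ler_peMl.
have hqq i : hs c (q i) (q i) = toC (c * a i) by rewrite hsq eqxx.
pose X := 1 + c * (A * K) + K.
have cAK : 0 <= c * (A * K) by rewrite mulr_ge0// ltW.
have X1 : 1 <= X by rewrite /X -addrA lerDl addr_ge0.
have main : forall n, n = size N -> forall w, cn (Pic c N f w - f w) <= B * (X ^+ n - 1).
  move=> n; elim: N n => [|k N IH] n ->; first by move=> w; rewrite /= subrr cn0 subrr mulr0.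
  move=> w /=; have GN : Gam (hs c) b q [::] (Pic c N f) by apply: (Gam_Pi bfree (hsq c) ca0).
  have E := S_lin bfree ca0 k (-1) w GN Gf.
  have Gd : Gam (hs c) b q [::] (fun v => Pic c N f v + -1 * f v) by exact: Gam_lin.
  have e1 : cn (S_ (hs c) q (fun j => c * a j) k (fun v => Pic c N f v + -1 * f v) w) <=
      `|c * a k| * (K * (B * (X ^+ size N - 1))).
    apply: (HK (hs c) (q k) (c * a k) (hqq k) (cal k) _ _ w (Gam_SB bfree Gd)).1 => v'.
    by rewrite mulN1r; exact: IH.
  have e2 : cn (S_ (hs c) q (fun j => c * a j) k f w - f w) <= K * B.
    exact: (HK (hs c) (q k) (c * a k) (hqq k) (cal k) _ _ w (Gam_SB bfree Gf)).2 (HB k).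
  rewrite (_ : S_ _ _ _ _ _ _ - f w = S_ (hs c) q (fun j => c * a j) k (fun v => Pic c N f v + -1 * f v) w
     + (S_ (hs c) q (fun j => c * a j) k f w - f w)); last by rewrite E mulN1r addrA subrK.
  apply: le_trans (cnD _ _) _; apply: le_trans (lerD e1 e2) _.
  have Xn : 1 <= X ^+ size N by exact: exprn_ege1.
  have e3 : `|c * a k| * (K * (B * (X ^+ size N - 1))) <= c * (A * K) * (B * (X ^+ size N - 1)).
    rewrite normrM (gtr0_norm c0) -!mulrA ler_pM2l//; apply: ler_wpM2r (HA k).
    by rewrite !mulr_ge0// subr_ge0.
  apply: le_trans (lerD e3 (lexx _)) _; rewrite exprS.
  rewrite -subr_ge0 (_ : _ - _ = B * ((1 + K) * (X ^+ size N - 1) + c * (A * K))).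
    by rewrite mulr_ge0// addr_ge0// mulr_ge0 ?subr_ge0// addr_ge0.
  rewrite {1}/X; ring.
apply: le_trans (main _ erefl v) _; apply: ler_wpM2l => //.
apply: (@le_trans _ _ (X ^+ size N)); first by rewrite gerBl.
rewrite lerXn2r ?nnegrE ?(le_trans ler01 X1)//.
  by rewrite mulr_ge0 ?(ltW c0)// !addr_ge0.
by rewrite /X !mulrDr mulr1 !lerD// ler_peMl.
Qed.

(** The harmonic projection of [Fc] differs from it at 0, where its value is 1, by O(c^g exp(- e
    c)), which is below 1 for large c. The projection is taken in all g directions, positive and
    negative alike. *)
Lemma harmonic_nonzero : exists m0 : nat, forall m, (m0 <= m)%N ->
  (forall l l', lat b l -> lat b l' -> cexp (cA (hs m%:R) l l') = 1) ->
  exists2 f, Hm (hs m%:R) b q (fun j => m%:R * a j) f & f 0 != 0.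
Proof.
have [Y Y1 HY] := Pi_near; have [e e0 He] := gauss_small.
have exD j : exists D : R, 0 <= D /\ forall v, lam 0 v = 0 ->
    cn (pd (q j) (fun w => toC (psi w)) v) + cn (pd (ci R *: q j) (fun w => toC (psi w)) v) <= D.
  by have [D D0 HD] := psi_bound j; exists D.
have [Dj HDj] := choice exD; pose D := \sum_j Dj j.
have D0 : 0 <= D by apply: sumr_ge0 => j _; case: (HDj j).
have HD j : Dj j <= D.
  by rewrite /D (bigD1 j)//= lerDl; apply: sumr_ge0 => i _; case: (HDj i).
have [M M0 HM] := exp_poly R g.+1.
pose Z := 2 * D * M * Y ^+ g / e ^+ g.+1.
have Y0 : 0 <= Y by exact: le_trans Y1.
have Z0 : 0 <= Z by rewrite !mulr_ge0 ?invr_ge0 ?exprn_ge0 ?(ltW e0).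
(* [Z] gathers the constants so that, by (e c)^(g + 1) <= M exp(e c), the error is at most Z / c;
   the successor also ensures m >= 1. *)
exists (Num.bound Z).+1 => m mZ.
have c1 : 1 <= m%:R :> R by rewrite ler1n; exact: leq_trans mZ.
have Zc : Z < m%:R.
  by apply: lt_le_trans (archi_boundP Z0) _; rewrite ler_nat; exact: ltnW.
move: (m%:R : R) c1 Zc => c c1 Zc hL; have c0 : 0 < c by exact: lt_le_trans c1.
have GF : Gam (hs c) b q [::] (Fc c) by split; [exact: sm_Fc|exact: Fc_auto|].
pose B := 2 * (D * expR (- (e * c))).
have B0 : 0 <= B by rewrite !mulr_ge0 ?expR_ge0.
have HB j w : cn (sdb (hs c) (q j) (c * a j) (Fc c) w) <= B.
  apply: le_trans (sdb_auto hL j w) _; apply: ler_wpM2l => //.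
  have l0 : lam 0 (w - lam 0 w) = 0 by rewrite (lamD bfree) ?subrr//; exact: (latN bfree (lam_lat b 0 w)).
  apply: (sdb_Fc_local c1 l0); first by rewrite mulr_ge0 ?expR_ge0.
  move=> k8; apply: le_trans (sdb_psi c1 j _) _; apply: ler_pM.
  - by rewrite addr_ge0 ?cn_ge0.
  - exact: cn_ge0.
  - by apply: le_trans (HD j); case: (HDj j) => _; exact.
  exact: He.
exists (Pic c (enum 'I_g) (Fc c)).
  apply: (Pi_Hm bfree (hsq c) (fun i => ca_neq0 i c1) (P := [::])) => //.
  - exact: enum_uniq.
  - by move=> j; rewrite mem_enum.
apply/eqP => p0; have := HY c c1 _ B GF B0 HB (enum 'I_g) 0.
rewrite p0 Fc0 sub0r cnN cn1 size_enum_ord; apply/negP; rewrite -ltNge.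
have ec : 0 < e * c by exact: mulr_gt0.
have h1 : expR (- (e * c)) * (e * c) ^+ g.+1 <= M.
  rewrite -ler_pdivlMl ?expR_gt0// expRN invrK; apply: le_trans (HM _ ec) _.
  by rewrite mulrC.
apply: (@le_lt_trans _ _ (Z / c)); last by rewrite ltr_pdivrMr// mul1r.
rewrite /B /Z ler_pdivlMr// (_ : 2 * D * M * Y ^+ g / e ^+ g.+1 = 2 * D * Y ^+ g * (M / e ^+ g.+1)); last by ring.
rewrite (_ : 2 * (D * expR (- (e * c))) * (c * Y) ^+ g * c = 2 * D * Y ^+ g * (expR (- (e * c)) * c ^+ g.+1)); last by rewrite exprMn exprS; ring.
apply: ler_wpM2l; first by rewrite !mulr_ge0 ?exprn_ge0.
by rewrite ler_pdivlMr ?exprn_gt0// -mulrA -exprMn (mulrC c).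
Qed.

End Nonvanishing.

Lemma dbar_cplx_alg (K : fieldType) (i x y r m H F : K) : i * i = -1 ->
  2^-1 * (r * x + m * y + i * (- m * x + r * y)) + 2^-1 * ((r - i * m) * H) * F =
  (r - i * m) * (2^-1 * (x + i * y) + 2^-1 * H * F).
Proof.
move=> ii; rewrite [RHS](_ : _ = 2^-1 * (r * x - (i * i) * m * y + i * (- m * x + r * y)) + 2^-1 * ((r - i * m) * H) * F); last by ring.
by rewrite ii; ring.
Qed.

(** * Holomorphy of quotients of sections *)

Section DbarSpan.

Variables (R : realType) (g : nat) (h : hermform R g).
Local Notation C := (Cplx R).
Local Notation V := 'cV[C]_g.
Implicit Types (f : V -> C) (U : set V) (v w d : V).

Lemma dbar_cplx U f v q (c : C) : vopen U -> sm U f -> U v -> dbar h (c *: q) f v = cconj c * dbar h q f v.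
Proof.
move=> oU sf Uv; rewrite (dbar_formula h (c *: q)) (dbar_formula h q) (scalerA (ci R)) hfZr.
rewrite (pd_cplx q c oU (sf 2%N) Uv) (pd_cplx q (ci R * c) oU (sf 2%N) Uv).
have -> : re (ci R * c) = - im c by rewrite !reimE mul0r mul1r add0r.
have -> : im (ci R * c) = re c by rewrite !reimE mul0r mul1r add0r.
have -> : cconj c = toC (re c) - ci R * toC (im c).
  by apply: ceq; rewrite !reimE; ring.
rewrite toCN; apply: dbar_cplx_alg; exact: ci2.
Qed.

Lemma dbar_addd U f v d d' : vopen U -> sm U f -> U v -> dbar h (d + d') f v = dbar h d f v + dbar h d' f v.
Proof.
move=> oU sf Uv; rewrite (dbar_formula h (d + d')) (dbar_formula h d) (dbar_formula h d') scalerDr hfDr.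
rewrite (pdD d d' oU (sf 2%N) Uv) (pdD (ci R *: d) (ci R *: d') oU (sf 2%N) Uv).
move: (pd d f v) (pd d' f v) (pd (ci R *: d) f v) (pd (ci R *: d') f v) => x y z t; ring.
Qed.

Lemma dbar_span U f v I (r : seq I) (c : I -> C) (q : I -> V) : vopen U -> sm U f -> U v ->
  (forall j, dbar h (q j) f v = 0) -> dbar h (\sum_(j <- r) c j *: q j) f v = 0.
Proof.
move=> oU sf Uv z; elim: r => [|j r IH].
  by rewrite big_nil -(scale0r 0) (dbar_cplx _ _ oU sf Uv) cconj0 mul0r.
by rewrite big_cons (dbar_addd _ _ oU sf Uv) IH (dbar_cplx _ _ oU sf Uv) z mulr0 addr0.
Qed.
(** Leibniz's rule for f = (f / f') f': the connection term belongs to the factor f', and what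
    remains is the Cauchy-Riemann equation for the quotient. *)
Lemma quot_differentiable Q f f' v : vopen Q -> sm Q f -> sm Q f' -> (forall w, Q w -> f' w != 0) -> Q v ->
  (forall d, dbar h d f v = 0) -> (forall d, dbar h d f' v = 0) -> differentiable (fun w => f w / f' w) v.
Proof.
move=> oQ sf sf' nz Qv df df'.
have sp : sm Q (fun w => f w / f' w) by apply: smM => //; exact: smV_cont.
have e w : Q w -> f w = f w / f' w * f' w by move=> Qw; rewrite divfK// nz.
apply: (sm_differentiable oQ sp Qv) => i.
have := df (ev R i); rewrite (dbar_ext h _ oQ Qv e) (dbarM h _ sf' sp Qv) df' mulr0 addr0.
move=> /eqP; rewrite !mulf_eq0 (negbTE (nz v Qv)) orbF invr_eq0 pnatr_eq0 /=.
by rewrite addr_eq0 => /eqP ->; rewrite mulrN mulrA ci2 mulN1r opprK.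
Qed.

End DbarSpan.

Lemma differentiable_mx1 (K : numFieldType) (W : normedModType K) (p : W -> K) v :
  differentiable p v -> differentiable (fun w => (p w)%:M : 'M[K]_1) v.
Proof.
move=> dp; apply: differentiable_mx => i j; rewrite !ord1.
by rewrite (_ : (fun z => _) = p)//; apply/funext => w; rewrite mxE eqxx.
Qed.

(** * Cochains indexed by tuples and by sequences *)

Section Indexing.

Variables (V : choiceType) (x0 : V).

Lemma dl_enum (K : fieldType) n (t : 'I_n.+1 -> V) (c : seq V -> K) :
  dl c [seq t k | k <- enum 'I_n.+1] =
  \sum_(k < n.+1) (-1) ^+ k * c [seq t (lift k l) | l <- enum 'I_n].
Proof.
elim: n t c => [|n IH] t c; rewrite big_ord_recl expr0 mul1r enum_ordSl /= -map_comp.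
  by rewrite big_ord0 addr0 [X in dl _ X](_ : _ = [::]) ?subr0 //; case: (enum 'I_0) => // -[].
rewrite (IH (fun k => t (lift ord0 k))); congr (_ + _); rewrite -sumrN; apply: eq_bigr => k _.
rewrite exprS mulN1r mulNr; congr (- (_ * c _)).
rewrite enum_ordSl /= -map_comp; congr (_ :: _); first by congr t; apply: val_inj.
by apply: eq_map => l /=; congr t; apply: val_inj; rewrite /= /bump /= !add1n ltnS addnS.
Qed.

Definition tseq p (t : 'I_p.+1 -> V) : seq V := [seq t k | k <- enum 'I_p.+1].
Definition seqt p (u : seq V) : 'I_p.+1 -> V := fun k => nth x0 u k.

Lemma tseqK p (t : 'I_p.+1 -> V) : seqt (tseq t) = t.
Proof.
apply/funext => k; by rewrite /seqt /tseq (nth_map ord0) ?size_enum_ord// nth_ord_enum.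
Qed.

Lemma seqtK p (u : seq V) : size u = p.+1 -> tseq (@seqt p u) = u.
Proof.
move=> su; apply: (@eq_from_nth _ x0); first by rewrite size_map size_enum_ord.
move=> k; rewrite size_map size_enum_ord => kp; rewrite (nth_map ord0) ?size_enum_ord//.
by rewrite /seqt nth_enum_ord.
Qed.

End Indexing.

(** * From framed line bundles to quasi-periodic functions *)

Section Framed.

Variables (R : realType) (g : nat) (h : hermform R g).
Local Notation C := (Cplx R).
Local Notation V := 'cV[C]_g.
Variables (b : 'I_(2 * g) -> V) (bfree : real_free b) (X : complexTorus R g).
Hypothesis Xb : lattice X = lat b.
Implicit Types (f : V -> C) (U : set V) (v w d l x y : V).

(** A family of local frames in the unitary gauge. The transition rule makes coefficient times frame
    independent of the chart, and the equations on the frame translate holomorphy of the coefficient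
    into [dbar] equations for the product. *)
Record framed (E : vbundle X 1) (fr : V -> V -> C) : Prop := Framed {
  fr_nz : forall x v, vdom E x v -> fr x v != 0;
  fr_tr : forall x y v, vdom E x v -> vdom E y v -> vtr E x y v = (fr y v / fr x v)%:M;
  fr_sm : forall x, sm (vdom E x) (fr x);
  fr_auto : forall x v l, lat b l -> vdom E x v -> fr x (v + l) = cexp (cA h v l) * fr x v;
  fr_dbar : forall x q v, vdom E x v -> dbar h q (fr x) v = 0 }.

Variables (q : 'I_g -> V) (a : 'I_g -> R).
Hypothesis zspan : forall v, v = \sum_i zc_ h q a i v *: q i.
Variables (s : seq 'I_g) (alls : forall j, j \in s).
Variables (E : vbundle X 1) (fr : V -> V -> C) (FE : framed E fr).
Local Notation F := (shS h b (map q s)).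
Local Notation lopen := (lopen b).
Local Notation Zb p := (@cocycles R g X 1 E p).
Local Notation Bb p := (@coboundaries R g X 1 E p).

Let nz := fr_nz FE.

Lemma openX_lopen U : openX X U <-> lopen U.
Proof. by rewrite /openX Xb open_vopen. Qed.

Lemma vdom_vopen x : vopen (vdom E x).
Proof. by apply/open_vopen; case: (vdom_open E x). Qed.

Lemma section_sh U t : openX X U -> is_section E U t -> F U (fun v => t v v ord0 ord0 * fr v v).
Proof.
move=> oXU [ht ct]; have lU := (openX_lopen U).1 oXU; have [oU iU] := lU.
have loc x v : U v -> vdom E x v -> t v v ord0 ord0 * fr v v = t x v ord0 ord0 * fr x v.
  move=> Uv xv; rewrite (ct v x v Uv (vdom_id E v) xv) (fr_tr FE (vdom_id E v) xv) mul_scalar_mx mxE.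
  by field; exact: nz (vdom_id E v).
have oQ x : vopen (U `&` vdom E x) by apply: vopenI => //; exact: vdom_vopen.
have dt x v : (U `&` vdom E x) v -> differentiable (fun w => t x w ord0 ord0) v.
  by move=> Qv; apply: differentiable_entry; exact: (ht x).1.
have st x : sm (U `&` vdom E x) (fun w => t x w ord0 ord0) by exact: differentiable_sm (oQ x) (dt x).
have sf x : sm (U `&` vdom E x) (fr x) by apply: sm_sub (fr_sm FE x) => v [].
have e x w : (U `&` vdom E x) w -> t x w ord0 ord0 * fr x w = t w w ord0 ord0 * fr w w.
  by move=> [Uw xw]; rewrite (loc x w).
split.
- apply: sm_loc => v Uv; exists (U `&` vdom E v); split; [exact: oQ|by split => //; exact: vdom_id|].
  exact: sm_ext (oQ v) (e v) (smM (oQ v) (st v) (sf v)).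
- move=> l ll v Uv; have Xl : lattice X l by rewrite Xb.
  have vv := vdom_id E v; have vl := (vdom_open E v).2 v l Xl vv.
  rewrite (loc v _ (iU v l ll Uv) vl) (fr_auto FE ll vv).
  by rewrite ((ht v).2 v l Xl (conj Uv vv)) mulrCA.
move=> p _ v Uv; have Qv : (U `&` vdom E v) v by split => //; exact: vdom_id.
rewrite -(dbar_ext h p (oQ v) Qv (e v)) (dbarM h p (sf v) (st v) Qv) (fr_dbar FE p (vdom_id E v)).
rewrite (differentiable_CR p (ci R) (dt v) Qv) mulrA ci2 mulN1r subrr mulr0 mul0r mulr0 addr0//.
Qed.

Lemma sh_section U f : openX X U -> F U f -> is_section E U (fun x v => (f v / fr x v)%:M).
Proof.
move=> oXU [sf af df]; have lU := (openX_lopen U).1 oXU; have [oU iU] := lU.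
split; last first.
  move=> x y v Uv xv yv; rewrite (fr_tr FE xv yv) -scalar_mxM; congr (_%:M).
  by field; rewrite !nz.
move=> x; have oQ : vopen (U `&` vdom E x) by apply: vopenI => //; exact: vdom_vopen.
split=> [v Qv|v l Xl [Uv xv]]; last first.
  have ll : lat b l by rewrite -Xb.
  rewrite (fr_auto FE ll xv) (af l ll v Uv); congr (_%:M).
  by field; rewrite nz// cexp_neq0.
apply: differentiable_mx1; apply: (quot_differentiable (h := h) oQ).
- by apply: sm_sub sf => w [].
- by apply: sm_sub (fr_sm FE x) => w [].
- by move=> w [_ xw]; exact: nz.
- exact: Qv.
- move=> d; rewrite (zspan d); apply: (dbar_span (U := U)) => //; first by case: Qv.
  by move=> j; apply: df; [exact: map_f|case: Qv].
by move=> d; exact: (fr_dbar FE d Qv.2).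
Qed.

Lemma size_tseq (p : nat) (t : 'I_p.+1 -> V) : size (tseq t) = p.+1.
Proof. by rewrite size_map size_enum_ord. Qed.

Lemma ov_tseq (W : V -> set V) (p : nat) (t : 'I_p.+1 -> V) : ov W (tseq t) = overlap W t.
Proof.
apply/seteqP; split=> v Hv.
  by move=> k; apply: Hv; apply: map_f; rewrite mem_enum.
by move=> x /mapP[k _ ->]; exact: Hv.
Qed.

(** At v the section is read in the chart at v itself, which always contains v; every other chart at
    v gives the same product. *)
Definition toch (p : nat) (c : cochain R g 1 p) : cch V C := fun u v => c (@seqt V 0 p u) v v ord0 ord0 * fr v v.
Definition ofch (p : nat) (c : cch V C) : cochain R g 1 p := fun t x v => (c (tseq t) v / fr x v)%:M.

Lemma cov_cover (W : V -> set V) : is_covering X W <-> cov lopen W.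
Proof. by split=> H x; have [ox ix] := H x; split=> //; apply/openX_lopen. Qed.

Lemma openX_overlap (W : V -> set V) (p : nat) (t : 'I_p.+1 -> V) : is_covering X W -> openX X (overlap W t).
Proof.
move=> cW; apply/openX_lopen; rewrite -ov_tseq; apply: (opn_ov (lopenT b) (@lopenI _ _ b)).
exact/cov_cover.
Qed.

Lemma toch_isC (W : V -> set V) (p : nat) (c : cochain R g 1 p) : is_covering X W -> is_cochain E W c -> isC F W p (toch c).
Proof.
move=> cW Hc u su; rewrite -(seqtK 0 su) ov_tseq /toch.
rewrite (_ : (fun v => _) = fun v => c (@seqt V 0 p u) v v ord0 ord0 * fr v v); last by rewrite (seqtK 0 su).
by apply: section_sh; [exact: openX_overlap|exact: Hc].
Qed.

Lemma ofch_isC (W : V -> set V) (p : nat) (c : cch V C) : is_covering X W -> isC F W p c -> is_cochain E W (ofch c : cochain R g 1 p).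
Proof.
move=> cW Hc t; apply: sh_section; first exact: openX_overlap.
by rewrite -ov_tseq; apply: Hc; exact: size_tseq.
Qed.

Lemma cochain_sumE p I (r : seq I) (F' : I -> cochain R g 1 p) t x v :
  (\sum_(i <- r) F' i) t x v = \sum_(i <- r) F' i t x v.
Proof. exact: (big_morph (fun c : cochain R g 1 p => c t x v)). Qed.

Lemma vv_sumE I (r : seq I) (F' : I -> V -> V -> 'cV[C]_1) x v :
  (\sum_(i <- r) F' i) x v = \sum_(i <- r) F' i x v.
Proof. exact: (big_morph (fun c : V -> V -> 'cV[C]_1 => c x v)). Qed.

Lemma toch_lin (p n : nat) (c : cochain R g 1 p) (al : 'rV[C]_n) (e : 'I_n -> cochain R g 1 p) u v :
  toch (c - \sum_i al ord0 i *: e i) u v = toch c u v - \sum_i al ord0 i * toch (e i) u v.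
Proof.
rewrite /toch (_ : (c - _) _ _ _ = c (seqt 0 u) v v - \sum_i al ord0 i *: e i (seqt 0 u) v v); last first.
  by rewrite -(cochain_sumE (index_enum _) (fun i => al ord0 i *: e i)).
rewrite !mxE mulrBl; congr (_ - _); rewrite summxE mulr_suml; apply: eq_bigr => i _.
by rewrite mxE mulrA.
Qed.

Lemma toch_coboundary (p : nat) (c : cochain R g 1 p) (t : 'I_p.+2 -> V) v :
  toch (coboundary c) (tseq t) v = dC (toch c) (tseq t) v.
Proof.
rewrite /dC (dl_enum t) {1}/toch (tseqK 0 t) /coboundary vv_sumE summxE mulr_suml; apply: eq_bigr => k _.
rewrite mxE -mulrA; congr (_ * _); rewrite /toch.
by have -> := @tseqK _ 0 p (fun l : 'I_p.+1 => t (lift k l)).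
Qed.

Lemma section_loc U t x v : is_section E U t -> U v -> vdom E x v ->
  t x v = (t v v ord0 ord0 * fr v v / fr x v)%:M.
Proof.
move=> [_ ct] Uv xv; rewrite (ct x v v Uv xv (vdom_id E v)) (fr_tr FE xv (vdom_id E v)).
by rewrite mul_scalar_mx; apply/matrixP => i j; rewrite !ord1 !mxE eqxx mulr1n; ring.
Qed.

Lemma toch_Z p c : Zb p c -> Zc F p (toch c).
Proof.
move=> [W [cW Hc z]]; exists W; split; [exact/cov_cover|exact: toch_isC|].
move=> u v su uv; rewrite -(seqtK 0 su) -toch_coboundary /toch.
have ot : overlap W (@seqt _ 0 p.+1 u) v by rewrite -ov_tseq seqtK.
by rewrite tseqK (z _ v v ot (vdom_id E v)) mxE mul0r.
Qed.

Lemma ofchK p c u v : size u = p.+1 -> toch (ofch c : cochain R g 1 p) u v = c u v.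
Proof.
move=> su; rewrite /toch /ofch (seqtK 0 su) mxE eqxx mulr1n divfK//.
exact: nz (vdom_id E v).
Qed.

Lemma ofch_Z p c : Zc F p c -> Zb p (ofch c).
Proof.
move=> [W [cW Hc z]]; have cW' := (cov_cover W).2 cW.
exists W; split; [exact: cW'|exact: ofch_isC|].
move=> t x v ot xv; rewrite /coboundary vv_sumE.
have := z (tseq t) v (size_tseq t); rewrite ov_tseq => /(_ ot).
rewrite /dC dl_enum /zc => e; apply/matrixP => i j; rewrite !ord1 summxE [RHS]mxE.
transitivity ((\sum_(k < p.+2) (-1) ^+ k * c [seq t (lift k l) | l : 'I_p.+1 <- enum 'I_p.+1] v) / fr x v); last by rewrite e mul0r.
rewrite mulr_suml; apply: eq_bigr => k _.
by rewrite mxE /ofch mxE eqxx mulr1n mulrA.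
Qed.

Lemma ofch_coboundary p (c : cch V C) (t : 'I_p.+2 -> V) x v :
  coboundary (ofch c : cochain R g 1 p) t x v = (dC c (tseq t) v / fr x v)%:M.
Proof.
rewrite /coboundary vv_sumE /dC dl_enum; apply/matrixP => i j; rewrite !ord1 summxE mxE eqxx mulr1n mulr_suml.
by apply: eq_bigr => k _; rewrite mxE /ofch mxE eqxx mulr1n mulrA.
Qed.

Lemma toch_B p c : Bb p c -> Bc F p (toch c).
Proof.
case: p c => [|p] c /=.
  move=> [W [cW z]]; exists W; split; first exact/cov_cover.
  move=> u v su uv; rewrite /toch (z _ v v _ (vdom_id E v)) ?mxE ?mul0r//.
  by rewrite -ov_tseq seqtK.
move=> [W [e [cW He z]]]; exists W, (toch e); split; [exact/cov_cover|exact: toch_isC|].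
move=> u v su uv; rewrite -(seqtK 0 su) -toch_coboundary /toch.
have ot : overlap W (@seqt _ 0 p.+1 u) v by rewrite -ov_tseq seqtK.
by rewrite tseqK (z _ v v ot (vdom_id E v)).
Qed.

(** A relation between the functions is a relation in the chart at v only; that c consists of
    sections over some covering carries it to every chart, on the intersection of the coverings. *)
Lemma toch_B_inv p c : Zb p c -> Bc F p (toch c) -> Bb p c.
Proof.
move=> [W0 [cW0 H0 _]]; case: p c H0 => [|p] c H0 /=.
  move=> [W [cW z]]; have cW' := (cov_cover W).2 cW.
  exists (capc W W0); split.
    apply/cov_cover; apply: (cov_cap (@lopenI _ _ b) cW); exact/cov_cover.
  move=> t x v ot xv; rewrite (section_loc (H0 t) _ xv); last by move=> k; exact: (ot k).2.
  have := z (tseq t) v (size_tseq t); rewrite /toch tseqK /zc => ->.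
    by rewrite mul0r; apply/matrixP => i j; rewrite !mxE mul0rn.
  by rewrite ov_tseq => k; exact: (ot k).1.
move=> [W [e [cW He z]]]; have cW' := (cov_cover W).2 cW.
exists (capc W W0), (ofch e); have cWW : is_covering X (capc W W0).
  by apply/cov_cover; apply: (cov_cap (@lopenI _ _ b) cW); exact/cov_cover.
split; [exact: cWW|apply: ofch_isC; first exact: cWW|].
  exact: (isC_sub (lopenT b) (@lopenI _ _ b) ((cov_cover _).1 cWW) (@capl _ W W0) He).
move=> t x v ot xv; rewrite (section_loc (H0 t) _ xv); last by move=> k; exact: (ot k).2.
rewrite ofch_coboundary; congr ((_ / _)%:M).
have := z (tseq t) v (size_tseq t); rewrite /toch tseqK => -> //.
by rewrite ov_tseq => k; exact: (ot k).1.
Qed.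

Lemma section_lin U t t' (al : C) : is_section E U t -> is_section E U t' ->
  is_section E U (fun x v => t x v + al *: t' x v).
Proof.
move=> [ht ct] [ht' ct']; split=> [x|x y v Uv xv yv]; last first.
  by rewrite mulmxDr -scalemxAr (ct x y v) ?(ct' x y v).
split=> [v Qv|v l Xl Qv]; last by rewrite ((ht x).2 v l) ?((ht' x).2 v l).
apply: differentiableD; first exact: (ht x).1.
by apply: differentiableZ; exact: (ht' x).1.
Qed.

Lemma Zb_lin p (c c' : cochain R g 1 p) (al : C) : Zb p c -> Zb p c' -> Zb p (c + al *: c').
Proof.
move=> [W [cW Hc z]] [W' [cW' Hc' z']]; exists (capc W W').
have cWW : is_covering X (capc W W').
  by apply/cov_cover; apply: (cov_cap (@lopenI _ _ b)); exact/cov_cover.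
have sub t v : overlap (capc W W') t v -> overlap W t v /\ @overlap R g W' p t v.
  by move=> o; split=> k; [exact: (o k).1|exact: (o k).2].
split; first exact: cWW.
  move=> t; have oo := openX_overlap t cWW.
  have st (T : V -> V -> 'cV[C]_1) Y : is_section E Y T -> (overlap (capc W W') t) `<=` Y ->
      is_section E (overlap (capc W W') t) T.
    move=> [h1 h2] YY; split=> [x|x y v ov xv yv]; last by apply: h2 => //; exact: YY.
    by split=> [v [ov xv]|v l Xl [ov xv]]; [apply: (h1 x).1|apply: (h1 x).2 => //]; split=> //; exact: YY.
  by apply: (section_lin al (st _ _ (Hc t) _) (st _ _ (Hc' t) _)) => v /sub[].
move=> t x v ot xv.
have -> : coboundary (c + al *: c') t x v = coboundary c t x v + al *: coboundary c' t x v.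
  rewrite /coboundary !vv_sumE scaler_sumr -big_split; apply: eq_bigr => k _ /=.
  rewrite !scalerA mulrC -scalerA -scalerDr//.
rewrite (z t x v _ xv) ?(z' t x v _ xv) ?scaler0 ?addr0//; move=> k; [exact: (ot k).2|exact: (ot k).1].
Qed.

Lemma Zb_sum p n (c : cochain R g 1 p) (al : 'rV[C]_n) (e : 'I_n -> cochain R g 1 p) : Zb p c ->
  (forall m, Zb p (e m)) -> Zb p (c - \sum_m al ord0 m *: e m).
Proof.
move=> Zc Ze; elim: (index_enum _) => [|m l IH]; first by rewrite big_nil subr0.
rewrite big_cons opprD addrCA addrC -scaleNr; exact: Zb_lin.
Qed.

(** Unique coordinates in Gam modulo N become unique coordinates of cohomology classes, so degree i
    has a finite dimension. Since [cohomology_dim] is a chosen value, it is shown that every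
    admissible value is 0 outside degree i and that 0 is not admissible in degree i; the Euler
    characteristic then has one nonzero term. *)
Lemma framed_index i Gam N r : pack F i Gam N r -> (i <= g)%N ->
  (exists n (e : 'I_n -> V -> C), (forall m, Gam (e m)) /\
    forall f, Gam f -> exists! c : 'rV[C]_n, N (fun x => f x - \sum_m c ord0 m * e m x)) ->
  (exists2 f, Gam f & ~ N f) ->
  has_index E i /\ nondegenerate_bundle E.
Proof.
move=> pk ig [n [e [Ge He]]] [f0 Gf0 Nf0].
have van p : p <> i -> cohomology_eq0 E p.
  by move=> pi c Zc; apply: (toch_B_inv Zc); apply: (pk_van pk pi); exact: toch_Z.
have nvan : ~ cohomology_eq0 E i.
  move=> ei; have [c rc] := pk_sur pk Gf0; have [Zc0 _] := pk_Z pk rc.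
  apply/Nf0/(pk_B pk rc); have [W [cW _ _]] := Zc0.
  apply: (Bc_ext (lopenT b) (@lopenI _ _ b) cW (c := toch (ofch c : cochain R g 1 i))).
    by move=> u v su _; exact: ofchK.
  by apply: toch_B; apply: ei; exact: ofch_Z.
have dim_i : has_cohomology_dim E i n.
  have ex m : exists c, r c (e m) by exact: (pk_sur pk (Ge m)).
  have [ec Hec] := choice ex.
  exists (fun m => ofch (ec m)); split; first by move=> m; apply: ofch_Z; exact: (pk_Z pk (Hec m)).1.
  have rm m : r (toch (ofch (ec m) : cochain R g 1 i)) (e m).
    have [[W [cW _ _]] _] := pk_Z pk (Hec m).
    apply: (pk_eqc (lopenT b) (@lopenI _ _ b) pk cW _ (Hec m)) => u v su _; exact/esym/ofchK.
  move=> c Zc; have Zc' := toch_Z Zc; have [f rf] := pk_tot pk Zc'.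
  have rl (al : 'rV[C]_n) : r (toch (c - \sum_m al ord0 m *: (ofch (ec m) : cochain R g 1 i)))
      (fun x => f x - \sum_m al ord0 m * e m x).
    have -> : toch (c - \sum_m al ord0 m *: (ofch (ec m) : cochain R g 1 i)) =
        fun u v => toch c u v - \sum_m al ord0 m * toch (ofch (ec m) : cochain R g 1 i) u v.
      by apply/funext => u; apply/funext => v; rewrite toch_lin.
    elim: (index_enum _) => [|m l IH].
      rewrite (_ : (fun u v => _) = toch c); last first.
        by apply/funext => u; apply/funext => v; rewrite big_nil subr0.
      by rewrite (_ : (fun x => _) = f)//; apply/funext => x; rewrite big_nil subr0.
    have := pk_lin pk (- al ord0 m) IH (rm m); congr r.
      by apply/funext => u; apply/funext => v; rewrite /lc big_cons mulNr opprD addrCA addrC.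
    by apply/funext => x; rewrite big_cons mulNr opprD addrCA addrC.
  have Zec m : Zb i (ofch (ec m) : cochain R g 1 i) by apply: ofch_Z; exact: (pk_Z pk (Hec m)).1.
  have iff (al : 'rV[C]_n) : Bb i (c - \sum_m al ord0 m *: (ofch (ec m) : cochain R g 1 i)) <->
      N (fun x => f x - \sum_m al ord0 m * e m x).
    rewrite -(pk_B pk (rl al)); split; first exact: toch_B.
    by apply: toch_B_inv; exact: Zb_sum.
  have [al [Nal uq]] := He f (pk_Z pk rf).2; exists al; split; first exact/iff.
  by move=> al' /iff; exact: uq.
split; first by split.
have dim0 p : p <> i -> cohomology_dim E p = 0%N.
  move=> pi; rewrite /cohomology_dim; case: xgetP => // k _ [e' [Ze' He']].
  case: k e' Ze' He' => // k e' Ze' He'.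
  have Z0 : Zb p (ofch (zc C) : cochain R g 1 p).
    apply: ofch_Z; exists (fun=> setT); have cT := covT (lopenT b).
    split; [exact: cT| |by rewrite dC0].
    by move=> u su; apply: sec0; apply: (opn_ov (lopenT b) (@lopenI _ _ b)).
  have [al [_ uq]] := He' _ Z0.
  have u0 al' : al = al'.
    by apply: uq; apply: (van p pi); exact: Zb_sum.
  have := u0 0; rewrite (u0 (const_mx 1)) => /rowP /(_ ord0); rewrite !mxE => /eqP.
  by rewrite oner_eq0.
have dimi : cohomology_dim E i <> 0%N.
  move=> d0; have : [set m | has_cohomology_dim E i m] (cohomology_dim E i).
    by apply: xgetPex; exists n.
  rewrite d0 => -[e' [_ He']]; apply: nvan => c Zc.
  have [al [Bal _]] := He' c Zc; by rewrite big_ord0 subr0 in Bal.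
rewrite /nondegenerate_bundle /euler_char (bigD1 (Ordinal (ig : (i < g.+1)%N)))//= big1 ?addr0; last first.
  by move=> p pi; rewrite dim0 ?mulr0//; move=> e1; move: pi; rewrite -val_eqE /= e1 eqxx.
by move/eqP; rewrite mulf_eq0 signr_eq0 /= => /eqP [] /dimi.
Qed.

End Framed.

(** * The line bundle of a form *)

Section LineBundle.

Variables (R : realType) (g : nat) (h : hermform R g).
Local Notation C := (Cplx R).
Local Notation V := 'cV[C]_g.
Variables (b : 'I_(2 * g) -> V) (bfree : real_free b) (X : complexTorus R g).
Hypothesis Xb : lattice X = lat b.
Hypothesis hL : forall l l', lat b l -> lat b l' -> cexp (cA h l l') = 1.
Implicit Types (f : V -> C) (U : set V) (v w d l x y : V).
Local Notation kap := (kap b).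
Local Notation lam := (lam b).
Let oT := @vopenT R g.

Lemma sm_hvv U : vopen U -> sm U (fun v => h v v).
Proof.
move=> oU; have e v : U v -> \sum_i v i ord0 * h (ev R i) v = h v v.
  move=> _; have E : v = \sum_i v i ord0 *: ev R i.
    by rewrite [LHS]matrix_sum_delta; apply: eq_bigr => i _; rewrite big_ord1.
  rewrite [RHS](_ : _ = h (\sum_i v i ord0 *: ev R i) v); last by rewrite -E.
  rewrite (big_morph (fun u => h u v) (fun u u' => hfD h u u' v) (hf0 h v)).
  by apply: eq_bigr => i _; rewrite hfZ.
apply: (sm_ext oU e); apply: sm_sum => // i _; apply: smM => //; apply: sm_rlin => //; first exact: rlin_coord.
split; first by move=> u w; rewrite hfDr.
split; first by move=> t u; rewrite /sc hfZr cconj_toC.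
have [K [_ HK]] := hfK h; exists (K * vn (ev R i)) => u; exact: HK.
Qed.

Lemma haspd_hvv v d : haspd (fun v => h v v) v d (h d v + h v d).
Proof.
have E t : h v v + toC t * (h d v + h v d) + toC t * (toC t * h d d) = h (v + sc t d) (v + sc t d).
  by rewrite /sc hfD !hfDr !hfZ !hfZr cconj_toC; ring.
apply: (iscd_ext E); have t1 := iscd_id (0 : R).
apply: iscd_eq (iscdD (iscdD (iscd_cst _ _) (iscdM t1 (iscd_cst _ _))) (iscdM t1 (iscdM t1 (iscd_cst _ _)))) _.
by rewrite !toC0; ring.
Qed.

(* The Gaussian is the trivializing section of the zero-curvature gauge:
   multiplying a holomorphic function by it gives a section killed by [dbar]. *)
Definition hgauss v : C := cexp (- 2^-1 * h v v).

Lemma sm_hgauss : sm setT hgauss.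
Proof. by apply: sm_cexp => //; apply: smZ => //; exact: sm_hvv. Qed.

Lemma dbar_hgauss d v : dbar h d hgauss v = 0.
Proof.
rewrite dbar_formula !(haspd_pd (haspd_cexp (haspdZ _ (haspd_hvv _ _)))) hfZ hfZr cconj_ci -/(hgauss v).
have i2 := ci2 R; move: (ci R) i2 (h d v) (h v d) (hgauss v) => i i2 x y z.
rewrite (_ : _ + _ = - 2^-1 * 2^-1 * z * (x + y + (i * i) * (x - y)) + 2^-1 * y * z); last by ring.
by rewrite i2; field.
Qed.

(** The frame near x: the Gaussian carried to all lattice translates of a neighbourhood of x with
    the factors of automorphy. Quotients of two such frames are holomorphic and periodic, and they
    are the transition functions. *)
Definition lfr x v : C := tr h (lam x v) hgauss v.
Definition ldom x : set V := [set v | kap x v < 1].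

Lemma lfr_nz x v : lfr x v != 0.
Proof. by rewrite /lfr /tr mulf_neq0// cexp_neq0. Qed.

Lemma lfr_loc x v : ldom x v -> exists Q, [/\ vopen Q, Q v &
  forall w, Q w -> lfr x w = tr h (lam x v) hgauss w].
Proof.
move=> kv; have [e e0 He] := lam_const bfree kv.
exists ([set w | vn (w - v) < e] `&` [set w | kap x w < 1]); split.
- by apply: vopenI; [exact: vopen_ball|exact: kap_lt_open].
- by split=> //=; rewrite subrr vn0.
by move=> w [we kw]; rewrite /lfr (He w we kw).
Qed.

Lemma sm_lfr x : sm (ldom x) (lfr x).
Proof.
apply: sm_loc => v /lfr_loc[Q [oQ Qv HQ]]; exists Q; split; [exact: oQ|exact: Qv|].
have s1 : sm Q (tr h (lam x v) hgauss) by apply: sm_sub (sm_tr h (lam x v) oT sm_hgauss).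
by apply: (sm_ext oQ _ s1) => w Qw; rewrite HQ.
Qed.

Lemma dbar_lfr x d v : ldom x v -> dbar h d (lfr x) v = 0.
Proof.
move=> /lfr_loc[Q [oQ Qv HQ]].
by rewrite (dbar_ext h d oQ Qv HQ) (dbar_tr h d sm_hgauss I) /tr dbar_hgauss mulr0.
Qed.

Lemma lfr_auto x v l : lat b l -> lfr x (v + l) = cexp (cA h v l) * lfr x v.
Proof. by move=> ll; exact: tr_auto. Qed.

Lemma ldom_open x : openX X (ldom x).
Proof. by apply/(openX_lopen Xb); exact: lopen_lt. Qed.

Lemma ldom_id x : ldom x x.
Proof. by rewrite /ldom /= kap_self. Qed.

Lemma ltr_hol x y : holX X (ldom x `&` ldom y) (fun v => (lfr y v / lfr x v)%:M : 'M[C]_1).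
Proof.
split=> [v Qv|v l Xl [xv yv]]; last first.
  have ll : lat b l by rewrite -Xb.
  rewrite (lfr_auto y v ll) (lfr_auto x v ll); congr (_%:M).
  have n1 := lfr_nz x v; have n2 := cexp_neq0 (cA h v l).
  by move: (lfr x v) (lfr y v) (cexp _) n1 n2 => u u' c n1 n2; field; rewrite n1.
have oQ : vopen (ldom x `&` ldom y) by apply: vopenI; exact: kap_lt_open.
apply: differentiable_mx1; apply: (quot_differentiable (h := h) oQ).
- by apply: sm_sub (sm_lfr y) => w [].
- by apply: sm_sub (sm_lfr x) => w [].
- by move=> w _; exact: lfr_nz.
- exact: Qv.
- by move=> d; exact: dbar_lfr Qv.2.
by move=> d; exact: dbar_lfr Qv.1.
Qed.

Lemma ltr_id x v : ldom x v -> (lfr x v / lfr x v)%:M = 1%:M :> 'M[C]_1.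
Proof. by rewrite divff// lfr_nz. Qed.

Lemma ltr_cocycle x y z v : ldom x v -> ldom y v -> ldom z v ->
  (lfr y v / lfr x v)%:M *m (lfr z v / lfr y v)%:M = (lfr z v / lfr x v)%:M :> 'M[C]_1.
Proof. move=> _ _ _; rewrite -scalar_mxM; congr (_%:M).
have n1 := lfr_nz x v; have n2 := lfr_nz y v.
by rewrite mulrC mulrA divfK.
Qed.

Definition line_bundle : vbundle X 1 := VBundle ldom_open ldom_id ltr_hol ltr_id ltr_cocycle.

Lemma framed_line_bundle : framed h b line_bundle lfr.
Proof.
split=> [x v _|x y v _ _|x|x v l ll _|x d v xv] //.
- exact: lfr_nz.
- exact: sm_lfr.
- exact: lfr_auto.
exact: dbar_lfr.
Qed.
End LineBundle.

Lemma tens_scalar (K : comPzRingType) (x y : K) : (x%:M : 'M[K]_1) *t (y%:M : 'M[K]_1) = (x * y)%:M :> 'M[K]_1.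
Proof.
apply/matrixP => i j; rewrite (ord1 i) (ord1 j) [LHS]mxE !ord1 !mxE !eqxx !mulr1n//.
Qed.

(** * Tensor products, simplicity and homogeneity in rank one *)

Section Rank1.

Variables (R : realType) (g : nat) (X : complexTorus R g).
Local Notation C := (Cplx R).
Local Notation V := 'cV[C]_g.
Implicit Types (U : set V) (v w d l x y : V).
Let oT := @vopenT R g.

(** Connection forms add while frames multiply, by the exponential law for the phases and Leibniz's
    rule for [dbar]. *)
Lemma framed_tensor (h1 h2 h : hermform R g) b (E1 E2 : vbundle X 1) fr1 fr2 :
  (forall v w, h v w = h1 v w + h2 v w) ->
  framed h1 b E1 fr1 -> framed h2 b E2 fr2 ->
  framed h b (tensor E1 E2 : vbundle X 1) (fun x v => fr1 x v * fr2 x v).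
Proof.
move=> hh F1 F2.
have o1 x : vopen (vdom E1 x) by apply/open_vopen; case: (vdom_open E1 x).
have o2 x : vopen (vdom E2 x) by apply/open_vopen; case: (vdom_open E2 x).
have s1 x : sm (vdom E1 x `&` vdom E2 x) (fr1 x) by apply: sm_sub (fr_sm F1 x) => v [].
have s2 x : sm (vdom E1 x `&` vdom E2 x) (fr2 x) by apply: sm_sub (fr_sm F2 x) => v [].
split=> [x v [xv1 xv2]|x y v [x1 x2] [y1 y2]|x|x v l ll [x1 x2]|x d v xv].
- by rewrite mulf_neq0 ?(fr_nz F1 xv1) ?(fr_nz F2 xv2).
- rewrite /= (fr_tr F1 x1 y1) (fr_tr F2 x2 y2) tens_scalar; congr (_%:M).
  by field; rewrite (fr_nz F1 x1) (fr_nz F2 x2).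
- exact: (smM (vopenI (o1 x) (o2 x)) (s1 x) (s2 x)).
- rewrite (fr_auto F1 ll x1) (fr_auto F2 ll x2) (_ : cA h v l = cA h1 v l + cA h2 v l) ?cexpD; first by ring.
  by rewrite /cA hh imD toCD mulrDr.
have z1 := fr_dbar F1 d xv.1; have z2 := fr_dbar F2 d xv.2.
rewrite dbar_formula in z1; rewrite dbar_formula in z2; rewrite dbar_formula hh.
have p d' := haspd_pd (haspdM (sm_has d' (s1 x) xv) (sm_has d' (s2 x) xv)).
rewrite !p; move: (pd d (fr1 x) v) (pd (ci R *: d) (fr1 x) v) (pd d (fr2 x) v) (pd (ci R *: d) (fr2 x) v) z1 z2 => A1 B1 A2 B2.
move: (fr1 x v) (fr2 x v) (h1 v d) (h2 v d) (ci R) => f1 f2 k1 k2 i z1 z2.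
transitivity ((2^-1 * (A1 + i * B1) + 2^-1 * k1 * f1) * f2 + f1 * (2^-1 * (A2 + i * B2) + 2^-1 * k2 * f2)); first by ring.
by rewrite z1 z2 mul0r mulr0 addr0.
Qed.

(** A periodic holomorphic function is bounded by its supremum on a period cube, and Cauchy's
    formula on large circles kills its derivatives. *)
Lemma liouville (b : 'I_(2 * g) -> V) (F : V -> C) : real_free b -> (forall v, differentiable F v) ->
  (forall v l, lat b l -> F (v + l) = F v) -> forall v, F v = F 0.
Proof.
move=> bfree dF per v.
have cF : chol setT F by apply: diff_chol => w _.
have sF : sm setT F by exact: chol_sm.
have [M M0 HM] := lb_cube (b := b) (x := 0) (r := 1) bfree (sF 0%N) (fun _ _ => I).
have {}HM w : cn (F w) <= M.
  have [l ll cl] := cube_lat bfree w; rewrite -(subrK l w) per//; exact: HM.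
have pz d w : pd d F w = 0.
  apply/eqP; rewrite -cn_eq0; apply/eqP/le_anti; rewrite cn_ge0 andbT leNgt; apply/negP => c0.
  (* With this radius, r times the derivative is 8 M + 1, while the circle formula bounds it by 4
     M. *)
  pose r := (8 * M + 1) / cn (pd d F w); have r0 : 0 < r by rewrite divr_gt0// ltr_wpDl// mulr_ge0.
  have p0 := pi_gt0 R.
  have r2 : 2 * r < 2 * r + 1 by rewrite ltrDl.
  have E := circ_formula cF r0 r2 (fun z _ => I : setT (w + z *: d)).
  have cc := circ_ccOn (r := r) (v := w) (d := d) cF (fun t => I).
  have cc2 : ccOn 0 (2 * pi) (fun t => F (w + (toC r * cis t) *: d) * cis (- t)).
    by apply: ccOnM cc _ => t _; exact: ccont_cisN.
  have tp : 0 <= 2 * pi :> R by rewrite mulr_ge0// ltW.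
  have b1 t : 0 <= t <= 2 * pi -> cn (F (w + (toC r * cis t) *: d) * cis (- t)) <= M * 2.
    by move=> _; apply: le_trans (cnM _ _) _; apply: ler_pM; rewrite ?cn_ge0 ?cn_cis.
  have := cI_norm tp cc2 b1; rewrite -/(circ F w d r) E cnMtoC subr0.
  have pr : 0 <= 2 * pi * r by apply: mulr_ge0 tp (ltW r0).
  rewrite (ger0_norm pr).
  have rc : r * cn (pd d F w) = 8 * M + 1 by rewrite /r divfK ?gt_eqF.
  rewrite -(mulrA (2 * pi)) rc (_ : 2 * (M * 2) * (2 * pi) = 2 * pi * (4 * M)); last by ring.
  rewrite ler_pM2l ?mulr_gt0//; move: M0; clear => M0; lra.
have h1 t : 0 <= t <= 1 -> haspd F (0 + sc (t * 1) v) v (pd v F (0 + sc (t * 1) v)).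
  by move=> _; exact: sm_has sF I.
have h2 t : 0 <= t <= 1 -> cn (pd v F (0 + sc (t * 1) v)) <= 0 by rewrite pz cn0.
have := line_bound h1 h2; rewrite mulr0 mul0r add0r sc1 => h3.
by apply/eqP; rewrite -subr_eq0 -cn_eq0; apply/eqP/le_anti; rewrite cn_ge0 andbT.
Qed.

(** Matrices of size 1 commute, so the local expressions of an endomorphism agree in all charts and
    form a periodic holomorphic function, constant by Liouville. *)
Lemma line_simple (E : vbundle X 1) : simple_bundle E.
Proof.
have [b [bfree Xb']] := latticeP X; have Xb : lattice X = lat b by rewrite Xb'.
move=> f [hf cf].
have glue x y v : vdom E x v -> vdom E y v -> f y v = f x v.
  move=> xv yv; have := cf x y v xv xv yv yv.
  rewrite (mx11_scalar (f x v)) (mx11_scalar (f y v)) (mx11_scalar (vtr E x y v)) -!scalar_mxM mulrC => e.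
  have n0 : vtr E x y v 0 0 != 0.
    apply: contraTneq isT => z; have := vtr_cocycle xv yv xv; rewrite vtr_id//.
    rewrite (mx11_scalar (vtr E x y v)) z mul_scalar_mx scale0r => /matrixP /(_ 0 0).
    by rewrite !mxE eqxx => /esym/eqP; rewrite oner_eq0.
  by congr (_%:M); apply: (mulIf n0); have := congr1 (fun A : 'M[C]_1 => A 0 0) e; rewrite !mxE eqxx !mulr1n.
pose F v := f v v ord0 ord0.
have oE x : vopen (vdom E x) by apply/open_vopen; case: (vdom_open E x).
have loc x v : vdom E x v -> f x v ord0 ord0 = F v.
  by move=> xv; rewrite /F (glue x v)//; exact: vdom_id.
have dl x v : vdom E x v -> differentiable (fun w => f x w ord0 ord0) v.
  by move=> xv; apply: differentiable_entry; apply: (hf x).1.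
have sl x := differentiable_sm (oE x) (dl x).
have sF : sm setT F.
  apply: sm_loc => v _; exists (vdom E v); split; [exact: oE|exact: vdom_id|].
  exact: sm_ext (oE v) (loc v) (sl v).
have dF v : differentiable F v.
  apply: (sm_differentiable oT sF I) => i.
  rewrite -!(pd_ext _ (oE v) (vdom_id E v) (loc v)).
  exact: differentiable_CR (dl v) (vdom_id E v).
have per v l : lat b l -> F (v + l) = F v.
  move=> ll; have Xl : lattice X l by rewrite Xb.
  have vl := (vdom_open E v).2 v l Xl (vdom_id E v).
  by rewrite -(loc v _ vl) ((hf v).2 v l Xl)//; split; exact: vdom_id.
exists (F 0) => x v xv; rewrite [LHS]mx11_scalar; congr (_%:M).
by rewrite -(liouville bfree dF per v) -(loc x v xv).
Qed.

(** The twist is the translate of E tensored with the dual of E; in the common charts the transition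
    functions then coincide, and identity matrices give the isomorphism. *)
Lemma line_semihomogeneous (E : vbundle X 1) : semihomogeneous E.
Proof.
move=> t; pose T := translate t E; pose L : vbundle X 1 := tensor T (dual E).
have e x y v : vdom E x v -> vdom E y v -> vtr (tensor E L) x y v = vtr T x y v :> 'M[C]_1.
  move=> xv yv; have := vtr_cocycle xv yv xv; rewrite vtr_id// => /matrixP/(_ 0 0).
  rewrite /= (mx11_scalar (vtr E x y v)) (mx11_scalar (vtr E y x v)) -scalar_mxM !mxE eqxx !mulr1n tr_scalar_mx => ee.
  rewrite (mx11_scalar (vtr E (x + t) (y + t) (v + t))) !tens_scalar; congr (_%:M).
  by rewrite mulrCA ee mulr1.
exists L; exists (fun _ _ => 1%:M : 'M[C]_1), (fun _ _ => 1%:M : 'M[C]_1); split.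
- split=> [x|x y v Tx [Ex Lx] Ty [Ey Ly]]; last by rewrite (e x y v Ex Ey) mulmx1 mul1mx.
  by split=> // v _; exact: differentiable_cst.
- split=> [x|x y v [Ex Lx] Tx [Ey Ly] Ty]; last by rewrite (e x y v Ex Ey) mulmx1 mul1mx.
  by split=> // v _; exact: differentiable_cst.
by move=> x v _ _; split; rewrite mulmx1.
Qed.
End Rank1.

(** * The index of a framed line bundle *)

Section TorusIndex.

Variables (R : realType) (g : nat).
Local Notation C := (Cplx R).
Local Notation V := 'cV[C]_g.
Variables (b : 'I_(2 * g) -> V) (bfree : real_free b) (X : complexTorus R g).
Hypothesis Xb : lattice X = lat b.
Variables (h : hermform R g) (q : 'I_g -> V) (a : 'I_g -> R).
Hypotheses (hq : forall i j, h (q i) (q j) = if i == j then toC (a i) else 0) (a0 : forall i, a i != 0).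
Hypothesis zspan : forall v, v = \sum_i zc_ h q a i v *: q i.

Lemma framed_torus_index : exists m0 : nat, forall m, (m0 <= m)%N ->
  (forall l l', lat b l -> lat b l' -> cexp (cA (hscale h m%:R) l l') = 1) ->
  forall (E : vbundle X 1) fr, framed (hscale h m%:R) b E fr ->
  has_index E #|[pred j | a j < 0]| /\ nondegenerate_bundle E.
Proof.
have [m0 Hm0] := harmonic_nonzero hq a0 zspan bfree; exists (maxn m0 1) => m.
rewrite geq_max => /andP[/Hm0 nz m1] hL E fr FE; have {nz} [f0 Hf0 f00] := nz hL.
have c0 : 0 < m%:R :> R by rewrite ltr0n.
have hq' := hscale_q hq m%:R.
have a0' i : m%:R * a i != 0 by rewrite mulf_neq0 ?a0// gt_eqF.
have zs' v : v = \sum_i zc_ (hscale h m%:R) q (fun j => m%:R * a j) i v *: q i.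
  by rewrite {1}(zspan v); apply: eq_bigr => i _; rewrite hscale_z ?gt_eqF.
pose N := [seq j <- enum 'I_g | a j < 0]; pose P := [seq j <- enum 'I_g | 0 < a j].
have uNP : uniq (N ++ P).
  rewrite cat_uniq; apply/and3P; split; [exact: filter_uniq (enum_uniq _)| |exact: filter_uniq (enum_uniq _)].
  apply/hasPn => j.
  by rewrite !mem_filter => /andP[/ltW aj _]; rewrite ltNge aj.
have all j : j \in N ++ P.
  rewrite mem_cat /N /P (mem_filter (fun j => a j < 0)) (mem_filter (fun j => 0 < a j)).
  have -> : j \in enum 'I_g by rewrite mem_enum.
  by rewrite !andbT -neq_lt; exact: a0.
have pos j : j \in P -> 0 < m%:R * a j by rewrite mem_filter => /andP[aj _]; exact: mulr_gt0.
have neg j : j \in N -> m%:R * a j < 0.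
  by rewrite mem_filter => /andP[aj _]; rewrite pmulr_rlt0.
have [r pk] := index_pack bfree hL hq' a0' zs' uNP all pos neg.
have sN : size N = #|[pred j | a j < 0]|.
  by rewrite cardE /enum_mem /N enumT.
rewrite -sN; apply: (framed_index Xb zs' all FE pk).
- by rewrite sN -[X in (_ <= X)%N]card_ord; exact: max_card.
- have [n [e [He uq]]] := harmonic_basis bfree hq' a0' zs'.
  exists n, e; split=> // f Hf; have [al [eal ual]] := uq f Hf.
  exists al; split=> [v|al' eal']; first by rewrite eal subrr.
  by apply: ual => v; apply/eqP; rewrite -subr_eq0; apply/eqP; exact: eal'.
by exists f0 => // z; move: f00; rewrite z eqxx.
Qed.
End TorusIndex.

(** * Weak approximation at the real places *)

Section Approximation.

Variables (R : realType) (K : fieldExtType rat) (e : nat) (sigma : 'I_e -> {rmorphism K -> R}).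
Hypothesis sinj : forall i j, sigma i =1 sigma j -> i = j.
Implicit Types (t u : 'I_e -> R) (i j : 'I_e).

(** Membership of t in the closure of K in R^e; the lemmas that follow make this closure a
    subalgebra over R containing K. *)
Definition approx t := forall x : R, 0 < x -> exists al, forall i, `|sigma i al - t i| < x.

Lemma approx_cst (c : R) : approx (fun=> c).
Proof.
move=> x x0; have cx : c - x < c + x by rewrite ltrD2l gtrN.
have [r] := rat_in_itvoo cx; rewrite in_itv /= => rc.
by exists (ratr r) => i; rewrite fmorph_rat; rewrite ltr_distl.
Qed.

Lemma approx_sigma al : approx (fun i => sigma i al).
Proof. by move=> x x0; exists al => i; rewrite subrr normr0. Qed.

Lemma approxD t u : approx t -> approx u -> approx (fun i => t i + u i).
Proof.
move=> ht hu x x0; have x2 : 0 < x / 2 by rewrite divr_gt0.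
have [al Ha] := ht _ x2; have [be Hb] := hu _ x2; exists (al + be) => i.
rewrite rmorphD opprD addrACA; apply: le_lt_trans (ler_normD _ _) _.
by rewrite (splitr x); apply: ltrD.
Qed.

Lemma approxM t u : approx t -> approx u -> approx (fun i => t i * u i).
Proof.
move=> ht hu x x0; pose M := 1 + \sum_i (`|t i| + `|u i|).
have S0 : 0 <= \sum_i (`|t i| + `|u i|) by apply: sumr_ge0 => i _; exact: addr_ge0.
have M1 : 1 <= M by rewrite lerDl.
have Mi i : `|t i| + `|u i| <= M.
  by rewrite /M (bigD1 i)//= addrCA lerDl addr_ge0// sumr_ge0// => j _; exact: addr_ge0.
pose y := Num.min 1 (x / (2 * M)).
have M0 : 0 < M by exact: lt_le_trans M1.
have y0 : 0 < y by rewrite lt_min ltr01 divr_gt0// mulr_gt0.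
have y1 : y <= 1 by rewrite ge_min lexx.
have yx : y * (2 * M) <= x by rewrite -ler_pdivlMr ?mulr_gt0// ge_min lexx orbT.
have [al Ha] := ht _ y0; have [be Hb] := hu _ y0; exists (al * be) => i; rewrite rmorphM.
have h1 := Ha i; have h2 := Hb i; have h3 := Mi i.
rewrite (_ : _ - _ = (sigma i al - t i) * (sigma i be - u i) + (sigma i al - t i) * u i + t i * (sigma i be - u i)); last by ring.
apply: le_lt_trans (ler_normD _ _) _; apply: le_lt_trans (lerD (ler_normD _ _) (lexx _)) _.
rewrite !normrM; move: (normr_ge0 (sigma i al - t i)) (normr_ge0 (sigma i be - u i)) (normr_ge0 (t i)) (normr_ge0 (u i)).
move: `|sigma i al - t i| `|sigma i be - u i| `|t i| `|u i| h1 h2 h3 => p r T U p1 r1 TU p0 r0 T0 U0.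
apply: (@le_lt_trans _ _ (p * 1 + p * U + T * r)).
  by rewrite !lerD2r ler_wpM2l// (le_trans (ltW r1)).
apply: (@lt_le_trans _ _ (y * (2 * M))) => //.
have : p * (1 + U) < y * (1 + U) by rewrite ltr_pM2r// ltr_wpDr.
have : T * r <= T * y by apply: ler_wpM2l => //; exact: ltW.
have : y * (T + U) <= y * M by apply: ler_wpM2l => //; exact: ltW.
have : y * 1 <= y * M by apply: ler_wpM2l => //; exact: ltW.
by rewrite mulr1; lra.
Qed.

Lemma approx_prod (I : Type) (r : seq I) (P : pred I) (T : I -> 'I_e -> R) : (forall k, P k -> approx (T k)) ->
  approx (fun i => \prod_(k <- r | P k) T k i).
Proof.
move=> H; elim: r => [|k r IH].
  by rewrite (_ : (fun i => _) = fun=> 1); [exact: approx_cst|apply/funext => i; rewrite big_nil].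
case Pk: (P k).
  rewrite (_ : (fun i => _) = fun i => T k i * \prod_(k <- r | P k) T k i); first exact: approxM (H k Pk) IH.
  by apply/funext => i; rewrite big_cons Pk.
by rewrite (_ : (fun i => _) = fun i => \prod_(k <- r | P k) T k i)//; apply/funext => i; rewrite big_cons Pk.
Qed.

Lemma approx_sum (I : Type) (r : seq I) (T : I -> 'I_e -> R) : (forall k, approx (T k)) ->
  approx (fun i => \sum_(k <- r) T k i).
Proof.
move=> H; elim: r => [|k r IH].
  by rewrite (_ : (fun i => _) = fun=> 0); [exact: approx_cst|apply/funext => i; rewrite big_nil].
rewrite (_ : (fun i => _) = fun i => T k i + \sum_(k <- r) T k i); first exact: approxD.
by apply/funext => i; rewrite big_cons.
Qed.

(* Interpolation: the indicator of one embedding is a product of factors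
   separating it from each of the others. *)
Lemma approx_all t : approx t.
Proof.
have sep i j : exists x, i != j -> sigma i x != sigma j x.
  have [->|ij] := eqVneq i j; first by exists 0.
  have [//|no] := pselect (exists x, true -> sigma i x != sigma j x).
  by move/eqP: ij; case; apply: sinj => x; apply: contrapT => /eqP n; apply: no; exists x.
have [x Hx] := choice (fun ij => sep ij.1 ij.2).
pose d j i k := (sigma k (x (j, i)) - sigma i (x (j, i))) / (sigma j (x (j, i)) - sigma i (x (j, i))).
pose L j k := \prod_(i | i != j) d j i k.
have aL j : approx (L j).
  apply: approx_prod => i ij; apply: approxM; last exact: approx_cst.
  by apply: approxD; [exact: approx_sigma|exact: approx_cst].
have -> : t = fun k => \sum_j t j * L j k.
  apply/funext => k; rewrite (bigD1 k)//= big1 ?addr0; last first.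
    move=> j jk; rewrite /L (bigD1 k) 1?eq_sym//= /d subrr !mul0r mulr0//.
  rewrite /L big1 ?mulr1// => i ik; rewrite /d divff// subr_eq0.
  by apply: (Hx (k, i)); rewrite eq_sym.
by apply: approx_sum => j; apply: approxM; [exact: approx_cst|exact: aL].
Qed.
End Approximation.

(** * Hermitian forms twisted by symmetric endomorphisms *)

Section Hermitian.

Variables (R : realType) (g : nat).
Local Notation C := (Cplx R).
Local Notation V := 'cV[C]_g.
Implicit Types (M A : 'M[C]_g) (u v w : V).

Lemma hermE M v w : herm M v w = \sum_i \sum_j v i ord0 * M i j * cconj (w j ord0).
Proof.
rewrite /herm mxE exchange_big /=; apply: eq_bigr => j _; rewrite !mxE mulr_suml.
by apply: eq_bigr => i _; rewrite !mxE conjE.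
Qed.

Lemma hermDl M u v w : herm M (u + v) w = herm M u w + herm M v w.
Proof. by rewrite /herm linearD /= !mulmxDl mxE. Qed.

Lemma hermZl M (c : C) v w : herm M (c *: v) w = c * herm M v w.
Proof. by rewrite /herm linearZ /= -!scalemxAl mxE. Qed.

Lemma herm_conj M v w : M \is hermsymmx -> herm M w v = cconj (herm M v w).
Proof.
move=> hM; have e i j : M i j = cconj (M j i).
  have /is_hermitianmxP := hM; rewrite expr0 scale1r => /matrixP /(_ i j); rewrite !mxE => ->.
  by rewrite conjE.
rewrite !hermE exchange_big /= (big_morph _ (@cconjD R) (cconj0 R)); apply: eq_bigr => i _.
rewrite (big_morph _ (@cconjD R) (cconj0 R)); apply: eq_bigr => j _.
by rewrite cconjM cconjM cconjK -e; ring.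
Qed.

Lemma herm_bound M : exists K : R, 0 <= K /\ forall v w, cn (herm M v w) <= K * vn v * vn w.
Proof.
exists (\sum_i \sum_j cn (M i j)); split; first by do 2!apply: sumr_ge0 => ? _; exact: cn_ge0.
move=> v w; rewrite hermE; apply: le_trans (cn_sum _ _ _) _; rewrite !mulr_suml; apply: ler_sum => i _.
apply: le_trans (cn_sum _ _ _) _; rewrite !mulr_suml; apply: ler_sum => j _.
apply: le_trans (cnM _ _) _; rewrite cn_conj; apply: ler_pM; rewrite ?cn_ge0 ?cn_le_vn//.
apply: le_trans (cnM _ _) _; rewrite mulrC; apply: ler_pM; rewrite ?cn_ge0 ?cn_le_vn//.
Qed.

Section Twist.

Variables (M A : 'M[C]_g) (hM : M \is hermsymmx) (MA : is_rosati M A A).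

(** Hermitian because A is its own Rosati image. When A preserves the lattice, the imaginary part
    takes values in 2 pi Z on lattice pairs, which is the cocycle condition for factors of
    automorphy without semicharacter. *)
Program Definition twist : hermform R g := @HermForm R g (fun v w => toC (2 * pi) * herm M (A *m v) w) _ _ _ _.
Next Obligation. by move=> u v w /=; rewrite mulmxDr hermDl mulrDr. Qed.
Next Obligation. by move=> c v w /=; rewrite -scalemxAr hermZl mulrCA. Qed.
Next Obligation.
move=> v w /=; rewrite (cconjM (toC _)) cconj_toC; congr (_ * _); rewrite -(herm_conj _ _ hM).
exact: (congr1 (fun f => f v) (MA w)).
Qed.
Next Obligation.
have [K [K0 HK]] := herm_bound (A^T *m M); exists (`|2 * pi| * K); split; first by rewrite mulr_ge0.
move=> v w; rewrite cnMtoC -!mulrA ler_wpM2l// mulrA.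
have := HK v w; rewrite /herm trmx_mul !mulmxA//.
Qed.
End Twist.

End Hermitian.

(** An orthogonal family with nonzero diagonal values is linearly independent even for an indefinite
    form, so g of them form a basis, and the coefficients are read off by pairing with q_i. *)
Lemma ortho_zspan (R : realType) (g : nat) (h : hermform R g) (q : 'I_g -> 'cV[Cplx R]_g) (a : 'I_g -> R) :
  (forall i j, h (q i) (q j) = if i == j then toC (a i) else 0) -> (forall i, a i != 0) ->
  forall v, v = \sum_i zc_ h q a i v *: q i.
Proof.
move=> hq a0 v; pose Q : 'M[Cplx R]_g := \matrix_i (q i)^T.
have hs (x : 'I_g -> Cplx R) i : h (\sum_j x j *: q j) (q i) = x i * toC (a i).
  rewrite (big_morph (fun u => h u (q i)) (fun u u' => hfD h u u' (q i)) (hf0 h (q i))).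
  rewrite (bigD1 i)//= hfZ hq eqxx big1 ?addr0// => j ji.
  by rewrite hfZ hq (negbTE ji) mulr0.
have uQ (u : 'rV_g) : u *m Q = (\sum_j u ord0 j *: q j)^T.
  rewrite mulmx_sum_row linear_sum /=; apply: eq_bigr => j _; rewrite linearZ /=.
  by congr (_ *: _); apply/rowP => k; rewrite !mxE.
have fr : row_free Q.
  apply: inj_row_free => u; rewrite uQ => /(congr1 trmx); rewrite trmxK trmx0 => z.
  apply/rowP => i; rewrite mxE; have := hs (fun j => u ord0 j) i; rewrite z hf0.
  by move/esym/eqP; rewrite mulf_eq0 toC_eq0 (negbTE (a0 i)) orbF => /eqP.
pose x := v^T *m invmx Q.
have vE : v = \sum_j x ord0 j *: q j.
  by apply: trmx_inj; rewrite -uQ /x mulmxKV// -row_free_unit.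
rewrite {1}vE; apply: eq_bigr => i _; congr (_ *: _).
by rewrite /zc_ [in h v]vE hs mulfK// toC_eq0.
Qed.

(** * Gram-Schmidt inside eigenspaces *)

Section GramSchmidt.

Variables (R : realType) (g : nat) (M : 'M[Cplx R]_g).
Local Notation C := (Cplx R).
Local Notation V := 'cV[C]_g.
Hypotheses (hM : M \is hermsymmx) (M0 : forall v, v != 0 -> 0 < herm M v v).
Variables (D : nat -> V -> Prop) (p : nat -> V).
Hypotheses (D0 : forall k, D k 0) (DD : forall k u v (c : C), D k u -> D k v -> D k (u + c *: v)).
Hypothesis Dsep : forall k j u v, D k u -> D j v -> herm M u v = 0 \/ D k v.

(** [D k] stands for the eigenspace of p k. By [Dsep] a correction term either is zero or lies in
    the same eigenspace, so orthogonalization stays within eigenspaces. The unitriangular expression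
    in the p j will show that no q k is zero. *)
Lemma gram_schmidt n : (forall k, (k < n)%N -> D k (p k)) -> exists q : nat -> V,
  forall k, (k < n)%N -> [/\ D k (q k), exists c : nat -> C, q k = p k + \sum_(j < k) c j *: p j
    & forall j, (j < n)%N -> j != k -> herm M (q k) (q j) = 0].
Proof.
elim: n => [|n IH] Dp; first by exists (fun=> 0).
have [q Hq] := IH (fun k kn => Dp k (ltnW kn)).
pose c k := - (herm M (p n) (q k) / herm M (q k) (q k)).
pose qn := p n + \sum_(k < n) c k *: q k.
have hz w : herm M 0 w = 0 by have := hermZl M 0 0 w; rewrite scale0r mul0r.
have orth j : (j < n)%N -> herm M qn (q j) = 0.
  move=> jn; rewrite /qn hermDl (big_morph (fun u => herm M u (q j)) (fun u u' => hermDl M u u' (q j)) (hz (q j))).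
  rewrite (bigD1 (Ordinal jn) isT) /= big1; last first.
    move=> k kj; have [_ _ /(_ j jn)] := Hq k (ltn_ord k).
    by rewrite hermZl => ->; rewrite ?mulr0// -val_eqE /= eq_sym in kj *.
  rewrite [X in _ + X]addr0 hermZl /c; have [q0|/M0 q0] := eqVneq (q j) 0.
    by rewrite q0 (herm_conj _ _ hM) hz cconj0 mul0r oppr0 mul0r addr0.
  by rewrite mulNr divfK ?subrr// gt_eqF.
exists (fun k => if (k < n)%N then q k else qn) => k kn1.
have [kn|nk] := ltnP k n.
  have [Dq [d qE] oq] := Hq k kn; split; [exact: Dq|by exists d|].
  move=> j jn1 jk; case: (ltnP j n) => [jn|nj]; first exact: oq.
  by rewrite (herm_conj _ _ hM) orth// cconj0.
have ek : k = n by apply/eqP; rewrite eqn_leq nk andbT -ltnS.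
rewrite ek; split.
- rewrite /qn; elim: (index_enum _) => [|j l IHl]; first by rewrite big_nil addr0; exact: Dp.
  rewrite big_cons addrCA addrC; have [Dq _ _] := Hq j (ltn_ord j).
  have [z|Dn] := Dsep (Dp n (ltnSn n)) Dq; last exact: DD.
  by rewrite /c z mul0r oppr0 scale0r addr0.
- have ex (j : 'I_n) : exists d : nat -> C, q j = \sum_(i < n) d i *: p i.
    have [_ [d ->] _] := Hq j (ltn_ord j).
    exists (fun i => if (i < j)%N then d i else (i == j)%:R).
    rewrite (bigID (fun i : 'I_n => (i < j)%N)) /= addrC; congr (_ + _).
      rewrite (bigD1 j) ?ltnn//= eqxx scale1r big1 ?addr0// => i /andP[ij ij'].
      by rewrite (negbTE ij) (_ : (i == j :> nat) = false) ?scale0r//; apply/negbTE.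
    rewrite (big_ord_widen n (fun i => d i *: p i) (ltnW (ltn_ord j))).
    by apply: eq_bigr => i ij; rewrite ij.
  have [d Hd] := choice ex; exists (fun i => \sum_(j < n) c j * d j i).
  rewrite /qn; congr (_ + _); under [RHS]eq_bigr => i _ do rewrite scaler_suml.
  rewrite exchange_big /=; apply: eq_bigr => j _; rewrite Hd scaler_sumr.
  by apply: eq_bigr => i _; rewrite scalerA.
move=> j jn1 jn; have jn' : (j < n)%N by rewrite ltn_neqAle jn -ltnS.
by rewrite jn' orth.
Qed.
End GramSchmidt.

(** * A common eigenbasis of the field action *)

Section Eigenbasis.

Variables (R : realType) (K : fieldExtType rat) (e g m : nat) (sigma : 'I_e -> {rmorphism K -> R}).
Local Notation C := (Cplx R).
Local Notation V := 'cV[C]_g.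
Variables (X : complexTorus R g) (M : 'M[C]_g) (iota : {rmorphism K -> 'M[C]_g}).
Hypotheses (gem : g = (e * m)%N) (g0 : (0 < g)%N).
Hypothesis sinj : forall i j, sigma i =1 sigma j -> i = j.
Hypothesis pes : polarized_endo_structure X M iota (rho sigma m).

(** The real place of the j-th basis vector, the first component of its index in the Kronecker
    product; each place occurs m times. *)
Definition cls (j : 'I_g) : 'I_e := (mxtens_unindex (cast_ord gem j)).1.

Lemma card_cls (S : {set 'I_e}) : #|[pred j | cls j \in S]| = (m * #|S|)%N.
Proof.
pose f (x : 'I_e * 'I_m) : 'I_g := cast_ord (esym gem) (mxtens_index x).
have fK x : mxtens_unindex (cast_ord gem (f x)) = x by rewrite /f cast_ordKV mxtens_indexK.
have bf : {on [pred j | cls j \in S], bijective f}.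
  exists (fun j => mxtens_unindex (cast_ord gem j)) => [x _|j _]; first exact: fK.
  rewrite /f; case E: _ / (mxtens_indexP (cast_ord gem j)) => [x y].
  by rewrite mxtens_indexK -E cast_ordK.
transitivity (\sum_(x | cls (f x) \in S) 1)%N.
  by rewrite -sum1_card; exact: (reindex f bf).
rewrite (eq_bigl (fun x => (x.1 \in S) && true)); last by move=> x; rewrite /cls fK andbT.
rewrite -(pair_big (fun i => i \in S) xpredT (fun _ _ => 1%N)) /=.
by rewrite sum_nat_const sum1_card card_ord mulnC.
Qed.

Lemma rho_col eta j : col j (rho sigma m eta) = toC (sigma (mxtens_unindex j).1 eta) *: col j 1%:M.
Proof.
case: (mxtens_indexP j) => j1 j2; rewrite mxtens_indexK /=; apply/matrixP => i k.
rewrite [LHS]mxE; case: (mxtens_indexP i) => i1 i2; rewrite /rho tensmxE !mxE (inj_eq (can_inj (@mxtens_indexK e m))) xpair_eqE.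
by case: eqVneq => [->|_]; rewrite /= ?mulr1n ?mulr0n ?mul0r ?mulr0.
Qed.

(** The columns of P are eigenvectors by the diagonal form of rho. The Rosati condition makes the
    action symmetric for M, and two embeddings differ at some eta with real values, so their
    eigenspaces are orthogonal. *)
Lemma eigenbasis : exists q : 'I_g -> V, exists c : 'I_g -> R,
  [/\ forall i, 0 < c i, forall i j, herm M (q i) (q j) = if i == j then toC (c i) else 0
    & forall i eta, iota eta *m q i = toC (sigma (cls i) eta) *: q i].
Proof.
have [[hM M0 _] _ [P [Q [PQ QP rep]]] ros] := pes.
(* Gram-Schmidt runs over natural numbers; [i0] is the default for indices out of range. *)
pose i0 : 'I_(e * m) := cast_ord gem (Ordinal g0).
pose ix k := insubd i0 k.
have ixE k : (k < g)%N -> ix k = k :> nat.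
  move=> kg; have kem : (k < e * m)%N by rewrite -gem.
  by rewrite /ix val_insubd kem.
pose cl k := (mxtens_unindex (ix k)).1; pose p k := col (ix k) P.
pose D k (v : V) := forall eta, iota eta *m v = toC (sigma (cl k) eta) *: v.
have Dp k : D k (p k).
  move=> eta; have cP : col (ix k) P = P *m col (ix k) 1%:M by rewrite !colE mul1mx.
  have QP' : Q *m (P *m col (ix k) 1%:M) = col (ix k) 1%:M by rewrite mulmxA QP mul1mx.
  rewrite rep /p cP -!mulmxA QP' (_ : rho sigma m eta *m col (ix k) 1%:M = col (ix k) (rho sigma m eta)).
    by rewrite rho_col -scalemxAr.
  by rewrite !colE mul1mx.
have DD k u v (c : C) : D k u -> D k v -> D k (u + c *: v).
  by move=> Du Dv eta; rewrite mulmxDr -scalemxAr Du Dv scalerDr !scalerA mulrC.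
have Dsep k j u v : D k u -> D j v -> herm M u v = 0 \/ D k v.
  move=> Du Dv; have [ejk|kj] := eqVneq (cl j) (cl k); first by right => eta; rewrite Dv ejk.
  left; have [eta se] : exists eta, sigma (cl j) eta != sigma (cl k) eta.
    have [//|no] := pselect (exists eta, sigma (cl j) eta != sigma (cl k) eta).
    by move/eqP: kj; case; apply: sinj => x; apply: contrapT => /eqP n; apply: no; exists x.
  have := congr1 (fun f => f v) (ros eta u); rewrite /phi /dual_map Du Dv hermZl.
  rewrite (herm_conj (toC _ *: v) u hM) hermZl cconjM cconj_toC -(herm_conj v u hM) => /eqP.
  rewrite -subr_eq0 -mulrBl mulf_eq0 -toCN -toCD toC_eq0 subr_eq0 eq_sym (negbTE se) /= => /eqP.
  by [].
have [q Hq] := gram_schmidt hM M0 DD Dsep (n := g) (fun k _ => Dp k).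
have qn0 (i : 'I_g) : q i != 0.
  have [_ [c ->] _] := Hq i (ltn_ord i); apply/eqP => /(congr1 (fun v => (Q *m v) (ix i) ord0)).
  have Qp k : Q *m p k = col (ix k) 1%:M by rewrite /p !colE mulmxA QP.
  rewrite mulmxDr mulmx_sumr mulmx0 [LHS]mxE [RHS]mxE summxE big1 ?addr0; last first.
    move=> j _; rewrite -scalemxAr Qp !mxE -val_eqE /= !ixE ?(ltn_trans (ltn_ord j))//.
    by rewrite gtn_eqF ?mulr0.
  by move/eqP; rewrite Qp !mxE eqxx oner_eq0.
exists (fun i => q i), (fun i => re (herm M (q i) (q i))); split.
- by move=> i; have [x x0 ->] := gt0C (M0 _ (qn0 i)).
- move=> i j; case: eqVneq => [->|ij].
    by have [x x0 ->] := gt0C (M0 _ (qn0 j)).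
  have [_ _ /(_ j (ltn_ord j))] := Hq i (ltn_ord i); apply.
  by apply: contra ij => /eqP /val_inj ->.
move=> i eta; have [-> _ _] := Hq i (ltn_ord i); congr (toC (sigma _ eta) *: _).
have -> : cl i = (mxtens_unindex (ix i)).1 by [].
by congr (mxtens_unindex _).1; apply: val_inj; exact: ixE.
Qed.
End Eigenbasis.

(** * Prescribed signs and the two line bundles *)

Lemma cexp_2pi_int (R : realType) (z : int) : cexp (ci R * toC (2 * pi * z%:~R)) = 1.
Proof.
have nat_case (n : nat) : cis (2 * pi * n%:R : R) = 1.
  elim: n => [|n IH]; first by rewrite mulr0 cis0.
  by rewrite -[n.+1%:R]natr1 mulrDr mulr1 cisD IH cis2pi mulr1.
case: z => n; first exact: nat_case.
have := nat_case n.+1; rewrite NegzE mulrNz mulrN -[cexp _]/(cis _) cisN => ->.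
by rewrite invr1.
Qed.

(** The negative target is - 2, not - 1, so that at a place where one element is near - 2 and the
    other near 1 their sum is still negative when each error is below 1/4. *)
Lemma near_sign (R : realFieldType) (x : R) (t : bool) : `|x - (if t then -2 else 1)| < 4^-1 ->
  (x != 0) * ((x < 0) = t).
Proof.
rewrite ltr_distl; case: t => /andP[h1 h2].
  by have z : x < 0; [lra|rewrite z lt_eqF].
by have z : 0 < x; [lra|rewrite ltNge (ltW z) gt_eqF].
Qed.

Theorem theorem2p3 (R : realType) (K : fieldExtType rat) (e g : nat)
    (sigma : 'I_e -> {rmorphism K -> R})
    (X : complexTorus R g) (H : 'M[Cplx R]_g)
    (iota : {rmorphism K -> 'M[Cplx R]_g}) :
  \dim {:K} = e ->
  totally_real R K ->
  enumerates_real_embeddings sigma ->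
  (0 < g)%N ->
  (e %| g)%N ->
  let m := (g %/ e)%N in
  polarized_endo_structure X H iota (rho sigma m) ->
  forall l k : nat, (l + k <= e)%N ->
  exists (a b : NSQ X) (r s : nat) (E : vbundle X r) (F : vbundle X s),
    (slope E = a /\ slope F = b) /\
    [/\ nondegenerate_bundle E, simple_bundle E & semihomogeneous E] /\
    [/\ nondegenerate_bundle F, simple_bundle F & semihomogeneous F] /\
    [/\ has_index E (m * l), has_index F (m * k),
        nondegenerate_bundle (tensor E F)
      & has_index (tensor E F) (m * (l + k))].
Proof.
move=> _ _ [sinj _] g0 eg m pes l k lke.
have gem : g = (e * m)%N by rewrite mulnC divnK.
have [b [bfree Xb']] := latticeP X; have Xb : lattice X = lat b by rewrite Xb'.
have [hM M0 HZ] := pes_polarization pes; have ros := pes_rosati pes.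
have [q [c [c0 hqM Eq]]] := eigenbasis gem g0 sinj pes.
have lD u v : lattice X u -> lattice X v -> lattice X (u + v) by rewrite Xb; exact: latD.
have EndoD A B : Endo X A -> Endo X B -> Endo X (A + B).
  by move=> HA HB u Xu; rewrite mulmxDl; apply: lD; [exact: HA|exact: HB].
have Endo_nat A n : Endo X A -> Endo X (n%:R *: A).
  move=> HA; elim: n => [|n IH]; last by rewrite -natr1 scalerDl scale1r; exact: EndoD.
  by move=> u _; rewrite scale0r mul0mx Xb; exact: lat0.
pose neg (A : pred nat) (i : 'I_e) : R := if A i then -2 else 1.
have app (A : pred nat) : exists al, EndoQ X (iota al) /\ forall i, `|sigma i al - neg A i| < 4^-1.
  have q0 : 0 < 4^-1 :> R by rewrite invr_gt0.
  have [al Hal] := approx_all sinj (neg A) q0; exists al; split; [exact: pes_endo pes al|exact: Hal].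
(* The first element is made negative at the first l places and the second at the next k; the sum is
   then negative exactly at the first l + k places. *)
have [al1 [[n1 n10 Hn1] ap1]] := app (fun i => (i < l)%N).
have [al2 [[n2 n20 Hn2] ap2]] := app (fun i => (l <= i < l + k)%N).
(* A common multiple of both denominators, so that the two elements and their sum act by
   endomorphisms preserving the lattice. *)
pose n := (n1 * n2)%N; have nn0 : 0 < n%:R :> R by rewrite ltr0n muln_gt0 n10.
pose al := n%:R * al1; pose be := n%:R * al2.
have Eal : Endo X (iota al).
  rewrite rmorphM rmorph_nat mulr_natl -scaler_nat /n natrM mulrC -scalerA; exact: Endo_nat.
have Ebe : Endo X (iota be).
  rewrite rmorphM rmorph_nat mulr_natl -scaler_nat /n natrM -scalerA; exact: Endo_nat.
have Eab : Endo X (iota (al + be)) by rewrite rmorphD; exact: EndoD.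
pose J r : {set 'I_e} := finset (fun i : 'I_e => (i < r)%N).
have cJ r : (r <= e)%N -> #|J r| = r.
  by move=> re; rewrite cardsE -sum1_card (big_ord_narrow re) sum1_card card_ord.
have main gam (S : {set 'I_e}) : Endo X (iota gam) -> (forall i, sigma i gam != 0) ->
    (forall i, (sigma i gam < 0) = (i \in S)) -> exists m0 : nat, forall d, (m0 <= d)%N ->
    (forall u v, lat b u -> lat b v -> cexp (cA (hscale (twist hM (ros gam)) d%:R) u v) = 1) /\
    forall (E : vbundle X 1) fr, framed (hscale (twist hM (ros gam)) d%:R) b E fr ->
      has_index E (m * #|S|) /\ nondegenerate_bundle E.
  move=> Eg s0 sS; pose h := twist hM (ros gam).
  pose a i := 2 * pi * sigma (cls gem i) gam * c i.
  have hq i j : h (q i) (q j) = if i == j then toC (a i) else 0.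
    rewrite /= Eq hermZl hqM; case: ifP => _; last by rewrite !mulr0.
    by rewrite -!toCM mulrA.
  have p0 := pi_gt0 R.
  have a0 i : a i != 0 by rewrite !mulf_neq0 ?s0 ?gt_eqF.
  have zs := ortho_zspan hq a0.
  have hL d u v : lat b u -> lat b v -> cexp (cA (hscale h d%:R) u v) = 1.
    move=> lu lv; rewrite -Xb in lu lv.
    have [z Hz] := HZ _ _ (Eg u lu) lv.
    have iz : im (herm H (iota gam *m u) v) = z%:~R.
      by apply: toC_inj; rewrite toC_int -Hz -complexIm.
    rewrite /cA (_ : im _ = 2 * pi * (d%:Z * z)%:~R) ?cexp_2pi_int// intrM !reimE iz.
    by rewrite !mul0r !addr0; ring.
  have [m0 Hm0] := framed_torus_index bfree Xb hq a0 zs.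
  exists m0 => d md; split; first exact: hL.
  move=> E fr FE; have := Hm0 d md (hL d) E fr FE.
  rewrite (_ : #|[pred j | a j < 0]| = (m * #|S|)%N)// -(card_cls gem); apply: eq_card => j.
  by rewrite !inE -sS /a mulrAC pmulr_rlt0// mulr_gt0// mulr_gt0.
have sal i : sigma i al = n%:R * sigma i al1 by rewrite rmorphM rmorph_nat.
have sbe i : sigma i be = n%:R * sigma i al2 by rewrite rmorphM rmorph_nat.
have s1 i : (sigma i al != 0) * ((sigma i al < 0) = (i \in J l)).
  by rewrite sal mulf_eq0 gt_eqF// pmulr_rlt0// inE; exact: near_sign (ap1 i).
have s2 i : (sigma i be != 0) * ((sigma i be < 0) = (i \in J (l + k) :\: J l)).
  by rewrite sbe mulf_eq0 gt_eqF// pmulr_rlt0// !inE -leqNgt; exact: near_sign (ap2 i).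
have s3 i : (sigma i (al + be) != 0) * ((sigma i (al + be) < 0) = (i \in J (l + k))).
  have := ap2 i; have := ap1 i.
  rewrite rmorphD sal sbe -mulrDr mulf_eq0 gt_eqF// pmulr_rlt0// inE /neg /=.
  move: (sigma i al1) (sigma i al2) => x y; rewrite !ltr_distl.
  have [il|li] /= := ltnP i l.
    rewrite (leq_trans il (leq_addr _ _)) => /andP[h1 h2] /andP[h3 h4].
    by have z : x + y < 0; [lra|rewrite z lt_eqF].
  case: ifP => _ /andP[h1 h2] /andP[h3 h4].
    by have z : x + y < 0; [lra|rewrite z lt_eqF].
  by have z : 0 < x + y; [lra|rewrite ltNge (ltW z) gt_eqF].
have [m1 H1] := main al (J l) Eal (fun i => (s1 i).1) (fun i => (s1 i).2).
have [m2 H2] := main be _ Ebe (fun i => (s2 i).1) (fun i => (s2 i).2).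
have [m3 H3] := main (al + be) _ Eab (fun i => (s3 i).1) (fun i => (s3 i).2).
(* One scale for all three forms: the form of the tensor product is then exactly the scaled form of
   [al + be]. *)
pose d := (maxn m1 (maxn m2 m3)).
have d1 : (m1 <= d)%N by rewrite leq_maxl.
have d2 : (m2 <= d)%N by rewrite /d leq_max leq_max leqnn orbT.
have d3 : (m3 <= d)%N by rewrite /d leq_max leq_max leqnn !orbT.
have [L1 I1] := H1 d d1; have [L2 I2] := H2 d d2; have [_ I3] := H3 d d3.
have F1 := framed_line_bundle bfree Xb L1; have F2 := framed_line_bundle bfree Xb L2.
have hh v w : hscale (twist hM (ros (al + be))) d%:R v w =
    hscale (twist hM (ros al)) d%:R v w + hscale (twist hM (ros be)) d%:R v w.
  by rewrite /= rmorphD mulmxDl hermDl !mulrDr.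
have F3 := framed_tensor hh F1 F2.
have lk : (l <= l + k)%N by exact: leq_addr.
have c2 : #|J (l + k) :\: J l| = k.
  rewrite cardsD (_ : J (l + k) :&: J l = J l) ?cJ ?addKn ?(leq_trans lk)//.
  by apply/setP => i; rewrite !inE; case: (ltnP i l) => // il; rewrite ?andbF// (leq_trans il lk).
have {}I1 := I1 _ _ F1; have {}I2 := I2 _ _ F2; have {}I3 := I3 _ _ F3.
rewrite cJ ?(leq_trans lk)// in I1; rewrite c2 in I2; rewrite cJ// in I3.
pose E := line_bundle bfree Xb L1; pose F := line_bundle bfree Xb L2.
exists (slope E), (slope F), 1%N, 1%N, E, F; split; first by split.
split; first by split; [exact: I1.2|exact: line_simple|exact: line_semihomogeneous].
split; first by split; [exact: I2.2|exact: line_simple|exact: line_semihomogeneous].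
split; [exact: I1.1|exact: I2.1|exact: I3.2|exact: I3.1].
Qed.
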